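(* Suppose that the operator $A$, its discretizations $\boldsymbol{A}_n$ and the parameters $\{\lambda_n\},\{\gamma_n\},\{\rho_n\}$ satisfy assumptions (A1) and (A2) stated in the context. For every $(u_n,v_n),(u,v)\in W_1^s(\Omega)\times W_1^r(\Omega,[0,1])$ with $$\lim_{n\to\infty}\big(\|u_n-u\|_{W_1^s(\Omega)}+\|v_n-v\|_{\mathscr{X}}\big)=0,$$ we have $$\lim_{n\to\infty}E_n(u_n,v_n)=E(u,v).$$ Consequently, $E_n$ $\Gamma$-converges to $E$ in $W_1^s(\Omega)\times W_1^r(\Omega,[0,1])$ with the subspace topology inherited from $W_1^s(\Omega)\times\mathscr{X}$.
   Context: Setting. $\Omega=(0,1)^2$; $h=2^{-n}$. For multi-indices, $|\alpha|=\alpha_1+\alpha_2$, $\partial^\alpha=\partial_2^{\alpha_2}\partial_1^{\alpha_1}$, $\beta\le\alpha$ is componentwise, and $\beta<\alpha$ means $\beta\le\alpha$, $\beta\ne\alpha$. B-spline framelets. Fix $m\in\mathbb{N}$ and the univariate B-spline tight framelet system of order $m$: masks $q_0,\dots,q_m$ given (up to sign) by $\widehat q_l(\xi)=\sum_kq_l[k]e^{-i\xi k}=i^l\sqrt{\binom ml}\,e^{-ij\xi/2}\sin^l(\xi/2)\cos^{m-l}(\xi/2)$, with $j=0$ for $m$ even and $j=1$ for $m$ odd; $\phi$ is the B-spline with $\int\phi=1$, $\phi(x)=2\sum_kq_0[k]\phi(2x-k)$, and $\psi_l(x)=2\sum_kq_l[k]\phi(2x-k)$. In two dimensions, $q_\alpha[k]=q_{\alpha_1}[k_1]q_{\alpha_2}[k_2]$,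 $\psi_\alpha(x)=\psi_{\alpha_1}(x_1)\psi_{\alpha_2}(x_2)$ (with $\psi_0=\phi$), $\phi(x)=\phi(x_1)\phi(x_2)$, and $\mathbb{B}=\{0,\dots,m\}^2\setminus\{0\}$. Each $\psi_\alpha$ has vanishing moments of order $\alpha$; let $\varphi_\alpha\in L_2(\mathbb{R}^2)$ be the unique compactly supported function with $\partial^\alpha\varphi_\alpha=\psi_\alpha$ (distributionally), and $c_\alpha=\int_{\mathbb{R}^2}\varphi_\alpha\,dx\ne0$. Grids. $\phi_{n,k}=2^n\phi(2^n\cdot-k)$; $\mathbb{O}_n=\{k\in\mathbb{Z}^2:2^{-n}k\in\overline\Omega\}$; $\mathbb{M}_n=\{k\in\mathbb{O}_n:\mathrm{supp}(\phi_{n,k})\subseteq\overline\Omega\}$; $\mathbb{K}_n=\{k\in\mathbb{M}_n:k+S_\alpha\subseteq\mathbb{M}_n\ \forall\alpha\in\mathbb{B}\cup\{0\}\}$, where $S_\alpha$ is the support of $q_\alpha$. For $\boldsymbol u\in\mathbb{R}^{\mathbb{M}_n}$ and $k\in\mathbb{K}_n$, $(\boldsymbol W_\alpha\boldsymbol u)[k]=\sum_{j}q_\alpha[j-k]\boldsymbol u[j]$. For $\boldsymbol u\in\mathbb{R}^{\mathbb{M}_n}$, $\|\boldsymbol u\|_p^p=h^2\sum_{k\in\mathbb{M}_n}|\boldsymbol u[k]|^p$. $\boldsymbol T_n:L_2(\Omega)\to\mathbb{R}^{\mathbb{M}_n}$, $(\boldsymbol T_nu)[k]=2^n\langle u,\phi_{n,k}\rangle$.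 Continuous functional. $\mathbb{I},\mathbb{I}',\mathbb{I}''\subseteq\mathbb{B}$ are nonempty index sets such that there is $\alpha\in\mathbb{I}$ with $\alpha>\beta$ for all $\beta\in\mathbb{I}'$; $s=\max_{\alpha\in\mathbb{I}\cup\mathbb{I}'}|\alpha|$, $r=\max_{\alpha\in\mathbb{I}''}|\alpha|$. $W_1^s(\Omega)=\{u\in L_1(\Omega):\partial^\alpha u\in L_1(\Omega),|\alpha|\le s\}$ with $\|u\|_{W_1^s(\Omega)}=\sum_{|\alpha|\le s}\|\partial^\alpha u\|_{L_1(\Omega)}$, and $W_1^r(\Omega,[0,1])=\{v\in W_1^r(\Omega):0\le v\le1\text{ a.e.}\}$. $\mathscr{X}=W_1^r(\Omega)\cap L_\infty(\Omega)$ with norm $\|v\|_{\mathscr{X}}=\|v\|_{W_1^r(\Omega)}+\|v\|_{L_\infty(\Omega)}$; $W_1^r(\Omega,[0,1])$ carries the subspace topology from $\mathscr{X}$. With $f\in L_2(\Omega)$, $$E(u,v)=\int_\Omega(1-v)\Big(\sum_{\alpha\in\mathbb{I}}|\partial^\alpha u|^2\Big)^{1/2}dx+\int_\Omega v\Big(\sum_{\alpha\in\mathbb{I}'}|\partial^\alpha u|^2\Big)^{1/2}dx+\int_\Omega\Big(\sum_{\alpha\in\mathbb{I}''}|\partial^\alpha v|^2\Big)^{1/2}dx+\tfrac12\|Au-f\|_{L_2(\Omega)}^2 .$$ Discrete functional. $\boldsymbol A_n$ is a linear operator on $\mathbb{R}^{\mathbb{M}_n}$ and $$E_n(u,v)=h^2\sum_{k\in\mathbb{K}_n}(1-\boldsymbol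 T_nv[k])\Big(\sum_{\alpha\in\mathbb{B}}\lambda_\alpha|(\boldsymbol W_\alpha\boldsymbol T_nu)[k]|^2\Big)^{1/2}+h^2\sum_{k\in\mathbb{K}_n}\boldsymbol T_nv[k]\Big(\sum_{\alpha\in\mathbb{B}}\gamma_\alpha|(\boldsymbol W_\alpha\boldsymbol T_nu)[k]|^2\Big)^{1/2}$$ $$\qquad+h^2\sum_{k\in\mathbb{K}_n}\Big(\sum_{\alpha\in\mathbb{B}}\rho_\alpha|(\boldsymbol W_\alpha\boldsymbol T_nv)[k]|^2\Big)^{1/2}+\tfrac12\|\boldsymbol A_n\boldsymbol T_nu-\boldsymbol T_nf\|_2^2,$$ where $\lambda_\alpha,\gamma_\alpha,\rho_\alpha$ depend on $n$. Assumptions. (A1) $A:L_2(\Omega)\to L_2(\Omega)$ is continuous and linear, and $\lim_{n\to\infty}\|\boldsymbol T_nAu-\boldsymbol A_n\boldsymbol T_nu\|_2=0$ for all $u\in L_2(\Omega)$. (A2) For $\alpha\in\mathbb{I}$, $\lambda_\alpha=(c_\alpha^{-1}2^{|\alpha|(n-1)})^2$; for $\alpha\in\mathbb{J}:=\mathbb{B}\setminus\mathbb{I}$, $0\le\lambda_\alpha\le O(2^{2|\beta|(n-1)})$ as $n\to\infty$ for some $\beta\in\mathbb{B}\cup\{0\}$ (depending on $\alpha$, not on $n$) with $0\le\beta<\alpha$ and $|\beta|\le s$. The $\gamma_\alpha$ are chosen the same way with $\mathbb{I}$ replaced by $\mathbb{I}'$, and the $\rho_\alpha$ the same way with $\mathbb{I}$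 replaced by $\mathbb{I}''$ and $s$ replaced by $r$. $\Gamma$-convergence. For a topological space $\mathscr{Y}$ and $E_n,E:\mathscr{Y}\to\overline{\mathbb{R}}$, $E_n$ $\Gamma$-converges to $E$ in $\mathscr{Y}$ if (1) for every sequence $w_n\to w$ in $\mathscr{Y}$, $E(w)\le\liminf_nE_n(w_n)$; and (2) for every $w\in\mathscr{Y}$ there is a sequence $w_n\to w$ in $\mathscr{Y}$ with $E(w)\ge\limsup_nE_n(w_n)$. *)

(* Defs.v *)
From HB Require Import structures.
From mathcomp Require Import all_boot all_order all_algebra.
From mathcomp Require Import all_classical all_reals all_analysis.
From mathcomp Require Import measurable_realfun ess_sup_inf.
From mathcomp Require Import complex.

Set Implicit Arguments.
Unset Strict Implicit.
Unset Printing Implicit Defensive.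
Import Order.TTheory GRing.Theory Num.Theory numFieldNormedType.Exports.
Local Open Scope classical_set_scope.
Local Open Scope ring_scope.

(* The library has semi-normed spaces of p-integrable functions ([LfunType]);
   the normed space is their quotient by the functions vanishing a.e. *)
Section Lp_space.
Context d (T : measurableType d) (R : realType).
Variables (mu : {measure set T -> \bar R}) (p : \bar R) (p1 : (1 <= p)%E).
Local Open Scope quotient_scope.

Definition ae_null : {pred LfunType mu p1} :=
  fun f => `[< (f : T -> R) = cst 0 %[ae mu] >].

Let LfunB (f g : LfunType mu p1) x : (f - g) x = f x - g x. Proof. by []. Qed.
Let LfunZ a (f : LfunType mu p1) x : (a *: f) x = a * f x. Proof. by []. Qed.

Lemma ae_null_zmod_closed : zmod_closed ae_null.
Proof.
split; first by apply/asboolP; apply: aeW.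
move=> f g /asboolP f0 /asboolP g0; apply/asboolP.
by apply: filterS2 f0 g0 => x fx gx h; rewrite LfunB fx// gx// subrr.
Qed.
HB.instance Definition _ :=
  GRing.isZmodClosed.Build (LfunType mu p1) ae_null ae_null_zmod_closed.

Definition Lp : Type := @Quotient.quot (LfunType mu p1) ae_null.
HB.instance Definition _ := Choice.on Lp.
HB.instance Definition _ := GRing.Zmodule.on Lp.

Definition Lp_class (f : LfunType mu p1) : Lp :=
  \pi_(@Quotient.quot (LfunType mu p1) ae_null) f.

Definition Lp_repr (f : Lp) : LfunType mu p1 :=
  @repr _ (@Quotient.quot (LfunType mu p1) ae_null) f.

Definition Lp_fun (f : Lp) : T -> R := Lp_repr f.

Lemma Lp_reprK f : Lp_class (Lp_repr f) = f.
Proof. exact: reprK. Qed.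

Lemma Lp_classP (f g : LfunType mu p1) :
  Lp_class f = Lp_class g <-> (f : T -> R) = g %[ae mu].
Proof.
have -> : (Lp_class f = Lp_class g) <-> (f - g \in ae_null).
  rewrite (@Quotient.idealrBE _ ae_null).
  by split=> [/eqP|/eqP].
split=> [/asboolP fg|fg].
  by apply: filterS fg => x /(_ I)/eqP; rewrite LfunB subr_eq0 => /eqP.
by apply/asboolP; apply: filterS fg => x /(_ I) fg _; rewrite LfunB fg subrr.
Qed.

Lemma Lp_reprP f : (Lp_repr (Lp_class f) : T -> R) = f %[ae mu].
Proof. by apply/Lp_classP; rewrite Lp_reprK. Qed.

Lemma Lp_classD f g : Lp_class (f + g) = Lp_class f + Lp_class g.
Proof. exact: (@Quotient.pi_add _ ae_null). Qed.

Definition Lp_scale (a : R) (f : Lp) : Lp := Lp_class (a *: Lp_repr f).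

Lemma Lp_classZ a f : Lp_class (a *: f) = Lp_scale a (Lp_class f).
Proof.
apply/Lp_classP; apply: filterS (Lp_reprP f) => x /(_ I) fx _.
by rewrite !LfunZ fx.
Qed.

Lemma Lp_scaleA a b f : Lp_scale a (Lp_scale b f) = Lp_scale (a * b) f.
Proof. by rewrite -(Lp_reprK f) -!Lp_classZ scalerA. Qed.

Lemma Lp_scale1 : left_id 1 Lp_scale.
Proof. by move=> f; rewrite -(Lp_reprK f) -Lp_classZ scale1r. Qed.

Lemma Lp_scaleDr : right_distributive Lp_scale +%R.
Proof.
move=> a f g; rewrite -(Lp_reprK f) -(Lp_reprK g) -Lp_classD -!Lp_classZ.
by rewrite scalerDr Lp_classD.
Qed.

Lemma Lp_scaleDl f : {morph Lp_scale^~ f : a b / a + b}.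
Proof.
by move=> a b; rewrite -(Lp_reprK f) -!Lp_classZ scalerDl Lp_classD.
Qed.

HB.instance Definition _ := GRing.Zmodule_isLmodule.Build R Lp
  Lp_scaleA Lp_scale1 Lp_scaleDr Lp_scaleDl.

Definition Lp_norm (f : Lp) : R := fine ('N[mu]_p[EFin \o Lp_fun f])%E.

Let ae_eq_Lnorm (f g : {mfun T >-> R}) : (f : T -> R) = g %[ae mu] ->
  ('N[mu]_p[EFin \o f] = 'N[mu]_p[EFin \o g])%E.
Proof.
move=> fg; rewrite unlock /Lnorm; case: (p) p1 => [r r1|r1|//].
- congr (_ `^ _)%E; apply: ge0_ae_eq_integral => //.
  + apply: (measurableT_comp (measurable_poweR _)).
    by apply: measurableT_comp => //; exact/measurable_EFinP.
  + apply: (measurableT_comp (measurable_poweR _)).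
    by apply: measurableT_comp => //; exact/measurable_EFinP.
  + by move=> x _; exact: poweR_ge0.
  + by move=> x _; exact: poweR_ge0.
  + by apply: filterS fg => x fg /fg /= ->.
- case: ifPn => // _; apply: eq_ess_sup.
  by apply: filterS fg => x /(_ I) /= ->.
Qed.

Lemma Lp_normE (f : LfunType mu p1) :
  Lp_norm (Lp_class f) = fine ('N[mu]_p[EFin \o f])%E.
Proof. by congr fine; apply: ae_eq_Lnorm; exact: Lp_reprP. Qed.

Lemma Lp_normD (f g : Lp) : Lp_norm (f + g) <= Lp_norm f + Lp_norm g.
Proof.
rewrite -(Lp_reprK f) -(Lp_reprK g) -Lp_classD !Lp_normE.
exact: ler_LnormD.
Qed.

Lemma Lp_normZ a (f : Lp) : Lp_norm (a *: f) = `|a| * Lp_norm f.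
Proof.
rewrite -(Lp_reprK f).
rewrite (_ : a *: _ = Lp_class (a *: Lp_repr f)); last by rewrite Lp_classZ.
by rewrite !Lp_normE LnormZ -finite_norm_fine.
Qed.

Lemma Lp_norm0_eq0 (f : Lp) : Lp_norm f = 0 -> f = 0.
Proof.
move=> /fine_Lnormr_eq0 f0; rewrite -(Lp_reprK f).
have -> : 0 = Lp_class 0.
  by rewrite -[RHS]addr0 -(subrr (Lp_class 0)) addrA -Lp_classD addr0 subrr.
by apply/Lp_classP.
Qed.

HB.instance Definition _ := Lmodule_isNormed.Build R Lp
  Lp_normD Lp_normZ Lp_norm0_eq0.

End Lp_space.

Coercion Lp_fun : Lp >-> Funclass.

Lemma le1_1E (R : realType) : (1 <= 1 :> \bar R)%E. Proof. exact: lexx. Qed.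
Lemma le1_2E (R : realType) : (1 <= 2%:E :> \bar R)%E.
Proof. by rewrite lee_fin ler1n. Qed.

Section domain.
Variable R : realType.

(* [measurableTypeR R] is [R] with its Borel sigma-algebra, hence functions of
   type [R * R -> R] can be integrated against these measures. *)
Definition leb2 :
    {measure set (measurableTypeR R * measurableTypeR R) -> \bar R} :=
  (@lebesgue_measure R \x @lebesgue_measure R)%E.

Definition Omega : set (R * R) := `]0, 1[ `*` `]0, 1[.

Lemma measurable_Omega :
  measurable (Omega : set (measurableTypeR R * measurableTypeR R)).
Proof. by apply: measurableX; exact: measurable_itv. Qed.

Definition lebO :
    {measure set (measurableTypeR R * measurableTypeR R) -> \bar R} :=
  mrestr leb2 measurable_Omega.

End domain.

(* L_1(Omega), L_2(Omega): functions on R^2 up to equality a.e. on Omega *)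
Notation L1 R := (Lp (lebO R) (le1_1E R)).
Notation L2 R := (Lp (lebO R) (le1_2E R)).

Section weak_derivatives.
Variable R : realType.

Definition pderiv (a b : nat) (f : R * R -> R) : R * R -> R :=
  iter b (fun (g : R * R -> R) x => 'D_(0, 1) g x)
    (iter a (fun (g : R * R -> R) x => 'D_(1, 0) g x) f).

(* Differentiability everywhere of all iterated partial derivatives makes them
   continuous and symmetric, so this is C^oo. *)
Definition smooth (f : R * R -> R) :=
  forall a b x, differentiable (pderiv a b f) x.

Definition test_function (U : set (R * R)) (t : R * R -> R) :=
  smooth t /\ exists2 K : set (R * R), compact K /\ K `<=` U &
    forall x, ~ K x -> t x = 0.

Definition is_weak_deriv (U : set (R * R)) (a b : nat) (u g : R * R -> R) :=
  forall t, test_function U t ->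
    \int[leb2 R]_(x in U) (u x * pderiv a b t x) =
    (-1) ^+ (a + b) * \int[leb2 R]_(x in U) (g x * t x).

(* The weak derivative is unique in L_1 when it exists. *)
Definition wderiv (a b : nat) (u : L1 R) : L1 R :=
  xget 0 [set g : L1 R | is_weak_deriv (@Omega R) a b (Lp_fun u) (Lp_fun g)].

End weak_derivatives.

(* The subset S of V with the topology of the norm N, which is only required to
   be meaningful on the span of S. *)
Record normed_subset (R : realType) (V : zmodType) (S : set V) (N : V -> R) :=
  NormedSubset { ns_val : V ; ns_valP : S ns_val }.

Section normed_subset.
Variables (R : realType) (V : zmodType) (S : set V) (N : V -> R).
Local Notation normed_subset := (normed_subset S N).

HB.instance Definition _ := gen_eqMixin normed_subset.
HB.instance Definition _ := gen_choiceMixin normed_subset.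

Definition norm_open (U : set normed_subset) :=
  forall u, U u -> exists2 e : R, 0 < e &
    forall v : normed_subset, N (ns_val v - ns_val u) < e -> U v.

Lemma norm_openT : norm_open setT.
Proof. by move=> u _; exists 1. Qed.

Lemma norm_openI (A B : set normed_subset) :
  norm_open A -> norm_open B -> norm_open (A `&` B).
Proof.
move=> oA oB u [/oA[e e0 eA] /oB[f f0 fB]].
exists (Num.min e f); first by rewrite lt_min e0 f0.
by move=> v; rewrite lt_min => /andP[/eA Av /fB Bv].
Qed.

Lemma norm_open_bigcup (I : Type) (f : I -> set normed_subset) :
  (forall i, norm_open (f i)) -> norm_open (\bigcup_i f i).
Proof.
move=> fo u [i _ /fo[e e0 ef]]; exists e => // v /ef fv; by exists i.
Qed.

HB.instance Definition _ := isOpenTopological.Build normed_subset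
  norm_openT norm_openI norm_open_bigcup.

End normed_subset.

Section sobolev.
Variable R : realType.

Definition sobolev (s : nat) : set (L1 R) :=
  [set u : L1 R | forall a b, (a + b <= s)%N ->
    exists g : L1 R, is_weak_deriv (@Omega R) a b (Lp_fun u) (Lp_fun g)].

Definition sobolev_norm (s : nat) (u : L1 R) : R :=
  \sum_(a : 'I_s.+1 * 'I_s.+1 | (a.1 + a.2 <= s)%N) `|wderiv a.1 a.2 u|.

Definition Linfty : set (L1 R) :=
  [set v : L1 R | Lp_fun v \in Lfun (lebO R) +oo%E].

Definition Linfty_norm (v : L1 R) : R :=
  fine ('N[lebO R]_+oo[EFin \o Lp_fun v])%E.

Definition sobolevX_norm (r : nat) (v : L1 R) : R :=
  sobolev_norm r v + Linfty_norm v.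

Definition sobolev_space (s : nat) := normed_subset (sobolev s) (sobolev_norm s).

Definition sobolevX_space (r : nat) :=
  normed_subset (sobolev r `&` Linfty) (sobolevX_norm r).

Definition unit_valued (v : R * R -> R) :=
  {ae lebO R, forall x, 0 <= v x <= 1}.

Definition sobolev01 (r : nat) : set (L1 R) :=
  [set v : L1 R | sobolev r v /\ unit_valued (Lp_fun v)].

(* W_1^s x W_1^r(Omega,[0,1]); its coercion to a type carries the subspace
   topology of the product. *)
Definition pairs01 (s r : nat) : set (sobolev_space s * sobolevX_space r) :=
  [set w | sobolev01 r (ns_val w.2)].

(* u viewed in L_2(Omega).  For u in W_1^s(Omega), s >= 1, the default value is
   not used, by the Sobolev embedding of W_1^1(Omega) in L_2(Omega). *)
Definition inL2 (u : R * R -> R) : L2 R :=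
  Lp_class (insubd (0 : LfunType (lebO R) (le1_2E R)) u).

End sobolev.

Definition gamma_cvg (R : realType) (Y : topologicalType)
    (En : nat -> Y -> \bar R) (E : Y -> \bar R) :=
  (forall (w_ : nat -> Y) (w : Y), w_ @ \oo --> w ->
     (E w <= limn_einf (fun n => En n (w_ n)))%E) /\
  (forall w : Y, exists2 w_ : nat -> Y, w_ @ \oo --> w &
     (limn_esup (fun n => En n (w_ n)) <= E w)%E).

Notation midx m := ('I_m.+1 * 'I_m.+1)%type.

Section multi_indices.
Variable m : nat.

Definition mabs (a : midx m) : nat := (a.1 + a.2)%N.

Definition mlt (b a : midx m) : bool :=
  [&& (b.1 <= a.1)%N, (b.2 <= a.2)%N & b != a].

Definition band : {set midx m} := [set~ (ord0, ord0)]%SET.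

End multi_indices.

Section framelets.
Variable R : realType.

Definition cis (t : R) : R[i] := (cos t +i* sin t)%C.

(* The Fourier series of q l is prescribed up to the sign (-1) ^+ e *)
Definition bspline_masks (m : nat) (q : nat -> int -> R) :=
  forall l, (l <= m)%N ->
    finite_set [set k | q l k != 0] /\
    exists e : bool, forall t : R,
      \sum_(k \in [set k | q l k != 0]) ((q l k)%:C)%C * cis (- (t * k%:~R)) =
      (-1) ^+ e * ('i%C ^+ l * ((Num.sqrt ('C(m, l))%:R)%:C)%C *
        cis (- ((odd m)%:R * t / 2)) *
        ((sin (t / 2) ^+ l * cos (t / 2) ^+ (m - l))%:C)%C).

(* cardinal B-spline of order k.+1, supported in [0, k.+1]; at order 1 the
   interval is half-open for the refinement equation to hold everywhere *)
Fixpoint cardinal_bspline (k : nat) : R -> R :=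
  match k with
  | 0 => \1_(`[0, 1[%classic)
  | k'.+1 => fun x =>
      \int[lebesgue_measure]_(t in `[0, 1]) cardinal_bspline k' (x - t)
  end.

(* The refinement equation determines the translation c *)
Definition is_bspline (m : nat) (q0 : int -> R) (phi : R -> R) :=
  [/\ exists c, forall x, phi x = cardinal_bspline m.-1 (x - c),
      \int[lebesgue_measure]_x phi x = 1 &
      forall x, phi x = 2 * \sum_(k \in [set: int]) q0 k * phi (2 * x - k%:~R)].

Definition framelet (q : nat -> int -> R) (phi : R -> R) (l : nat) (x : R) : R :=
  2 * \sum_(k \in [set: int]) q l k * phi (2 * x - k%:~R).

Variables (m : nat) (q : nat -> int -> R) (phi : R -> R).

Definition qmask2 (a : midx m) (k : int * int) : R := q a.1 k.1 * q a.2 k.2.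

Definition phi2 (x : R * R) : R := phi x.1 * phi x.2.

Definition framelet2 (a : midx m) (x : R * R) : R :=
  framelet q phi a.1 x.1 * framelet q phi a.2 x.2.

(* Compact support is meant up to null sets, vphi being an L_2 class *)
Definition framelet_antiderivative (a : midx m) (vphi : R * R -> R) :=
  [/\ vphi \in Lfun (leb2 R) 2%:E,
      exists2 K : set (R * R), compact K &
        {ae leb2 R, forall x, ~ K x -> vphi x = 0} &
      is_weak_deriv setT a.1 a.2 vphi (framelet2 a)].

End framelets.

Section discretization.
Variable R : realType.
Variables (m : nat) (q : nat -> int -> R) (phi : R -> R).

(* the factor 2 ^+ n is the L_2 normalization in dimension 2 *)
Definition phi_nk (n : nat) (k : int * int) (x : R * R) : R :=
  2 ^+ n * phi2 phi (2 ^+ n * x.1 - k.1%:~R, 2 ^+ n * x.2 - k.2%:~R).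

Definition Ogrid (n : nat) : set (int * int) :=
  [set k | closure (@Omega R) (2 ^- n * k.1%:~R, 2 ^- n * k.2%:~R)].

Definition Mgrid (n : nat) : set (int * int) :=
  [set k | Ogrid n k /\
    closure [set x | phi_nk n k x != 0] `<=` closure (@Omega R)].

Definition gridfun (n : nat) : Type := Mgrid n -> R.

Definition Kgrid (n : nat) : set (Mgrid n) :=
  [set k | forall (a : midx m) (j : int * int), qmask2 q a j != 0 ->
    Mgrid n (set_val k + j)].

Definition wavelet (n : nat) (a : midx m) (u : gridfun n) (k : Mgrid n) : R :=
  \sum_(j \in [set: Mgrid n]) qmask2 q a (set_val j - set_val k) * u j.

Definition grid_norm2 (n : nat) (u : gridfun n) : R :=
  Num.sqrt ((2 ^- n) ^+ 2 * \sum_(k \in [set: Mgrid n]) `|u k| ^+ 2).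

(* As L_2(Omega) is included in L_1(Omega), sampling makes sense for any function
   integrable on Omega; it only depends on the class of u. *)
Definition sampling (n : nat) (u : R * R -> R) : gridfun n :=
  fun k => 2 ^+ n * \int[leb2 R]_(x in @Omega R) (u x * phi_nk n (set_val k) x).

End discretization.

Arguments sampling {R} phi n u.
Arguments Kgrid {R} m q phi n.

Section functionals.
Variable R : realType.
Variables (m : nat).

Definition pointwise_norm (J : {set midx m}) (u : L1 R) (x : R * R) : R :=
  Num.sqrt (\sum_(a in J) `|wderiv a.1 a.2 u x| ^+ 2).

(* Extended-real integrals: they are finite on W_1^s x W_1^r(Omega,[0,1]). *)
Definition energy (I I' I'' : {set midx m}) (A : L2 R -> L2 R) (f : L2 R)
    (u v : L1 R) : \bar R :=
  (\int[lebO R]_x ((1 - v x) * pointwise_norm I u x)%:E +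
   \int[lebO R]_x (v x * pointwise_norm I' u x)%:E +
   \int[lebO R]_x (pointwise_norm I'' v x)%:E +
   (2^-1 * `|A (inL2 (Lp_fun u)) - f| ^+ 2)%:E)%E.

Variables (q : nat -> int -> R) (phi : R -> R).

Definition wavelet_norm (n : nat) (w : midx m -> R) (u : gridfun phi n)
    (k : Mgrid phi n) : R :=
  Num.sqrt (\sum_(a in band m) w a * `|wavelet q a u k| ^+ 2).

Definition discrete_energy (lambda gamma rho : nat -> midx m -> R)
    (An : forall n, gridfun phi n -> gridfun phi n) (f : L2 R)
    (n : nat) (u v : L1 R) : R :=
  let Tu := sampling phi n (Lp_fun u) in
  let Tv := sampling phi n (Lp_fun v) in
  (2 ^- n) ^+ 2 * (\sum_(k \in Kgrid m q phi n)
    (1 - Tv k) * wavelet_norm (lambda n) Tu k) +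
  (2 ^- n) ^+ 2 * (\sum_(k \in Kgrid m q phi n)
    Tv k * wavelet_norm (gamma n) Tu k) +
  (2 ^- n) ^+ 2 * (\sum_(k \in Kgrid m q phi n)
    wavelet_norm (rho n) Tv k) +
  2^-1 * grid_norm2 (An n Tu - sampling phi n (Lp_fun f)) ^+ 2.

Definition operator_consistent (A : L2 R -> L2 R)
    (An : forall n, gridfun phi n -> gridfun phi n) :=
  forall u : L2 R,
    grid_norm2 (sampling phi n (Lp_fun (A u)) -
                An n (sampling phi n (Lp_fun u))) @[n --> \oo] --> 0.

Definition admissible_weights (c : midx m -> R) (J : {set midx m}) (s : nat)
    (w : nat -> midx m -> R) :=
  (forall a, a \in J -> forall n,
     w n a = ((c a)^-1 * 2 ^ ((mabs a)%:Z * (n%:Z - 1))) ^+ 2) /\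
  (forall a, a \in band m :\: J -> (forall n, 0 <= w n a) /\
     exists b : midx m, [/\ mlt b a, (mabs b <= s)%N &
       (fun n => w n a) =O_\oo
         (fun n => (2 : R) ^ ((2 * mabs b)%N%:Z * (n%:Z - 1)))]).

End functionals.

(* Main.v *)
Require Import Defs.
From HB Require Import structures.
From mathcomp Require Import all_boot all_order all_algebra.
From mathcomp Require Import all_classical all_reals all_analysis.
From mathcomp Require Import measurable_realfun ess_sup_inf complex.
From mathcomp Require Import zify ring lra.

Set Implicit Arguments.
Unset Strict Implicit.
Unset Printing Implicit Defensive.
Import Order.TTheory GRing.Theory Num.Theory numFieldNormedType.Exports.
Local Open Scope classical_set_scope.
Local Open Scope ring_scope.

(* The Fourier series prescribed for [q l] forces its generating polynomial to be
   [(1 - X)^l * P] with [P 1 <> 0].  Hence a wavelet coefficient of index [a] of a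
   sampled function is an average of [u] over a cell of side [2^-n] against a
   compactly supported spline kernel which is a [b]-th derivative for all [b <= a];
   integrating by parts, [2^(n|b|) W_a T_n u] is an average of [D^b u].  The kernel
   has mass [2^|a| c_a] for [b = a], up to the sign of the integration by parts, and
   mass zero for [b < a].  As cell averages against a kernel converge in L_1 to the
   function times the mass of the kernel, (A2) makes the weighted coefficients
   converge in L_1 to [D^a u] for [a] in the index set and to [0] otherwise;
   multiplying by the step functions of [T_n v], bounded by [1] and convergent in L_1,
   gives the limits of the three regularizing terms.
   For the fidelity term, the grid functions embed isometrically in L_2 as step
   functions, and [T_n A - A_n T_n] become operators on L_2 converging pointwise to
   [0], hence uniformly bounded by Banach-Steinhaus; [u_n -> u] in L_2 because W_1^1
   embeds in L_2 in dimension 2.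
   Constant recovery sequences then give Gamma-convergence. *)

Import HBSimple.

(** * Convergence in L_1 *)

(** The obstacle to integrating by parts is that the kernels are splines, not test functions, and
    that their supports may touch the boundary of the square. Convolving a smoothed indicator with
    the same unit boxes keeps the identity between derivatives and backward differences exact, so
    one polynomial calculus in [1 - 'X] serves both the splines and their smooth approximations; the
    limit is taken outside countably many lines. The masks are known only up to sign and through
    their Fourier series, so squared moduli are compared: the order of vanishing at frequency 0
    gives the power of [1 - 'X]. The constants [c_a] are found without constructing [vphi], by
    testing its defining relation on a function whose mixed derivative is 1 on a large square. The
    convergence of cell averages also proves the uniqueness of weak derivatives and, with splines of
    order one and two, a discrete Gagliardo-Nirenberg inequality whose limit is the embedding in
    L_2. *)

Section l1_toolbox.
Context d (T : measurableType d) (R : realType).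
Variable mu : {measure set T -> \bar R}.
Implicit Types (f g h : T -> R).
Local Notation mfun := (measurable_fun setT).

Lemma cvge0P (a : nat -> \bar R) : (forall n, (0 <= a n)%E) ->
  (a @ \oo --> 0%E) <-> (forall e : R, 0 < e -> \forall n \near \oo, (a n <= e%:E)%E).
Proof.
move=> a0; split=> [ac e e0|H].
  have /fine_cvgP[afin] := ac; move=> /cvgrPdist_le /(_ _ e0) H.
  near=> n; have : `|0 - fine (a n)| <= e by near: n.
  rewrite sub0r normrN ger0_norm ?fine_ge0// -lee_fin fineK//.
  by near: n.
apply/fine_cvgP; split.
  apply: filterS (H 1 ltr01) => n an.
  by rewrite ge0_fin_numE// (le_lt_trans an)// ltry.
apply/cvgrPdist_le => e e0; apply: filterS (H _ e0) => n an /=.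
rewrite sub0r normrN ger0_norm ?fine_ge0// -lee_fin fineK//.
by rewrite ge0_fin_numE// (le_lt_trans an)// ltry.
Unshelve. all: by end_near. Qed.

Definition nrm1 f : \bar R := (\int[mu]_x `|f x|%:E)%E.

Lemma nrm1_ge0 f : (0 <= nrm1 f)%E.
Proof. by apply: integral_ge0 => x _; rewrite lee_fin. Qed.

Lemma measurable_normE f : mfun f -> mfun (fun x => `|f x|%:E).
Proof. by move=> mf; apply/measurable_EFinP; exact: measurableT_comp. Qed.

Lemma nrm1_le f g : mfun f -> mfun g -> {ae mu, forall x, `|f x| <= g x} ->
  (nrm1 f <= nrm1 g)%E.
Proof.
move=> mf mg fg; apply: ae_ge0_le_integral => //.
- exact: measurable_normE.
- exact: measurable_normE.
- by apply: filterS fg => x fg _; rewrite lee_fin (le_trans fg)// ler_norm.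
Qed.

Lemma nrm1D f g : mfun f -> mfun g -> (nrm1 (f \+ g)%R <= nrm1 f + nrm1 g)%E.
Proof.
move=> mf mg; rewrite -ge0_integralD//; last 2 first.
- exact: measurable_normE.
- exact: measurable_normE.
apply: ge0_le_integral => //.
- by apply: measurable_normE; exact: measurable_funD.
- by apply: emeasurable_funD; exact: measurable_normE.
- by move=> x _; rewrite -EFinD lee_fin ler_normD.
Qed.

Lemma nrm1Z k f : mfun f -> (nrm1 (fun x => k * f x)%R = `|k|%:E * nrm1 f)%E.
Proof.
move=> mf; rewrite -ge0_integralZl//; last exact: measurable_normE.
by apply: eq_integral => x _; rewrite -EFinM normrM.
Qed.

Lemma ae_eq_nrm1 f g : mfun f -> mfun g -> {ae mu, forall x, f x = g x} ->
  nrm1 f = nrm1 g.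
Proof.
move=> mf mg fg; apply: ge0_ae_eq_integral => //.
- exact: measurable_normE.
- exact: measurable_normE.
- by apply: filterS fg => x -> _.
Qed.

Lemma integrable_nrm1P f : mfun f ->
  mu.-integrable setT (EFin \o f) <-> (nrm1 f < +oo)%E.
Proof.
move=> mf; split=> [/integrableP[_]//|fi].
by apply/integrableP; split=> //; exact/measurable_EFinP.
Qed.

Lemma integrable_mfun f : mu.-integrable setT (EFin \o f) -> mfun f.
Proof. by move=> /integrableP[/measurable_EFinP]. Qed.

Lemma integrable_nrm1 f : mu.-integrable setT (EFin \o f) -> (nrm1 f < +oo)%E.
Proof. by move=> fi; apply/(integrable_nrm1P (integrable_mfun fi)). Qed.

Lemma nrm1_fin f : mu.-integrable setT (EFin \o f) -> nrm1 f \is a fin_num.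
Proof. by move=> fi; rewrite ge0_fin_numE ?nrm1_ge0// integrable_nrm1. Qed.

Lemma integrable_mulbd f g (M : R) : mu.-integrable setT (EFin \o f) -> mfun g ->
  (forall x, `|g x| <= M) -> mu.-integrable setT (EFin \o (fun x => f x * g x)).
Proof.
move=> fi mg gM; have mf := integrable_mfun fi.
apply: (@le_integrable _ _ _ _ _ measurableT _
    (EFin \o (fun x => f x * M))).
- by apply/measurable_EFinP; exact: measurable_funM.
- move=> x _; rewrite lee_fin !normrM ler_wpM2l// (le_trans (gM x))//.
  exact: ler_norm.
- have := integrableZr measurableT M fi.
  by apply: eq_integrable => // x _; rewrite /= EFinM.
Qed.

(** An extended-real limit, so that neither the sequence nor its limit has to be integrable
    beforehand; [cvg1_integrable_limit] recovers the integrability of the limit. *)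
Definition cvg1 (f_ : nat -> T -> R) f := nrm1 (fun x => f_ n x - f x) @[n --> \oo] --> 0%E.

Lemma cvg1P (f_ : nat -> T -> R) f : cvg1 f_ f <->
  (forall e : R, 0 < e -> \forall n \near \oo, (nrm1 (fun x => f_ n x - f x)%R <= e%:E)%E).
Proof. by apply: cvge0P => n; exact: nrm1_ge0. Qed.

Lemma cvg1_squeeze (f_ : nat -> T -> R) f (b_ : nat -> \bar R) :
  (\forall n \near \oo, (nrm1 (fun x => f_ n x - f x)%R <= b_ n)%E) ->
  b_ @ \oo --> 0%E -> cvg1 f_ f.
Proof.
move=> fb b0; apply: (@squeeze_cvge _ _ _ _ (cst 0%E) _ b_) => //.
- by apply: filterS fb => n ->; rewrite nrm1_ge0.
- exact: cvg_cst.
Qed.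

Lemma cvg1_cst f : cvg1 (fun=> f) f.
Proof.
rewrite /cvg1 /nrm1; under eq_fun do under eq_integral do rewrite subrr normr0.
by rewrite integral0; exact: cvg_cst.
Qed.

Lemma cvg1D (f_ : nat -> T -> R) f (g_ : nat -> T -> R) g : (forall n, mfun (f_ n)) -> mfun f ->
  (forall n, mfun (g_ n)) -> mfun g -> cvg1 f_ f -> cvg1 g_ g ->
  cvg1 (fun n x => f_ n x + g_ n x) (fun x => f x + g x).
Proof.
move=> mf_ mf mg_ mg cf cg; apply: cvg1_squeeze; last first.
  by have := cvgeD _ cf cg; rewrite adde0; apply.
apply: nearW => n; rewrite (_ : (fun x => _) =
  (fun x => f_ n x - f x) \+ (fun x => g_ n x - g x)); last first.
  by apply/funext => x /=; ring.
by apply: nrm1D; exact: measurable_funB.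
Qed.

Lemma cvg1Z k (f_ : nat -> T -> R) f : (forall n, mfun (f_ n)) -> mfun f -> cvg1 f_ f ->
  cvg1 (fun n x => k * f_ n x) (fun x => k * f x).
Proof.
move=> mf_ mf cf.
have H n : (nrm1 (fun x => k * f_ n x - k * f x)%R =
    `|k|%:E * nrm1 (fun x => f_ n x - f x)%R)%E.
  rewrite -nrm1Z; first by congr nrm1; apply/funext => x; rewrite mulrBr.
  exact: measurable_funB.
rewrite /cvg1; under eq_fun do rewrite H.
by have := cvgeZl _ cf => /(_ `|k|%:E isT); rewrite mule0.
Qed.

Lemma cvg1_integrable_limit (f_ : nat -> T -> R) f : mfun f -> (forall n, mu.-integrable setT (EFin \o f_ n)) ->
  cvg1 f_ f -> mu.-integrable setT (EFin \o f).
Proof.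
move=> mf fi_ /cvg1P/(_ 1 ltr01)[N _ /(_ N (leqnn _)) HN].
have mN := integrable_mfun (fi_ N).
apply/integrable_nrm1P => //.
have -> : f = (fun x => -1 * (f_ N x - f x)) \+ f_ N.
  by apply/funext => x /=; ring.
apply: (le_lt_trans (nrm1D _ _)) => //.
  by apply: measurable_funM => //; exact: measurable_funB.
apply: lte_add_pinfty; last exact: integrable_nrm1.
rewrite nrm1Z; last exact: measurable_funB.
by rewrite normrN1 mul1e (le_lt_trans HN)// ltry.
Qed.

Lemma cvg1_integral (f_ : nat -> T -> R) f : (forall n, mu.-integrable setT (EFin \o f_ n)) ->
  mu.-integrable setT (EFin \o f) -> cvg1 f_ f ->
  (\int[mu]_x (f_ n x)%:E @[n --> \oo] --> \int[mu]_x (f x)%:E)%E.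
Proof.
move=> fi_ fi cf; apply/sube_cvg0; first by have := integrable_fin_num measurableT fi.
apply/(cvg_abse0P (F := \oo) (fun n => \int[mu]_x (f_ n x)%:E - \int[mu]_x (f x)%:E)%E).
apply: (@squeeze_cvge _ _ _ _ (cst 0%E) _ (fun n => nrm1 (fun x => f_ n x - f x)%R)) => //; last exact: cvg_cst.
apply: nearW => n; rewrite abse_ge0/=.
rewrite -[X in (`|X| <= _)%E](integralB measurableT (fi_ n) fi).
apply: (le_trans (le_abse_integral _ _ _)) => //.
apply: emeasurable_funB => //; [exact: (measurable_int mu (fi_ n))|exact: (measurable_int mu fi)].
Qed.

Lemma sfun_approx f (e : R) : 0 < e -> mu.-integrable setT (EFin \o f) ->
  exists g : {sfun T >-> R}, mu.-integrable setT (EFin \o g) /\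
    (nrm1 (fun x => f x - g x)%R <= e%:E)%E.
Proof.
move=> e0 fi; have [g_ [gi _ gc]] := approximation_sfun_integrable measurableT fi.
have /cvge0P : forall n, (0 <= \int[mu]_z `|(EFin \o f) z - (g_ n z)%:E|)%E.
  by move=> n; exact: integral_ge0.
move=> /iffLR/(_ gc _ e0)[N _ /(_ N (leqnn _)) HN].
by exists (g_ N); split.
Qed.

Lemma sfun_bounded (g : {sfun T >-> R}) : exists2 M : R, 0 <= M & forall x, `|g x| <= M.
Proof.
have [M [_ HM]] := simple_bounded g.
exists (`|M| + 1); first by rewrite addr_ge0.
by move=> x; apply: HM => //; rewrite (le_lt_trans (ler_norm _))// ltrDl.
Qed.

(** Both factors converge in L_1 only, so [w] is replaced by a bounded simple function [g]: in
    [(v_ n - v) * w] the part with [w - g] is small because [v_ n - v] is bounded by 2 almost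
    everywhere, the part with [g] because [g] is bounded. *)
Lemma cvg1M (v_ w_ : nat -> T -> R) (v w : T -> R) :
  (forall n, mfun (v_ n)) -> mfun v ->
  (forall n x, `|v_ n x| <= 1) -> {ae mu, forall x, `|v x| <= 1} ->
  (forall n, mfun (w_ n)) -> mu.-integrable setT (EFin \o w) ->
  cvg1 v_ v -> cvg1 w_ w -> cvg1 (fun n x => v_ n x * w_ n x) (fun x => v x * w x).
Proof.
move=> mv_ mv v_1 v1 mw_ wi vv /cvg1P ww; apply/cvg1P => e e0.
have e5 : 0 < e / 4 by rewrite divr_gt0.
have [g [gi wg]] := sfun_approx e5 wi.
have [M M0 gM] := sfun_bounded g.
have mw := integrable_mfun wi; have mg : mfun g by [].
have M1 : 0 < M + 1 by rewrite ltr_wpDl.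
have e4 : 0 < e / 4 / (M + 1) by rewrite divr_gt0.
move/cvg1P : vv => /(_ _ e4) vv; have {}ww := ww _ e5.
near=> n.
have vvn : (nrm1 (fun x => v_ n x - v x)%R <= (e / 4 / (M + 1))%:E)%E by near: n.
have wwn : (nrm1 (fun x => w_ n x - w x)%R <= (e / 4)%:E)%E by near: n.
pose A x := v_ n x * (w_ n x - w x).
pose B x := (v_ n x - v x) * (w x - g x).
pose C x := (v_ n x - v x) * g x.
have mA : mfun A by apply: measurable_funM => //; exact: measurable_funB.
have mB : mfun B by apply: measurable_funM => //; exact: measurable_funB.
have mC : mfun C by apply: measurable_funM => //; exact: measurable_funB.
have -> : (fun x => v_ n x * w_ n x - v x * w x) = A \+ (B \+ C).
  by apply/funext => x; rewrite /A /B /C /=; ring.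
apply: (le_trans (nrm1D _ _)) => //; first exact: measurable_funD.
apply: (le_trans (leeD2l _ (nrm1D _ _))) => //.
(* Budget for [A], [B] and [C]; the middle term carries the bound 2 on [v_ n - v]. *)
have -> : e = e / 4 + (2 * (e / 4) + e / 4) by field.
rewrite !EFinD; apply: leeD; [|apply: leeD].
- apply: le_trans wwn; apply: (le_trans (nrm1_le (g := fun x => `|w_ n x - w x|) _ _ _)) => //.
  + by apply: measurableT_comp => //; exact: measurable_funB.
  + by apply: aeW => x; rewrite normrM ler_piMl.
  + by rewrite /nrm1; under eq_integral do rewrite normr_id.
- have mwg : mfun (fun x => w x - g x) by exact: measurable_funB.
  have -> : ((2 * (e / 4))%:E = `|2%R|%:E * (e / 4)%:E)%E by rewrite ger0_norm.
  apply: (@le_trans _ _ (`|2%R|%:E * nrm1 (fun x => w x - g x)%R)%E); last exact: lee_wpmul2l.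
  rewrite -nrm1Z//.
  apply: (le_trans (nrm1_le (g := fun x => `|2 * (w x - g x)|) _ _ _)) => //.
  + by apply: measurableT_comp => //; exact: measurable_funM.
  + apply: filterS v1 => x v1; rewrite !normrM ler_wpM2r// (le_trans (ler_normB _ _))//.
    by rewrite [leRHS]ger0_norm// (_ : 2 = 1 + 1 :> R) ?lerD// -natr1.
  + by rewrite /nrm1; under eq_integral do rewrite normr_id.
- have mvv : mfun (fun x => v_ n x - v x) by exact: measurable_funB.
  apply: (@le_trans _ _ (`|M|%:E * nrm1 (fun x => v_ n x - v x)%R)%E).
    rewrite -nrm1Z//; apply: (le_trans (nrm1_le (g := fun x => `|M * (v_ n x - v x)|) _ _ _)) => //.
    + by apply: measurableT_comp => //; exact: measurable_funM.
    + by apply: aeW => x; rewrite !normrM mulrC ler_wpM2r// (le_trans (gM x))// ler_norm.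
    + by rewrite /nrm1; under eq_integral do rewrite normr_id.
  apply: (@le_trans _ _ (`|M|%:E * (e / 4 / (M + 1))%:E)%E); first exact: lee_wpmul2l.
  rewrite -EFinM lee_fin ger0_norm// mulrCA ger_pMr// ler_pdivrMr// mul1r.
  by rewrite lerDl.
Unshelve. all: by end_near. Qed.

Lemma cvg1_of_ptws (f_ : nat -> T -> R) f (M : R) : (mu setT < +oo)%E ->
  (forall n, mfun (f_ n)) -> mfun f -> (forall n x, `|f_ n x| <= M) ->
  {ae mu, forall x, f_ ^~ x @ \oo --> f x} -> cvg1 f_ f.
Proof.
move=> muT mf_ mf fM ff.
have Mi : mu.-integrable setT (EFin \o cst M).
  by apply: measurable_bounded_integrable => //; exists `|M|; split; [exact: num_real|move=> y yM x _ /=; exact: ltW].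
have [] := @dominated_convergence _ _ _ mu setT measurableT (fun n => EFin \o f_ n)
  (EFin \o f) (EFin \o cst M) _ _ _ Mi _.
- by move=> n; exact/measurable_EFinP.
- exact/measurable_EFinP.
- by apply: filterS ff => x ff _; apply: cvg_EFin => //; apply: nearW.
- by apply: aeW => x n _; rewrite lee_fin.
- by [].
Qed.

End l1_toolbox.

(** * Change of variables and tensor products *)

Section affine_change_of_variables.
Variable R : realType.
Local Notation lam := (@lebesgue_measure R).
Local Notation mR := (measurableTypeR R).

Lemma measurable_affine (a b : R) : measurable_fun setT (fun x : mR => a * x + b : mR).
Proof. by apply: measurable_funD => //; exact: measurable_funM. Qed.

(** The right-hand side is a scaled push-forward of Lebesgue measure; agreement on half-open
    intervals and uniqueness conclude. *)
Lemma lebesgue_measure_affine (a b : R) (a0 : 0 < a) (A : set mR) : measurable A ->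
  lam A = (a%:E * lam ((fun x => a * x + b)%R @^-1` A))%E.
Proof.
move=> mA; have maff := measurable_affine a b.
pose nu : {measure set mR -> \bar R} := mscale (NngNum (ltW a0)) (pushforward lam (fun x : mR => a * x + b : mR)).
rewrite (_ : (_ * _)%E = nu maff A)//; apply: lebesgue_measure_unique => //.
move=> _ [[c d] _ <-].
transitivity (a%:E * lam `]((c - b) / a)%R, ((d - b) / a)%R]%classic)%E; last first.
  congr (_ * lam _)%E.
  apply/seteqP; split=> x /=; rewrite !in_itv/= ltr_pdivrMr// ler_pdivlMr// ltrBlDr lerBrDr mulrC => //.
rewrite !lebesgue_measure_itv/= !lte_fin ltr_pM2r ?invr_gt0// ltrD2r.
case: ifPn => _; last by rewrite mule0.
by rewrite -!EFinB -EFinM; congr EFin; field; rewrite gt_eqF.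
Qed.

Lemma ge0_integral_affine (a b : R) (f : R -> \bar R) : 0 < a ->
  measurable_fun setT f -> (forall x, 0 <= f x)%E ->
  (\int[lam]_x f x = a%:E * \int[lam]_x f (a * x + b)%R)%E.
Proof.
move=> a0 mf f0; have maff := measurable_affine a b.
pose nu : {measure set mR -> \bar R} := mscale (NngNum (ltW a0)) (pushforward lam (fun x : mR => a * x + b : mR)).
rewrite (eq_measure_integral (nu maff)); last first.
  by move=> A mA _; exact: lebesgue_measure_affine.
rewrite ge0_integral_mscale//=; congr (_ * _)%E.
by rewrite ge0_integral_pushforward.
Qed.

Lemma ge0_integral_reflect (b : R) (f : R -> \bar R) :
  measurable_fun setT f -> (forall x, 0 <= f x)%E ->
  (\int[lam]_x f x = \int[lam]_x f (b - x)%R)%E.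
Proof.
move=> mf f0.
have mN : measurable_fun setT (-%R : mR -> mR) by exact: measurable_funN.
transitivity (\int[lam]_x f (- x)%R)%E.
  rewrite (eq_measure_integral (pushforward lam (-%R : mR -> mR))); last first.
    by move=> A mA _; apply: esym; exact: lebesgue_measureN.
  by rewrite ge0_integral_pushforward.
rewrite (@ge0_integral_affine 1 (- b))//; last by apply: measurableT_comp.
by rewrite mul1e; apply: eq_integral => x _; rewrite mul1r opprD opprK addrC.
Qed.

Lemma integrable_affine (a b : R) (f : R -> R) : 0 < a ->
  lam.-integrable setT (EFin \o f) ->
  lam.-integrable setT (EFin \o (fun x => f (a * x + b))).
Proof.
move=> a0 fi; have mf := integrable_mfun fi; have maff := measurable_affine a b.
have mfa : measurable_fun setT (fun x : mR => f (a * x + b)) by apply: (measurableT_comp mf).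
apply/integrable_nrm1P => //; have := integrable_nrm1 fi.
rewrite /nrm1 (@ge0_integral_affine a b)//; last exact: measurable_normE.
have: (0 <= \int[lam]_x `|f (a * x + b)%R|%:E)%E by exact: integral_ge0.
case: (\int[lam]_x _)%E => [r _ _|_|//]; first exact: ltry.
by rewrite gt0_muley ?lte_fin// ltxx.
Qed.

Lemma Rintegral_affine (a b : R) (f : R -> R) : 0 < a ->
  lam.-integrable setT (EFin \o f) ->
  \int[lam]_x f (a * x + b) = a^-1 * \int[lam]_x f x.
Proof.
move=> a0 fi; have mf := integrable_mfun fi.
have fia := integrable_affine b a0 fi.
rewrite /Rintegral [in RHS]integralE [in LHS]integralE.
rewrite (@ge0_integral_affine a b ((EFin \o f)^\+)%E) => //; last exact/measurable_funepos/measurable_EFinP.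
rewrite (@ge0_integral_affine a b ((EFin \o f)^\-)%E) => //; last exact/measurable_funeneg/measurable_EFinP.
have p1 : (\int[lam]_x ((EFin \o f)^\+)%E (a * x + b)%R)%E \is a fin_num.
  have fia' : lam.-integrable setT ((EFin \o f) \o (fun x => a * x + b)) := fia.
  by have := integrable_fin_num measurableT (integrable_funepos measurableT fia'); rewrite funepos_comp.
have p2 : (\int[lam]_x ((EFin \o f)^\-)%E (a * x + b)%R)%E \is a fin_num.
  have fia' : lam.-integrable setT ((EFin \o f) \o (fun x => a * x + b)) := fia.
  by have := integrable_fin_num measurableT (integrable_funeneg measurableT fia'); rewrite funeneg_comp.
rewrite -muleBr//; last by rewrite fin_num_adde_defr.
have p12 : (\int[lam]_x ((EFin \o f)^\+)%E (a * x + b)%R -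
    \int[lam]_x ((EFin \o f)^\-)%E (a * x + b)%R)%E \is a fin_num.
  by rewrite fin_numB p1 p2.
rewrite (fineM _ p12)//.
rewrite mulrA (mulVf (x := a)); last by rewrite gt_eqF.
by rewrite mul1r; congr (fine (_ - _)%E); apply: eq_integral => x _; rewrite ?funeposE ?funenegE.
Qed.

End affine_change_of_variables.

Section tensor_products.
Variable R : realType.
Local Notation lam := (@lebesgue_measure R).
Local Notation mR := (measurableTypeR R).

Definition tensor (f g : R -> R) (x : R * R) : R := f x.1 * g x.2.

Lemma measurable_tensor (f g : mR -> R) : measurable_fun setT f -> measurable_fun setT g ->
  measurable_fun setT (tensor f g : mR * mR -> R).
Proof.
by move=> mf mg; apply: measurable_funM; apply: measurableT_comp.
Qed.

Lemma ge0_integral_tensor (f g : mR -> R) : measurable_fun setT f -> measurable_fun setT g ->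
  (forall x, 0 <= f x) -> (forall x, 0 <= g x) ->
  (\int[leb2 R]_x (tensor f g x)%:E = (\int[lam]_x (f x)%:E) * (\int[lam]_x (g x)%:E))%E.
Proof.
move=> mf mg f0 g0.
have g00 : (0 <= \int[lam]_x (g x)%:E)%E by apply: integral_ge0 => x _; rewrite lee_fin.
rewrite /leb2 fubini_tonelli1//; last 2 first.
- by apply/measurable_EFinP; exact: (measurable_tensor mf mg).
- by move=> x; rewrite lee_fin mulr_ge0.
rewrite /fubini_F -ge0_integralZr//; last 2 first.
- exact/measurable_EFinP.
- by move=> x _; rewrite lee_fin.
apply: eq_integral => x _; rewrite -ge0_integralZl ?lee_fin//.
- exact/measurable_EFinP.
- by move=> y _; rewrite lee_fin.
Qed.

Lemma integrable_tensor (f g : mR -> R) : lam.-integrable setT (EFin \o f) ->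
  lam.-integrable setT (EFin \o g) -> (leb2 R).-integrable setT (EFin \o tensor f g).
Proof.
move=> fi gi; have mf := integrable_mfun fi; have mg := integrable_mfun gi.
apply/(@integrable_nrm1P _ _ _ (leb2 R)); first exact: measurable_tensor.
rewrite /nrm1.
under eq_integral do rewrite /tensor normrM.
rewrite (@ge0_integral_tensor (fun x => `|f x|) (fun x => `|g x|))//; [|exact: measurableT_comp..].
apply: lte_mul_pinfty; last exact: integrable_nrm1.
- exact: nrm1_ge0.
- exact: nrm1_fin.
Qed.

Lemma Rintegral_tensor (f g : mR -> R) : lam.-integrable setT (EFin \o f) ->
  lam.-integrable setT (EFin \o g) ->
  \int[leb2 R]_x tensor f g x = (\int[lam]_x f x) * (\int[lam]_x g x).
Proof.
move=> fi gi; have mf := integrable_mfun fi; have mg := integrable_mfun gi.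
have fgi := integrable_tensor fi gi.
have fN := integrable_fin_num measurableT fi; have gN := integrable_fin_num measurableT gi.
rewrite /Rintegral -fineM//; congr fine.
rewrite -(integral12_prod_meas1 fgi) /fubini_F -(fineK gN).
rewrite -integralZr//; apply: eq_integral => x _.
by rewrite fineK// -integralZl.
Qed.

End tensor_products.

(** * Lebesgue measure on the unit square *)

Section omega.
Variable R : realType.
Local Notation mR := (measurableTypeR R).

Lemma leb2_setX (A B : set mR) : measurable A -> measurable B ->
  (leb2 R (A `*` B) = lebesgue_measure A * lebesgue_measure B)%E.
Proof. by move=> mA mB; exact: product_measure1E. Qed.

Lemma lebO_setT : lebO R setT = 1%E.
Proof.
rewrite /lebO /= /mrestr setTI /Omega leb2_setX; [|exact: measurable_itv..].
by rewrite lebesgue_measure_itv/= lte_fin ltr01 oppr0 adde0 mule1.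
Qed.

Lemma lebO_finite : (lebO R setT < +oo)%E.
Proof. by rewrite lebO_setT ltry. Qed.

Lemma ae_Omega (P : R * R -> Prop) : (forall x, Omega x -> P x) ->
  {ae lebO R, forall x, P x}.
Proof.
move=> OP; exists (~` (@Omega R)); split.
- by apply: measurableC; exact: measurable_Omega.
- by rewrite /lebO /= /mrestr setICl measure0.
- by move=> x /=; apply: contra_not => /OP.
Qed.

Lemma ae_lebO (P : R * R -> Prop) : {ae leb2 R, forall x, P x} ->
  {ae lebO R, forall x, P x}.
Proof.
move=> [N [mN N0 NP]]; exists N; split => //.
apply/eqP; rewrite eq_le measure_ge0 andbT -[leRHS]N0.
rewrite /lebO /= /mrestr; apply: le_measure; rewrite ?inE//.
by apply: measurableI => //; exact: measurable_Omega.
Qed.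

(** Bridge between the two encodings of integrals on the square: restriction of the domain in the
    definitions of weak derivatives and sampling, restriction of the measure in the L_p spaces. *)
Lemma integral_Omega (f : R * R -> \bar R) : measurable_fun setT (f : mR * mR -> _) ->
  (\int[leb2 R]_(x in @Omega R) f x = \int[lebO R]_x f x)%E.
Proof.
move=> mf; have mO := @measurable_Omega R.
transitivity (\int[lebO R]_(x in @Omega R) f x)%E.
  by apply: eq_measure_integral => A mA AO; rewrite /lebO /= /mrestr setIidl.
rewrite integral_mkcond; apply: ae_eq_integral => //.
  by apply/(measurable_restrictT _ mO); exact: measurable_funTS.
by apply: ae_Omega => x Ox _; rewrite patchE mem_set.
Qed.

End omega.

(** * Smooth cut-off functions *)

Section smooth_functions.
Variable R : realType.
Implicit Types (f g : R -> R).

Definition smooth1 f := forall n x, derivable (derive1n n f) x (1 : R).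

(** Coinduction: closing a class under a single derivation is enough, so no formula for iterated
    derivatives is ever needed. *)
Lemma smooth1_coind (Q : (R -> R) -> Prop) :
  (forall f, Q f -> exists2 f', Q f' & forall x : R, is_derive x (1 : R) f (f' x)) ->
  forall f, Q f -> smooth1 f.
Proof.
move=> HQ f Qf n; suff : Q (derive1n n f).
  by move=> /HQ[f' _ H] x; have [] := H x.
elim: n => [//|n /HQ[f' Qf' H]]; rewrite derive1nS.
suff -> : ((derive1n n f)^`())%classic = f' by [].
by apply/funext => x; rewrite derive1E; have [_ ->] := H x.
Qed.

Lemma smooth1_is_derive f (x : R) : smooth1 f -> is_derive x (1 : R) f (derive1 f x).
Proof. by move=> sf; apply: DeriveDef; [exact: (sf 0%N)|rewrite derive1E]. Qed.

Lemma derive1n_derive1 n f : derive1n n (derive1 f) = derive1n n.+1 f.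
Proof. by rewrite /derive1n -iterSr. Qed.

Lemma smooth1_derive1 f : smooth1 f -> smooth1 (derive1 f).
Proof. by move=> sf n; rewrite derive1n_derive1; exact: sf. Qed.

Lemma smooth1_derive1n n f : smooth1 f -> smooth1 (derive1n n f).
Proof. by elim: n => [//|n IH] sf; rewrite derive1nS; apply: smooth1_derive1; exact: IH. Qed.

Lemma is_derive1_eq f f' : (forall x : R, is_derive x (1 : R) f (f' x)) -> derive1 f = f'.
Proof. by move=> H; apply/funext => x; rewrite derive1E; have [_ ->] := H x. Qed.

Lemma smooth1_continuous f : smooth1 f -> continuous f.
Proof.
move=> sf x; apply: differentiable_continuous.
by apply/derivable1_diffP; exact: (sf 0%N).
Qed.

Lemma smooth1_measurable f : smooth1 f -> measurable_fun setT (f : measurableTypeR R -> R).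
Proof. by move=> /smooth1_continuous; exact: continuous_measurable_fun. Qed.

Lemma is_derive_affine f (f' a b x : R) : is_derive (a * x + b) (1 : R) f f' ->
  is_derive x (1 : R) (fun x => f (a * x + b)) (a * f').
Proof.
move=> df.
have da : is_derive x (1:R) (fun x : R => a * x + b) a.
  by apply: is_derive_eq; rewrite addr0 scaler1.
by apply: is_derive_eq; rewrite -mulrC.
Qed.

(* Stable under derivation, up to linear combinations, hence smooth. *)
Definition exp_inv (n : nat) (x : R) : R :=
  if 0 < x then x^-1 ^+ n * expR (- x^-1) else 0.

Lemma exp_inv_ge0 n x : 0 <= exp_inv n x.
Proof.
rewrite /exp_inv; case: ifPn => // x0.
by rewrite mulr_ge0 ?expR_ge0// exprn_ge0// invr_ge0 ltW.
Qed.

(** Keeps only the term of degree [n.+1] of the exponential series at [x^-1]. The linear decay is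
    what makes [exp_inv] differentiable at 0. *)
Lemma exp_inv_le n x : exp_inv n x <= (n.+1)`!%:R * `|x|.
Proof.
rewrite /exp_inv; case: ifPn => [x0|_]; last by rewrite mulr_ge0.
have xi : 0 <= x^-1 by rewrite invr_ge0 ltW.
rewrite gtr0_norm// expRN -ler_pdivrMr//.
rewrite mulrAC ler_pdivrMr ?expR_gt0// -exprSr -ler_pdivrMl ?ltr0n ?fact_gt0// mulrC.
by rewrite (le_trans _ (expR_ge1Dxn n xi))// lerDr.
Qed.

Lemma is_derive_exp_inv n (x : R) :
  is_derive x (1 : R) (exp_inv n) (exp_inv n.+2 x - n%:R * exp_inv n.+1 x).
Proof.
have [x0|x0|->] := ltgtP x 0.
- have E k y : y < 0 -> exp_inv k y = 0 by move=> y0; rewrite /exp_inv ltNge ltW.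
  rewrite !E// mulr0 subr0.
  apply: (near_eq_is_derive (f := cst 0)).
  near=> y; rewrite E//.
  by near: y; exact: lt_nbhsl.
- rewrite /exp_inv x0.
  apply: (near_eq_is_derive (f := fun y : R => y^-1 ^+ n * expR (- y^-1))).
    near=> y; rewrite /exp_inv ifT//.
    by near: y; exact: lt_nbhsr.
  have xN0 : x != 0 by rewrite gt_eqF.
  have dinv : is_derive x (1:R) (fun y : R => y^-1) (- x^-2).
    apply: DeriveDef; first by apply: derivableV => //; exact: derivable_id.
    by rewrite deriveV// ?derive_id ?scaler1//; exact: derivable_id.
  have dexp : is_derive x (1:R) (fun y : R => expR (- y^-1)) (expR (- x^-1) * - - x^-2).
    exact: is_derive1_comp.
  have dpow : is_derive x (1:R) (fun y : R => y^-1 ^+ n) ((n%:R * x^-1 ^+ n.-1) *: (- x^-2)).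
    have := is_deriveX n dinv; rewrite exprfctE.
    by rewrite /GRing.scale/= mulrC.
  apply: is_derive_eq; rewrite /GRing.scale/=.
  case: n dpow => [|n] _; rewrite /= ?exprS ?expr0 ?exprVn.
    by rewrite !mul0r !mulr0 addr0 subr0 !mulr1; field.
  by field; rewrite xN0 expf_neq0.
- have E k : exp_inv k 0 = 0 by rewrite /exp_inv ltxx.
  rewrite !E mulr0 subr0.
  suff H : (fun h : R => h^-1 *: (exp_inv n (h *: (1:R) + 0) - exp_inv n 0)) @ 0^' --> (0 : R).
    apply: DeriveDef; first by apply/cvg_ex; exists 0.
    by apply: cvg_lim => //; exact: Rhausdorff.
  apply/cvgrPdist_le => e e0; near=> h.
  have h0 : h != 0 by near: h; exact: nbhs_dnbhs_neq.
  rewrite E subr0 sub0r normrN /GRing.scale/= mulr1 addr0.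
  (* The difference quotient at 0 just raises the index, so the linear bound applies again. *)
  have -> : h^-1 * exp_inv n h = exp_inv n.+1 h.
    by rewrite /exp_inv; case: ifPn => _; rewrite ?mulr0// mulrA exprS.
  rewrite ger0_norm ?exp_inv_ge0// (le_trans (exp_inv_le _ _))//.
  rewrite -ler_pdivlMl ?ltr0n ?fact_gt0//; near: h.
  apply: dnbhs0_le; rewrite mulr_gt0// invr_gt0 ltr0n fact_gt0//.
Unshelve. all: by end_near. Qed.

(** By the Leibniz rule the derivative of a product is a sum of products; closing under all these
    operations at once gives a class stable under derivation, as [smooth1_coind] requires. *)
Inductive smooth_closure : (R -> R) -> Prop :=
| sc_smooth f : smooth1 f -> smooth_closure f
| sc_exp_inv n : smooth_closure (exp_inv n)
| sc_cst c : smooth_closure (fun=> c)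
| sc_add f g : smooth_closure f -> smooth_closure g -> smooth_closure (fun x => f x + g x)
| sc_mul f g : smooth_closure f -> smooth_closure g -> smooth_closure (fun x => f x * g x)
| sc_affine f a b : smooth_closure f -> smooth_closure (fun x => f (a * x + b)).

Lemma smooth_closure_smooth1 f : smooth_closure f -> smooth1 f.
Proof.
apply: smooth1_coind => {}f; elim=> {f}.
- move=> f sf; exists (derive1 f); first by apply: sc_smooth; exact: smooth1_derive1.
  by move=> x; exact: smooth1_is_derive.
- move=> n; exists (fun x => exp_inv n.+2 x + (- n%:R) * exp_inv n.+1 x).
    by apply: sc_add; [exact: sc_exp_inv|apply: sc_mul; [exact: sc_cst|exact: sc_exp_inv]].
  by move=> x; rewrite mulNr; exact: is_derive_exp_inv.
- by move=> c; exists (fun=> 0); [exact: sc_cst|move=> x; exact: is_derive_cst].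
- move=> f g sf [f' sf' df] sg [g' sg' dg]; exists (fun x => f' x + g' x).
    exact: sc_add.
  by move=> x; exact: is_deriveD.
- move=> f g sf [f' sf' df] sg [g' sg' dg]; exists (fun x => f x * g' x + g x * f' x).
    by apply: sc_add; exact: sc_mul.
  by move=> x; exact: is_deriveM.
- move=> f a b sf [f' sf' df]; exists (fun x => a * f' (a * x + b)).
    by apply: sc_mul; [exact: sc_cst|exact: sc_affine].
  by move=> x; exact: is_derive_affine.
Qed.

Lemma smooth1D f g : smooth1 f -> smooth1 g -> smooth1 (fun x => f x + g x).
Proof. by move=> sf sg; apply: smooth_closure_smooth1; apply: sc_add; exact: sc_smooth. Qed.

Lemma smooth1Z c f : smooth1 f -> smooth1 (fun x => c * f x).
Proof.
move=> sf; apply: smooth_closure_smooth1.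
by apply: sc_mul; [exact: sc_cst|exact: sc_smooth].
Qed.

Lemma smooth1B f g : smooth1 f -> smooth1 g -> smooth1 (fun x => f x - g x).
Proof.
move=> sf sg; rewrite (_ : (fun x => _) = (fun x => f x + -1 * g x)).
  exact (smooth1D sf (@smooth1Z (-1) g sg)).
by apply/funext => x; rewrite mulN1r.
Qed.

Lemma smooth1_affine a b f : smooth1 f -> smooth1 (fun x => f (a * x + b)).
Proof. by move=> sf; apply: smooth_closure_smooth1; apply: sc_affine; exact: sc_smooth. Qed.

Lemma smooth1_sum (I : Type) (r : seq I) (F : I -> R -> R) :
  (forall i, smooth1 (F i)) -> smooth1 (fun x => \sum_(i <- r) F i x).
Proof.
move=> sF; elim: r => [|i r IH].
  rewrite (_ : (fun _ => _) = fun=> 0); last by apply/funext => x; rewrite big_nil.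
  by apply: smooth_closure_smooth1; exact: sc_cst.
rewrite (_ : (fun _ => _) = fun x => F i x + \sum_(j <- r) F j x).
  exact: smooth1D.
by apply/funext => x; rewrite big_cons.
Qed.

Lemma derive1n_affine n a b f : smooth1 f ->
  derive1n n (fun x => f (a * x + b)) = (fun x => a ^+ n * derive1n n f (a * x + b)).
Proof.
move=> sf; elim: n => [|n IH]; first by apply/funext => x; rewrite !derive1n0 mul1r.
rewrite derive1nS IH; apply: is_derive1_eq => x.
have H : is_derive (a * x + b) (1 : R) (derive1n n f) (derive1n n.+1 f (a * x + b)).
  by rewrite derive1nS; apply: smooth1_is_derive; exact: smooth1_derive1n.
have := is_derive_affine H => {}H.
by apply: is_derive_eq; rewrite /GRing.scale/= exprSr mulrA.
Qed.

Lemma derive1nD n f g : smooth1 f -> smooth1 g ->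
  derive1n n (fun x => f x + g x) = (fun x => derive1n n f x + derive1n n g x).
Proof.
move=> sf sg; elim: n => [//|n IH].
rewrite derive1nS IH; apply: is_derive1_eq => x.
by apply: is_deriveD; rewrite derive1nS; apply: smooth1_is_derive; exact: smooth1_derive1n.
Qed.

Lemma derive1nZ n c f : smooth1 f ->
  derive1n n (fun x => c * f x) = (fun x => c * derive1n n f x).
Proof.
move=> sf; elim: n => [//|n IH].
rewrite derive1nS IH; apply: is_derive1_eq => x.
apply: (is_deriveZ (f := derive1n n f)); rewrite derive1nS.
by apply: smooth1_is_derive; exact: smooth1_derive1n.
Qed.

Lemma derive1n_cst0 n : derive1n n (fun=> 0 : R) = fun=> 0.
Proof.
by elim: n => [//|n IH]; rewrite derive1nS IH; apply: is_derive1_eq => x.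
Qed.

Lemma derive1n_sum (I : Type) (r : seq I) (F : I -> R -> R) n :
  (forall i, smooth1 (F i)) ->
  derive1n n (fun x => \sum_(i <- r) F i x) = (fun x => \sum_(i <- r) derive1n n (F i) x).
Proof.
move=> sF; elim: r => [|i r IH].
  rewrite (_ : (fun _ => _) = fun=> 0); last by apply/funext => x; rewrite big_nil.
  by rewrite derive1n_cst0; apply/funext => x; rewrite big_nil.
rewrite (_ : (fun x => \sum_(_ <- _) F _ _) = fun x => F i x + \sum_(j <- r) F j x); last first.
  by apply/funext => x; rewrite big_cons.
rewrite derive1nD ?IH//; last exact: smooth1_sum.
by apply/funext => x; rewrite big_cons.
Qed.

End smooth_functions.

Section smooth_step.
Variable R : realType.
Local Notation lam := (@lebesgue_measure R).
Local Notation mR := (measurableTypeR R).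

Lemma integrable_cpt (f : mR -> R) (M a b : R) : measurable_fun setT f ->
  (forall x, `|f x| <= M) -> (forall x, f x != 0 -> a <= x <= b) ->
  lam.-integrable setT (EFin \o f).
Proof.
move=> mf fM fab.
have -> : EFin \o f = (EFin \o f) \_ `[a, b].
  apply/funext => x; rewrite patchE; case: ifPn => //.
  rewrite notin_setE /= in_itv /= => /negP; apply: contraNeq => fx.
  by apply: fab; apply: contraNneq fx => ->.
apply/integrable_restrict => //; rewrite setTI.
apply: measurable_bounded_integrable => //.
- have h : (lebesgue_measure (`[a, b]%classic : set mR) < +oo)%E.
    by rewrite lebesgue_measure_itv/=; case: ifP => _; rewrite ?ltry// -EFinB ltry.
  exact: h.
- exact: measurable_funTS.
- by exists M; split; [exact: num_real|move=> y yM x _ /=; rewrite (le_trans (fM x))// ltW].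
Qed.

Lemma is_derive_primitive (g : R -> R) (x : R) : continuous g ->
  lam.-integrable setT (EFin \o g) ->
  is_derive x (1 : R) (fun y => \int[lam]_(t in `]-oo, y]) g t) (g x).
Proof.
move=> cg ig.
have ig' : lam.-integrable [set` `]-oo, (x + 1)%R]] (EFin \o g).
  exact: integrableS ig.
have x1 : x < x + 1 by rewrite ltrDl.
have := @continuous_FTC1 R g (BInfty R true) x (x + 1) x1 ig'.
move=> /(_ (ltNyr _) (cg x)) [d1 d2].
apply: (DeriveDef d1); rewrite -derive1E; exact: d2.
Qed.

Lemma primitive_le (g : R -> R) (x y : R) : lam.-integrable setT (EFin \o g) ->
  (forall t, 0 <= g t) -> x <= y ->
  \int[lam]_(t in `]-oo, x]) g t <= \int[lam]_(t in `]-oo, y]) g t.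
Proof.
move=> ig g0 xy; rewrite /Rintegral fine_le//.
- by apply: integrable_fin_num => //; exact: integrableS ig.
- by apply: integrable_fin_num => //; exact: integrableS ig.
- apply: ge0_subset_integral => //.
  + by apply: measurable_funTS; exact: measurable_int ig.
  + by move=> t _; rewrite lee_fin.
  + by apply: subset_itvl; rewrite bnd_simp.
Qed.

Lemma primitive_eq (g : R -> R) (x y : R) : lam.-integrable setT (EFin \o g) ->
  x <= y -> (forall t, x < t <= y -> g t = 0) ->
  \int[lam]_(t in `]-oo, x]) g t = \int[lam]_(t in `]-oo, y]) g t.
Proof.
move=> ig xy g0; rewrite !(Rintegral_mkcond _ [set` _]).
apply: eq_Rintegral => t _; rewrite !patchE !mem_setE !in_itv/=.
case: leP => tx; first by rewrite (le_trans tx xy).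
by case: ifP => // ty; rewrite g0// tx.
Qed.

Lemma primitive_0 (g : R -> R) (x : R) : (forall t, t <= x -> g t = 0) ->
  \int[lam]_(t in `]-oo, x]) g t = 0.
Proof.
move=> g0; rewrite -[RHS](Rintegral_set0 lam g) !(Rintegral_mkcond _ [set` _]) (Rintegral_mkcond _ set0).
apply: eq_Rintegral => t _; rewrite !patchE !mem_setE !in_itv/= in_set0.
by case: leP => // tx; rewrite g0.
Qed.

(** Normalized primitive of a bump supported in [[-1, 0]], the product of [exp_inv 0] at [- x] and
    at [x + 1]. *)
Lemma exists_smooth_step : exists H : R -> R,
  [/\ smooth1 H, forall x : R, 0 <= H x <= 1, {homo H : x y / x <= y},
    forall x : R, x <= -1 -> H x = 0 & forall x : R, 0 <= x -> H x = 1].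
Proof.
pose e (x : R) : R := exp_inv 0 (-1 * x + 0) * exp_inv 0 (1 * x + 1).
have se : smooth1 e.
  by apply: smooth_closure_smooth1; apply: sc_mul; apply: sc_affine; exact: sc_exp_inv.
have ce := smooth1_continuous se.
have e0 (x : R) : 0 <= e x by rewrite mulr_ge0// exp_inv_ge0.
have exp1 (x : R) : exp_inv 0 x <= 1.
  rewrite /exp_inv; case: ifP => // x0; rewrite expr0 mul1r.
  by rewrite -expR0 ler_expR oppr_le0 invr_ge0 ltW.
have ee (x : R) : e x != 0 -> -1 <= x <= 0.
  rewrite /e /exp_inv mulN1r addr0 mul1r oppr_gt0.
  case: ltP => x0; last by rewrite mul0r eqxx.
  case: ltP => x1; last by rewrite mulr0 eqxx.
  by move=> _; rewrite (ltW x0) andbT; lra.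
have ie : lam.-integrable setT (EFin \o e).
  apply: (@integrable_cpt _ 1 (-1) 0) => //; first exact: smooth1_measurable.
  by move=> x; rewrite ger0_norm// mulr_ile1// exp_inv_ge0.
pose G (x : R) := \int[lam]_(t in `]-oo, x]) e t.
have dG (x : R) : is_derive x (1 : R) G (e x) by exact: is_derive_primitive.
have Gle (x y : R) : x <= y -> G x <= G y by exact: primitive_le.
have G0 (x : R) : x <= -1 -> G x = 0.
  move=> x1; apply: primitive_0 => t tx; apply/eqP; apply: contraT => /[dup] et /ee/andP[t1 _].
  have t_ : t = -1 by apply/le_anti; rewrite t1 andbT (le_trans tx).
  by move: et; rewrite /e t_ /exp_inv mul1r addNr ltxx mulr0 eqxx.
have G1 (x : R) : 0 <= x -> G x = G 0.
  move=> x1; apply/esym/primitive_eq => // t /andP[t0 _].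
  by apply/eqP; apply: contraT => /ee/andP[_]; rewrite leNgt t0.
have Gge0 (x : R) : 0 <= G x.
  have [x1|x1] := leP x (-1); first by rewrite G0.
  by rewrite -(G0 (-1))// Gle// ltW.
(* Otherwise the nonnegative nondecreasing [G] vanishes on the left of 0, and so does its derivative
   at [- 2^-1], where [e] is positive. *)
have Gp : 0 < G 0.
  rewrite lt_neqAle Gge0 andbT; apply/eqP => G00.
  have : derive1 G (- 2^-1) = 0.
    rewrite derive1E; apply: (@derive_val _ _ _ _ _ G).
    apply: (near_eq_is_derive (f := cst 0)).
    near=> y; apply/esym/eqP; rewrite eq_le Gge0 andbT G00 Gle// ltW//.
    by near: y; apply: lt_nbhsl; rewrite oppr_lt0 invr_gt0.
  rewrite (is_derive1_eq dG) => /eqP.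
  rewrite /e /exp_inv !ifT; [|lra|lra].
  by rewrite !mul1r gt_eqF// mulr_gt0// expR_gt0.
have sG : smooth1 G.
  move=> [|n] x; first by have [] := dG x.
  by rewrite -derive1n_derive1 (is_derive1_eq dG); exact: se.
exists (fun x => (G 0)^-1 * G x); split.
- exact: smooth1Z.
- move=> x; rewrite mulr_ge0 ?invr_ge0//= ler_pdivrMl// mulr1.
  by have [x0|x0] := leP 0 x; [rewrite (G1 x)|exact/Gle/ltW].
- by move=> x y xy; rewrite ler_wpM2l ?invr_ge0// Gle.
- by move=> x x1; rewrite (G0 x)// mulr0.
- by move=> x x0; rewrite (G1 x)// mulVf// gt_eqF.
Unshelve. all: by end_near. Qed.

End smooth_step.

(** * Cardinal B-splines *)

Section box_convolution.
Variable R : realType.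
Local Notation lam := (@lebesgue_measure R).
Local Notation mR := (measurableTypeR R).

Definition box_conv (g : R -> R) (x : R) : R := \int[lam]_(t in `[0, 1]) g (x - t).

(** The base is a parameter: the indicator of [[0, 1[] gives the cardinal B-splines, a smoothed
    indicator gives smooth functions satisfying the same difference identities. *)
Fixpoint bspl (b : R -> R) (k : nat) : R -> R :=
  if k is k'.+1 then box_conv (bspl b k') else b.

Lemma cardinal_bsplineE k : cardinal_bspline k = bspl (\1_(`[0, 1[%classic : set R)) k :> (R -> R).
Proof. by elim: k => [//|k /= ->]. Qed.

(** Invariant under box convolution; it makes every convolution integral finite and provides the
    uniform bound for dominated convergence. *)
Definition in01 (g : R -> R) := measurable_fun setT (g : mR -> R) /\ (forall x, 0 <= g x <= 1).

Let mB (g : mR -> R) (x : R) : measurable_fun setT g ->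
  measurable_fun setT (fun t : mR => g (x - t)).
Proof. by move=> mg; apply: (measurableT_comp mg); exact: measurable_funB. Qed.

Lemma box_convE g x : in01 g ->
  ((box_conv g x)%:E = \int[lam]_t (\1_(`[0, 1]%classic : set R) t * g (x - t))%:E)%E.
Proof.
move=> [mg g01].
have -> : (\int[lam]_t (\1_(`[0, 1]%classic : set R) t * g (x - t))%:E =
    \int[lam]_(t in `[0%R, 1%R]) (g (x - t))%:E)%E.
  rewrite [RHS]integral_mkcond; apply: eq_integral => t _.
  by rewrite patchE indicE; case: ifP => _; rewrite ?mul1r ?mul0r.
rewrite /box_conv /Rintegral fineK// ge0_fin_numE; last first.
  by apply: integral_ge0 => t _; rewrite lee_fin; case/andP: (g01 (x - t)).
apply: (@le_lt_trans _ _ (\int[lam]_(t in `[0%R, 1%R]) (cst 1%E t))%E).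
  apply: ge0_le_integral => //.
  - by move=> t _; rewrite lee_fin; case/andP: (g01 (x - t)).
  - by apply/measurable_EFinP; apply: measurable_funTS; exact: mB.
  - by move=> t _; rewrite lee_fin; case/andP: (g01 (x - t)).
rewrite integral_cst// mul1e.
have h : (lebesgue_measure (`[0%R, 1%R]%classic : set mR) < +oo)%E.
  by rewrite lebesgue_measure_itv/= lte_fin ltr01 -EFinB ltry.
exact: h.
Qed.

Let mF g : in01 g -> measurable_fun setT
  (fun z : mR * mR => (\1_(`[0, 1]%classic : set R) z.2 * g (z.1 - z.2))%:E).
Proof.
move=> [mg _]; apply/measurable_EFinP; apply: measurable_funM.
  have m1 : measurable_fun setT (\1_(`[0, 1]%classic : set mR) : mR -> R) by exact: measurable_indic.
  exact: (measurableT_comp m1 measurable_snd).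
by apply: (measurableT_comp mg); apply: measurable_funB.
Qed.

Let F0 g (z : mR * mR) : in01 g -> (0 <= (\1_(`[0, 1]%classic : set R) z.2 * g (z.1 - z.2))%:E)%E.
Proof. by move=> [_ g01]; rewrite lee_fin mulr_ge0//; case/andP: (g01 (z.1 - z.2)). Qed.

Lemma box_conv_in01 g : in01 g -> in01 (box_conv g).
Proof.
move=> gg; have [mg g01] := gg; split.
  apply/measurable_EFinP.
  rewrite (_ : _ \o _ = fubini_F lam (fun z : mR * mR => (\1_(`[0, 1]%classic : set R) z.2 * g (z.1 - z.2))%:E)).
    by apply: measurable_fun_fubini_tonelli_F; [exact: mF|move=> z; exact: F0].
  by apply/funext => x /=; rewrite box_convE.
move=> x; rewrite -!lee_fin box_convE//; apply/andP; split.
  by apply: integral_ge0 => t _; exact: (@F0 g (x, t)).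
apply: (@le_trans _ _ (\int[lam]_t (\1_(`[0, 1]%classic : set mR) t)%:E)%E).
  apply: ge0_le_integral => //.
  - by move=> t _; exact: (@F0 g (x, t)).
  - apply/measurable_EFinP; apply: measurable_funM; last exact: mB.
    exact: measurable_indic.
  - by apply/measurable_EFinP; exact: measurable_indic.
  - move=> t _; rewrite lee_fin ler_piMr//; first by case/andP: (g01 (x - t)).
rewrite integral_indic// setIT.
have h : (lebesgue_measure (`[0%R, 1%R]%classic : set mR) <= 1)%E.
  by rewrite lebesgue_measure_itv/= lte_fin ltr01 oppr0 adde0.
exact: h.
Qed.

Lemma box_conv_supp g (s s' : R) : (forall x, g x != 0 -> s <= x <= s') ->
  forall x, box_conv g x != 0 -> s <= x <= s' + 1.
Proof.
move=> gs x; apply: contraNT => xs; apply/eqP.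
rewrite /box_conv (_ : \int[lam]_(_ in _) _ = \int[lam]_(t in `[0, 1]) cst 0 t).
  by rewrite /Rintegral integral0.
apply: eq_Rintegral => t; rewrite inE/= in_itv/= => /andP[t0 t1].
apply/eqP; apply: contraNT xs => /gs/andP[]; lra.
Qed.

Lemma box_conv_mass g : in01 g ->
  (\int[lam]_x (box_conv g x)%:E = \int[lam]_x (g x)%:E)%E.
Proof.
move=> gg; have [mg g01] := gg.
under eq_integral do rewrite box_convE//.
have := @fubini_tonelli _ _ _ _ _ lam lam
  (fun z : mR * mR => (\1_(`[0, 1]%classic : set R) z.2 * g (z.1 - z.2))%:E) (mF gg) (fun z => F0 z gg).
move=> ->.
transitivity (\int[lam]_y ((\int[lam]_x (g x)%:E) * (\1_(`[0, 1]%classic : set mR) y)%:E))%E.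
  apply: eq_integral => y _; rewrite muleC.
  rewrite (ge0_integral_affine (- y) ltr01 (f := fun x => (g x)%:E)); last 2 first.
  - exact/measurable_EFinP.
  - by move=> x; rewrite lee_fin; case/andP: (g01 x).
  rewrite mul1e -ge0_integralZl//.
  - by apply: eq_integral => x _; rewrite mul1r EFinM.
  - by apply/measurable_EFinP; apply: (measurableT_comp mg); exact: measurable_affine.
  - by move=> x _; rewrite lee_fin; case/andP: (g01 (1 * x - y)).
have m0 : (0 <= \int[lam]_x (g x)%:E)%E.
  by apply: integral_ge0 => x _; rewrite lee_fin; case/andP: (g01 x).
rewrite ge0_integralZl//; last by apply/measurable_EFinP; exact: measurable_indic.
rewrite integral_indic// setIT.
rewrite -[RHS]mule1; congr (_ * _)%E.
have h : (lebesgue_measure (`[0%R, 1%R]%classic : set mR) = 1)%E.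
  by rewrite lebesgue_measure_itv/= lte_fin ltr01 oppr0 adde0.
exact: h.
Qed.

(** Convolution with the unit box is [G x - G (x - 1)] for a primitive [G] of [g]. Derivation thus
    becomes a backward difference, the origin of every factor [1 - 'X] below. *)
Lemma is_derive_box_conv g x : continuous g -> in01 g ->
  lam.-integrable setT (EFin \o g) ->
  is_derive x (1 : R) (box_conv g) (g x - g (x - 1)).
Proof.
move=> cg gg ig; have [mg g01] := gg.
pose G (x : R) := \int[lam]_(t in `]-oo, x]) g t.
have -> : box_conv g = (fun x => G x - G (1 * x + - 1)).
  apply/funext => {}x; rewrite mul1r /G Rintegral_itvB; last 3 first.
  - exact: integrableS ig.
  - by rewrite bnd_simp.
  - by rewrite bnd_simp gerBl.
  apply: EFin_inj; rewrite box_convE//.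
  rewrite (ge0_integral_reflect x); last 2 first.
  - apply/measurable_EFinP; apply: measurable_funM; last exact: mB.
    exact: measurable_indic.
  - by move=> t; exact: (@F0 g (x, t)).
  rewrite (Rintegral_itv_obnd_cbnd (r := x - 1)); last first.
    exact: integrableS ig.
  rewrite /Rintegral fineK; last first.
    by apply: integrable_fin_num => //; exact: integrableS ig.
  rewrite [RHS]integral_mkcond; apply: eq_integral => t _.
  rewrite patchE indicE subKr mem_setE (_ : (x - t \in _) = (t \in `[x - 1, x])).
    by rewrite mem_setE; case: ifP => _; rewrite ?mul1r ?mul0r.
  by rewrite !in_itv/= subr_ge0 [RHS]andbC; congr (_ && _); lra.
have dG y : is_derive y (1 : R) G (g y) by exact: is_derive_primitive.
have dG1 := is_derive_affine (dG (1 * x + -1)).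
by apply: is_derive_eq; rewrite !mul1r.
Qed.

Lemma bspl_in01 b k : in01 b -> in01 (bspl b k).
Proof. by move=> bb; elim: k => [//|k]; exact: box_conv_in01. Qed.

Lemma bspl_supp b k (s s' : R) : (forall x, b x != 0 -> s <= x <= s') ->
  forall x, bspl b k x != 0 -> s <= x <= s' + k%:R.
Proof.
move=> bs; elim: k => [|k IH] x; first by rewrite addr0; exact: bs.
by rewrite -natr1 addrA; exact: (box_conv_supp IH).
Qed.

Lemma bspl_mass b k : in01 b -> (\int[lam]_x (bspl b k x)%:E = \int[lam]_x (b x)%:E)%E.
Proof.
move=> bb; elim: k => [//|k IH] /=; rewrite box_conv_mass//; exact: bspl_in01.
Qed.

Lemma bspl_integrable b k (s s' : R) : in01 b -> (forall x, b x != 0 -> s <= x <= s') ->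
  lam.-integrable setT (EFin \o bspl b k).
Proof.
move=> bb bs; have [mb b01] := bspl_in01 k bb.
apply: (@integrable_cpt _ _ 1 s (s' + k%:R)) => //; last exact: bspl_supp.
by move=> x; have /andP[b0 b1] := b01 x; rewrite ger0_norm.
Qed.

Lemma bspl_smooth1 b k (s s' : R) : smooth1 b -> in01 b ->
  (forall x, b x != 0 -> s <= x <= s') -> smooth1 (bspl b k).
Proof.
move=> sb bb bs; elim: k => [//|k IH] [|n] x.
  have := is_derive_box_conv x (smooth1_continuous IH) (bspl_in01 k bb) (bspl_integrable k bb bs).
  by case.
have /is_derive1_eq d y := is_derive_box_conv y (smooth1_continuous IH)
  (bspl_in01 k bb) (bspl_integrable k bb bs).
rewrite -derive1n_derive1 /= d.
suff : smooth1 (fun x => bspl b k x - bspl b k (1 * x + -1)).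
  by under eq_fun do rewrite mul1r; exact.
exact (smooth1B IH (@smooth1_affine _ 1 (-1) _ IH)).
Qed.

Lemma derive1_bspl b k (s s' : R) : smooth1 b -> in01 b ->
  (forall x, b x != 0 -> s <= x <= s') ->
  derive1 (bspl b k.+1) = (fun x => bspl b k x - bspl b k (x - 1)).
Proof.
move=> sb bb bs; apply: is_derive1_eq => x; apply: is_derive_box_conv.
- by apply: smooth1_continuous; exact: bspl_smooth1 bs.
- exact: bspl_in01.
- exact: bspl_integrable bs.
Qed.

Lemma indic01_in01 : in01 (\1_(`[0, 1[%classic : set R)).
Proof.
split; first exact: measurable_indic.
by move=> x; rewrite indicE; case: (_ \in _); rewrite ?lexx ler01.
Qed.

Lemma indic01E (x : R) : \1_(`[0, 1[%classic : set R) x = (0 <= x < 1)%R%:R :> R.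
Proof. by rewrite indicE mem_setE in_itv. Qed.

Lemma indic01_supp (x : R) : \1_(`[0, 1[%classic : set R) x != 0 :> R -> 0 <= x <= 1.
Proof.
rewrite indic01E; case: (boolP (0 <= x < 1)) => [/andP[-> /ltW ->]//|_].
by rewrite eqxx.
Qed.

Lemma cardinal_bspline_in01 k : in01 (@cardinal_bspline R k).
Proof. by rewrite cardinal_bsplineE; apply: bspl_in01; exact: indic01_in01. Qed.

Lemma cardinal_bspline_supp k (x : R) : cardinal_bspline k x != 0 -> 0 <= x <= k.+1%:R.
Proof.
by rewrite cardinal_bsplineE -nat1r; apply: bspl_supp; exact: indic01_supp.
Qed.

Lemma cardinal_bspline_integrable k : lam.-integrable setT (EFin \o cardinal_bspline k).
Proof.
rewrite cardinal_bsplineE; apply: bspl_integrable; first exact: indic01_in01.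
exact: indic01_supp.
Qed.

Lemma cardinal_bspline_mass k : \int[lam]_x cardinal_bspline k x = 1.
Proof.
rewrite cardinal_bsplineE /Rintegral bspl_mass; last exact: indic01_in01.
rewrite integral_indic// setIT.
have h : (lebesgue_measure (`[0%R, 1%R[%classic : set mR) = 1)%E.
  by rewrite lebesgue_measure_itv/= lte_fin ltr01 oppr0 adde0.
by rewrite [X in fine X]h.
Qed.

(** If the convolution integral vanished, its nonnegative integrand would vanish almost everywhere,
    but by induction it is positive on a nonempty interval. Strict positivity later turns the
    support condition of [Mgrid] into inequalities on indices. *)
Lemma cardinal_bspline_gt0 k (x : R) : 0 < x < k.+1%:R -> 0 < cardinal_bspline k x.
Proof.
elim: k x => [|k IH] x xk.
  by rewrite /= indicE mem_setE in_itv/=; case/andP: xk => /ltW -> ->.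
have kk := cardinal_bspline_in01 k; have [mk k01] := kk.
have /andP[p0 _] := (cardinal_bspline_in01 k.+1).2 x.
rewrite lt_neqAle p0 andbT; apply/negP => /eqP p00.
have := box_convE x kk; rewrite -[box_conv _ _]p00.
pose F t := (\1_(`[0, 1]%classic : set R) t * cardinal_bspline k (x - t))%:E.
have mF' : measurable_fun setT (F : mR -> _).
  by apply/measurable_EFinP; apply: measurable_funM; [exact: measurable_indic|exact: mB].
move=> F00; have : (\int[lam]_t `|F t| = 0)%E.
  rewrite [RHS]F00; apply: eq_integral => t _; rewrite gee0_abs//; exact: (@F0 _ (x, t)).
move=> /(ae_eq_integral_abs _ measurableT mF') [N [mN N0 FN]].
(* On []l, r[] both [t] is in the box and [x - t] is inside the support of the previous spline. *)
pose l := Num.max 0 (x - k.+1%:R); pose r := Num.min 1 x.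
have JN : `]l, r[%classic `<=` N.
  move=> t /=; rewrite in_itv/= gt_max lt_min => /andP[/andP[t0 tx] /andP[t1 tx1]].
  apply: FN => /= /(_ I)/eqP; apply/negP; rewrite eqe gt_eqF// mulr_gt0//.
    by rewrite indicE mem_setE in_itv/= !ltW.
  by apply: IH; apply/andP; split; lra.
have : (0 < lebesgue_measure (`]l, r[%classic : set mR))%E.
  have lr : l < r.
    case/andP: xk => x0; rewrite -natr1 => xk.
    by rewrite lt_min !gt_max ltr01 x0 gtrBl ltr0n/= andbT; lra.
  by rewrite lebesgue_measure_itv/= lte_fin lr -EFinB lte_fin subr_gt0.
rewrite ltNge => /negP; apply; rewrite -N0; apply: le_measure => //; rewrite inE//.
Qed.

End box_convolution.

(** * Smooth approximations of the B-splines *)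

Section smooth_indicator.
Variable R : realType.
Local Notation lam := (@lebesgue_measure R).
Local Notation mR := (measurableTypeR R).

Definition smooth_step (H : R -> R) :=
  [/\ smooth1 H, forall x : R, 0 <= H x <= 1, {homo H : x y / x <= y},
    forall x : R, x <= -1 -> H x = 0 & forall x : R, 0 <= x -> H x = 1].

Variable H : R -> R.
Hypothesis HH : smooth_step H.

(** Smoothed indicator of [[0, 1[], with transitions on [[- e, 0]] and [[1 - e, 1]]. The [+ 0] puts
    both terms in the shape of [smooth1_affine]. *)
Definition smooth_box (e x : R) : R := H (e^-1 * x + 0) - H (e^-1 * x + - e^-1).

Lemma smooth_box_smooth1 e : smooth1 (smooth_box e).
Proof. by case: HH => sH _ _ _ _; apply: smooth1B; exact: smooth1_affine. Qed.

Lemma smooth_box_in01 e : 0 < e -> in01 (smooth_box e).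
Proof.
move=> e0; split; first by apply: smooth1_measurable; exact: smooth_box_smooth1.
case: HH => _ H01 Hle _ _ x.
have /andP[a0 a1] := H01 (e^-1 * x + 0); have /andP[b0 b1] := H01 (e^-1 * x + - e^-1).
have : H (e^-1 * x + - e^-1) <= H (e^-1 * x + 0).
  by apply: Hle; rewrite lerD2l oppr_le0 invr_ge0 ltW.
by rewrite /smooth_box; lra.
Qed.

Let eM (e x y : R) : 0 < e -> (e^-1 * x <= y) = (x <= e * y).
Proof. by move=> e0; rewrite ler_pdivrMl. Qed.

Lemma smooth_box_supp e x : 0 < e -> smooth_box e x != 0 -> - e <= x <= 1.
Proof.
case: HH => _ _ _ H0 H1 e0; apply: contraNT; rewrite negb_and -!ltNge => /orP[xe|x1].
  have h1 : e^-1 * x <= -1 by rewrite eM//; lra.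
  have h2 : 0 < e^-1 by rewrite invr_gt0.
  rewrite /smooth_box !H0 ?subrr//; lra.
have h1 : e^-1 <= e^-1 * x by rewrite ler_pMr ?invr_gt0// ltW.
have h2 : 0 < e^-1 by rewrite invr_gt0.
by rewrite /smooth_box !H1 ?subrr//; lra.
Qed.

Lemma smooth_box_1 e x : 0 < e -> 0 <= x <= 1 - e -> smooth_box e x = 1.
Proof.
case: HH => _ _ _ H0 H1 e0 /andP[x0 x1]; have h0 : 0 <= e^-1 * x by rewrite mulr_ge0// invr_ge0 ltW.
have h : e^-1 * x <= e^-1 - 1.
  by rewrite eM// mulrBr mulfV ?gt_eqF// mulr1.
by rewrite /smooth_box H1 ?H0 ?subr0//; lra.
Qed.

(** At 0 and 1 the limit would depend on how [z_ n] approaches them, hence their exclusion. The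
    argument moves with [n] because the dilation applied later does. *)
Lemma smooth_box_cvg (e_ z_ : nat -> R) (z : R) : (forall n, 0 < e_ n) ->
  e_ @ \oo --> 0 -> z_ @ \oo --> z -> z != 0 -> z != 1 ->
  smooth_box (e_ n) (z_ n) @[n --> \oo] --> (\1_(`[0, 1[%classic : set R) z : R).
Proof.
move=> e0 ec zc z0 z1; apply: cvg_near_cst; rewrite indic01E.
case: (ltgtP z 0) z0 => // [zn|zp] _.
  near=> n; rewrite /=; apply/eqP; apply: contraT => /(smooth_box_supp (e0 n))/andP[+ _].
  rewrite leNgt (_ : z_ n < - e_ n)//.
  have : e_ n < - z / 2 by near: n; apply: cvgr_lt ec _ _; lra.
  have : z_ n < z / 2 by near: n; apply: cvgr_lt zc _ _; lra.
  lra.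
rewrite /=; case: (ltgtP z 1) z1 => // [zl|zg] _.
  near=> n; apply: smooth_box_1 => //; apply/andP; split.
    by near: n; apply: cvgr_ge zc _ _.
  have : e_ n < (1 - z) / 2 by near: n; apply: cvgr_lt ec _ _; lra.
  have : z_ n < (1 + z) / 2 by near: n; apply: cvgr_lt zc _ _; lra.
  lra.
near=> n; apply/eqP; apply: contraT => /(smooth_box_supp (e0 n))/andP[_].
rewrite leNgt (_ : 1 < z_ n)//.
by near: n; apply: cvgr_gt zc _ _.
Unshelve. all: by end_near. Qed.

Lemma bspl_smooth_box_cvg k (e_ z_ : nat -> R) (z : R) : (forall n, 0 < e_ n) ->
  e_ @ \oo --> 0 -> z_ @ \oo --> z -> z != 0 -> z != 1 ->
  bspl (smooth_box (e_ n)) k (z_ n) @[n --> \oo] --> (cardinal_bspline k z : R).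
Proof.
move=> e0 ec; elim: k z_ z => [|k IH] z_ z zc z0 z1; first exact: smooth_box_cvg.
have mI : measurable (`[0, 1]%classic : set mR) by exact: measurable_itv.
have I1 : (lam (`[0%R, 1%R]%classic : set mR) < +oo)%E.
  have h : (lebesgue_measure (`[0%R, 1%R]%classic : set mR) < +oo)%E.
    by rewrite lebesgue_measure_itv/= lte_fin ltr01 -EFinB ltry.
  exact: h.
have b01 n := bspl_in01 k (smooth_box_in01 (e0 n)).
have mg (g : mR -> R) (x : R) : measurable_fun setT g ->
    measurable_fun (`[0, 1]%classic : set mR) (EFin \o (fun t : mR => g (x - t))).
  move=> mg; apply/measurable_EFinP; apply: measurable_funTS.
  by apply: (measurableT_comp mg); exact: measurable_funB.
have [] := @dominated_convergence _ _ _ lam `[0, 1] mI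
  (fun n => EFin \o (fun t => bspl (smooth_box (e_ n)) k (z_ n - t)))
  (EFin \o (fun t => cardinal_bspline k (z - t))) (EFin \o cst 1) _ _ _ _ _.
- by move=> n; apply: mg; case: (b01 n).
- by apply: mg; case: (cardinal_bspline_in01 R k).
- exists ([set z] `|` [set (z - 1)]); split.
  + by apply: measurableU; exact: measurable_set1.
  + apply: countable_lebesgue_measure0; apply: finite_set_countable.
    by rewrite finite_setU; split; exact: finite_set1.
  + move=> t /= /not_implyP[_ ht]; apply: contrapT => /not_orP[/= tz tz1]; apply: ht.
    apply: cvg_EFin; first exact: nearW.
    apply: IH.
    * by apply: cvgB => //; exact: cvg_cst.
    * by rewrite subr_eq0; apply/eqP => /esym.
    * by apply/eqP => h; apply: tz1; rewrite -h; ring.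
- apply: measurable_bounded_integrable => //; exists 1; split; first exact: num_real.
  by move=> y yM x _ /=; rewrite normr1 ltW.
- apply: aeW => t n _ /=; have /andP[b0 b1] := (b01 n).2 (z_ n - t).
  by rewrite lee_fin ger0_norm.
move=> ci _; rewrite -(fineK (integrable_fin_num mI ci)) => /fine_cvg.
exact.
Qed.

End smooth_indicator.

(** * Polynomials acting as combinations of translates *)

Section discrete_combinations.
Variable R : realType.
Implicit Types (P : {poly R}) (g : R -> R).

(** Action of polynomials on functions in which ['X] is the translation by 1: the factor [1 - 'X] is
    the backward difference. *)
Definition comb P g (z : R) : R := \sum_(i < size P) P`_i * g (z - i%:R).

Lemma combE n P g z : (size P <= n)%N -> comb P g z = \sum_(i < n) P`_i * g (z - i%:R).
Proof.
move=> Pn; rewrite /comb (big_ord_widen n (fun i => P`_i * g (z - i%:R)) Pn) big_mkcond.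
apply: eq_bigr => i _; case: ltnP => // iP.
by rewrite (nth_default _ iP) mul0r.
Qed.

Lemma comb_nabla P g : comb ((1 - 'X) * P) g = comb P (fun y => g y - g (y - 1)).
Proof.
apply/funext => z.
have s1 : (size ((1 - 'X : {poly R}) * P)%R <= (size P).+1)%N.
  rewrite (leq_trans (size_polyMleq _ _))//.
  by rewrite -(opprB 'X 1) size_polyN -polyC1 size_XsubC.
rewrite (combE _ _ s1) [RHS](combE _ _ (leqnSn _)).
under eq_bigr do rewrite mulrBl mul1r coefB coefXM mulrBl.
under [RHS]eq_bigr do rewrite mulrBr.
rewrite !sumrB; congr (_ - _).
rewrite big_ord_recl/= mul0r add0r [RHS]big_ord_recr/= nth_default// mul0r addr0.
by apply: eq_bigr => i _; rewrite /bump/= add1n -natr1 opprD addrA.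
Qed.

Lemma combXn_nabla l P g :
  comb ((1 - 'X) ^+ l * P) g = comb P (iter l (fun (h : R -> R) y => h y - h (y - 1)) g).
Proof. by elim: l g => [|l IH] g; [rewrite mul1r|rewrite exprS -mulrA comb_nabla IH -iterSr]. Qed.

Lemma comb_supp P g (s s' : R) : (forall x, g x != 0 -> s <= x <= s') ->
  forall z, comb P g z != 0 -> s <= z <= s' + (size P).-1%:R.
Proof.
move=> gs z; apply: contraNT => zs; apply/eqP; rewrite /comb big1// => i _.
suff -> : g (z - i%:R) = 0 by rewrite mulr0.
apply/eqP; apply: contraNT zs => /gs/andP[h1 h2].
have : (i%:R : R) <= (size P).-1%:R by rewrite ler_nat -ltnS (ltn_predK (ltn_ord i)).
have : 0 <= (i%:R : R) by [].
lra.
Qed.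

Definition coef_norm P : R := \sum_(i < size P) `|P`_i|.

Lemma comb_bound P g z : (forall x, 0 <= g x <= 1) -> `|comb P g z| <= coef_norm P.
Proof.
move=> g01; rewrite /comb (le_trans (ler_norm_sum _ _ _))//.
apply: ler_sum => i _; rewrite normrM ler_piMr//.
by have /andP[g0 g1] := g01 (z - i%:R); rewrite ger0_norm.
Qed.

Lemma measurable_comb P (g : measurableTypeR R -> R) : measurable_fun setT g ->
  measurable_fun setT (comb P g : measurableTypeR R -> R).
Proof.
move=> mg; apply: measurable_sum => i; apply: measurable_funM => //.
by apply: (measurableT_comp mg); exact: measurable_funB.
Qed.

Lemma smooth1_comb P g : smooth1 g -> smooth1 (comb P g).
Proof.
move=> sg; apply: smooth1_sum => i; apply: smooth1Z.
rewrite (_ : (fun _ => _) = fun x => g (1 * x + - i%:R)); last by apply/funext => x; rewrite mul1r.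
exact: smooth1_affine.
Qed.

Lemma derive1_comb P g : smooth1 g -> derive1 (comb P g) = comb P (derive1 g).
Proof.
move=> sg.
have sgi i : smooth1 (fun x : R => g (x - i%:R)).
  rewrite (_ : (fun _ => _) = fun x => g (1 * x + - i%:R)); last by apply/funext => x; rewrite mul1r.
  exact: smooth1_affine.
rewrite -derive1n1 /comb derive1n_sum; last by move=> i; exact (@smooth1Z _ _ _ (sgi i)).
apply/funext => x; apply: eq_bigr => i _; rewrite (derive1nZ _ _ (sgi i)); congr (_ * _).
rewrite (_ : (fun _ => _) = fun x => g (1 * x + - i%:R)); last by apply/funext => y; rewrite mul1r.
by rewrite derive1n_affine// expr1 !mul1r derive1n1.
Qed.

(** Each derivation trades one box convolution for one factor [1 - 'X]. Read from right to left, a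
    mask divisible by [(1 - 'X) ^+ l] makes its spline an [l]-th derivative. *)
Lemma derive1n_comb_bspl l k P b (s s' : R) : smooth1 b -> in01 b ->
  (forall x, b x != 0 -> s <= x <= s') ->
  derive1n l (comb P (bspl b (k + l))) = comb ((1 - 'X) ^+ l * P) (bspl b k).
Proof.
move=> sb bb bs; elim: l P => [|l IH] P; first by rewrite addn0 mul1r.
rewrite -derive1n_derive1 addnS derive1_comb; last exact: bspl_smooth1 bs.
by rewrite (derive1_bspl (k + l) sb bb bs) -comb_nabla IH mulrA -exprSr.
Qed.

End discrete_combinations.

(** * Integration by parts against splines *)

Section tensor_test_functions.
Variable R : realType.
Implicit Types (f g : R -> R).

Lemma derive_tensor1 f g (x : R * R) : derivable f x.1 (1 : R) ->
  'D_(1, 0) (tensor f g) x = derive1 f x.1 * g x.2.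
Proof.
move=> df; rewrite derive1E; apply: cvg_lim; first exact: Rhausdorff.
rewrite (_ : (fun _ => _) =
    (fun h => (h^-1 *: (f (h *: (1 : R) + x.1) - f x.1)) * g x.2)).
  by apply: cvgMr_tmp; exact: df.
apply/funext => h; rewrite /tensor /= /GRing.scale/= mulr0 add0r.
by rewrite -mulrA mulrBl.
Qed.

Lemma derive_tensor2 f g (x : R * R) : derivable g x.2 (1 : R) ->
  'D_(0, 1) (tensor f g) x = f x.1 * derive1 g x.2.
Proof.
move=> df; rewrite derive1E; apply: cvg_lim; first exact: Rhausdorff.
rewrite (_ : (fun _ => _) =
    (fun h => f x.1 * (h^-1 *: (g (h *: (1 : R) + x.2) - g x.2)))).
  by apply: cvgMl_tmp; exact: df.
apply/funext => h; rewrite /tensor /= /GRing.scale/= mulr0 add0r.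
by rewrite -mulrBr mulrCA.
Qed.

Lemma pderiv_tensor a b f g : smooth1 f -> smooth1 g ->
  pderiv a b (tensor f g) = tensor (derive1n a f) (derive1n b g).
Proof.
move=> sf sg; rewrite /pderiv.
have -> : iter a (fun (h : R * R -> R) x => 'D_(1, 0) h x) (tensor f g) =
    tensor (derive1n a f) g.
  elim: a => [//|a /= ->]; apply/funext => x.
  by rewrite derive_tensor1//; exact: sf.
elim: b => [//|b /= ->]; apply/funext => x.
by rewrite derive_tensor2//; exact: sg.
Qed.

Lemma differentiable_tensor f g (x : R * R) : derivable f x.1 (1 : R) ->
  derivable g x.2 (1 : R) -> differentiable (tensor f g) x.
Proof.
move=> /derivable1_diffP df /derivable1_diffP dg.
have d1 : differentiable (fst : R * R -> R) x.
  by apply: linear_differentiable => y; exact: cvg_fst.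
have d2 : differentiable (snd : R * R -> R) x.
  by apply: linear_differentiable => y; exact: cvg_snd.
by apply: (differentiableM (f := f \o fst) (g := g \o snd)); exact: differentiable_comp.
Qed.

Lemma tensor_test_function (U : set (R * R)) f g (l1 r1 l2 r2 : R) :
  smooth1 f -> smooth1 g ->
  (forall x, f x != 0 -> l1 <= x <= r1) -> (forall x, g x != 0 -> l2 <= x <= r2) ->
  `[l1, r1] `*` `[l2, r2] `<=` U -> test_function U (tensor f g).
Proof.
move=> sf sg fl gl lU; split.
  by move=> a b x; rewrite pderiv_tensor//; apply: differentiable_tensor;
    [exact: sf|exact: sg].
exists (`[l1, r1] `*` `[l2, r2]).
  by split => //; apply: compact_setX; exact: segment_compact.
move=> x /= /not_andP[] /negP; rewrite in_itv/= => h; rewrite /tensor.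
- have [-> | /fl h'] := eqVneq (f x.1) 0; first by rewrite mul0r.
  by rewrite h' in h.
- have [-> | /gl h'] := eqVneq (g x.2) 0; first by rewrite mulr0.
  by rewrite h' in h.
Qed.

End tensor_test_functions.

Lemma ae_lebO_and (R : realType) (P Q S : R * R -> Prop) :
  {ae lebO R, forall x, P x} -> {ae lebO R, forall x, Q x} ->
  (forall x, P x -> Q x -> S x) -> {ae lebO R, forall x, S x}.
Proof.
move=> [M [mM M0 MP]] [N [mN N0 NQ]] PQS; exists (M `|` N); split.
- exact: measurableU.
- by rewrite null_set_setU.
- move=> x /= nS; apply: contrapT => /not_orP[nM nN]; apply: nS; apply: PQS.
  + by apply: contrapT => nP; apply: nM; exact: MP.
  + by apply: contrapT => nP; apply: nN; exact: NQ.
Qed.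

Section integration_by_parts.
Variable R : realType.
Local Notation mR := (measurableTypeR R).
Local Notation mR2 := (mR * mR)%type.
Local Notation mu := (lebO R).

Lemma cvg_RintegralM d (T : measurableType d) (nu : {measure set T -> \bar R})
    (u : T -> R) (h_ : nat -> T -> R) (h : T -> R) (M : R) :
  nu.-integrable setT (EFin \o u) ->
  (forall n, measurable_fun setT (h_ n)) -> measurable_fun setT h ->
  (forall n x, `|h_ n x| <= M) -> {ae nu, forall x, h_ n x @[n --> \oo] --> h x} ->
  \int[nu]_x (u x * h_ n x) @[n --> \oo] --> \int[nu]_x (u x * h x).
Proof.
move=> ui mh_ mh hM hh; have mu_ := integrable_mfun ui.
have [] := @dominated_convergence _ _ _ nu setT measurableT
  (fun n => EFin \o (fun x => u x * h_ n x)) (EFin \o (fun x => u x * h x))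
  (EFin \o (fun x => `|u x * M|)) _ _ _ _ _.
- by move=> n; apply/measurable_EFinP; exact: measurable_funM.
- by apply/measurable_EFinP; exact: measurable_funM.
- apply: filterS hh => x hx _; apply: cvg_EFin; first exact: nearW.
  exact: cvgMl_tmp.
- have := integrable_abse (integrableZr measurableT M ui).
  by apply: eq_integrable => // x _; rewrite /= -EFinM.
- apply: aeW => x n _ /=; rewrite lee_fin !normrM ler_wpM2l//.
  by rewrite (le_trans (hM n x))// ler_norm.
move=> ci _; rewrite -(fineK (integrable_fin_num measurableT ci)) => /fine_cvg.
exact.
Qed.

Lemma is_weak_deriv_lebO a b (u g : R * R -> R) (t : R * R -> R) :
  mu.-integrable setT (EFin \o u) -> mu.-integrable setT (EFin \o g) ->
  is_weak_deriv (@Omega R) a b u g -> test_function (@Omega R) t ->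
  measurable_fun setT (t : mR2 -> R) -> measurable_fun setT (pderiv a b t : mR2 -> R) ->
  \int[mu]_x (u x * pderiv a b t x) = (-1) ^+ (a + b) * \int[mu]_x (g x * t x).
Proof.
move=> ui gi ug tt mt mp; have := ug t tt.
rewrite /Rintegral !integral_Omega//.
- by apply/measurable_EFinP; apply: measurable_funM => //; exact: (integrable_mfun gi).
- by apply/measurable_EFinP; apply: measurable_funM => //; exact: (integrable_mfun ui).
Qed.

Definition spline (P : {poly R}) (k : nat) (N s y : R) : R :=
  comb P (cardinal_bspline k) (N * y - s).

Lemma measurable_spline (P : {poly R}) k (N s : R) : measurable_fun setT (spline P k N s : mR -> R).
Proof.
apply: (measurableT_comp (measurable_comb P (cardinal_bspline_in01 R k).1)).
exact: measurable_affine.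
Qed.

Lemma spline_bound (P : {poly R}) k (N s y : R) : `|spline P k N s y| <= coef_norm P.
Proof. by apply: comb_bound; exact: (cardinal_bspline_in01 R k).2. Qed.

Lemma tensor_bound (f g : R -> R) (M1 M2 : R) x : (forall y, `|f y| <= M1) ->
  (forall y, `|g y| <= M2) -> `|tensor f g x| <= M1 * M2.
Proof. by move=> fM gM; rewrite normrM ler_pM. Qed.

Variable H : R -> R.
Hypothesis HH : smooth_step H.

(* The dilation by [1 + d] about the centre of the square moves the support of the
   spline, which may touch the boundary, to the interior. *)
Let delta (n : nat) : R := n.+1%:R^-1.
(** The smoothing widens the support on the left by [eps n] in the variable of the spline, less than
    the room freed by the dilation. *)
Let eps (n : nat) : R := delta n / 4.
(** The argument is [N * (2^-1 + (1 + delta n) * (y - 2^-1)) - s], expanded into affine form. *)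
Let approx (P : {poly R}) k (N s : R) (n : nat) (y : R) : R :=
  comb P (bspl (smooth_box H (eps n)) k)
    ((1 + delta n) * N * y + (N / 2 - s - (1 + delta n) * N / 2)).

Let delta0 n : 0 < delta n. Proof. by rewrite /delta invr_gt0. Qed.
Let eps0 n : 0 < eps n. Proof. by rewrite /eps divr_gt0. Qed.
Let deltac : delta @ \oo --> 0. Proof. exact: cvg_harmonic. Qed.
Let epsc : eps @ \oo --> 0.
Proof. by rewrite -(mul0r (4^-1 : R)); exact: cvgMr_tmp. Qed.
Let delta1 n : delta n <= 1. Proof. by rewrite /delta invf_le1// ler1n. Qed.

Let boxin n := smooth_box_in01 HH (eps0 n).
Let boxsupp n x := @smooth_box_supp _ _ HH (eps n) x (eps0 n).

Let base_smooth n k : smooth1 (bspl (smooth_box H (eps n)) k).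
Proof. exact (@bspl_smooth1 R _ k _ _ (@smooth_box_smooth1 R H HH (eps n)) (boxin n) (@boxsupp n)). Qed.

Let approx_smooth (P : {poly R}) k N s n : smooth1 (approx P k N s n).
Proof.
by apply: smooth1_affine; apply: smooth1_comb.
Qed.

Let approx_derive l (P : {poly R}) k N s n :
  derive1n l (approx P (k + l) N s n) =
  (fun y => ((1 + delta n) * N) ^+ l * approx ((1 - 'X) ^+ l * P) k N s n y).
Proof.
rewrite /approx derive1n_affine; last first.
  exact: smooth1_comb.
by rewrite (derive1n_comb_bspl _ _ _ (@smooth_box_smooth1 R H HH (eps n)) (boxin n) (@boxsupp n)).
Qed.

Let approx_supp (P : {poly R}) k N s n : 1 <= N -> 0 <= s -> s + (k + size P)%:R <= N -> (0 < size P)%N ->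
  exists l r, [/\ 0 < l, r < 1 & forall y, approx P k N s n y != 0 -> l <= y <= r].
Proof.
move=> N1 s0 sN P0; have d0 := delta0 n; have d1 := delta1 n.
pose c := (1 + delta n) * N.
have c0 : 0 < c by rewrite /c mulr_gt0; lra.
(* The points where the dilated coordinate [2^-1 + (1 + delta n) * (y - 2^-1)] equals
   [- delta n / 4] and [1]; as [1 <= N], the overhang [eps n / N] is at most [delta n / 4]. *)
exists (2^-1 - (2^-1 + delta n / 4) / (1 + delta n)), (2^-1 + 2^-1 / (1 + delta n)); split.
- by rewrite subr_gt0 ltr_pdivrMr; lra.
- by rewrite -ltrBrDl ltr_pdivrMr; lra.
move=> y /(comb_supp (bspl_supp (k := k) (@boxsupp n))) /andP[h1 h2].
have kP : (k%:R : R) + (size P).-1%:R + 1 = (k + size P)%:R.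
  by rewrite natrD -{2}(prednK P0) -natr1 addrA.
have dE : (1 + delta n) * (y - 2^-1) * N = (1 + delta n) * N * y - (1 + delta n) * N / 2.
  by ring.
have {}h1 : - (delta n / 4) * N <= (1 + delta n) * (y - 2^-1) * N + N / 2.
  rewrite dE; have : delta n / 4 <= delta n / 4 * N by rewrite ler_peMr// divr_ge0// ltW.
  by rewrite /eps in h1; lra.
have {}h2 : (1 + delta n) * (y - 2^-1) * N <= N / 2 by rewrite dE; lra.
have N0 : 0 < N by lra.
have {}h1 : - (delta n / 4) - 2^-1 <= (1 + delta n) * (y - 2^-1).
  by rewrite -(ler_pM2r N0) mulrBl; lra.
have {}h2 : (1 + delta n) * (y - 2^-1) <= 2^-1.
  by rewrite -(ler_pM2r N0); lra.
have dd : 0 < 1 + delta n by lra.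
apply/andP; split.
  have : 2^-1 - y <= (2^-1 + delta n / 4) / (1 + delta n) by rewrite ler_pdivlMr//; lra.
  by lra.
by rewrite -lerBlDl ler_pdivlMr//; lra.
Qed.

Let approx_bound (P : {poly R}) k N s n y : `|approx P k N s n y| <= coef_norm P.
Proof. by apply: comb_bound; exact: (bspl_in01 k (boxin n)).2. Qed.

Let approx_cvg (P : {poly R}) k (N s y : R) : (N * y - s) \isn't a Num.int ->
  approx P k N s n y @[n --> \oo] --> spline P k N s y.
Proof.
move=> yN; apply: cvg_big => //; first exact: add_continuous.
move=> i _; apply: cvgMl_tmp; apply: (@bspl_smooth_box_cvg _ _ HH) => //.
- apply: cvgB; last exact: cvg_cst.
  rewrite (_ : N * y - s = (1 + 0) * N * y + (N / 2 - s - (1 + 0) * N / 2)); last by ring.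
  apply: cvgD.
    by do 2 apply: cvgMr_tmp; apply: cvgD => //; exact: cvg_cst.
  apply: cvgB; first exact: cvg_cst.
  by do 2 apply: cvgMr_tmp; apply: cvgD => //; exact: cvg_cst.
- by apply: contra yN; rewrite subr_eq0 => /eqP ->; exact: rpred_nat.
- apply: contra yN; rewrite subr_eq => /eqP ->; rewrite rpredD ?rpred_nat ?rpred1//.
Qed.

(** The breakpoints of the splines lie on countably many horizontal and vertical lines, which are
    null; [approx_cvg] holds elsewhere. *)
Let ae_nonint (N s : R) : N != 0 ->
  {ae mu, forall x : R * R, (N * x.1 - s) \isn't a Num.int /\ (N * x.2 - s) \isn't a Num.int}.
Proof.
move=> N0; apply: ae_lebO.
pose Z := [set y : R | N * y - s \is a Num.int].
have cZ : countable Z.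
  apply: (@sub_countable _ _ _ [set ((z%:~R + s) / N) | z in [set: int]]).
    apply: subset_card_le => y /= /intrP[z Ez]; exists z => //.
    by rewrite -Ez subrK mulrC mulKf.
  by apply: (card_le_trans (card_image_le _ _)); apply: countableP.
have mZ : measurable (Z : set mR) by exact: countable_measurable.
have Z0 : lebesgue_measure Z = 0%E by exact: countable_lebesgue_measure0.
exists ((Z `*` setT) `|` (setT `*` Z)); split.
- by apply: measurableU; exact: measurableX.
- apply/eqP; rewrite -measure_le0 (le_trans (measureU2 _ _ _))//.
  + exact: measurableX.
  + exact: measurableX.
  + have e1 : leb2 R (Z `*` setT) = 0%E.
      by have := leb2_setX mZ measurableT; rewrite Z0 mul0e.
    have e2 : leb2 R (setT `*` Z) = 0%E.
      by have := leb2_setX measurableT mZ; rewrite Z0 mule0.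
    by rewrite [X in (X + _)%E]e1 [X in (_ + X)%E]e2 adde0.
- move=> x /= /not_andP[|] /negP; rewrite negbK => h; [left|right]; split => //.
Qed.

(** The weak derivative is tested on the smooth approximations, supported inside the open square,
    and both sides pass to the limit by dominated convergence. The bounds on [s1] and [s2] say that
    the splines are supported in [[0, 1]], boundary included. *)
Lemma weak_deriv_spline (u g : R * R -> R) a b k1 k2 (P1 P2 : {poly R}) (N s1 s2 : R) :
  mu.-integrable setT (EFin \o u) -> mu.-integrable setT (EFin \o g) ->
  is_weak_deriv (@Omega R) a b u g ->
  1 <= N -> 0 <= s1 -> s1 + (k1 + a + size P1)%:R <= N -> (0 < size P1)%N ->
  0 <= s2 -> s2 + (k2 + b + size P2)%:R <= N -> (0 < size P2)%N ->
  N ^+ (a + b) * \int[mu]_x (u x * tensor (spline ((1 - 'X) ^+ a * P1) k1 N s1)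
    (spline ((1 - 'X) ^+ b * P2) k2 N s2) x) =
  (-1) ^+ (a + b) * \int[mu]_x (g x * tensor (spline P1 (k1 + a) N s1)
    (spline P2 (k2 + b) N s2) x).
Proof.
move=> ui gi ug N1 s10 s1N P10 s20 s2N P20.
pose f1 n := approx P1 (k1 + a) N s1 n; pose f2 n := approx P2 (k2 + b) N s2 n.
pose d1 n := approx ((1 - 'X) ^+ a * P1) k1 N s1 n.
pose d2 n := approx ((1 - 'X) ^+ b * P2) k2 N s2 n.
have mt (P Q : {poly R}) k k' n : measurable_fun setT (tensor (approx P k N s1 n) (approx Q k' N s2 n) : mR2 -> R).
  by apply: measurable_tensor; apply: smooth1_measurable; exact: approx_smooth.
have pE n : pderiv a b (tensor (f1 n) (f2 n)) =
    (fun x => ((1 + delta n) * N) ^+ (a + b) * tensor (d1 n) (d2 n) x).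
  rewrite pderiv_tensor; [|exact: approx_smooth..].
  by rewrite !approx_derive; apply/funext => x; rewrite /tensor exprD mulrACA.
have E n : ((1 + delta n) * N) ^+ (a + b) * \int[mu]_x (u x * tensor (d1 n) (d2 n) x) =
    (-1) ^+ (a + b) * \int[mu]_x (g x * tensor (f1 n) (f2 n) x).
  rewrite -(is_weak_deriv_lebO ui gi ug); first last.
  - rewrite pE; apply: measurable_funM => //; exact: mt.
  - exact: mt.
  - have [l1 [r1 [l10 r11 h1]]] := approx_supp n N1 s10 s1N P10.
    have [l2 [r2 [l20 r21 h2]]] := approx_supp n N1 s20 s2N P20.
    apply: (tensor_test_function _ _ h1 h2); [exact: approx_smooth..|].
    move=> x /=; rewrite !in_itv/= => -[/andP[a1 a2] /andP[a3 a4]].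
    by split; rewrite /= in_itv/=; apply/andP; split; lra.
  rewrite pE -RintegralZl//; first by apply: eq_Rintegral => x _; ring.
  apply: (integrable_mulbd ui (mt _ _ _ _ _)) => x; apply: tensor_bound => y; exact: approx_bound.
have c1 : ((1 + delta n) * N) ^+ (a + b) * \int[mu]_x (u x * tensor (d1 n) (d2 n) x) @[n --> \oo] -->
  N ^+ (a + b) * \int[mu]_x (u x * tensor (spline ((1 - 'X) ^+ a * P1) k1 N s1)
    (spline ((1 - 'X) ^+ b * P2) k2 N s2) x).
  apply: cvgM.
    rewrite -[N in X in _ --> X]mul1r -[1 in X in _ --> X]addr0.
    have h : (1 + delta x) * N @[x --> \oo] --> (1 + 0) * N.
      by apply: cvgMr_tmp; apply: cvgD => //; exact: cvg_cst.
    exact: (cvg_comp _ _ h (@exprn_continuous R (a + b) _)).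
  apply: (cvg_RintegralM (M := coef_norm ((1 - 'X) ^+ a * P1) * coef_norm ((1 - 'X) ^+ b * P2))) => //.
  - by move=> n; exact: mt.
  - by apply: measurable_tensor; exact: measurable_spline.
  - by move=> n x; apply: tensor_bound => y; exact: approx_bound.
  - have n0 : N != 0 by rewrite gt_eqF//; lra.
    apply: ae_lebO_and (ae_nonint s1 n0) (ae_nonint s2 n0) _ => x [h1 _] [_ h2].
    by apply: cvgM; exact: approx_cvg.
have c2 : (-1) ^+ (a + b) * \int[mu]_x (g x * tensor (f1 n) (f2 n) x) @[n --> \oo] -->
  (-1) ^+ (a + b) * \int[mu]_x (g x * tensor (spline P1 (k1 + a) N s1)
    (spline P2 (k2 + b) N s2) x).
  apply: cvgMl_tmp.
  apply: (cvg_RintegralM (M := coef_norm P1 * coef_norm P2)) => //.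
  - by move=> n; exact: mt.
  - by apply: measurable_tensor; exact: measurable_spline.
  - by move=> n x; apply: tensor_bound => y; exact: approx_bound.
  - have n0 : N != 0 by rewrite gt_eqF//; lra.
    apply: ae_lebO_and (ae_nonint s1 n0) (ae_nonint s2 n0) _ => x [h1 _] [_ h2].
    by apply: cvgM; exact: approx_cvg.
move: c1; under eq_fun do rewrite E; move=> c1.
exact: (cvg_unique _ c1 c2).
Qed.

End integration_by_parts.

(** * Cells, step functions and averages *)

Section borel_plane.
Variable R : realType.
Local Notation mR := (measurableTypeR R).

Lemma lambda_system_borel (P : set (set mR)) : lambda_system setT P ->
  (forall a : R, P `]a, +oo[%classic) -> forall A, measurable A -> P A.
Proof.
move=> lP Pray A mA.
have GI : setI_closed (@RGenOInfty.G R).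
  move=> _ _ [a ->] [b ->]; exists (Num.max a b); apply/seteqP; split=> x /=.
    by rewrite !in_itv/= !andbT gt_max => -[-> ->].
  by rewrite !in_itv/= !andbT gt_max => /andP[].
apply: (lambda_system_subset GI lP) => //.
- by move=> _ [a ->]; exact: Pray.
- by move: mA; rewrite {1}RGenOInfty.measurableE.
Qed.

(** Quadrants suffice: the pi-lambda argument is run in each coordinate with the other factor fixed,
    then over the measurable rectangles. *)
Lemma lambda_system_plane (P : set (set (mR * mR))) : lambda_system setT P ->
  (forall a b : R, P (`]a, +oo[%classic `*` `]b, +oo[%classic)) ->
  forall A, measurable A -> P A.
Proof.
move=> lP Pray; have [_ PT PD PU] := lP.
have rays : \bigcup_i `](- i%:R : R), +oo[%classic = setT.
  apply/seteqP; split=> // x _; exists (Num.truncn `|x|).+1 => //=.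
  rewrite in_itv/= andbT ltrNl (le_lt_trans (ler_norm _))// normrN.
  exact: truncnS_gt.
(* A lambda-system must contain the whole space; for the slices this comes from writing the line as
   an increasing union of rays. *)
have raysT (S : set (set mR)) : (forall a : R, S `]a, +oo[%classic) -> ndseq_closed S -> S setT.
  move=> Sa SU; rewrite -rays; apply: SU => // i j ij; apply/subsetPset => x /=.
  by rewrite !in_itv/= !andbT; apply: le_lt_trans; rewrite lerN2 ler_nat.
have l1 (B : set mR) : (forall a : R, P (`]a, +oo[%classic `*` B)) ->
    forall A : set mR, measurable A -> P (A `*` B).
  move=> PB; have ndP : ndseq_closed [set A : set mR | P (A `*` B)].
    move=> F ndF PF /=; rewrite setX_bigcupl; apply: PU => // i j ij.
    by apply/subsetPset; apply: setSX => //; exact/subsetPset/ndF.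
  apply: lambda_system_borel => //; split => //.
  - exact: (raysT [set A : set mR | P (A `*` B)]).
  - move=> A A' AA' PA PA' /=; rewrite (_ : _ `*` _ = (A `*` B) `\` (A' `*` B)).
      by apply: PD => //; exact: setSX.
    by apply/seteqP; split=> x /=; tauto.
have l2 (A : set mR) : measurable A -> forall B : set mR, measurable B -> P (A `*` B).
  move=> mA; have ndP : ndseq_closed [set B : set mR | P (A `*` B)].
    move=> F ndF PF /=; rewrite setX_bigcupr; apply: PU => // i j ij.
    by apply/subsetPset; apply: setSX => //; exact/subsetPset/ndF.
  have Pr (b : R) : P (A `*` `]b, +oo[%classic) by apply: l1.
  apply: lambda_system_borel => //; split => //.
  - exact: (raysT [set B : set mR | P (A `*` B)]).
  - move=> B B' BB' PB PB' /=; rewrite (_ : _ `*` _ = (A `*` B) `\` (A `*` B')).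
      by apply: PD => //; exact: setSX.
    by apply/seteqP; split=> x /=; tauto.
move=> A mA; pose C := [set A1 `*` A2 | A1 in @measurable _ mR & A2 in @measurable _ mR].
have CI : setI_closed C.
  move=> X Y [X1 mX1 [X2 mX2 <-{X}]] [Y1 mY1 [Y2 mY2 <-{Y}]].
  exists (X1 `&` Y1); first exact: measurableI.
  by exists (X2 `&` Y2); [exact: measurableI|rewrite setXI].
apply: (lambda_system_subset CI lP) => //.
  by move=> _ [A1 mA1 [A2 mA2 <-]]; exact: l2.
by rewrite -measurable_prod_measurableType.
Qed.

End borel_plane.

Section cells.
Variable R : realType.
Local Notation mR := (measurableTypeR R).
Local Notation mu := (lebO R).

Definition cell_index (e : R) (n : nat) (x : R * R) : int * int :=
  (Num.floor (2 ^+ n * x.1 - e), Num.floor (2 ^+ n * x.2 - e)).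

(* [e] is the translation of the B-spline: the cell of a grid point is then inside the
   support of its scaling function, so that grid points of [M_n] have cells in the square. *)
Definition cell1 (e : R) (n : nat) (k : int) : set R :=
  `[(k%:~R + e) / 2 ^+ n, (k%:~R + e + 1) / 2 ^+ n[%classic.

Definition cell (e : R) (n : nat) (k : int * int) : set (R * R) :=
  cell1 e n k.1 `*` cell1 e n k.2.

Lemma floor_cell1 e n k (x : R) : (Num.floor (2 ^+ n * x - e) == k) = (x \in cell1 e n k).
Proof.
rewrite floor_eq /cell1 mem_setE in_itv/=.
rewrite ler_pdivrMr ?exprn_gt0// ltr_pdivlMr ?exprn_gt0// intrD.
by rewrite lerBrDr ltrBlDr addrAC [x * _]mulrC.
Qed.

Lemma cell_indexE e n k x : (cell_index e n x == k) = (x \in cell e n k).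
Proof.
rewrite /cell_index -pair_eqE /pair_eq/= !floor_cell1 /cell.
by apply/andP/idP => [[]|]; rewrite !inE//=.
Qed.

Lemma measurable_cell e n k : measurable (cell e n k : set (mR * mR)).
Proof. by apply: measurableX; exact: measurable_itv. Qed.

(** The cell lies in the closed square, up to its boundary, so the restricted measure gives it its
    full area. *)
Definition inner_cell (e : R) (n : nat) (k : int * int) :=
  [/\ 0 <= k.1%:~R + e, k.1%:~R + e + 1 <= 2 ^+ n,
      0 <= k.2%:~R + e & k.2%:~R + e + 1 <= 2 ^+ n].

Lemma cell1_measure e n k : 0 <= k%:~R + e -> k%:~R + e + 1 <= 2 ^+ n ->
  (lebesgue_measure (cell1 e n k `&` `]0%R, 1%R[%classic : set mR) = (2 ^- n)%:E)%E.
Proof.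
move=> k0 k1; set a := (k%:~R + e) / 2 ^+ n; set b := (k%:~R + e + 1) / 2 ^+ n.
have p0 : 0 < (2 ^+ n : R) by rewrite exprn_gt0.
have ab : a < b by rewrite ltr_pM2r ?invr_gt0// ltrDl.
have a0 : 0 <= a by rewrite divr_ge0// ltW.
have b1 : b <= 1 by rewrite ler_pdivrMr// mul1r.
have bE : b = a + 2 ^- n by rewrite /b mulrDl mul1r.
apply/eqP; rewrite eq_le; apply/andP; split.
  have <- : lebesgue_measure (`[a, b[%classic : set mR) = (2 ^- n)%:E.
    by rewrite lebesgue_measure_itv/= lte_fin ab -EFinB bE addrAC subrr add0r.
  by apply: le_measure; rewrite ?inE; [apply: measurableI; exact: measurable_itv|exact: measurable_itv|exact: subIsetl].
have <- : lebesgue_measure (`]a, b[%classic : set mR) = (2 ^- n)%:E.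
  by rewrite lebesgue_measure_itv/= lte_fin ab -EFinB bE addrAC subrr add0r.
apply: le_measure; rewrite ?inE; [exact: measurable_itv|apply: measurableI; exact: measurable_itv|].
move=> x /=; rewrite !in_itv/= => /andP[xa xb]; split.
  by rewrite /cell1/= in_itv/= (ltW xa).
by rewrite (le_lt_trans a0)//= (lt_le_trans xb).
Qed.

Lemma cell_measure e n k : inner_cell e n k -> (mu (cell e n k) = ((2 ^- n) ^+ 2)%:E)%E.
Proof.
move=> [k0 k1 k2 k3].
have mc k' : measurable (cell1 e n k' `&` `]0%R, 1%R[%classic : set mR).
  by apply: measurableI; exact: measurable_itv.
transitivity (leb2 R ((cell1 e n k.1 `&` `]0%R, 1%R[) `*` (cell1 e n k.2 `&` `]0%R, 1%R[))).
  by rewrite /lebO /= /mrestr /cell /Omega -setXI.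
rewrite [LHS](leb2_setX (mc _) (mc _)).
by rewrite [X in (X * _)%E]cell1_measure// [X in (_ * X)%E]cell1_measure.
Qed.

(** Encodes a grid function on the finite list [r] as a function on the square, zero elsewhere;
    discrete weighted norms then become L_1 and L_2 norms. *)
Definition step (e : R) (n : nat) (r : seq (int * int)) (F : int * int -> R) (x : R * R) : R :=
  if cell_index e n x \in r then F (cell_index e n x) else 0.

Lemma stepE e n r F : uniq r ->
  step e n r F = (fun x => \sum_(k <- r) F k * \1_(cell e n k) x).
Proof.
move=> ur; apply/funext => x; rewrite /step.
under eq_bigr do rewrite indicE -cell_indexE.
case: ifPn => xr.
  rewrite (bigD1_seq (cell_index e n x))//= eqxx mulr1 big1 ?addr0// => k kx.
  by rewrite eq_sym (negbTE kx) mulr0.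
rewrite big1_seq// => k /= kr; case: eqP => [kx|_]; last by rewrite mulr0.
by rewrite kx kr in xr.
Qed.

Lemma measurable_step e n r F : uniq r ->
  measurable_fun setT (step e n r F : mR * mR -> R).
Proof.
move=> ur; rewrite stepE//; apply: measurable_sum => k; apply: measurable_funM => //.
by apply: measurable_indic; exact: measurable_cell.
Qed.

(** Turns the sums with weight [h ^+ 2] of the discrete energy into integrals over the square. *)
Lemma ge0_integral_step e n r F : uniq r -> (forall k, k \in r -> inner_cell e n k) ->
  (forall k, k \in r -> 0 <= F k) ->
  (\int[mu]_x (step e n r F x)%:E = ((2 ^- n) ^+ 2 * \sum_(k <- r) F k)%:E)%E.
Proof.
move=> ur ri F0.
have -> : step e n r F = step e n r (fun k => `|F k|).
  by apply/funext => x; rewrite /step; case: ifP => // /F0/ger0_norm ->.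
rewrite stepE//; under eq_integral do rewrite -sumEFin.
rewrite ge0_integral_sum//; last first.
  move=> k; apply/measurable_EFinP; apply: measurable_funM => //.
  by apply: measurable_indic; exact: measurable_cell.
rewrite mulr_sumr -sumEFin big_seq [RHS]big_seq; apply: eq_bigr => k kr.
under eq_integral do rewrite EFinM.
rewrite ge0_integralZl//; last first.
  by apply/measurable_EFinP; apply: measurable_indic; exact: measurable_cell.
rewrite integral_indic//; last exact: measurable_cell.
rewrite setIT [X in (_ * X)%E]cell_measure; last exact: ri.
by rewrite -EFinM mulrC ger0_norm// F0.
Qed.

Lemma norm_step e n r F x : `|step e n r F x| = step e n r (fun k => `|F k|) x.
Proof. by rewrite /step; case: ifP => //; rewrite normr0. Qed.

End cells.

(** * Averages against dilated kernels *)

Section kernel_averages.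
Variable R : realType.
Local Notation mR := (measurableTypeR R).
Local Notation lam := (@lebesgue_measure R).
Local Notation mu := (lebO R).

Lemma ler_sum_subset (I : eqType) (s t : seq I) (F : I -> R) : (forall i, 0 <= F i) ->
  uniq s -> {in s, forall i, F i != 0 -> i \in t} ->
  \sum_(i <- s) F i <= \sum_(i <- t) F i.
Proof.
move=> F0; elim: s t => [|i s IH] t; first by rewrite big_nil sumr_ge0.
move=> /= /andP[iNs us] st; rewrite big_cons.
have [Fi|Fi] := eqVneq (F i) 0.
  by rewrite Fi add0r IH// => j js; apply: st; rewrite inE js orbT.
have it : i \in t by apply: st => //; rewrite mem_head.
rewrite (perm_big _ (perm_to_rem it)) big_cons lerD2l IH// => j js Fj.
have : j \in t by apply: st => //; rewrite inE js orbT.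
rewrite (perm_mem (perm_to_rem it)) inE => /orP[/eqP ji|//].
by rewrite -ji js in iNs.
Qed.

Definition is_kernel (K : R -> R) (M L : R) :=
  [/\ measurable_fun setT (K : mR -> R), forall x, `|K x| <= M &
      forall x, K x != 0 -> `|x| <= L].

Lemma is_kernel_M0 K M L : is_kernel K M L -> 0 <= M.
Proof. by case=> _ + _ => /(_ 0); exact: le_trans. Qed.

Lemma is_kernel_integrable K M L : is_kernel K M L -> lam.-integrable setT (EFin \o K).
Proof.
case=> mK KM KL; apply: (@integrable_cpt _ _ M (- L) L) => //.
by move=> x /KL; rewrite ler_norml.
Qed.

Lemma is_kernel_abs K M L : is_kernel K M L -> is_kernel (fun x => `|K x|) M L.
Proof.
case=> mK KM KL; split.
- exact: measurableT_comp.
- by move=> x; rewrite normr_id.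
- by move=> x; rewrite normr_eq0; exact: KL.
Qed.

Definition ker_nk (K1 K2 : R -> R) (n : nat) (k : int * int) : R * R -> R :=
  tensor (fun y => K1 (2 ^+ n * y + - k.1%:~R)) (fun y => K2 (2 ^+ n * y + - k.2%:~R)).

(** The prefactor is the inverse of the area of a cell, so the total mass of the kernel does not
    depend on [n]. *)
Definition avg (K1 K2 : R -> R) (n : nat) (g : R * R -> R) (k : int * int) : R :=
  (2 ^+ n) ^+ 2 * \int[mu]_x (g x * ker_nk K1 K2 n k x).

(** Bounds the number of integers in an interval of length [2 * L], hence the number of integer
    translates of a kernel of radius [L] that overlap at a point. *)
Definition count_bound (L : R) : nat := (Num.truncn (2 * L + 1)).+1.

Lemma int_window (L z : R) (k : int) : `|z - k%:~R| <= L ->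
  exists2 i : nat, (i < count_bound L)%N & k = Num.floor (z - L) + i%:Z.
Proof.
rewrite ler_norml => /andP[h1 h2].
have /andP[f1 f2] := real_floor_itv (num_real (z - L)).
have fk : Num.floor (z - L) <= k.
  by rewrite -(ler_int R) (le_trans f1)//; lra.
exists `|k - Num.floor (z - L)|%N; last first.
  by rewrite gez0_abs ?subr_ge0// [RHS]addrC subrK.
rewrite ltnS truncn_ge_nat; last by lra.
rewrite natr_absz ger0_norm ?subr_ge0// intrB.
by rewrite intrD in f2; lra.
Qed.

Section kernels.
Variables (K1 K2 : R -> R) (M L : R).
Hypotheses (hK1 : is_kernel K1 M L) (hK2 : is_kernel K2 M L).

Lemma measurable_ker n k : measurable_fun setT (ker_nk K1 K2 n k : mR * mR -> R).
Proof.
case: hK1 hK2 => [mK1 _ _] [mK2 _ _]; apply: measurable_tensor.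
- by apply: (measurableT_comp mK1); exact: measurable_affine.
- by apply: (measurableT_comp mK2); exact: measurable_affine.
Qed.

Lemma ker_bound n k x : `|ker_nk K1 K2 n k x| <= M ^+ 2.
Proof.
case: hK1 hK2 => [_ K1M _] [_ K2M _].
by rewrite normrM expr2 ler_pM.
Qed.

Lemma ker_supp n k x : ker_nk K1 K2 n k x != 0 ->
  `|2 ^+ n * x.1 - k.1%:~R| <= L /\ `|2 ^+ n * x.2 - k.2%:~R| <= L.
Proof.
case: hK1 hK2 => [_ _ K1L] [_ _ K2L].
by rewrite mulf_eq0 negb_or => /andP[/K1L ? /K2L ?].
Qed.

Lemma ker_sum_bound n (r : seq (int * int)) x : uniq r ->
  \sum_(k <- r) `|ker_nk K1 K2 n k x| <= (count_bound L ^ 2)%:R * M ^+ 2.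
Proof.
move=> ur; pose c := count_bound L.
pose f z := Num.floor (2 ^+ n * z - L).
pose t := [seq (f x.1 + i%:Z, f x.2 + j%:Z) | i <- iota 0 c, j <- iota 0 c].
apply: (@le_trans _ _ (\sum_(k <- t) `|ker_nk K1 K2 n k x|)).
  apply: ler_sum_subset => // k _; rewrite normr_eq0 => /ker_supp[].
  move=> /int_window[i ic Ei] /int_window[j jc Ej].
  rewrite [k]surjective_pairing Ei Ej; apply: allpairs_f; rewrite mem_iota//.
apply: (@le_trans _ _ (\sum_(k <- t) M ^+ 2)).
  by apply: ler_sum => k _; exact: ker_bound.
rewrite big_const_seq count_predT iter_addr_0 size_allpairs !size_iota.
by rewrite mulnn mulr_natl.
Qed.

Lemma integrable_ker n k : (leb2 R).-integrable setT (EFin \o ker_nk K1 K2 n k).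
Proof.
by apply: integrable_tensor; apply: integrable_affine; rewrite ?exprn_gt0//;
  apply: is_kernel_integrable; eassumption.
Qed.

Lemma integral_ker n k : \int[leb2 R]_x ker_nk K1 K2 n k x =
  (2 ^- n) ^+ 2 * (\int[lam]_x K1 x * \int[lam]_x K2 x).
Proof.
have p0 : 0 < (2 ^+ n : R) by rewrite exprn_gt0.
have i1 := is_kernel_integrable hK1; have i2 := is_kernel_integrable hK2.
rewrite Rintegral_tensor; [|exact: integrable_affine..].
by rewrite !Rintegral_affine// mulrACA expr2.
Qed.

Lemma integrable_mulker n k g : mu.-integrable setT (EFin \o g) ->
  mu.-integrable setT (EFin \o (fun x => g x * ker_nk K1 K2 n k x)).
Proof.
by move=> gi; apply: (integrable_mulbd gi (measurable_ker n k)) => x; exact: ker_bound.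
Qed.

Lemma avgD n g h k : mu.-integrable setT (EFin \o g) -> mu.-integrable setT (EFin \o h) ->
  avg K1 K2 n (fun x => g x + h x) k = avg K1 K2 n g k + avg K1 K2 n h k.
Proof.
move=> gi hi; rewrite /avg -mulrDr -RintegralD//; [|exact: integrable_mulker..].
by congr (_ * _); apply: eq_Rintegral => x _; rewrite mulrDl.
Qed.

Lemma avgZ n a g k : mu.-integrable setT (EFin \o g) ->
  avg K1 K2 n (fun x => a * g x) k = a * avg K1 K2 n g k.
Proof.
move=> gi; rewrite /avg [RHS]mulrCA -[in RHS]RintegralZl//; last exact: integrable_mulker.
by congr (_ * _); apply: eq_Rintegral => x _; rewrite mulrA.
Qed.

Lemma avg_ae n g h k : measurable_fun setT (g : mR * mR -> R) ->
  measurable_fun setT (h : mR * mR -> R) ->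
  {ae mu, forall x, g x = h x} -> avg K1 K2 n g k = avg K1 K2 n h k.
Proof.
move=> mg mh gh; rewrite /avg /Rintegral; congr (_ * fine _).
have mk := measurable_ker n k.
apply: ae_eq_integral => //.
- by apply/measurable_EFinP; exact: measurable_funM.
- by apply/measurable_EFinP; exact: measurable_funM.
- by apply: filterS gh => x -> _.
Qed.

Lemma norm_avg n g k : mu.-integrable setT (EFin \o g) ->
  `|avg K1 K2 n g k| <= (2 ^+ n) ^+ 2 * \int[mu]_x (`|g x| * `|ker_nk K1 K2 n k x|).
Proof.
move=> gi; rewrite normrM ger0_norm ?exprn_ge0//.
rewrite ler_wpM2l ?exprn_ge0//.
rewrite (le_trans (le_normr_Rintegral _ (integrable_mulker n k gi)))//.
by under eq_Rintegral do rewrite normrM.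
Qed.

Let C := (count_bound L ^ 2)%:R * M ^+ 2.

(** Exchanging sum and integral leaves the sum of the translated kernels at a point, bounded by
    finite overlap. The constant does not depend on [n]: this stability reduces convergence to a
    dense class of functions. *)
Lemma nrm1_step_avg e n (r : seq (int * int)) g : uniq r ->
  (forall k, k \in r -> inner_cell e n k) -> mu.-integrable setT (EFin \o g) ->
  (nrm1 mu (step e n r (avg K1 K2 n g)) <= C%:E * nrm1 mu g)%E.
Proof.
move=> ur ri gi; rewrite /nrm1; under eq_integral do rewrite norm_step.
rewrite ge0_integral_step//.
have mg := integrable_mfun gi.
have mgk k : measurable_fun setT (fun x : mR * mR => (`|g x| * `|ker_nk K1 K2 n k x|)%:E).
  apply/measurable_EFinP; apply: measurable_funM; first exact: measurableT_comp.
  by apply: measurableT_comp => //; exact: measurable_ker.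
have igk k : mu.-integrable setT (EFin \o (fun x => `|g x| * `|ker_nk K1 K2 n k x|)).
  have := integrable_abse (integrable_mulker n k gi).
  by apply: eq_integrable => // x _; rewrite /= normrM.
apply: (@le_trans _ _ (\sum_(k <- r) \int[mu]_x (`|g x| * `|ker_nk K1 K2 n k x|)%:E)%E).
  rewrite mulr_sumr -sumEFin; apply: lee_sum => k _.
  rewrite -[leRHS]fineK; last exact: (integrable_fin_num measurableT (igk k)).
  rewrite lee_fin -ler_pdivlMl ?exprn_gt0 ?invr_gt0 ?exprn_gt0//.
  by rewrite (le_trans (norm_avg n k gi))// exprVn invrK.
rewrite -ge0_integral_sum//.
rewrite -ge0_integralZl//; last 2 first.
- exact: measurable_normE.
- by rewrite lee_fin mulr_ge0// exprn_ge0// (is_kernel_M0 hK1).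
apply: ge0_le_integral => //.
- by move=> x _; rewrite sumEFin lee_fin sumr_ge0// => k _; rewrite mulr_ge0.
- exact: emeasurable_sum.
- by apply: measurable_funeM; exact: measurable_normE.
- move=> x _; rewrite sumEFin lee_fin -mulr_sumr mulrC ler_wpM2r//.
  exact: ker_sum_bound.
Qed.

End kernels.

Lemma Rintegral_Omega_leb2 (f g : R * R -> R) : measurable_fun setT (f : mR * mR -> R) ->
  (forall x, Omega x -> f x = g x) -> (forall x, ~ Omega x -> g x = 0) ->
  \int[mu]_x f x = \int[leb2 R]_x g x.
Proof.
move=> mf fg g0; rewrite /Rintegral -integral_Omega; last exact/measurable_EFinP.
rewrite (_ : (\int[leb2 R]_(x in @Omega R) (f x)%:E = \int[leb2 R]_x (g x)%:E)%E)//.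
rewrite integral_mkcond; apply: eq_integral => x _; rewrite patchE.
by case: (boolP (x \in Omega (R := R))) => [/set_mem/fg ->//|]; rewrite notin_setE => /g0 ->.
Qed.

Lemma le_Rintegral_Omega_leb2 (f g : R * R -> R) : mu.-integrable setT (EFin \o f) ->
  (leb2 R).-integrable setT (EFin \o g) ->
  (forall x, 0 <= f x) -> (forall x, f x <= g x) ->
  \int[mu]_x f x <= \int[leb2 R]_x g x.
Proof.
move=> fi gi f0 fg; have mf := integrable_mfun fi; have mg := integrable_mfun gi.
rewrite /Rintegral; apply: fine_le.
- exact: (integrable_fin_num measurableT fi).
- exact: (integrable_fin_num measurableT gi).
- rewrite -integral_Omega; last exact/measurable_EFinP.
  apply: (@le_trans _ _ (\int[leb2 R]_(x in @Omega R) (g x)%:E)%E).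
    apply: ge0_le_integral => //.
    + exact: measurable_Omega.
    + by move=> x _; rewrite lee_fin.
    + by apply/measurable_EFinP; apply: measurable_funTS.
    + by apply/measurable_EFinP; apply: measurable_funTS.
    + by move=> x _; rewrite lee_fin.
  apply: ge0_subset_integral => //.
  + exact: measurable_Omega.
  + exact/measurable_EFinP.
  + by move=> x _; rewrite lee_fin (le_trans (f0 x)).
Qed.

(** * Convergence of the averages in L_1 *)

Section step_convergence.
Variables (K1 K2 : R -> R) (M L : R).
Hypotheses (hK1 : is_kernel K1 M L) (hK2 : is_kernel K2 M L).
Variables (e : R) (r_ : nat -> seq (int * int)).
Hypothesis ur : forall n, uniq (r_ n).
Hypothesis ri : forall n k, k \in r_ n -> inner_cell e n k.
Hypothesis rO : forall x, Omega x -> \forall n \near \oo, cell_index e n x \in r_ n.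

Let m := \int[lam]_x K1 x * \int[lam]_x K2 x.
Let P n g : R * R -> R := step e n (r_ n) (avg K1 K2 n g).
Let C := (count_bound L ^ 2)%:R * M ^+ 2.
Let good (g : R * R -> R) := cvg1 mu (fun n => P n g) (fun x => m * g x).

Let mP n g : measurable_fun setT (P n g : mR * mR -> R).
Proof. exact: measurable_step. Qed.

Let C0 : 0 <= C. Proof. by rewrite mulr_ge0// exprn_ge0// (is_kernel_M0 hK1). Qed.

Let PD n g h : mu.-integrable setT (EFin \o g) -> mu.-integrable setT (EFin \o h) ->
  P n (fun x => g x + h x) = (fun x => P n g x + P n h x).
Proof.
move=> gi hi; apply/funext => x; rewrite /P /step; case: ifP => _; last by rewrite addr0.
by rewrite (avgD hK1 hK2).
Qed.

Let PZ n a g : mu.-integrable setT (EFin \o g) ->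
  P n (fun x => a * g x) = (fun x => a * P n g x).
Proof.
move=> gi; apply/funext => x; rewrite /P /step; case: ifP => _; last by rewrite mulr0.
by rewrite (avgZ hK1 hK2).
Qed.

Let goodD g h : mu.-integrable setT (EFin \o g) -> mu.-integrable setT (EFin \o h) ->
  good g -> good h -> good (fun x => g x + h x).
Proof.
move=> gi hi gg gh; have mg := integrable_mfun gi; have mh := integrable_mfun hi.
rewrite /good (_ : (fun n => _) = (fun n x => P n g x + P n h x)).
  under [X in cvg1 _ _ X]eq_fun do rewrite mulrDr.
  by apply: cvg1D => //; exact: measurable_funM.
by apply/funext => n; exact: PD.
Qed.

Let goodZ a g : mu.-integrable setT (EFin \o g) -> good g -> good (fun x => a * g x).
Proof.
move=> gi gg; have mg := integrable_mfun gi.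
rewrite /good (_ : (fun n => _) = (fun n x => a * P n g x)).
  under [X in cvg1 _ _ X]eq_fun do rewrite mulrCA.
  by apply: cvg1Z => //; exact: measurable_funM.
by apply/funext => n; exact: PZ.
Qed.

(** The error made by replacing [g] with [h] is controlled uniformly in [n] by [nrm1_step_avg], so
    the good functions are closed in L_1. *)
Let good_limit g : mu.-integrable setT (EFin \o g) ->
  (forall d : R, 0 < d -> exists h, [/\ mu.-integrable setT (EFin \o h), good h &
     (nrm1 mu (fun x => g x - h x)%R <= d%:E)%E]) -> good g.
Proof.
move=> gi gh; apply/cvg1P => d d0.
(* Constants of the two terms in [g - h], that of the averages and that of the limit; 1 is added for
   positivity. *)
pose A := C + `|m| + 1.
have A0 : 0 < A by rewrite ltr_wpDl// addr_ge0.
have dA : 0 < d / 2 / A by rewrite !divr_gt0.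
have [h [hi hg ghd]] := gh _ dA.
have mg := integrable_mfun gi; have mh := integrable_mfun hi.
have gNh : mu.-integrable setT (EFin \o (fun x => g x - h x)).
  by have := integrableB measurableT gi hi; apply: eq_integrable.
move/cvg1P : hg => /(_ (d / 2)) hg.
have d2 : 0 < d / 2 by rewrite divr_gt0.
apply: filterS (hg d2) => n hn.
have -> : (fun x => P n g x - m * g x) =
    (fun x => P n (fun x => g x - h x) x) \+ ((fun x => P n h x - m * h x) \+
      (fun x => (- m) * (g x - h x))).
  have -> : P n g = (fun x => P n (fun x => g x - h x) x + P n h x).
    by rewrite -PD//; congr (P n _); apply/funext => x; rewrite subrK.
  by apply/funext => x /=; ring.
apply: (le_trans (nrm1D _ _ _)) => //.
  apply: measurable_funD; first by apply: measurable_funB => //; exact: measurable_funM.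
  by apply: measurable_funM => //; exact: measurable_funB.
apply: (le_trans (leeD2l _ (nrm1D _ _ _))) => //.
- by apply: measurable_funB => //; exact: measurable_funM.
- by apply: measurable_funM => //; exact: measurable_funB.
apply: (@le_trans _ _ (C%:E * (d / 2 / A)%:E + ((d / 2)%:E + `|m|%:E * (d / 2 / A)%:E))%E).
  apply: leeD; [|apply: leeD => //].
    apply: (le_trans (nrm1_step_avg hK1 hK2 (ur n) (@ri n) gNh)).
    by apply: lee_wpmul2l; rewrite ?lee_fin.
  by rewrite nrm1Z ?normrN; [apply: lee_wpmul2l; rewrite ?lee_fin|exact: measurable_funB].
rewrite -!EFinM -!EFinD lee_fin.
have -> : C * (d / 2 / A) + (d / 2 + `|m| * (d / 2 / A)) = d / 2 + (C + `|m|) / A * (d / 2) by ring.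
rewrite [leRHS](splitr d) lerD2l ler_piMl//; first exact: ltW.
by rewrite ler_pdivrMr// mul1r /A lerDl.
Qed.

Lemma mono_exp2 (x d : R) : 0 < d -> \forall n \near \oo, x < 2 ^+ n * d.
Proof.
move=> d0; exists (Num.truncn (`|x| / d)).+1 => // n /= hn.
rewrite -ltr_pdivrMr// (@le_lt_trans _ _ (`|x| / d))//.
  by rewrite ler_pM2r ?invr_gt0// ler_norm.
apply: (lt_le_trans (truncnS_gt _)); rewrite -natrX ler_nat (leq_trans hn)//.
by rewrite ltnW// ltn_expl.
Qed.

(* For large [n] the kernel at [x] only sees a neighbourhood of [x]. *)
Let avg_local (g : R * R -> R) x d : measurable_fun setT (g : mR * mR -> R) ->
  Omega x -> 0 < d ->
  (forall y : R * R, `|x.1 - y.1| < d -> `|x.2 - y.2| < d -> g y = g x) ->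
  \forall n \near \oo, avg K1 K2 n g (cell_index e n x) = m * g x.
Proof.
move=> mg Ox d0 gx; have [] := Ox; rewrite /= !in_itv/= => /andP[x10 x11] /andP[x20 x21].
(* Staying at this distance also keeps the support of the kernel inside the square, so that no mass
   is lost by restricting the measure. *)
pose d' := Num.min d (Num.min (Num.min x.1 (1 - x.1)) (Num.min x.2 (1 - x.2))).
have d'0 : 0 < d' by rewrite !lt_min d0 x10 x20 !subr_gt0 x11 x21.
(* In units of the grid: the radius of the kernel, the rounding by the floor, and the shift of the
   cells. *)
apply: filterS (mono_exp2 (L + 1 + `|e|) d'0) => n hn.
have p0 : 0 < (2 ^+ n : R) by rewrite exprn_gt0.
set k := cell_index e n x.
have mk := measurable_ker hK1 hK2 n k.
have near_ (a b : R) : `|2 ^+ n * b - (Num.floor (2 ^+ n * a - e))%:~R| <= L -> `|a - b| < d'.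
    have /andP[f1 f2] := real_floor_itv (num_real (2 ^+ n * a - e)).
    rewrite -(ltr_pM2l p0) => h; apply: le_lt_trans hn.
    rewrite -[2 ^+ n in leLHS]gtr0_norm// -normrM.
    rewrite intrD in f2; have := ler_norm e; have := ler_norm (- e); rewrite normrN.
    by rewrite ler_norml in h; case/andP: h => h1 h2 e1 e2; rewrite ler_norml; lra.
have near_y (y : R * R) : `|2 ^+ n * y.1 - k.1%:~R| <= L -> `|2 ^+ n * y.2 - k.2%:~R| <= L ->
    g y = g x /\ Omega y.
  move=> /near_ + /near_.
  rewrite !lt_min !ltr_norml => /andP[/andP[a1 a2] /andP[/andP[/andP[a3 a4] /andP[a5 a6]] /andP[/andP[a7 a8] /andP[a9 a10]]]].
  move=> /andP[/andP[b1 b2] /andP[/andP[/andP[b3 b4] /andP[b5 b6]] /andP[/andP[b7 b8] /andP[b9 b10]]]].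
  split; first by apply: gx; rewrite ltr_norml; apply/andP.
  move: a4 b8 a5 b9; rewrite !ltrBlDr !ltrDl !opprB !ltrD2l !ltrN2 => y10 y20 y11 y21.
  by split; rewrite /= in_itv/= ?y10 ?y20.
rewrite /avg (@Rintegral_Omega_leb2 _ (fun y => g x * ker_nk K1 K2 n k y)); first last.
- move=> y nO; have [->|/(ker_supp hK1 hK2)[s1 s2]] := eqVneq (ker_nk K1 K2 n k y) 0.
    by rewrite mulr0.
  by have [_ /nO] := near_y y s1 s2.
- move=> y Oy.
  have [->|/(ker_supp hK1 hK2)[s1 s2]] := eqVneq (ker_nk K1 K2 n k y) 0.
    by rewrite !mulr0.
  by have [gy _] := near_y y s1 s2; rewrite gy.
- exact: measurable_funM.
rewrite RintegralZl//; last exact: (integrable_ker hK1 hK2).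
rewrite (integral_ker hK1 hK2) -/m [g x * _]mulrC mulrA mulrA -exprMn.
by rewrite divff ?gt_eqF// expr1n mul1r.
Qed.

Let avg_bounded n g k : measurable_fun setT (g : mR * mR -> R) -> (forall x, `|g x| <= 1) ->
  `|avg K1 K2 n g k| <= \int[lam]_x `|K1 x| * \int[lam]_x `|K2 x|.
Proof.
move=> mg g1.
have gi : mu.-integrable setT (EFin \o g).
  apply: measurable_bounded_integrable => //; first exact: lebO_finite.
  by exists 1; split; [exact: num_real|move=> y y1 x _ /=; rewrite (le_trans (g1 x))// ltW].
apply: (le_trans (norm_avg hK1 hK2 n k gi)).
have a1 := is_kernel_abs hK1; have a2 := is_kernel_abs hK2.
have E x : `|ker_nk K1 K2 n k x| = ker_nk (fun x => `|K1 x|) (fun x => `|K2 x|) n k x.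
  by rewrite /ker_nk /tensor normrM.
have := integral_ker a1 a2 n k.
move/(congr1 (fun z => (2 ^+ n) ^+ 2 * z)).
rewrite [in RHS]mulrA -exprMn mulfV ?expf_neq0// expr1n mul1r => <-.
apply: ler_wpM2l; first by rewrite exprn_ge0.
have k0 y : 0 <= ker_nk (fun x => `|K1 x|) (fun x => `|K2 x|) n k y by rewrite mulr_ge0.
apply: le_Rintegral_Omega_leb2.
- have := integrable_abse (integrable_mulker hK1 hK2 n k gi).
  by apply: eq_integrable => // x _; rewrite /= normrM.
- exact: integrable_ker a1 a2 n k.
- by move=> x; rewrite mulr_ge0.
- by move=> x; rewrite E ler_piMl.
Qed.

(** Where [A] is locally constant the averages are eventually equal to their limit; they are also
    uniformly bounded, so dominated convergence applies. *)
Let good_indic (A : set (mR * mR)) : measurable A ->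
  {ae mu, forall x, exists2 d : R, 0 < d & forall y : R * R,
     `|x.1 - y.1| < d -> `|x.2 - y.2| < d -> (y \in A) = (x \in A)} ->
  good (\1_A).
Proof.
move=> mA hA; have mI : measurable_fun setT (\1_A : mR * mR -> R) by exact: measurable_indic.
have I1 x : `|\1_A x : R| <= 1.
  by rewrite indicE; case: (_ \in _); rewrite ?normr0 ?normr1.
apply: (@cvg1_of_ptws _ _ _ mu _ _ (\int[lam]_x `|K1 x| * \int[lam]_x `|K2 x|)).
- exact: lebO_finite.
- by [].
- exact: measurable_funM.
- move=> n x; rewrite /P norm_step /step; case: ifP => _; first exact: avg_bounded.
  by rewrite mulr_ge0//; apply: Rintegral_ge0.
- apply: ae_lebO_and hA (ae_Omega (P := @Omega R) (fun x => id)) _ => x [d d0 xA] Ox.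
  apply: cvg_near_cst.
  have gx (y : R * R) : `|x.1 - y.1| < d -> `|x.2 - y.2| < d -> (\1_A y : R) = \1_A x.
    by move=> h1 h2; rewrite !indicE xA.
  apply: filterS2 (rO Ox) (avg_local mI Ox d0 gx) => n xr xE.
  by rewrite /P /step xr.
Qed.

Let integrable_indicO (A : set (mR * mR)) : measurable A ->
  mu.-integrable setT (EFin \o (\1_A : _ -> R)).
Proof.
move=> mA; apply: measurable_bounded_integrable => //; first exact: lebO_finite.
exists 1; split; first exact: num_real.
by move=> y y1 x _ /=; rewrite indicE (le_trans _ (ltW y1))//; case: (_ \in _); rewrite ?normr0 ?normr1.
Qed.

(** The boundary of a quadrant lies in two null lines; elsewhere the distance to these lines is a
    radius on which the indicator is constant. *)
Let good_ray (a b : R) : good (\1_(`]a, +oo[%classic `*` `]b, +oo[%classic : set (mR * mR))).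
Proof.
apply: good_indic; first by apply: measurableX; exact: measurable_itv.
apply: ae_lebO.
exists (([set a] `*` setT) `|` (setT `*` [set b])); split.
- by apply: measurableU; apply: measurableX => //; exact: measurable_set1.
- apply/eqP; rewrite -measure_le0 (le_trans (measureU2 _ _ _))//.
  + by apply: measurableX => //; exact: measurable_set1.
  + by apply: measurableX => //; exact: measurable_set1.
  + have e1 : leb2 R ([set a] `*` setT) = 0%E.
      by have := @leb2_setX R [set a] setT (measurable_set1 _) measurableT; rewrite lebesgue_measure_set1 mul0e.
    have e2 : leb2 R (setT `*` [set b]) = 0%E.
      by have := @leb2_setX R setT [set b] measurableT (measurable_set1 _); rewrite lebesgue_measure_set1 mule0.
    by rewrite [X in (X + _)%E]e1 [X in (_ + X)%E]e2 adde0.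
- move=> x /= h; apply: contrapT => /not_orP[]; rewrite /= => h1 h2; apply: h.
  have {}h1 : x.1 - a != 0 by rewrite subr_eq0; apply/eqP => ?; apply: h1.
  have {}h2 : x.2 - b != 0 by rewrite subr_eq0; apply/eqP => ?; apply: h2.
  exists (Num.min `|x.1 - a| `|x.2 - b|); first by rewrite lt_min !normr_gt0 h1 h2.
  move=> y; rewrite !lt_min => /andP[y1 _] /andP[_ y2].
  have key (s t c : R) : `|s - t| < `|s - c| -> (c < t) = (c < s).
    have [cs|sc|->] := ltgtP c s.
    - rewrite [`|s - c|]gtr0_norm ?subr_gt0// ltr_norml => /andP[h3 h4].
      by have -> : c < t by lra.
    - rewrite [`|s - c|]ltr0_norm ?subr_lt0// ltr_norml => /andP[h3 h4].
      by apply/negbTE; rewrite -leNgt; lra.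
    - by rewrite subrr normr0 ltNge normr_ge0.
  rewrite !(mem_setE, in_setX)/= !in_itv/= !andbT.
  by rewrite (key _ _ _ y1) (key _ _ _ y2).
Qed.

(** The good sets form a lambda-system: differences by linearity, increasing unions by [good_limit];
    quadrants are good by [good_ray]. *)
Let good_measurable (A : set (mR * mR)) : measurable A -> good (\1_A).
Proof.
move=> mA; suff [] : measurable A /\ good (\1_A) by [].
have lP : lambda_system setT [set A : set (mR * mR) | measurable A /\ good (\1_A)].
  split => //.
  - split => //; apply: good_indic => //; by apply: aeW => x; exists 1.
  - move=> A1 A2 A12 [m1 g1] [m2 g2]; split; first exact: measurableD.
    have -> : \1_(A1 `\` A2) = (fun x => \1_A1 x + -1 * \1_A2 x) :> (_ -> R).
      apply/funext => x; rewrite !indicE in_setD; have := A12 x.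
      by case: (boolP (x \in A2)) => [|_] /=; rewrite ?inE;
        [move=> a2 /(_ a2) a1; rewrite (mem_set a1) /= mulr1 subrr|rewrite andbT mulr0 addr0].
    apply: goodD; [exact: integrable_indicO| |exact: g1|apply: goodZ => //; exact: integrable_indicO].
    by have := integrableZl measurableT (-1) (integrable_indicO m2); apply: eq_integrable => // x _; rewrite /= EFinM.
  - move=> F ndF mgF; have mF i := (mgF i).1.
    have mU : measurable (\bigcup_i F i) by exact: bigcup_measurable.
    split => //; apply: good_limit; first exact: integrable_indicO.
    move=> d d0.
    have cF : cvg1 mu (fun n => \1_(F n)) (\1_(\bigcup_i F i)).
      apply: (@cvg1_of_ptws _ _ _ mu _ _ 1).
      + exact: lebO_finite.
      + by move=> n; exact: measurable_indic.
      + exact: measurable_indic.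
      + by move=> n x; rewrite indicE; case: (_ \in _); rewrite ?normr0 ?normr1.
      + apply: aeW => x; apply: cvg_near_cst; rewrite indicE.
        case: (boolP (x \in \bigcup_i F i)) => [|xF].
          rewrite inE => -[i _ Fix]; exists i => // j /= ij.
          by rewrite indicE mem_set//; exact: (subsetPset _ _ (ndF _ _ ij)).
        apply: nearW => n; rewrite indicE memNset// => Fn.
        by move: xF; rewrite notin_setE; apply; exists n.
    move/cvg1P : cF => /(_ d d0)[N _ /(_ N (leqnn _)) hN].
    exists (\1_(F N)); split; [exact: integrable_indicO|exact: (mgF N).2|].
    apply: le_trans hN; rewrite /nrm1; apply: ge0_le_integral => //.
    + by apply: measurable_normE; apply: measurable_funB; exact: measurable_indic.
    + by apply: measurable_normE; apply: measurable_funB; exact: measurable_indic.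
    + by move=> x _; rewrite lee_fin distrC.
apply: (lambda_system_plane lP) => // a b; split; last exact: good_ray.
by apply: measurableX; exact: measurable_itv.
Qed.

(** Simple functions are good by linearity from [good_measurable], and they are dense in L_1. *)
Lemma step_avg_cvg g : mu.-integrable setT (EFin \o g) ->
  cvg1 mu (fun n => step e n (r_ n) (avg K1 K2 n g)) (fun x => m * g x).
Proof.
move=> gi; apply: good_limit => // d d0.
have [h [hi hd]] := sfun_approx d0 gi; exists h; split => //.
have hE x : h x = \sum_(y <- finmap.enum_fset (fset_set (range h))) y * \1_(h @^-1` [set y]) x.
  by rewrite {1}fimfunE fsbig_finite.
have mh (y : R) : measurable (h @^-1` [set y]) by [].
have gy (y : R) : good (fun x => y * \1_(h @^-1` [set y]) x).
  by apply: goodZ; [exact: integrable_indicO|exact: good_measurable].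
have iy (y : R) : mu.-integrable setT (EFin \o (fun x => y * \1_(h @^-1` [set y]) x)).
  by have := integrableZl measurableT y (integrable_indicO (mh y)); apply: eq_integrable => // x _; rewrite /= EFinM.
rewrite (_ : (h : _ -> R) = fun x => \sum_(y <- finmap.enum_fset (fset_set (range h))) y * \1_(h @^-1` [set y]) x); last first.
  exact/funext.
set s := finmap.enum_fset _.
suff [] : mu.-integrable setT (EFin \o (fun x => \sum_(y <- s) y * \1_(h @^-1` [set y]) x)) /\
   good (fun x => \sum_(y <- s) y * \1_(h @^-1` [set y]) x) by [].
elim: s => [|y s [IHi IHg]].
  under eq_fun do rewrite big_nil.
  have i0 : mu.-integrable setT (EFin \o (fun _ : R * R => 0 : R)) by exact: integrable0.
  split => //; rewrite (_ : (fun _ => 0) = fun x : R * R => 0 * (\1_set0 x : R)).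
    by apply: goodZ; [exact: integrable_indicO|exact: good_measurable].
  by apply/funext => x; rewrite mul0r.
under eq_fun do rewrite big_cons.
split; last exact: goodD.
by have := integrableD measurableT (iy y) IHi; apply: eq_integrable => // x _; rewrite /= EFinD.
Qed.

End step_convergence.

End kernel_averages.

(** * Masks *)

Lemma fsum_int_nat (V : zmodType) (lo : int) (N : nat) (D : set int) (F : int -> V) :
  (forall i, (i < N)%N -> D (lo + i%:Z) \/ F (lo + i%:Z) = 0) ->
  (forall k, D k -> F k != 0 -> exists2 i, (i < N)%N & k = lo + i%:Z) ->
  \sum_(k \in D) F k = \sum_(i < N) F (lo + i%:Z).
Proof.
move=> h1 h2; pose T := (fun i : nat => lo + i%:Z) @` `I_N.
have -> : \sum_(i < N) F (lo + i%:Z) = \sum_(k \in T) F k.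
  rewrite (fsbig_ord _ _ (fun i => F (lo + i%:Z))) fsbig_image// => i j _ _ /addrI.
  by case.
have -> : \sum_(k \in T) F k = \sum_(k \in D `|` T) F k.
  apply: fsbig_widen => [k ?|k [[Dk|//] nT]]; first by right.
  rewrite /=; apply/eqP; apply: contra_notT nT => /(h2 _ Dk)[i iN ->].
  by exists i.
apply: fsbig_widen => [k ?|k [[//|[i iN <-]] nD]]; first by left.
by rewrite /=; case: (h1 _ iN).
Qed.

Section masks.
Variable R : realType.

(** Coefficients of the Laurent polynomial ['X ^ lo * Q], which represents a mask whose support may
    contain negative integers. *)
Definition zcoef (Q : {poly R}) (lo k : int) : R :=
  if lo <= k then Q`_`|k - lo| else 0.

Lemma zcoef_nat Q lo (i : nat) : zcoef Q lo (lo + i%:Z) = Q`_i.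
Proof. by rewrite /zcoef lerDl lez_nat leq0n [lo + _]addrC addrK. Qed.

Lemma zcoef_neq0 Q lo k : zcoef Q lo k != 0 -> exists2 i, (i < size Q)%N & k = lo + i%:Z.
Proof.
rewrite /zcoef; case: ifPn; rewrite ?eqxx// => lok Qk; exists `|k - lo|%N; last first.
  by rewrite gez0_abs ?subr_ge0// [RHS]addrC subrK.
by rewrite ltnNge; apply: contra Qk => /leq_sizeP -> .
Qed.

(** With [lo] the least index of a nonzero entry, the constant coefficient of [Q] is nonzero; the
    lowest point of the mask is then really in its support, which [avg_kap] uses to locate the
    kernel. *)
Lemma finite_zcoef (q : int -> R) (x0 : int) : finite_set [set k | q k != 0] -> q x0 != 0 ->
  exists lo Q, [/\ q =1 zcoef Q lo & Q`_0 != 0].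
Proof.
move=> /finite_seqP[s sE] qx0.
have qs k : q k != 0 -> k \in s.
  by move=> qk; have : [set k | q k != 0] k by []; rewrite sE.
pose N := \max_(k <- s) `|k|%N.
have sN k : k \in s -> (`|k| <= N)%N by move=> ks; exact: leq_bigmax_seq.
have Nk k : q k != 0 -> - (N%:Z) <= k <= N%:Z.
  by move=> /qs/sN; rewrite -lez_nat abszE ler_norml.
have ex : exists i : nat, q (- N%:Z + i%:Z) != 0.
  exists `|(x0 + N%:Z)%R|%N; have /andP[h1 h2] := Nk _ qx0.
  by rewrite gez0_abs -?lerBlDr ?sub0r// addrC addrK.
case: (ex_minnP ex) => i0 qi0 imin.
pose lo := - N%:Z + i0%:Z.
have lok k : q k != 0 -> lo <= k.
  move=> qk; have /andP[h1 h2] := Nk _ qk.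
  have := imin `|(k + N%:Z)%R|%N; rewrite gez0_abs -?lerBlDr ?sub0r//.
  rewrite addrC addrK => /(_ qk); rewrite -lez_nat gez0_abs -?lerBlDr ?sub0r//.
  by rewrite /lo; lia.
exists lo, (\poly_(i < (N + N).+1) q (lo + i%:Z)); split; last first.
  by rewrite coef_poly addr0.
move=> k; rewrite /zcoef; case: ifPn => [lk|]; last by move/negP => h; apply/eqP; apply: contra_notT h => /lok.
rewrite coef_poly gez0_abs ?subr_ge0//.
rewrite [lo + _]addrC subrK; case: ifPn => // /negP h.
apply/eqP; apply: contra_notT h => qk.
have /andP[h1 h2] := Nk _ qk; have := lk; rewrite /lo; lia.
Qed.

(** Squared modulus with real values. *)
Definition nsq (z : R[i]) : R := let: (a +i* b)%C := z in a ^+ 2 + b ^+ 2.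

Lemma nsqM z w : nsq (z * w) = nsq z * nsq w.
Proof. by case: z w => [a b] [c d] /=; ring. Qed.

Lemma nsqX z n : nsq (z ^+ n) = nsq z ^+ n.
Proof.
by elim: n => [|n IH]; rewrite ?expr0 /= ?expr1n ?expr0n ?addr0// !exprS nsqM IH.
Qed.

Lemma nsq_cis (t : R) : nsq (cis t) = 1.
Proof. exact: cos2Dsin2. Qed.

Lemma nsqR (a : R) : nsq (a%:C)%C = a ^+ 2.
Proof. by rewrite /nsq /= expr0n addr0. Qed.

Lemma cisD (s t : R) : cis (s + t) = cis s * cis t.
Proof. by rewrite /cis cosD sinD /GRing.mul /= [X in (_ +i* X)%C]addrC. Qed.

Lemma cisX (t : R) n : cis (t *+ n) = cis t ^+ n.
Proof. by elim: n => [|n IH]; rewrite ?mulr0n ?expr0 /cis ?cos0 ?sin0// mulrS exprS -IH -cisD. Qed.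

Lemma nsq_1Bcis (t : R) : nsq (1 - cis (- t)) = 4 * sin (t / 2) ^+ 2.
Proof.
have tE : t = (t / 2) *+ 2 by rewrite mulr2n -splitr.
rewrite {1}tE; set u := t / 2.
rewrite /nsq /cis /= cosN sinN opprK add0r cos_mulr2n sin_mulr2n.
have := cos2Dsin2 u; set c := cos u; set s := sin u => h.
have c2 : c ^+ 2 = 1 - s ^+ 2 by rewrite -h addrK.
rewrite -[c * s *+ 2]mulr_natl -[c ^+ 2 *+ 2]mulr_natl.
have -> : (2 * (c * s)) ^+ 2 = 4 * c ^+ 2 * s ^+ 2 by ring.
by rewrite c2; ring.
Qed.

Definition peval (P : {poly R}) (t : R) : R[i] :=
  (map_poly (real_complex R) P).[cis (- t)].

(** Continuity at frequency 0, where [cis] equals 1, along the sequence used to compare orders of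
    vanishing. *)
Lemma nsq_peval_cvg (P : {poly R}) :
  nsq (peval P n.+1%:R^-1) @[n --> \oo] --> P.[1] ^+ 2.
Proof.
pose f (t : R) := (\sum_(i < size P) P`_i * cos (t * i%:R)) ^+ 2 +
   (\sum_(i < size P) P`_i * sin (t * i%:R)) ^+ 2.
have fE t : nsq (peval P t) = f t.
  rewrite /peval (@horner_coef_wide _ (size P)); last by rewrite size_map_poly.
  have -> : \sum_(i < size P) (map_poly (real_complex R) P)`_i * cis (- t) ^+ i =
      ((\sum_(i < size P) P`_i * cos (t * i%:R)) +i* - (\sum_(i < size P) P`_i * sin (t * i%:R)))%C.
    elim: (size P) => [|k IH]; first by rewrite !big_ord0 oppr0.
    rewrite !big_ord_recr/= IH coef_map /= -cisX /cis mulNrn -[t *+ k]mulr_natr cosN sinN.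
    by rewrite /GRing.add /GRing.mul /= !mul0r subr0 addr0 mulrN opprD.
  by rewrite /nsq sqrrN.
have f0 : f 0 = P.[1] ^+ 2.
  rewrite /f horner_coef; under eq_bigr do rewrite mul0r cos0 mulr1.
  under [X in _ + X ^+ 2]eq_bigr do rewrite mul0r sin0 mulr0.
  rewrite big1_eq expr0n addr0; congr (_ ^+ 2).
  by apply: eq_bigr => i _; rewrite expr1n mulr1.
rewrite -f0; under eq_fun do rewrite fE.
have cs (g : R -> R) : continuous g ->
    (fun t : R => \sum_(i < size P) P`_i * g (t * i%:R)) @ (0 : R) --> \sum_(i < size P) P`_i * g (0 * i%:R).
  move=> cg; elim: (size P) => [|k IH].
    rewrite (_ : (fun t : R => _) = cst (\sum_(i < 0) P`_i * g (0 * i%:R))); first exact: cvg_cst.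
    by apply/funext => t; rewrite !big_ord0.
  rewrite (_ : (fun t : R => _) = fun t : R => \sum_(i < k) P`_i * g (t * i%:R) + P`_k * g (t * k%:R)); last first.
    by apply/funext => t; rewrite big_ord_recr.
  rewrite big_ord_recr /=; apply: cvgD => //; apply: cvgMl_tmp.
  have h : (fun t : R => t * k%:R) @ (0 : R) --> (0 * k%:R : R) by apply: cvgMr_tmp; exact: cvg_id.
  exact: (cvg_comp _ _ h (cg _)).
have fc : f @ (0 : R) --> f 0.
  rewrite /f; under eq_fun do rewrite !expr2; rewrite !expr2.
  by apply: cvgD; apply: cvgM; apply: cs; [exact: continuous_cos..|exact: continuous_sin|exact: continuous_sin].
exact: (cvg_comp _ _ (@cvg_harmonic R) fc).
Qed.

(** The unknown sign, the power of the imaginary unit, the phase and the shift by [lo] all have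
    modulus 1 and disappear. *)
Lemma mask_modulus (q : nat -> int -> R) (m l : nat) (lo : int) (Q : {poly R}) : bspline_masks m q ->
  (l <= m)%N -> q l =1 zcoef Q lo -> forall t,
  nsq (peval Q t) = 'C(m, l)%:R * (sin (t / 2) ^+ 2) ^+ l * (cos (t / 2) ^+ 2) ^+ (m - l).
Proof.
move=> hq lm qE t; have [_ [e /(_ t)]] := hq _ lm.
rewrite (@fsum_int_nat _ lo (size Q)); first last.
- by move=> k /=; rewrite qE => /zcoef_neq0.
- move=> i _ /=; rewrite qE zcoef_nat; case: eqVneq => [->|]; last by left.
  by right; rewrite mul0r.
have -> : \sum_(i < size Q) ((q l (lo + i%:Z))%:C)%C * cis (- (t * (lo + i%:Z)%:~R)) =
   cis (- (t * lo%:~R)) * peval Q t.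
  rewrite /peval (@horner_coef_wide _ (size Q)); last by rewrite size_map_poly.
  rewrite mulr_sumr; apply: eq_bigr => i _; rewrite qE zcoef_nat coef_map /= mulrCA; congr (_ * _).
  by rewrite -cisX -cisD intrD mulrDr opprD mulNrn mulr_natr.
move=> /(congr1 nsq); rewrite !nsqM !nsqX !nsq_cis mul1r mulr1 => ->.
rewrite !nsqR.
have -> : nsq (-1) = 1 by rewrite /nsq /= sqrrN expr1n oppr0 expr0n addr0.
have -> : nsq 'i%C = 1 by rewrite /nsq /= expr1n expr0n add0r.
rewrite !expr1n !mul1r sqr_sqrtr ?ler0n// exprMn mulrA.
by rewrite -!exprM mulnC [((m - l) * 2)%N]mulnC.
Qed.

(** Write the mask polynomial as [(1 - 'X) ^+ j * P] with [P.[1] != 0]. As [1 - cis (- t)] has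
    squared modulus [4 * sin (t / 2) ^+ 2], comparing the orders of vanishing at [t = 0] in
    [mask_modulus] forces [j = l]. *)
Lemma mask_factor (q : nat -> int -> R) (m l : nat) : bspline_masks m q -> (l <= m)%N ->
  exists lo P, [/\ q l =1 zcoef ((1 - 'X) ^+ l * P) lo, P.[1] != 0 & ((1 - 'X) ^+ l * P)`_0 != 0].
Proof.
move=> hq lm.
(* A zero mask would contradict the prescribed modulus at [t = pi / 2], where sine and cosine of the
   half angle are both positive. *)
have [x0 qx0] : exists x0, q l x0 != 0.
  apply: contrapT => h.
  have q0 : q l =1 zcoef 0 0.
    move=> k; rewrite /zcoef coef0 if_same; apply/eqP; apply: contrapT => /negP qk.
    by apply: h; exists k.
  have := mask_modulus hq lm q0 (pi / 2).
  rewrite /peval rmorph0 horner0.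
  have -> : nsq (0 : R[i]) = 0 by rewrite /nsq /= expr0n addr0.
  move/esym/eqP; rewrite !mulf_eq0 !expf_eq0 /= pnatr_eq0 -leqn0 leqNgt bin_gt0 lm /=.
  have p0 : 0 < pi / 2 / 2 :> R by rewrite !divr_gt0// pi_gt0.
  have p1 : pi / 2 / 2 < pi / 2 :> R by rewrite ltr_pdivrMr// ltr_pMr ?ltr1n// divr_gt0// pi_gt0.
  have s0 : 0 < sin (pi / 2 / 2 : R) by apply: sin_gt0_pihalf; rewrite p0.
  have c0 : 0 < cos (pi / 2 / 2 : R).
    by apply: cos_gt0_pihalf; rewrite p1 (lt_trans _ p0)// oppr_lt0 divr_gt0// pi_gt0.
  by rewrite (gt_eqF s0) (gt_eqF c0) !andbF.
have [lo [Q [qE Q0]]] := finite_zcoef (hq _ lm).1 qx0.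
have Qn0 : Q != 0 by apply: contraNneq Q0 => ->; rewrite coef0.
have [j [P0]] := multiplicity_XsubC Q 1; rewrite Qn0 /= => nr QE.
have {QE} [P [QE P1]] : exists P : {poly R}, Q = (1 - 'X) ^+ j * P /\ P.[1] != 0.
  exists ((-1) ^+ j * P0); split; first by rewrite mulrA -exprMn mulrC mulrN1 opprB -QE.
  by rewrite hornerM horner_exp hornerN hornerC mulf_neq0// expf_neq0// oppr_eq0 oner_eq0.
suff jl : j = l.
  by rewrite jl in QE; exists lo, P; split=> //; rewrite -QE.
have key t : nsq (peval P t) * 4 ^+ j * (sin (t / 2) ^+ 2) ^+ j =
    'C(m, l)%:R * (sin (t / 2) ^+ 2) ^+ l * (cos (t / 2) ^+ 2) ^+ (m - l).
  rewrite -(mask_modulus hq lm qE) QE /peval rmorphM rmorphXn /=.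
  have -> : map_poly (real_complex R) (1 - 'X) = 1 - 'X.
    by apply/polyP => i; rewrite coef_map /= !coefB !coef1 !coefX rmorphB !rmorph_nat.
  rewrite /=.
  have -> : ((1 - 'X) ^+ j * map_poly (real_complex R) P).[cis (- t)] = (1 - cis (- t)) ^+ j * (map_poly (real_complex R) P).[cis (- t)].
    by rewrite hornerM horner_exp !hornerE.
  rewrite nsqM nsqX nsq_1Bcis [(4 * _) ^+ j]exprMn.
  by rewrite [RHS]mulrC mulrA.
pose s_ (n : nat) : R := sin (n.+1%:R^-1 / 2) ^+ 2.
have s0 n : s_ n != 0.
  rewrite /s_ expf_neq0// gt_eqF// sin_gt0_pi// divr_gt0//=.
  rewrite ltr_pdivrMr// (@le_lt_trans _ _ 1) ?invf_le1 ?ler1n//.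
  by rewrite (lt_le_trans (ltr1n _ 2 : (1 : R) < 2))// -[leLHS]mul1r ler_pM// (le_trans _ (pi_ge2 R)) ?ler1n.
have hc : n.+1%:R^-1 / 2 @[n --> \oo] --> (0 : R).
  by rewrite -[X in _ --> X](mul0r (2^-1)); apply: cvgMr_tmp; exact: cvg_harmonic.
have sc : s_ n @[n --> \oo] --> (0 : R).
  have : sin (n.+1%:R^-1 / 2) @[n --> \oo] --> sin (0 : R).
    by apply: continuous_cvg hc; exact: continuous_sin.
  by rewrite sin0 => h; rewrite -[X in _ --> X](mulr0 0) /s_; under eq_fun do rewrite expr2; exact: cvgM.
have cc : cos (n.+1%:R^-1 / 2) ^+ 2 @[n --> \oo] --> (1 : R).
  have : cos (n.+1%:R^-1 / 2) @[n --> \oo] --> cos (0 : R).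
    by apply: continuous_cvg hc; exact: continuous_cos.
  by rewrite cos0 => h; rewrite -[X in _ --> X](mulr1 1); under eq_fun do rewrite expr2; exact: cvgM.
have cX (u : nat -> R) (a : R) k : u n @[n --> \oo] --> a -> u n ^+ k @[n --> \oo] --> (a ^+ k : R).
  by move=> ua; elim: k => [|k IH]; [exact: cvg_cst|under eq_fun do rewrite exprS; rewrite exprS; exact: cvgM].
have L : nsq (peval P n.+1%:R^-1) * 4 ^+ j @[n --> \oo] --> P.[1] ^+ 2 * 4 ^+ j.
  by apply: cvgMr_tmp; exact: nsq_peval_cvg.
have Rr : 'C(m, l)%:R * (cos (n.+1%:R^-1 / 2) ^+ 2) ^+ (m - l) @[n --> \oo] --> ('C(m, l)%:R * 1 ^+ (m - l) : R).
  by apply: cvgMl_tmp; exact: cX.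
have uniq (u : nat -> R) (a b : R) : u @ \oo --> a -> u @ \oo --> b -> a = b.
  by move=> ua ub; rewrite -(cvg_lim (@Rhausdorff R) ua) -(cvg_lim (@Rhausdorff R) ub).
(* In either strict case, dividing [key] by the smaller power of [s_ n] equates a sequence with
   nonzero limit to one that tends to 0. *)
case: (ltngtP j l) => // jl.
- have : nsq (peval P n.+1%:R^-1) * 4 ^+ j @[n --> \oo] --> ('C(m, l)%:R * 1 ^+ (m - l) * 0 ^+ (l - j) : R).
    have e n : nsq (peval P n.+1%:R^-1) * 4 ^+ j =
       'C(m, l)%:R * (cos (n.+1%:R^-1 / 2) ^+ 2) ^+ (m - l) * s_ n ^+ (l - j).
      apply: (mulIf (expf_neq0 j (s0 n))); rewrite -[RHS]mulrA -exprD subnK ?(ltnW jl)//.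
      by rewrite {1}/s_ key -/(s_ n) mulrAC.
    by under eq_fun do rewrite e; apply: cvgM => //; exact: cX.
  move/(uniq _ _ _ L) => /eqP; rewrite expr0n subn_eq0 leqNgt jl mulr0 mulf_eq0 !expf_eq0 (negPf P1) /=.
  by rewrite pnatr_eq0 andbF.
- have : nsq (peval P n.+1%:R^-1) * 4 ^+ j * s_ n ^+ (j - l) @[n --> \oo] --> ('C(m, l)%:R * 1 ^+ (m - l) : R).
    have e n : nsq (peval P n.+1%:R^-1) * 4 ^+ j * s_ n ^+ (j - l) =
       'C(m, l)%:R * (cos (n.+1%:R^-1 / 2) ^+ 2) ^+ (m - l).
      apply: (mulIf (expf_neq0 l (s0 n))); rewrite -[LHS]mulrA -exprD subnK ?(ltnW jl)//.
      by rewrite {1}/s_ key -/(s_ n) mulrAC.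
    by under eq_fun do rewrite e.
  have L2 : nsq (peval P n.+1%:R^-1) * 4 ^+ j * s_ n ^+ (j - l) @[n --> \oo] --> P.[1] ^+ 2 * 4 ^+ j * 0 ^+ (j - l).
    by apply: cvgM => //; exact: cX.
  move/(uniq _ _ _ L2)/eqP.
  rewrite expr0n subn_eq0 leqNgt jl mulr0 expr1n mulr1 eq_sym pnatr_eq0 -leqn0 leqNgt bin_gt0 lm /=.
  by [].
Qed.

End masks.

Lemma integrable_fsum d (T : measurableType d) (R : realType) (mu : {measure set T -> \bar R})
    (I : Type) (r : seq I) (F : I -> T -> R) :
  (forall i, mu.-integrable setT (EFin \o F i)) ->
  mu.-integrable setT (EFin \o (fun x => \sum_(i <- r) F i x)).
Proof.
move=> Fi; rewrite (_ : EFin \o _ = (fun x => \sum_(i <- r) (F i x)%:E)%E).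
  by apply: integrable_sum => // i _; exact: Fi.
by apply/funext => x; rewrite /= sumEFin.
Qed.

Lemma Rintegral_fsum d (T : measurableType d) (R : realType) (mu : {measure set T -> \bar R})
    (I : Type) (r : seq I) (F : I -> T -> R) :
  (forall i, mu.-integrable setT (EFin \o F i)) ->
  \int[mu]_x (\sum_(i <- r) F i x) = \sum_(i <- r) \int[mu]_x F i x.
Proof.
move=> Fi; elim: r => [|i r IH].
  by under eq_Rintegral do rewrite big_nil; rewrite big_nil /Rintegral integral0.
rewrite big_cons -IH -RintegralD//; last exact: integrable_fsum.
by apply: eq_Rintegral => x _; rewrite big_cons.
Qed.

(** * The constants c_a *)

Section antiderivative_mass.
Variable R : realType.
Local Notation mR := (measurableTypeR R).
Local Notation lam := (@lebesgue_measure R).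

(** A compactly supported smooth substitute for the monomial of degree [l] divided by its
    factorial. *)
Definition flat (l : nat) (M : R) (t : R -> R) := [/\ smooth1 t,
  exists r : R, forall x, t x != 0 -> - r <= x <= r, exists C, forall x, `|t x| <= C & forall x, `|x| <= M -> derive1n l t x = 1].

Lemma exists_flat l M : 0 < M -> exists t, flat l M t.
Proof.
move=> M0; have [H HH] := exists_smooth_step R; have {}HH : smooth_step H := HH.
pose b := smooth_box H 4^-1; have e0 : 0 < 4^-1 :> R by rewrite invr_gt0.
have sb : smooth1 b by exact: smooth_box_smooth1.
have bb : in01 b by exact: smooth_box_in01.
have bs x : b x != 0 -> - 4^-1 <= x <= 1 by exact: smooth_box_supp.
pose S := bspl b l.
have sS : smooth1 S by exact: bspl_smooth1 bs.
(* On this interval only the untranslated copy of [b] contributes, and it equals 1; the next copy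
   starts at [1 - 4^-1]. *)
have S1 x : 0 <= x <= 2^-1 -> derive1n l S x = 1.
  move=> /andP[x0 x1].
  have -> : S = comb 1 (bspl b (0 + l)).
    by apply/funext => y; rewrite /comb size_poly1 big_ord1 coef1 mul1r subr0.
  rewrite (derive1n_comb_bspl _ 0 1 sb bb bs) mulr1 /=.
  set Q := (1 - 'X) ^+ l.
  have Q0 : Q`_0 = 1.
    by rewrite -horner_coef0 /Q horner_exp !hornerE subr0 expr1n.
  have Q1 : (0 < size Q)%N.
    by rewrite lt0n size_poly_eq0; apply: contra_eq_neq Q0 => ->; rewrite coef0 eq_sym oner_neq0.
  rewrite /comb (bigD1 (Ordinal Q1))//= big1 ?addr0 => [|[i iQ] i0]; last first.
    have i1 : (1 <= i)%N by rewrite lt0n; apply: contraNneq i0 => i00; apply/eqP/val_inj.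
    have -> : b (x - i%:R) = 0; last by rewrite mulr0.
    apply/eqP; apply: contraT => /bs/andP[h _].
    have : (1 : R) <= i%:R by rewrite ler1n.
    lra.
  by rewrite Q0 mul1r subr0 /b smooth_box_1// x0/=; lra.
(* With this dilation [D^-1 * x + 4^-1] stays in [[0, 2^-1]] as long as the absolute value of [x] is
   at most [M]. *)
pose D := 4 * M; have D0 : 0 < D by rewrite mulr_gt0.
exists (fun x => D ^+ l * S (D^-1 * x + 4^-1)); split.
- exact: (@smooth1Z _ (D ^+ l) _ (@smooth1_affine _ D^-1 4^-1 S sS)).
- exists (D * (1 + l%:R)) => x.
  rewrite mulf_eq0 negb_or => /andP[_] /(bspl_supp (k := l) bs)/andP[h1 h2].
  have DK : D * (D^-1 * x) = x by rewrite mulrA divff ?mul1r// gt_eqF.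
  rewrite -{1 2}DK -mulrN !ler_pM2l//.
  have : (0 : R) <= l%:R by [].
  by move: h1 h2; set y := D^-1 * x => h1 h2 h3; apply/andP; split; lra.
- exists (D ^+ l) => x; rewrite normrM ger0_norm ?exprn_ge0 ?(ltW D0)//.
  have /andP[S0 S1'] := (bspl_in01 l bb).2 (D^-1 * x + 4^-1).
  by rewrite ler_piMr ?exprn_ge0 ?(ltW D0)// ger0_norm.
- move=> x xM; have sS' := @smooth1_affine _ D^-1 4^-1 S sS.
  rewrite (@derive1nZ _ l (D ^+ l) _ sS') (@derive1n_affine _ l D^-1 4^-1 _ sS).
  rewrite exprVn mulrA divff ?mul1r ?expf_neq0 ?gt_eqF// S1//.
  have : `|D^-1 * x| <= 4^-1.
    by rewrite normrM gtr0_norm ?invr_gt0// ler_pdivrMl// /D mulrAC divff ?mul1r.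
  rewrite ler_norml; set y := D^-1 * x => /andP[h1 h2]; apply/andP; split; lra.
Qed.

(** By the mean value theorem, one backward difference lowers the order of the constant derivative
    by one and keeps the constant, at the cost of a unit of the interval. *)
Lemma diff_iter_cst (l : nat) (g : R -> R) (c u v : R) : smooth1 g ->
  (forall x, u <= x <= v -> derive1n l g x = c) ->
  forall x, u + l%:R <= x <= v -> iter l (fun (h : R -> R) y => h y - h (y - 1)) g x = c.
Proof.
elim: l g u => [|l IH] g u sg gc x; first by rewrite addr0; exact: gc.
move=> /andP[xu xv]; rewrite iterSr.
have e1 : (fun y => g y - g (y - 1)) = (fun y => g y + -1 * g (1 * y + -1)).
  by apply/funext => y; rewrite mul1r mulN1r.
have sg1 : smooth1 (fun y => g (1 * y + -1)) by exact: (@smooth1_affine _ 1 (-1) g sg).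
have sg2 : smooth1 (fun y => -1 * g (1 * y + -1)) by exact: (@smooth1Z _ (-1) _ sg1).
apply: (IH _ (u + 1)).
- by rewrite e1; exact: smooth1D.
- move=> y /andP[yu yv]; rewrite e1 (derive1nD l sg sg2) (@derive1nZ _ l (-1) _ sg1) (@derive1n_affine _ l 1 (-1) _ sg) expr1n !mul1r mulN1r.
  set G := derive1n l g; have sG : smooth1 G by exact: smooth1_derive1n.
  have [z zI ->] : exists2 z, z \in `]y - 1, y[ & G y - G (y - 1) = derive1 G z * (y - (y - 1)).
    apply: (@MVT _ G (derive1 G)); first by rewrite ltrBlDr ltrDl.
    - by move=> z _; exact: smooth1_is_derive.
    - by apply: continuous_subspaceT => z; exact: (smooth1_continuous sG).
  move: zI; rewrite in_itv/= => /andP[z1 z2].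
  have -> : derive1 G z = c by apply: gc; apply/andP; split; lra.
  by rewrite opprB addrC subrK mulr1.
- by apply/andP; split=> //; rewrite -addrA nat1r.
Qed.

(** Changes of variables move the translates from the spline to [t], where [(1 - 'X) ^+ l] acts as
    an [l]-fold difference of step [2^-1]; since the [l]-th derivative of [t] is 1 there, this is a
    constant and only the mass of the B-spline remains. *)
Lemma flat_moment l (P : {poly R}) k s M t :
  flat l M t -> (`|s| + (k.+1 + (size ((1 - 'X) ^+ l * P)%R) + size P + l)%:R) / 2 <= M ->
  \int[lam]_x (2 * spline ((1 - 'X) ^+ l * P) k 2 s x * t x) = (- 2^-1) ^+ l * P.[1].
Proof.
move=> [st [r tr] [C tC] tM] hM; set Q := (1 - 'X) ^+ l * P.
have [mB B01] := cardinal_bspline_in01 R k.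
have mt : measurable_fun setT (t : mR -> R) by exact: smooth1_measurable.
pose F z := 2 * comb Q (cardinal_bspline k) z * t (2^-1 * z + s / 2).
have Bi : lam.-integrable setT (EFin \o cardinal_bspline k) by exact: cardinal_bspline_integrable.
have Bti (a : R) : lam.-integrable setT (EFin \o (fun z => cardinal_bspline k z * t (2^-1 * z + a))).
  apply: (integrable_mulbd (M := C) Bi) => //.
  by apply: (measurableT_comp mt); exact: measurable_affine.
have Ri (i : nat) : lam.-integrable setT (EFin \o (fun z => cardinal_bspline k (1 * z + - i%:R) * t (2^-1 * z + s / 2))).
  apply: (integrable_mulbd (M := C) (integrable_affine (- i%:R) ltr01 Bi)) => //.
  by apply: (measurableT_comp mt); exact: measurable_affine.
have FE z : F z = \sum_(i < size Q) 2 * Q`_i * (cardinal_bspline k (1 * z + - i%:R) * t (2^-1 * z + s / 2)).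
  rewrite /F /comb mulr_sumr mulr_suml; apply: eq_bigr => i _.
  by rewrite mul1r -!mulrA.
have Fi : lam.-integrable setT (EFin \o F).
  rewrite (_ : F = fun z => \sum_(i < size Q) 2 * Q`_i * (cardinal_bspline k (1 * z + - i%:R) * t (2^-1 * z + s / 2))); last exact/funext.
  apply: integrable_fsum => i.
  by have := integrableZl measurableT (2 * Q`_i) (Ri i); apply: eq_integrable => // z _; rewrite /= EFinM.
transitivity (\int[lam]_x F (2 * x + - s)).
  apply: eq_Rintegral => x _; rewrite /F /spline.
  by congr (_ * t _); rewrite mulrDr mulrA mulVf ?pnatr_eq0// mul1r mulrN [2^-1 * s]mulrC subrK.
rewrite Rintegral_affine//.
have -> : \int[lam]_x F x = \sum_(i < size Q) 2 * Q`_i * \int[lam]_z (cardinal_bspline k z * t (2^-1 * z + (i%:R + s) / 2)).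
  under eq_Rintegral do rewrite FE.
  rewrite Rintegral_fsum; last first.
    by move=> i; have := integrableZl measurableT (2 * Q`_i) (Ri i); apply: eq_integrable => // z _; rewrite /= EFinM.
  apply: eq_bigr => i _; rewrite RintegralZl//; congr (_ * _).
  rewrite -[LHS](mul1r) -[X in X * _ = _]invr1 -[in LHS](@Rintegral_affine _ 1 i%:R _ ltr01); last exact: Ri.
  by apply: eq_Rintegral => z _; rewrite !mul1r addrK mulrDr -addrA mulrDl [2^-1 * i%:R]mulrC.
under eq_bigr do rewrite -RintegralZl//.
rewrite -Rintegral_fsum; last first.
  by move=> i; have := integrableZl measurableT (2 * Q`_i) (Bti ((i%:R + s) / 2)); apply: eq_integrable => // z _; rewrite /= EFinM.
(* The reflection turns forward shifts of [t] into backward shifts of [g]; each derivation of [g]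
   brings out a factor [- 2^-1]. *)
pose g (w : R) := t (- 2^-1 * w + s / 2).
have sg : smooth1 g by exact: (@smooth1_affine _ (- 2^-1) (s / 2) t st).
have gl : forall z, 0 <= z <= k.+1%:R -> comb Q g (- z) = (- 2^-1) ^+ l * P.[1].
  move=> z /andP[z0 zk]; rewrite /Q combXn_nabla /comb horner_coef mulr_sumr.
  apply: eq_bigr => i _; rewrite expr1n mulr1 mulrC; congr (_ * _).
  have iP : (i%:R : R) <= (size P)%:R by rewrite ler_nat ltnW.
  have i0 : 0 <= i%:R :> R by [].
  have l0 : 0 <= l%:R :> R by [].
  apply: (@diff_iter_cst _ _ _ (- z - i%:R - l%:R) 0 sg); last by apply/andP; split; lra.
  move=> x /andP[x0 x1]; rewrite /g derive1n_affine// tM ?mulr1//.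
  apply: le_trans hM; rewrite natrD natrD natrD.
  have q0 : 0 <= (size Q)%:R :> R by [].
  have : `|x| <= k.+1%:R + (size P)%:R + l%:R by rewrite ler_norml; apply/andP; split; lra.
  have := ler_normD (- 2^-1 * x) (s / 2); rewrite !normrM normrN normfV [`|2|]ger0_norm//.
  move: q0; rewrite -/Q; set qq := (size Q)%:R; lra.
rewrite (_ : \int[lam]_x _ = \int[lam]_x (2 * ((- 2^-1) ^+ l * P.[1]) * cardinal_bspline k x)).
  rewrite RintegralZl// cardinal_bspline_mass mulr1 mulKf// pnatr_eq0.
apply: eq_Rintegral => z _.
have [B0|/cardinal_bspline_supp zk] := eqVneq (cardinal_bspline k z) 0.
  by rewrite B0 mulr0 big1// => i _; rewrite mul0r mulr0.
rewrite -(gl z zk) /comb mulr_sumr mulr_suml; apply: eq_bigr => i _.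
rewrite /g !mulrA mulrAC; congr (_ * t _ * _).
by rewrite mulrDr !mulrN !mulNr !opprK mulrDl addrA [2^-1 * i%:R]mulrC.
Qed.

(** The defining relation of [vphi] is tested on a tensor product of two flat functions: one side is
    the integral of [vphi], the mixed derivative being 1 on its support, the other is a product of
    two moments. *)
Lemma antiderivative_mass (m : nat) (q : nat -> int -> R) (phi : R -> R) (a : midx m) (vphi : R * R -> R)
    (c : R) (lo1 lo2 : int) (P1 P2 : {poly R}) :
  (forall x, phi x = cardinal_bspline m.-1 (x - c)) ->
  q a.1 =1 zcoef ((1 - 'X) ^+ a.1 * P1) lo1 -> q a.2 =1 zcoef ((1 - 'X) ^+ a.2 * P2) lo2 ->
  framelet_antiderivative q phi a vphi ->
  \int[leb2 R]_x vphi x = 2^-1 ^+ mabs a * (P1.[1] * P2.[1]).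
Proof.
move=> hphi q1 q2 [vL [K cK vK] hw].
set s1 := lo1%:~R + c; set s2 := lo2%:~R + c.
have fE (l : nat) (lo : int) (P : {poly R}) : q l =1 zcoef P lo ->
    forall x, framelet q phi l x = 2 * spline P m.-1 2 (lo%:~R + c) x.
  move=> qE x; rewrite /framelet (@fsum_int_nat _ lo (size P)); first last.
  - by move=> k _; rewrite qE mulf_eq0 negb_or => /andP[/zcoef_neq0].
  - by move=> i _; left.
  congr (_ * _); rewrite /spline /comb; apply: eq_bigr => i _.
  rewrite qE zcoef_nat hphi; congr (_ * cardinal_bspline _ _).
  by rewrite intrD; ring.
set N1 := (m.-1.+1 + size ((1 - 'X) ^+ a.1 * P1)%R + size P1 + a.1)%N.
set N2 := (m.-1.+1 + size ((1 - 'X) ^+ a.2 * P2)%R + size P2 + a.2)%N.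
have [r Kr] : exists r : R, forall x, K x -> `|x.1| <= r /\ `|x.2| <= r.
  have [r [_ hr]] := compact_bounded cK; exists (r + 1) => x Kx.
  have := hr (r + 1); rewrite ltrDl ltr01 => /(_ isT x Kx).
  by rewrite /= prod_normE ge_max => /andP[].
(* Large enough for the support of [vphi] and for both applications of [flat_moment]. *)
pose M := `|r| + 1 + (`|s1| + N1%:R) / 2 + (`|s2| + N2%:R) / 2.
have h1 : 0 <= (`|s1| + N1%:R) / 2 by rewrite divr_ge0// addr_ge0.
have h2 : 0 <= (`|s2| + N2%:R) / 2 by rewrite divr_ge0// addr_ge0.
have r0 := normr_ge0 r; have rr := ler_norm r.
have M0 : 0 < M by rewrite /M; lra.
have [t1 ft1] := exists_flat a.1 M0; have [t2 ft2] := exists_flat a.2 M0.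
have [st1 [r1 tr1] [C1 tC1] tM1] := ft1; have [st2 [r2 tr2] [C2 tC2] tM2] := ft2.
have tt : test_function setT (tensor t1 t2) by exact: (tensor_test_function st1 st2 tr1 tr2).
have := hw _ tt; rewrite pderiv_tensor//.
have -> : \int[leb2 R]_x (vphi x * tensor (derive1n a.1 t1) (derive1n a.2 t2) x) = \int[leb2 R]_x vphi x.
  have mv : measurable_fun setT (vphi : mR * mR -> R).
    by have := set_mem (sub_Lfun_mfun vL).
  rewrite /Rintegral; congr fine; apply: ae_eq_integral => //.
  - apply/measurable_EFinP; apply: measurable_funM => //.
    by apply: measurable_tensor; apply: smooth1_measurable; exact: smooth1_derive1n.
  - exact/measurable_EFinP.
  - case: vK => N [mN N0 NP]; exists N; split => //; apply: subset_trans NP => x.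
    apply: contra_not => vx _ /=; have [Kx|/vx ->] := pselect (K x); last by rewrite mul0r.
    have [x1 x2] := Kr _ Kx; rewrite /tensor tM1 ?tM2 ?mulr1//.
    + by rewrite (le_trans x2)// /M; lra.
    + by rewrite (le_trans x1)// /M; lra.
move=> ->.
rewrite (_ : \int[leb2 R]_x _ = \int[leb2 R]_x tensor (fun y => 2 * spline ((1 - 'X) ^+ a.1 * P1) m.-1 2 s1 y * t1 y)
    (fun y => 2 * spline ((1 - 'X) ^+ a.2 * P2) m.-1 2 s2 y * t2 y) x); last first.
  by apply: eq_Rintegral => x _; rewrite /tensor /framelet2 (fE _ _ _ q1) (fE _ _ _ q2) mulrACA.
have ti (l : nat) (P : {poly R}) s t C : smooth1 t -> (forall x, `|t x| <= C) ->
    (exists r : R, forall x, t x != 0 -> - r <= x <= r) ->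
    lam.-integrable setT (EFin \o (fun y => 2 * spline P l 2 s y * t y)).
  move=> st tC [r' tr].
  apply: (integrable_cpt (M := 2 * coef_norm P * C) (a := - r') (b := r')).
  - apply: measurable_funM; last exact: smooth1_measurable.
    by apply: measurable_funM => //; exact: measurable_spline.
  - move=> x; rewrite !normrM [`|2|]ger0_norm// ler_pM ?mulr_ge0// ler_pM2l//.
    exact: spline_bound.
  - by move=> x; rewrite mulf_eq0 negb_or => /andP[_]; exact: tr.
rewrite Rintegral_tensor; [|apply: (ti _ _ _ _ C1) => //; by exists r1|apply: (ti _ _ _ _ C2) => //; by exists r2].
rewrite (flat_moment ft1); last by rewrite -/N1 /M; lra.
rewrite (flat_moment ft2); last by rewrite -/N2 /M; lra.
(* The sign of the weak derivative cancels the signs of the two moments. *)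
rewrite [X in _ * X]mulrACA -exprD [LHS]mulrA -exprMn mulrNN mul1r.
by [].
Qed.

End antiderivative_mass.

(** * Sampling and wavelet coefficients as averages *)

Lemma addpE (k j : int * int) : k + j = (k.1 + j.1, k.2 + j.2). Proof. by []. Qed.

Lemma oppE (k : int * int) : - k = (- k.1, - k.2). Proof. by []. Qed.

Section discretization_kernels.
Variable R : realType.
Local Notation mR := (measurableTypeR R).
Local Notation mu := (lebO R).
Local Notation lam := (@lebesgue_measure R).

Lemma closed_box (a b c d : R) : closed (`[a, b]%classic `*` `[c, d]%classic : set (R * R)).
Proof.
apply: compact_closed; first exact: norm_hausdorff.
by apply: compact_setX; exact: segment_compact.
Qed.

Lemma closure_Omega_sub : closure (@Omega R) `<=` `[0, 1]%classic `*` `[0, 1]%classic.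
Proof.
rewrite closureE; apply: smallest_sub; first exact: closed_box.
move=> x [/=]; rewrite !in_itv/= => /andP[h1 h2] /andP[h3 h4].
by rewrite !ltW.
Qed.

Lemma window_sub (c J M z w k : R) : `|z - k - c| <= 1 + J -> 0 <= w - k - c -> w - k - c <= M ->
  z - (`|c| + 1 + J + M) <= w <= z + (`|c| + 1 + J + M).
Proof. by have := normr_ge0 c; rewrite ler_norml => ? /andP[? ?] ? ?; apply/andP; split; lra. Qed.

Variables (m : nat) (q : nat -> int -> R) (phi : R -> R).
Variables (c : R) (lo : nat -> int) (P : nat -> {poly R}).
Hypothesis m0 : (0 < m)%N.
Hypothesis hphi : forall x, phi x = cardinal_bspline m.-1 (x - c).
Hypothesis hq : forall l, (l <= m)%N -> [/\ q l =1 zcoef ((1 - 'X) ^+ l * P l) (lo l),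
  (P l).[1] != 0 & ((1 - 'X) ^+ l * P l)`_0 != 0].

Let Q l := (1 - 'X) ^+ l * P l.

Lemma phi_supp x : phi x != 0 -> 0 <= x - c <= m%:R.
Proof. by rewrite hphi => /cardinal_bspline_supp; rewrite prednK. Qed.

Lemma phi_gt0 x : 0 < x - c < m%:R -> 0 < phi x.
Proof. by rewrite hphi => h; apply: cardinal_bspline_gt0; rewrite prednK. Qed.

(** As [phi] is positive inside its support, every point at offset [d] in []0, m[] from the corner
    must lie in the closed square; [d] then tends to 0 and to [m]. *)
Lemma Mgrid_bound n k : Mgrid phi n k -> [/\ 0 <= k.1%:~R + c, k.1%:~R + c + m%:R <= 2 ^+ n,
  0 <= k.2%:~R + c & k.2%:~R + c + m%:R <= 2 ^+ n].
Proof.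
move=> [_ hk]; have p0 : 0 < (2 ^+ n : R) by rewrite exprn_gt0.
have mR0 : 0 < m%:R :> R by rewrite ltr0n.
have key (d : R) : 0 < d < m%:R -> (0 <= k.1%:~R + c + d <= 2 ^+ n) /\ (0 <= k.2%:~R + c + d <= 2 ^+ n).
  move=> dm; pose x : R * R := (2 ^- n * (k.1%:~R + c + d), 2 ^- n * (k.2%:~R + c + d)).
  have : closure (@Omega R) x.
    apply: hk; apply: subset_closure; rewrite /= /phi_nk /phi2 /=.
    rewrite !mulrA divff ?gt_eqF// !mul1r.
    have e (z : R) : z + c + d - z = d + c by ring.
    by rewrite !e !mulr_gt0// phi_gt0// addrK.
  move=> /closure_Omega_sub[]; rewrite /= !in_itv/=.
  by rewrite !pmulr_rge0 ?invr_gt0// ![2 ^- n * _]mulrC !ler_pdivrMr// !mul1r.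
have dE (e : R) : 0 < e -> exists2 d : R, 0 < d < m%:R & d <= e.
  move=> e0; exists (Num.min e (m%:R / 2)); last by rewrite ge_min lexx.
  by rewrite lt_min e0 divr_gt0//= gt_min ltr_pdivrMr// ltr_pMr ?ltr1n ?orbT.
split; apply/ler_addgt0Pr => e /dE[d /andP[d1 d2] de].
- have [/andP[+ _] _] : (0 <= k.1%:~R + c + d <= 2 ^+ n) /\ (0 <= k.2%:~R + c + d <= 2 ^+ n) by apply: key; rewrite d1.
  by move: de; lra.
- have [/andP[_ +] _] : (0 <= k.1%:~R + c + (m%:R - d) <= 2 ^+ n) /\ (0 <= k.2%:~R + c + (m%:R - d) <= 2 ^+ n).
    by apply: key; rewrite subr_gt0 d2 ltrBlDr ltrDl.
  by move: (2 ^+ n) de => ?; lra.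
- have [_ /andP[+ _]] : (0 <= k.1%:~R + c + d <= 2 ^+ n) /\ (0 <= k.2%:~R + c + d <= 2 ^+ n) by apply: key; rewrite d1.
  by lra.
- have [_ /andP[_ +]] : (0 <= k.1%:~R + c + (m%:R - d) <= 2 ^+ n) /\ (0 <= k.2%:~R + c + (m%:R - d) <= 2 ^+ n).
    by apply: key; rewrite subr_gt0 d2 ltrBlDr ltrDl.
  by move: (2 ^+ n) de => ?; lra.
Qed.

Lemma Mgrid_inner n k : Mgrid phi n k -> inner_cell c n k.
Proof.
move=> /Mgrid_bound[h1 h2 h3 h4]; have : (1 : R) <= m%:R by rewrite ler1n.
by move=> h5; split => //; [move: h2|move: h4]; apply: le_trans; rewrite lerD2l.
Qed.

Lemma finite_Mgrid n : finite_set (Mgrid phi n).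
Proof.
pose B := count_bound (2 ^+ n : R); pose f := Num.floor (- c - 2 ^+ n).
apply: (@sub_finite_set _ _ ((fun i : nat * nat => (f + i.1%:Z, f + i.2%:Z)) @` (`I_B `*` `I_B))).
  move=> [k1 k2] /Mgrid_inner[/= h1 h2 h3 h4].
  have key (k : int) : 0 <= k%:~R + c -> k%:~R + c + 1 <= 2 ^+ n -> exists2 i : nat, (i < B)%N & k = f + i%:Z.
    move=> k0 k1'; apply: int_window; rewrite -opprD normrN addrC ger0_norm//.
    by rewrite (le_trans _ k1')// lerDl.
  have [i iB ->] := key _ h1 h2; have [j jB ->] := key _ h3 h4.
  by exists (i, j).
by apply: finite_image; apply: finite_setX; exact: finite_II.
Qed.

(** Serves both grids: [J = 0] for the points of [Mgrid], and [J] bounding all the mask supports for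
    those of [Kgrid]. *)
Lemma Mgrid_near (x : R * R) (J : nat) : Omega x ->
  \forall n \near \oo, forall j : int * int, (`|j.1| <= J%:Z)%R -> (`|j.2| <= J%:Z)%R ->
    Mgrid phi n (cell_index c n x + j).
Proof.
move=> [/=]; rewrite !in_itv/= => /andP[x10 x11] /andP[x20 x21].
pose d := Num.min (Num.min x.1 (1 - x.1)) (Num.min x.2 (1 - x.2)).
have d0 : 0 < d by rewrite !lt_min x10 x20 !subr_gt0 x11 x21.
(* In units of the grid: translation of the spline, rounding, index shift, and width of the support
   of [phi]. *)
pose C : R := `|c| + 1 + J%:R + m%:R.
apply: filterS (mono_exp2 C d0) => n; set p := 2 ^+ n => hn j j1 j2.
have p0 : 0 < p by rewrite exprn_gt0.
have C0 : 0 <= C by rewrite /C !addr_ge0.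
have inO (y : R * R) : `|y.1 - x.1| * p <= C -> `|y.2 - x.2| * p <= C -> Omega y.
  move=> h1 h2; have := hn; rewrite mulrC.
  move=> h; have := le_lt_trans h1 h; have := le_lt_trans h2 h.
  rewrite !ltr_pM2r// /d !lt_min !ltr_distl !subrr ![_ + (1 - _)]addrC !subrK.
  move=> /andP[_ /andP[/andP[y20 _] /andP[_ y21]]] /andP[/andP[/andP[y10 _] /andP[_ y11]] _].
  by split; rewrite /= in_itv/= ?y10 ?y20.
have kc (z : R) (i : int) : `|i| <= J%:Z -> `|p * z - (Num.floor (p * z - c) + i)%:~R - c| <= 1 + J%:R.
  move=> iJ; have /andP[f1 f2] := real_floor_itv (num_real (p * z - c)).
  rewrite intrD in f2; have : `|i%:~R| <= J%:R :> R by rewrite -intr_norm -[J%:R]/((J%:Z)%:~R) ler_int.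
  rewrite intrD !ler_norml; move: f1 f2; move: (p * z) (_%:~R) (i%:~R) => ? ? ? ? ? /andP[? ?].
  by apply/andP; split; lra.
have cn := ler_norm c; have cn' := ler_norm (- c); rewrite normrN in cn'.
have mm : 0 <= m%:R :> R by [].
split.
- apply: subset_closure; apply: inO; rewrite /= -[X in _ * X]gtr0_norm// -normrM mulrBl.
  + rewrite [2 ^- n * _]mulrC divfK ?gt_eqF// [x.1 * p]mulrC.
    have := kc x.1 _ j1; rewrite /C !ler_norml; move: (p * _) (_%:~R) => ? ? /andP[? ?].
    by apply/andP; split; lra.
  + rewrite [2 ^- n * _]mulrC divfK ?gt_eqF// [x.2 * p]mulrC.
    have := kc x.2 _ j2; rewrite /C !ler_norml; move: (p * _) (_%:~R) => ? ? /andP[? ?].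
    by apply/andP; split; lra.
- pose D := C / p.
  apply: subset_trans (@subset_closure _ (@Omega R)).
  apply: (@subset_trans _ (`[x.1 - D, x.1 + D]%classic `*` `[x.2 - D, x.2 + D]%classic)).
    rewrite closureE; apply: smallest_sub; first exact: closed_box.
    move=> y /=; rewrite /phi_nk /phi2 /= !mulf_eq0 !negb_or => /andP[_ /andP[]].
    move=> /phi_supp/andP[a1 a2] /phi_supp/andP[b1 b2].
    have h (z w : R) (i : int) : `|i| <= J%:Z -> 0 <= p * w - (Num.floor (p * z - c) + i)%:~R - c ->
       p * w - (Num.floor (p * z - c) + i)%:~R - c <= m%:R -> z - D <= w <= z + D.
      move=> iJ g1 g2; rewrite -(ler_pM2l p0 (z - D)) -(ler_pM2l p0 w (z + D)) mulrBr mulrDr /D [p * (C / p)]mulrC divfK ?gt_eqF//.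
      exact: (window_sub (kc z _ iJ) g1 g2).
    by split; rewrite /= in_itv/=; [exact: h a1 a2|exact: h b1 b2].
  move=> y [/=]; rewrite !in_itv/= => /andP[a1 a2] /andP[b1 b2].
  by apply: inO; rewrite -ler_pdivlMr// -/D ler_distl ?a1 ?b1.
Qed.

(* The kernel of a one-dimensional wavelet coefficient of index [l] after [b]
   integrations by parts. *)
Definition kap (l b : nat) (z : R) : R :=
  comb ((1 - 'X) ^+ (l - b) * P l) (cardinal_bspline (m.-1 + b)) (z - ((lo l)%:~R + c)).

Lemma kap_kernel l b : exists M L, is_kernel (kap l b) M L.
Proof.
set P' := (1 - 'X) ^+ (l - b) * P l; set s := (lo l)%:~R + c.
exists (coef_norm P'), (`|s| + (m.-1 + b).+1%:R + (size P').-1%:R); split.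
- apply: (measurableT_comp (measurable_comb P' (cardinal_bspline_in01 R (m.-1 + b)).1)).
  exact: measurable_funB.
- by move=> x; apply: comb_bound; exact: (cardinal_bspline_in01 R _).2.
- move=> x /(comb_supp (@cardinal_bspline_supp R _))/andP[h1 h2].
  have s1 := ler_norm s; have s2 := ler_norm (- s); rewrite normrN in s2.
  have h3 : (0 : R) <= (m.-1 + b).+1%:R by []. 
  have h4 : (0 : R) <= (size P').-1%:R by [].
  move: h1 h2 h3 h4; rewrite -/P' -/s; move: (_%:R) (_.-1%:R) => ? ? ? ? ? ?.
  by rewrite ler_norml; apply/andP; split; lra.
Qed.

(** The mass of a combination of translates is the value of its polynomial at 1, which is 0 as long
    as a factor [1 - 'X] is left. *)
Lemma kap_mass l b : \int[lam]_x kap l b x = (l <= b)%N%:R * (P l).[1].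
Proof.
set P' := (1 - 'X) ^+ (l - b) * P l; set s := (lo l)%:~R + c; set k := (m.-1 + b)%N.
have Bi : lam.-integrable setT (EFin \o cardinal_bspline k) by exact: cardinal_bspline_integrable.
have Bii (a : R) : lam.-integrable setT (EFin \o (fun x => cardinal_bspline k (1 * x + a))).
  exact: integrable_affine.
have -> : (l <= b)%N%:R * (P l).[1] = P'.[1].
  by rewrite /P' hornerM horner_exp !hornerE subrr expr0n subn_eq0.
transitivity (\int[lam]_x \sum_(i < size P') P'`_i * cardinal_bspline k (1 * x + (- s - i%:R))).
  by apply: eq_Rintegral => x _; apply: eq_bigr => i _; rewrite mul1r addrA.
rewrite Rintegral_fsum; last first.
  by move=> i; have := integrableZl measurableT (P'`_i) (Bii (- s - i%:R)); apply: eq_integrable => // z _; rewrite /= EFinM.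
rewrite horner_coef; apply: eq_bigr => i _.
by rewrite RintegralZl// Rintegral_affine// cardinal_bspline_mass invr1 expr1n mul1r mulr1.
Qed.

Lemma phi_kernel : is_kernel phi 1 (m%:R + `|c|).
Proof.
have [mB B01] := cardinal_bspline_in01 R m.-1.
split.
- rewrite (_ : phi = fun x => cardinal_bspline m.-1 (x - c)); last exact/funext.
  by apply: (measurableT_comp mB); exact: measurable_funB.
- by move=> x; rewrite hphi; have /andP[h1 h2] := B01 (x - c); rewrite ger0_norm.
- move=> x /phi_supp/andP[h1 h2]; have c1 := ler_norm c; have c2 := ler_norm (- c).
  rewrite normrN in c2; have : 0 <= m%:R :> R by [].
  by move: (m%:R) h2 => M h2 h3; rewrite ler_norml; apply/andP; split; lra.
Qed.

Lemma phi_mass : \int[lam]_x phi x = 1.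
Proof.
transitivity (\int[lam]_x cardinal_bspline m.-1 (1 * x + - c)).
  by apply: eq_Rintegral => x _; rewrite hphi mul1r.
by rewrite Rintegral_affine// ?cardinal_bspline_mass ?invr1 ?mulr1//; exact: cardinal_bspline_integrable.
Qed.

(** Of the two factors [2 ^+ n], one comes from [sampling] and one from the normalization of
    [phi_nk]. *)
Lemma sampling_avg n u (k : Mgrid phi n) : mu.-integrable setT (EFin \o u) ->
  sampling phi n u k = avg phi phi n u (set_val k).
Proof.
move=> ui; have mu_ := integrable_mfun ui; have mk := measurable_ker phi_kernel phi_kernel n (set_val k).
set I2 := \int[mu]_x (2 ^+ n * (u x * ker_nk phi phi n (set_val k) x)).
have I2E : I2 = 2 ^+ n * \int[mu]_x (u x * ker_nk phi phi n (set_val k) x).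
  by rewrite /I2 RintegralZl//; exact: (integrable_mulker phi_kernel phi_kernel).
rewrite /avg expr2 -mulrA -I2E /sampling.
suff -> : \int[leb2 R]_(x in @Omega R) (u x * phi_nk phi n (set_val k) x) = I2 by [].
have -> : (fun x => u x * phi_nk phi n (set_val k) x) = fun x => 2 ^+ n * (u x * ker_nk phi phi n (set_val k) x).
  by apply/funext => x; rewrite /phi_nk /phi2 /ker_nk /tensor/= mulrCA.
rewrite /I2 /Rintegral integral_Omega//; apply/measurable_EFinP.
by apply: measurable_funM => //; exact: measurable_funM.
Qed.

Lemma fsum_set_type (A : set (int * int)) (B : set A) (F : int * int -> R) (r : seq (int * int)) :
  uniq r -> (forall k : A, B k -> F (set_val k) != 0 -> set_val k \in r) ->
  (forall k, k \in r -> F k = 0 \/ exists2 k' : A, B k' & k = set_val k') ->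
  \sum_(k \in B) F (set_val k) = \sum_(k <- r) F k.
Proof.
move=> ur Br rB; rewrite [RHS]fsbig_seq//.
pose S : set (int * int) := set_val @` B.
have -> : \sum_(k \in B) F (set_val k) = \sum_(k \in S) F k.
  by rewrite fsbig_image// => x y _ _; rewrite set_valE => /val_inj.
transitivity (\sum_(k \in S `|` [set` r]) F k).
  apply: fsbig_widen => [k ?|k [[//|kr] nS]]; first by left.
  by case: (rB _ kr) => // -[k' Bk' kE]; exfalso; apply: nS; exists k'.
apply/esym/fsbig_widen => [k ?|k [[[k' Bk' <-]|//] nr]]; first by right.
by apply/eqP; apply: contra_notT nr => /(Br _ Bk').
Qed.

Definition Kset n : set (int * int) := set_val @` (Kgrid m q phi n).

Lemma Kset_Mgrid n : Kset n `<=` Mgrid phi n.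
Proof. by move=> _ [k _ <-]; exact: set_valP. Qed.

Lemma KsetP n k : Kset n k -> forall (a : midx m) i1 i2, (Q a.1)`_i1 != 0 -> (Q a.2)`_i2 != 0 ->
  Mgrid phi n (k.1 + lo a.1 + i1%:Z, k.2 + lo a.2 + i2%:Z).
Proof.
move=> [k' Kk' <-] a i1 i2 h1 h2.
have [q1 _ _] := hq (ltn_ord a.1 : (a.1 <= m)%N); have [q2 _ _] := hq (ltn_ord a.2 : (a.2 <= m)%N).
have := Kk' a (lo a.1 + i1%:Z, lo a.2 + i2%:Z).
rewrite /qmask2 q1 q2 !zcoef_nat mulf_neq0// => /(_ isT).
by rewrite addpE /= !addrA.
Qed.

Lemma finite_Kset n : finite_set (Kset n).
Proof. exact: sub_finite_set (@Kset_Mgrid n) (finite_Mgrid n). Qed.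

Definition rM n : seq (int * int) := finmap.enum_fset (fset_set (Mgrid phi n)).
Definition rK n : seq (int * int) := finmap.enum_fset (fset_set (Kset n)).

Lemma rM_uniq n : uniq (rM n). Proof. exact: finmap.fset_uniq. Qed.
Lemma rK_uniq n : uniq (rK n). Proof. exact: finmap.fset_uniq. Qed.

Lemma mem_rM n k : k \in rM n <-> Mgrid phi n k.
Proof. by rewrite -[X in _ <-> X k](fset_setK (finite_Mgrid n)). Qed.

Lemma mem_rK n k : k \in rK n <-> Kset n k.
Proof. by rewrite -[X in _ <-> X k](fset_setK (finite_Kset n)). Qed.

Lemma rM_inner n k : k \in rM n -> inner_cell c n k.
Proof. by move/mem_rM; exact: Mgrid_inner. Qed.

Lemma rK_inner n k : k \in rK n -> inner_cell c n k.
Proof. by move/mem_rK/Kset_Mgrid; exact: Mgrid_inner. Qed.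

Lemma rM_near x : Omega x -> \forall n \near \oo, cell_index c n x \in rM n.
Proof.
move=> Ox; apply: filterS (@Mgrid_near x 0 Ox) => n hn; apply/mem_rM.
by have := hn 0; rewrite addr0; apply; rewrite normr0.
Qed.

Lemma rK_near x : Omega x -> \forall n \near \oo, cell_index c n x \in rK n.
Proof.
move=> Ox.
(* A crude bound for the offsets reached by all the masks at once. *)
pose J := (\sum_(l < m.+1) (`|lo l| + size (Q l)))%N.
apply: filterS (@Mgrid_near x J Ox) => n hn; apply/mem_rK.
have Mx : Mgrid phi n (cell_index c n x).
  by have := hn 0; rewrite addr0; apply; rewrite normr0.
exists (SigSub (mem_set Mx)) => // a j; rewrite /qmask2 mulf_eq0 negb_or => /andP[].
have [q1 _ _] := hq (ltn_ord a.1 : (a.1 <= m)%N); have [q2 _ _] := hq (ltn_ord a.2 : (a.2 <= m)%N).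
rewrite q1 q2 => /zcoef_neq0[i1 i1Q j1] /zcoef_neq0[i2 i2Q j2].
have bnd (l : 'I_m.+1) i : (i < size (Q l))%N -> (`|lo l + i%:Z| <= J%:Z)%R.
  move=> iQ; apply: (le_trans (ler_normD _ _)).
  have : (`|lo l| + size (Q l) <= J)%N by rewrite /J (bigD1 l)//= leq_addr.
  by rewrite -lez_nat PoszD abszE; apply: le_trans; rewrite lerD2l ger0_norm// lez_nat ltnW.
by apply: hn; rewrite ?j1 ?j2; exact: bnd.
Qed.

Lemma Kgrid_sum n (F : int * int -> R) :
  \sum_(k \in Kgrid m q phi n) F (set_val k) = \sum_(k <- rK n) F k.
Proof.
apply: fsum_set_type; first exact: rK_uniq.
- by move=> k Kk _; apply/mem_rK; exists k.
- by move=> k /mem_rK[k' Kk' <-]; right; exists k'.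
Qed.

Lemma Mgrid_sum n (F : int * int -> R) :
  \sum_(k \in [set: Mgrid phi n]) F (set_val k) = \sum_(k <- rM n) F k.
Proof.
apply: fsum_set_type; first exact: rM_uniq.
- by move=> k _ _; apply/mem_rM; exact: set_valP.
- by move=> k /mem_rM Mk; right; exists (SigSub (mem_set Mk)).
Qed.

Lemma qmask2_shift (a : midx m) (k : int * int) (i j : nat) :
  qmask2 q a ((k.1 + lo a.1 + i%:Z, k.2 + lo a.2 + j%:Z) - k) = (Q a.1)`_i * (Q a.2)`_j.
Proof.
have [q1 _ _] := hq (ltn_ord a.1 : (a.1 <= m)%N); have [q2 _ _] := hq (ltn_ord a.2 : (a.2 <= m)%N).
have sub3 (x y z : int) : x + y + z - x = y + z by ring.
by rewrite /qmask2 addpE oppE /= q1 q2 !sub3 !zcoef_nat.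
Qed.

Lemma combI (P' : {poly R}) g (z : R) : comb P' g z = \sum_(i <- iota 0 (size P')) P'`_i * g (z - i%:R).
Proof. by rewrite /comb -(big_mkord xpredT (fun i => P'`_i * g (z - i%:R))) /index_iota subn0. Qed.

(** The mask combines translates of [phi] into the kernel [kap] without integration by parts.
    Membership in [Kgrid] ensures that every translate with a nonzero coefficient is sampled, so the
    sum over [Mgrid] misses no term. *)
Lemma wavelet_avg n (a : midx m) u (k : Mgrid phi n) : mu.-integrable setT (EFin \o u) ->
  Kgrid m q phi n k ->
  wavelet q a (sampling phi n u) k = avg (kap a.1 0) (kap a.2 0) n u (set_val k).
Proof.
move=> ui Kk; set k0 := set_val k.
have Kk0 : Kset n k0 by exists k.
pose r := [seq (k0.1 + lo a.1 + i%:Z, k0.2 + lo a.2 + j%:Z) | i <- iota 0 (size (Q a.1)), j <- iota 0 (size (Q a.2))].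
have ur : uniq r.
  apply: allpairs_uniq; [exact: iota_uniq|exact: iota_uniq|].
  by move=> [i j] [i' j'] _ _ /= [] /addrI[->] /addrI[->].
have [q1 _ _] := hq (ltn_ord a.1 : (a.1 <= m)%N); have [q2 _ _] := hq (ltn_ord a.2 : (a.2 <= m)%N).
pose F j := qmask2 q a (j - k0) * avg phi phi n u j.
transitivity (\sum_(j <- r) F j).
  rewrite /wavelet; transitivity (\sum_(j \in [set: Mgrid phi n]) F (set_val j)).
    by apply: eq_fsbigr => j _; rewrite /F (sampling_avg j ui).
  apply: (fsum_set_type ur).
  - move=> j _; rewrite /F mulf_eq0 negb_or => /andP[+ _].
    rewrite /qmask2 mulf_eq0 negb_or q1 q2 => /andP[/zcoef_neq0[i1 i1Q j1] /zcoef_neq0[i2 i2Q j2]].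
    apply/allpairsP; exists (i1, i2); rewrite !mem_iota /=; split => //.
    move: j1 j2; rewrite addpE oppE /= => j1 j2.
    by case: (set_val j) j1 j2 => [x y] /= j1 j2; congr (_, _); rewrite -addrA -?j1 -?j2 addrC subrK.
  - move=> j /allpairsP[[i1 i2] /= [_ _ ->]].
    have [Q1|Q1] := eqVneq (Q a.1)`_i1 0.
      by left; rewrite /F qmask2_shift Q1 !mul0r.
    have [Q2|Q2] := eqVneq (Q a.2)`_i2 0.
      by left; rewrite /F qmask2_shift Q2 mulr0 mul0r.
    by right; exists (SigSub (mem_set (KsetP Kk0 Q1 Q2))).
have kE x : ker_nk (kap a.1 0) (kap a.2 0) n k0 x =
    \sum_(j <- r) qmask2 q a (j - k0) * ker_nk phi phi n j x.
  rewrite /r big_allpairs_dep /ker_nk /tensor /kap !combI !subn0 !addn0 -/(Q a.1) -/(Q a.2).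
  rewrite big_distrlr.
  apply: eq_bigr => i _; apply: eq_bigr => j _.
  rewrite qmask2_shift [RHS]mulrACA !hphi; congr (_ * cardinal_bspline _ _ * (_ * cardinal_bspline _ _)).
    by rewrite /= !intrD; ring.
  by rewrite /= !intrD; ring.
rewrite /avg.
transitivity ((2 ^+ n) ^+ 2 * \int[mu]_x (\sum_(j <- r) qmask2 q a (j - k0) * (u x * ker_nk phi phi n j x))).
  rewrite Rintegral_fsum.
    rewrite mulr_sumr; apply: eq_bigr => j _; rewrite /F /avg RintegralZl//; last first.
      exact: (integrable_mulker phi_kernel phi_kernel).
    by rewrite mulrCA.
  move=> j; have := integrableZl measurableT (qmask2 q a (j - k0)) (integrable_mulker phi_kernel phi_kernel n j ui).
  by apply: eq_integrable => // z _; rewrite /= EFinM.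
congr (_ * _); apply: eq_Rintegral => x _; rewrite kE mulr_sumr; apply: eq_bigr => j _.
by rewrite mulrCA.
Qed.

(** Integration by parts is legitimate because the grid points at both ends of the mask are in
    [Mgrid], which confines the support of the whole kernel to the closed square. *)
Lemma avg_kap n (a : midx m) (b1 b2 : nat) u g k : Kset n k ->
  mu.-integrable setT (EFin \o u) -> mu.-integrable setT (EFin \o g) ->
  is_weak_deriv (@Omega R) b1 b2 u g -> (b1 <= a.1)%N -> (b2 <= a.2)%N ->
  (2 ^+ n) ^+ (b1 + b2) * avg (kap a.1 0) (kap a.2 0) n u k =
  (-1) ^+ (b1 + b2) * avg (kap a.1 b1) (kap a.2 b2) n g k.
Proof.
move=> Kk ui gi ug ba1 ba2; have [H HH] := exists_smooth_step R.
have QE l b : (b <= l)%N -> Q l = (1 - 'X) ^+ b * ((1 - 'X) ^+ (l - b) * P l).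
  by move=> bl; rewrite mulrA -exprD subnKC.
have [_ p1 q10] := hq (ltn_ord a.1 : (a.1 <= m)%N); have [_ p2 q20] := hq (ltn_ord a.2 : (a.2 <= m)%N).
have PN l b : (b <= l)%N -> (P l).[1] != 0 -> (1 - 'X) ^+ (l - b) * P l != 0 /\ size (Q l) = (b + size ((1 - 'X) ^+ (l - b) * P l)%R)%N.
  move=> bl Pl.
  have X0 : (1 - 'X : {poly R}) != 0.
    by rewrite -opprB oppr_eq0 polyXsubC_eq0.
  have Pl0 : P l != 0 by apply: contraNneq Pl => ->; rewrite horner0.
  have h : (1 - 'X) ^+ (l - b) * P l != 0 by rewrite mulf_neq0// expf_neq0.
  split => //; rewrite (QE _ _ bl) size_mul ?expf_neq0//.
  have -> : (1 - 'X : {poly R}) ^+ b = (-1) ^+ b * ('X - 1%:P) ^+ b.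
    by rewrite -exprMn mulN1r opprB.
  by rewrite -signr_odd mulr_sign; case: ifP => _; rewrite ?size_polyN size_exp_XsubC.
have [n1 s1] := PN _ _ ba1 p1; have [n2 s2] := PN _ _ ba2 p2.
(* Leading coefficients are nonzero, as are the constant ones by [hq]: the extreme points of the
   mask therefore give grid points through [KsetP]. *)
have Q1 : (Q a.1)`_(size (Q a.1)).-1 != 0.
  by rewrite -lead_coefE lead_coef_eq0 (QE _ _ ba1) mulf_neq0// expf_neq0// -opprB oppr_eq0 polyXsubC_eq0.
have Q2 : (Q a.2)`_(size (Q a.2)).-1 != 0.
  by rewrite -lead_coefE lead_coef_eq0 (QE _ _ ba2) mulf_neq0// expf_neq0// -opprB oppr_eq0 polyXsubC_eq0.
have [l1 _ l2 _] := Mgrid_bound (KsetP Kk q10 q20).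
have [_ u1 _ u2] := Mgrid_bound (KsetP Kk Q1 Q2).
have N1 : 1 <= (2 ^+ n : R) by rewrite exprn_ege1// ler1n.
have := @weak_deriv_spline _ H HH u g b1 b2 m.-1 m.-1 _ _ (2 ^+ n)
  (k.1%:~R + (lo a.1)%:~R + c) (k.2%:~R + (lo a.2)%:~R + c) ui gi ug N1.
move=> /(_ ((1 - 'X) ^+ (a.1 - b1) * P a.1) ((1 - 'X) ^+ (a.2 - b2) * P a.2)).
have sz (l b : nat) (x : R) : (0 < size ((1 - 'X) ^+ (l - b) * P l)%R)%N ->
   size (Q l) = (b + size ((1 - 'X) ^+ (l - b) * P l)%R)%N ->
   (x + (lo l)%:~R + ((size (Q l)).-1)%:R) + c + m%:R <= 2 ^+ n ->
   x + (lo l)%:~R + c + (m.-1 + b + size ((1 - 'X) ^+ (l - b) * P l)%R)%:R <= 2 ^+ n.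
  move=> s0 sE; apply: le_trans.
  rewrite le_eqVlt; apply/orP; left; apply/eqP.
  (* The [b] additional box convolutions make up for the [b] factors removed from the mask, so the
     width of the support does not change. *)
  have -> : (m.-1 + b + size ((1 - 'X) ^+ (l - b) * P l)%R)%N = ((size (Q l)).-1 + m)%N.
    by rewrite sE; move: s0 m0; clear; case: (m) => // m'; lia.
  by rewrite natrD; ring.
rewrite !intrD in l1 l2 u1 u2.
move=> /(_ _ _ _ _ _ _) h.
rewrite /avg [LHS]mulrCA [RHS]mulrCA; congr (_ * _).
have e (b1' b2' : nat) (w : R * R -> R) : \int[mu]_x (w x * ker_nk (kap a.1 b1') (kap a.2 b2') n k x) =
   \int[mu]_x (w x * tensor (spline ((1 - 'X) ^+ (a.1 - b1') * P a.1) (m.-1 + b1') (2 ^+ n) (k.1%:~R + (lo a.1)%:~R + c))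
     (spline ((1 - 'X) ^+ (a.2 - b2') * P a.2) (m.-1 + b2') (2 ^+ n) (k.2%:~R + (lo a.2)%:~R + c)) x).
  by apply: eq_Rintegral => x _; rewrite /ker_nk /tensor /kap /spline !opprD !addrA.
rewrite !e !subn0 !addn0 -/(Q a.1) -/(Q a.2) (QE _ _ ba1) (QE _ _ ba2).
apply: h.
- by move: l1; rewrite addr0.
- by apply: sz => //; rewrite size_poly_gt0.
- by rewrite size_poly_gt0.
- by move: l2; rewrite addr0.
- by apply: sz => //; rewrite size_poly_gt0.
- by rewrite size_poly_gt0.
Qed.

End discretization_kernels.

(** * Weak derivatives and Sobolev norms *)

Section weak_derivative_facts.
Variable R : realType.
Local Notation mR := (measurableTypeR R).
Local Notation mu := (lebO R).
Local Notation lam := (@lebesgue_measure R).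

Lemma floor_grid_cvg (z : R) : 2 ^- n * (Num.floor (2 ^+ n * z - 0))%:~R @[n --> \oo] --> z.
Proof.
apply/cvgrPdist_le => d d0; apply: filterS (mono_exp2 1 d0) => n hn; rewrite subr0.
have p0 : 0 < (2 ^+ n : R) by rewrite exprn_gt0.
have /andP[f1 f2] := real_floor_itv (num_real (2 ^+ n * z)).
rewrite -(ler_pM2l p0) -{1}(gtr0_norm p0) -normrM mulrBr mulVKf ?gt_eqF//.
rewrite intrD in f2; rewrite (le_trans _ (ltW hn))// ger0_norm ?subr_ge0// lerBlDl ltW//.
Qed.

(** Measurability is for the product sigma-algebra; it is reached by sampling [f] at the corners of
    dyadic cells, which gives functions constant on countably many cells and converging
    pointwise. *)
Lemma continuous_measurable_plane (f : R * R -> R) : continuous f ->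
  measurable_fun setT (f : mR * mR -> R).
Proof.
move=> cf; pose pt n (k : int * int) : R * R := (2 ^- n * k.1%:~R, 2 ^- n * k.2%:~R).
pose f_ n (x : mR * mR) : R := f (pt n (cell_index 0 n x)).
apply: (@measurable_fun_cvg _ _ _ _ f_).
- move=> n _ Y mY; rewrite setTI.
  have -> : f_ n @^-1` Y = \bigcup_k (if f (pt n k) \in Y then cell 0 n k else set0).
    apply/seteqP; split => [x Yx|x [k _]].
      exists (cell_index 0 n x) => //; rewrite mem_set//=.
      by apply/set_mem; rewrite -cell_indexE.
    case: ifPn => // /set_mem Yk /mem_set; rewrite -cell_indexE => /eqP kx.
    by rewrite /= /f_ kx.
  apply: countable_bigcupT_measurable; first exact: countableP.
  by move=> k; case: ifP => // _; exact: measurable_cell.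
- move=> [x1 x2] _.
  have h : pt n (cell_index 0 n (x1, x2)) @[n --> \oo] --> ((x1, x2) : R * R).
    exact: (cvg_pair (@floor_grid_cvg x1) (@floor_grid_cvg x2)).
  exact: (cvg_comp _ _ h (cf (x1, x2))).
Qed.

Lemma test_pderiv_continuous (U : set (R * R)) a b t : test_function U t -> continuous (pderiv a b t).
Proof. by move=> [st _] x; apply: differentiable_continuous; exact: st. Qed.

Lemma test_pderiv_bounded (U : set (R * R)) a b (t : R * R -> R) : test_function U t ->
  exists M, forall x, Omega x -> `|pderiv a b t x| <= M.
Proof.
move=> tt; pose B := (`[0, 1]%classic `*` `[0, 1]%classic : set (R * R)).
have cB : compact (pderiv a b t @` B).
  apply: continuous_compact; last by apply: compact_setX; exact: segment_compact.
  by apply: continuous_subspaceT; exact: test_pderiv_continuous tt.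
have [M [_ hM]] := compact_bounded cB; exists (M + 1) => x [].
rewrite /= !in_itv/= => /andP[h1 h2] /andP[h3 h4].
apply: (hM (M + 1)); rewrite ?ltrDl//.
by exists x => //; split; rewrite /= in_itv/= !ltW.
Qed.

Lemma integrable_test_pderiv a b (u t : R * R -> R) : mu.-integrable setT (EFin \o u) ->
  test_function (@Omega R) t -> mu.-integrable setT (EFin \o (fun x => u x * pderiv a b t x)).
Proof.
move=> ui tt; have mu_ := integrable_mfun ui.
have mp : measurable_fun setT (pderiv a b t : mR * mR -> R).
  by apply: continuous_measurable_plane; exact: test_pderiv_continuous tt.
have [M hM] := test_pderiv_bounded a b tt.
have mO : measurable (@Omega R : set (mR * mR)) by exact: measurable_Omega.
(* The derivative is bounded on the square only; the indicator makes the bound global without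
   changing integrals against [lebO]. *)
have mI : measurable_fun setT (\1_(@Omega R) : mR * mR -> R) by exact: measurable_indic.
have Mi : forall x, `|pderiv a b t x * (\1_(@Omega R) x : R)| <= `|M|.
  move=> x; rewrite indicE; have [Ox|nO] := boolP (x \in Omega (R := R)).
    by rewrite mulr1 (le_trans (hM _ (set_mem Ox)))// ler_norm.
  by rewrite mulr0 normr0.
have := integrable_mulbd ui (measurable_funM mp mI) Mi.
move/integrableP => [_ h]; apply/integrableP; split.
  by apply/measurable_EFinP; exact: measurable_funM.
apply: le_lt_trans h; rewrite le_eqVlt; apply/orP; left; apply/eqP.
apply: ae_eq_integral => //.
- by apply: measurable_normE; exact: measurable_funM.
- by apply: measurable_normE; do 2 apply: measurable_funM => //.
- by apply: ae_Omega => x Ox _; rewrite /= indicE mem_set//= mulr1.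
Qed.

Lemma is_weak_derivE a b (u g : R * R -> R) : mu.-integrable setT (EFin \o u) ->
  mu.-integrable setT (EFin \o g) ->
  is_weak_deriv (@Omega R) a b u g <-> forall t, test_function (@Omega R) t ->
    \int[mu]_x (u x * pderiv a b t x) = (-1) ^+ (a + b) * \int[mu]_x (g x * t x).
Proof.
move=> ui gi.
have E1 t : test_function (@Omega R) t ->
    \int[leb2 R]_(x in @Omega R) (u x * pderiv a b t x) = \int[mu]_x (u x * pderiv a b t x).
  move=> tt; rewrite /Rintegral integral_Omega//.
  by apply/measurable_EFinP; apply: integrable_mfun; exact: integrable_test_pderiv.
have E2 t : test_function (@Omega R) t ->
    \int[leb2 R]_(x in @Omega R) (g x * t x) = \int[mu]_x (g x * t x).
  move=> tt; rewrite /Rintegral integral_Omega//.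
  by apply/measurable_EFinP; apply: integrable_mfun; exact: (@integrable_test_pderiv 0 0).
split=> h t tt.
  exact: (etrans (esym (E1 t tt)) (etrans (h t tt) (congr1 (fun z => (-1) ^+ (a + b) * z) (E2 t tt)))).
exact: (etrans (E1 t tt) (etrans (h t tt) (congr1 (fun z => (-1) ^+ (a + b) * z) (esym (E2 t tt))))).
Qed.

Lemma is_weak_deriv_ae a b (u g u' g' : R * R -> R) : mu.-integrable setT (EFin \o u) ->
  mu.-integrable setT (EFin \o g) -> mu.-integrable setT (EFin \o u') ->
  mu.-integrable setT (EFin \o g') -> {ae mu, forall x, u x = u' x} -> {ae mu, forall x, g x = g' x} ->
  is_weak_deriv (@Omega R) a b u g -> is_weak_deriv (@Omega R) a b u' g'.
Proof.
move=> ui gi u'i g'i uu' gg' /(is_weak_derivE a b ui gi) h; apply/is_weak_derivE => // t tt.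
have E (a' b' : nat) (w w' : R * R -> R) : mu.-integrable setT (EFin \o w) -> mu.-integrable setT (EFin \o w') ->
    {ae mu, forall x, w x = w' x} ->
    \int[mu]_x (w x * pderiv a' b' t x) = \int[mu]_x (w' x * pderiv a' b' t x).
  move=> wi w'i ww'; rewrite /Rintegral; congr fine; apply: ae_eq_integral => //.
  - by apply/measurable_EFinP; apply: integrable_mfun; exact: integrable_test_pderiv.
  - by apply/measurable_EFinP; apply: integrable_mfun; exact: integrable_test_pderiv.
  - by apply: (ae_lebO_and ww' ww') => x -> _ _.
by rewrite -(E a b _ _ ui u'i uu') -(E 0 0 _ _ gi g'i gg') h.
Qed.

Lemma is_weak_derivB a b (u g u' g' : R * R -> R) : mu.-integrable setT (EFin \o u) ->
  mu.-integrable setT (EFin \o g) -> mu.-integrable setT (EFin \o u') ->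
  mu.-integrable setT (EFin \o g') -> is_weak_deriv (@Omega R) a b u g ->
  is_weak_deriv (@Omega R) a b u' g' ->
  is_weak_deriv (@Omega R) a b (fun x => u x - u' x) (fun x => g x - g' x).
Proof.
move=> ui gi u'i g'i /(is_weak_derivE a b ui gi) h /(is_weak_derivE a b u'i g'i) h'.
have ii (w w' : R * R -> R) : mu.-integrable setT (EFin \o w) -> mu.-integrable setT (EFin \o w') ->
    mu.-integrable setT (EFin \o (fun x => w x - w' x)).
  by move=> wi w'i; have := integrableB measurableT wi w'i; apply: eq_integrable => // x _; rewrite /= EFinB.
apply/is_weak_derivE; [exact: ii|exact: ii|move=> t tt].
have E (a' b' : nat) (w w' : R * R -> R) : mu.-integrable setT (EFin \o w) -> mu.-integrable setT (EFin \o w') ->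
    \int[mu]_x ((w x - w' x) * pderiv a' b' t x) = \int[mu]_x (w x * pderiv a' b' t x) - \int[mu]_x (w' x * pderiv a' b' t x).
  move=> wi w'i; rewrite -RintegralB//; try exact: integrable_test_pderiv.
  by apply: eq_Rintegral => x _; rewrite mulrBl.
by rewrite (E a b)// (E 0 0 g g')// mulrBr h// h'.
Qed.

(** A margin of [M] cells is left on the right and on top, for kernels that extend upwards from the
    lower left corner of a cell. *)
Definition sq_grid (M n : nat) : seq (int * int) :=
  [seq (i%:Z, j%:Z) | i <- iota 0 (2 ^ n - M), j <- iota 0 (2 ^ n - M)].

Lemma sq_grid_uniq M n : uniq (sq_grid M n).
Proof.
apply: allpairs_uniq; [exact: iota_uniq|exact: iota_uniq|].
by move=> [i j] [i' j'] _ _ /= [-> ->].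
Qed.

Lemma sq_gridP M n k : k \in sq_grid M n ->
  exists i j : nat, [/\ k = (i%:Z, j%:Z), (i + M < 2 ^ n)%N & (j + M < 2 ^ n)%N].
Proof.
by move=> /allpairsP[[i j] /= [+ + ->]]; rewrite !mem_iota /= !add0n !ltn_subRL ![(M + _)%N]addnC => *; exists i, j.
Qed.

Lemma sq_grid_inner M n k : k \in sq_grid M n -> inner_cell (0 : R) n k.
Proof.
move=> /sq_gridP[i [j [-> iM jM]]]; rewrite /inner_cell /= !addr0 -!pmulrn.
have key (l : nat) : (l + M < 2 ^ n)%N -> l%:R + 1 <= 2 ^+ n :> R.
  by move=> lM; rewrite natr1 -natrX ler_nat (leq_trans _ lM)// ltnS leq_addr.
by split => //; exact: key.
Qed.

Lemma sq_grid_near M (x : R * R) : Omega x -> \forall n \near \oo, cell_index 0 n x \in sq_grid M n.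
Proof.
move=> [/=]; rewrite !in_itv/= => /andP[x10 x11] /andP[x20 x21].
pose d := Num.min (1 - x.1) (1 - x.2).
have d0 : 0 < d by rewrite lt_min !subr_gt0 x11 x21.
apply: filterS (mono_exp2 M%:R d0) => n hn.
have p0 : 0 < (2 ^+ n : R) by rewrite exprn_gt0.
have key (z : R) : 0 < z -> d <= 1 - z -> exists2 i : nat, (i < 2 ^ n - M)%N & Num.floor (2 ^+ n * z - 0) = i%:Z.
  move=> z0 dz; rewrite subr0.
  have f0 : 0 <= Num.floor (2 ^+ n * z) by rewrite floor_ge0 mulr_ge0// ltW.
  exists `|Num.floor (2 ^+ n * z)|%N; last by rewrite gez0_abs.
  rewrite ltn_subRL -(ltr_nat R) natrD natr_absz ger0_norm// natrX.
  have /andP[f1 _] := real_floor_itv (num_real (2 ^+ n * z)).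
  rewrite -ltrBrDl; apply: (le_lt_trans f1).
  rewrite ltrBrDr -ltrBrDl.
  have -> : 2 ^+ n - 2 ^+ n * z = 2 ^+ n * (1 - z) by rewrite mulrBr mulr1.
  by rewrite (lt_le_trans hn)// ler_pM2l.
have [|i iM ie] := key _ x10; first by rewrite /d ge_min lexx.
have [|j jM je] := key _ x20; first by rewrite /d ge_min lexx orbT.
by apply/allpairsP; exists (i, j); rewrite !mem_iota /= !add0n /cell_index ie je.
Qed.

(** By [weak_deriv_spline] with [u = 0], the averages of [g] against tensor products of B-splines
    all vanish, while by [step_avg_cvg] they converge to [g] in L_1. *)
Lemma is_weak_deriv0 a b (g : R * R -> R) : mu.-integrable setT (EFin \o g) ->
  is_weak_deriv (@Omega R) a b (fun=> 0) g -> {ae mu, forall x, g x = 0}.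
Proof.
move=> gi g0; have [H HH] := exists_smooth_step R.
have i0 : mu.-integrable setT (EFin \o (fun _ : R * R => 0 : R)) by exact: integrable0.
have kB (l : nat) : is_kernel (cardinal_bspline l : R -> R) 1 l.+1%:R.
  split; first exact: (cardinal_bspline_in01 R l).1.
  - by move=> x; have /andP[h1 h2] := (cardinal_bspline_in01 R l).2 x; rewrite ger0_norm.
  - by move=> x /cardinal_bspline_supp/andP[h1 h2]; rewrite ger0_norm.
pose L : R := (a + b).+1%:R.
have kL (l : nat) : (l <= a + b)%N -> is_kernel (cardinal_bspline l : R -> R) 1 L.
  move=> lab; have [h1 h2 h3] := kB l; split => // x /h3 /le_trans; apply.
  by rewrite ler_nat.
have ka := kL a (leq_addr _ _); have kb := kL b (leq_addl _ _).
have := step_avg_cvg ka kb (@sq_grid_uniq (a + b).+1) (@sq_grid_inner (a + b).+1) (@sq_grid_near (a + b).+1) gi.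
rewrite !cardinal_bspline_mass !mul1r.
have comb1 l z : comb 1 (cardinal_bspline l) z = cardinal_bspline l z :> R.
  by rewrite /comb size_poly1 big_ord1 coef1 mul1r subr0.
have -> : (fun n => step 0 n (sq_grid (a + b).+1 n) (avg (cardinal_bspline a) (cardinal_bspline b) n g)) =
    (fun=> (fun=> 0)).
  apply/funext => n; apply/funext => x; rewrite /step; case: ifP => // /sq_gridP[i [j [-> iM jM]]].
  have N1 : 1 <= (2 ^+ n : R) by rewrite exprn_ege1// ler1n.
  have bd (l k : nat) : (l <= a + b)%N -> (k + (a + b).+1 < 2 ^ n)%N -> k%:R + (0 + l + size (1%R : {poly R}))%:R <= 2 ^+ n :> R.
    by move=> lab kn; rewrite size_poly1 -natrD -natrX ler_nat; move: (2 ^ n)%N kn => N; lia.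
  have := @weak_deriv_spline _ H HH (fun=> 0) g a b 0 0 1 1 (2 ^+ n) i%:R j%:R i0 gi g0 N1 (ler0n _ _)
    (bd _ _ (leq_addr _ _) iM) _ (ler0n _ _) (bd _ _ (leq_addl _ _) jM) _.
  rewrite size_poly1 => /(_ isT isT).
  under eq_Rintegral do rewrite mul0r.
  rewrite {1}/Rintegral integral0 /= mulr0 => /esym/eqP; rewrite mulf_eq0 signr_eq0 /= => /eqP h.
  rewrite /avg (_ : \int[mu]_y (g y * ker_nk (cardinal_bspline a) (cardinal_bspline b) n (i%:Z, j%:Z) y) = 0) ?mulr0//.
  rewrite -[RHS]h; apply: eq_Rintegral => y _; rewrite /ker_nk /tensor /spline !comb1.
  by rewrite !add0n.
move/cvg1P => h.
have n0 : nrm1 mu g = 0%E.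
  apply/eqP; rewrite eq_le nrm1_ge0 andbT; apply/lee_addgt0Pr => d d0; rewrite add0e.
  have [N _ /(_ N (leqnn _))] := h d d0; apply: le_trans.
  rewrite /nrm1 le_eqVlt; apply/orP; left; apply/eqP; apply: eq_integral => x _.
  by rewrite sub0r mul1r normrN.
have mg := integrable_mfun gi.
have mgE : measurable_fun setT (EFin \o g) by exact/measurable_EFinP.
have [N [mN N0 NP]] : ae_eq mu setT (EFin \o g) (cst 0%E).
  by apply/ae_eq_integral_abs.
exists N; split => //; apply: subset_trans NP => x; apply: contra_not => h0.
by have := h0 I; case.
Qed.

Lemma is_weak_deriv_unique a b (u g g' : R * R -> R) : mu.-integrable setT (EFin \o u) ->
  mu.-integrable setT (EFin \o g) -> mu.-integrable setT (EFin \o g') ->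
  is_weak_deriv (@Omega R) a b u g -> is_weak_deriv (@Omega R) a b u g' ->
  {ae mu, forall x, g x = g' x}.
Proof.
move=> ui gi g'i ug ug'; have := is_weak_derivB ui gi ui g'i ug ug'.
under eq_fun do rewrite subrr.
move/is_weak_deriv0 => h.
have {}h : {ae mu, forall x, g x - g' x = 0}.
  by apply: h; have := integrableB measurableT gi g'i; apply: eq_integrable => // x _; rewrite /= EFinB.
by apply: (ae_lebO_and h h) => x _ /eqP; rewrite subr_eq0 => /eqP.
Qed.

End weak_derivative_facts.

Section sobolev_facts.
Variable R : realType.
Local Notation mR := (measurableTypeR R).
Local Notation mu := (lebO R).

Lemma L1_integrable (u : L1 R) : mu.-integrable setT (EFin \o (u : R * R -> R)).
Proof. by apply/Lfun1_integrable; exact: LfunP. Qed.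

Lemma L1_norm (u : L1 R) : (`|u|%:E = nrm1 mu u)%E.
Proof.
rewrite /Num.norm/= /Lp_norm Lnorm1 fineK//.
exact: (nrm1_fin (L1_integrable u)).
Qed.

Section Lp_ae.
Variables (p : \bar R) (p1 : (1 <= p)%E).

Lemma Lp_opp (u : Lp mu p1) : - u = Lp_class (- Lp_repr u).
Proof.
have z : Lp_class (0 : LfunType mu p1) = 0 :> Lp mu p1.
  by apply: (addrI (Lp_class 0)); rewrite -Lp_classD !addr0.
by apply/eqP; rewrite eq_sym -subr_eq0 opprK -{2}(Lp_reprK u) -Lp_classD addNr z.
Qed.

Lemma Lp_D (u v : Lp mu p1) : {ae mu, forall x, Lp_fun (u + v) x = Lp_fun u x + Lp_fun v x}.
Proof.
have h := Lp_reprP (Lp_repr u + Lp_repr v); rewrite Lp_classD !Lp_reprK in h.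
by apply: (ae_lebO_and h h) => x /(_ I) + _; apply.
Qed.

Lemma Lp_N (u : Lp mu p1) : {ae mu, forall x, Lp_fun (- u) x = - Lp_fun u x}.
Proof.
have h := Lp_reprP (- Lp_repr u); rewrite -Lp_opp in h.
by apply: (ae_lebO_and h h) => x /(_ I) + _; apply.
Qed.

Lemma Lp_B (u v : Lp mu p1) : {ae mu, forall x, Lp_fun (u - v) x = Lp_fun u x - Lp_fun v x}.
Proof. by apply: (ae_lebO_and (Lp_D u (- v)) (Lp_N v)) => x -> ->. Qed.

Lemma Lp_Z a (u : Lp mu p1) : {ae mu, forall x, Lp_fun (a *: u) x = a * Lp_fun u x}.
Proof.
have h := Lp_reprP (a *: Lp_repr u); rewrite Lp_classZ Lp_reprK in h.
by apply: (ae_lebO_and h h) => x /(_ I) + _; apply.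
Qed.

Lemma Lp_ext (u v : Lp mu p1) : {ae mu, forall x, Lp_fun u x = Lp_fun v x} -> u = v.
Proof.
move=> uv; rewrite -(Lp_reprK u) -(Lp_reprK v); apply/Lp_classP.
by apply: (ae_lebO_and uv uv) => x + _ _; apply.
Qed.

End Lp_ae.

Lemma wderivP s a b (u : L1 R) : sobolev s u -> (a + b <= s)%N ->
  is_weak_deriv (@Omega R) a b u (wderiv a b u).
Proof. move=> su ab; have := su _ _ ab.
exact: (@xgetPex _ 0 [set g : L1 R | is_weak_deriv (@Omega R) a b (Lp_fun u) (Lp_fun g)]). Qed.

(** Uniqueness makes the value chosen by [xget] computable, which yields the compatibility of
    [wderiv] with differences. *)
Lemma wderiv_eq a b (u g : L1 R) : is_weak_deriv (@Omega R) a b u g -> wderiv a b u = g.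
Proof.
move=> ug; have h : is_weak_deriv (@Omega R) a b u (wderiv a b u).
  by apply: (@xgetPex _ 0 [set g : L1 R | is_weak_deriv (@Omega R) a b (Lp_fun u) (Lp_fun g)]); exists g.
by apply: Lp_ext; apply: is_weak_deriv_unique h ug; exact: L1_integrable.
Qed.

Lemma weak_deriv_L1B a b (u v g h : L1 R) : is_weak_deriv (@Omega R) a b u g ->
  is_weak_deriv (@Omega R) a b v h -> is_weak_deriv (@Omega R) a b (Lp_fun (u - v)) (Lp_fun (g - h)).
Proof.
move=> ug vh; have := is_weak_derivB (L1_integrable u) (L1_integrable g) (L1_integrable v) (L1_integrable h) ug vh.
have ii (w w' : L1 R) : mu.-integrable setT (EFin \o (fun x => w x - w' x)).
  by have := integrableB measurableT (L1_integrable w) (L1_integrable w'); apply: eq_integrable => // x _; rewrite /= EFinB.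
apply: is_weak_deriv_ae => //; [exact: L1_integrable|exact: L1_integrable| |].
- by have e := Lp_B u v; apply: (ae_lebO_and e e) => x -> _.
- by have e := Lp_B g h; apply: (ae_lebO_and e e) => x -> _.
Qed.

Lemma sobolevB s (u v : L1 R) : sobolev s u -> sobolev s v -> sobolev s (u - v).
Proof.
move=> su sv a b ab; exists (wderiv a b u - wderiv a b v).
by apply: weak_deriv_L1B; exact: wderivP ab.
Qed.

Lemma wderivB s a b (u v : L1 R) : sobolev s u -> sobolev s v -> (a + b <= s)%N ->
  wderiv a b (u - v) = wderiv a b u - wderiv a b v.
Proof. by move=> su sv ab; apply: wderiv_eq; apply: weak_deriv_L1B; exact: wderivP ab. Qed.

Lemma wderiv00 (u : L1 R) : wderiv 0 0 u = u.
Proof. by apply: wderiv_eq => t _; rewrite expr0 mul1r. Qed.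

Lemma sobolev_norm_ge s a b (u : L1 R) : (a + b <= s)%N -> `|wderiv a b u| <= sobolev_norm s u.
Proof.
move=> ab; have a1 : (a < s.+1)%N by rewrite ltnS (leq_trans _ ab)// leq_addr.
have b1 : (b < s.+1)%N by rewrite ltnS (leq_trans _ ab)// leq_addl.
rewrite /sobolev_norm (bigD1 (Ordinal a1, Ordinal b1))//= lerDl.
by apply: sumr_ge0.
Qed.

Lemma sobolev_norm_ge0 s (u : L1 R) : 0 <= sobolev_norm s u.
Proof. exact: sumr_ge0. Qed.

Lemma cvg1_L1 (u_ : nat -> L1 R) (u : L1 R) : `|u_ n - u| @[n --> \oo] --> (0 : R) ->
  cvg1 mu (fun n => u_ n : R * R -> R) u.
Proof.
move=> h; rewrite /cvg1 (_ : (fun n => _) = (fun n => (`|u_ n - u|)%:E)).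
  by apply: cvg_EFin; [exact: nearW|exact: h].
apply/funext => n; rewrite L1_norm; apply: ae_eq_nrm1.
- by apply: measurable_funB; exact: (integrable_mfun (L1_integrable _)).
- exact: (integrable_mfun (L1_integrable _)).
- by have e := Lp_B (u_ n) u; apply: (ae_lebO_and e e) => x -> _.
Qed.

Lemma sobolev_cvg1 s a b (u_ : nat -> L1 R) (u : L1 R) : (forall n, sobolev s (u_ n)) -> sobolev s u ->
  sobolev_norm s (u_ n - u) @[n --> \oo] --> (0 : R) -> (a + b <= s)%N ->
  cvg1 mu (fun n => wderiv a b (u_ n) : R * R -> R) (wderiv a b u).
Proof.
move=> su_ su h ab; apply: cvg1_L1.
apply: (squeeze_cvgr _ (cvg_cst 0) h); apply: nearW => n.
rewrite normr_ge0 /= -(wderivB (su_ n) su ab).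
exact: sobolev_norm_ge.
Qed.

End sobolev_facts.

(** * Convergence of the wavelet energies *)

Section energy_convergence.
Variable R : realType.
Local Notation mR := (measurableTypeR R).
Local Notation mu := (lebO R).
Local Notation lam := (@lebesgue_measure R).

Lemma is_kernel_mono (K : R -> R) (M L M' L' : R) : M <= M' -> L <= L' -> is_kernel K M L -> is_kernel K M' L'.
Proof.
move=> MM LL [mK KM KL]; split => //; first by move=> x; exact: le_trans MM.
by move=> x /KL xL; exact: le_trans LL.
Qed.

Lemma is_kernel_join (K1 K2 : R -> R) (M1 L1 M2 L2 : R) : is_kernel K1 M1 L1 -> is_kernel K2 M2 L2 ->
  exists M L, is_kernel K1 M L /\ is_kernel K2 M L.
Proof.
move=> h1 h2; exists (Num.max M1 M2), (Num.max L1 L2).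
by split; [apply: is_kernel_mono h1|apply: is_kernel_mono h2]; rewrite le_max lexx ?orbT.
Qed.

Lemma integrable_step e n (r : seq (int * int)) F : uniq r -> (forall k, k \in r -> inner_cell e n k) ->
  mu.-integrable setT (EFin \o (step e n r F : R * R -> R)).
Proof.
move=> ur ri; apply/(@integrable_nrm1P _ _ _ mu); first exact: measurable_step.
rewrite /nrm1; under eq_integral do rewrite norm_step.
by rewrite ge0_integral_step// ltry.
Qed.

Lemma nrm1_le_norm (f g : R * R -> R) : measurable_fun setT (f : mR * mR -> R) ->
  measurable_fun setT (g : mR * mR -> R) -> {ae mu, forall x, `|f x| <= `|g x|} ->
  (nrm1 mu f <= nrm1 mu g)%E.
Proof.
move=> mf mg fg; apply: ae_ge0_le_integral => //; [exact: measurable_normE|exact: measurable_normE|].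
by apply: (ae_lebO_and fg fg) => x + _ _; rewrite lee_fin.
Qed.

Lemma cvg1_norm (f_ : nat -> R * R -> R) f : (forall n, measurable_fun setT (f_ n : mR * mR -> R)) ->
  measurable_fun setT (f : mR * mR -> R) -> cvg1 mu f_ f ->
  cvg1 mu (fun n x => `|f_ n x|) (fun x => `|f x|).
Proof.
move=> mf_ mf cf; apply: (cvg1_squeeze _ cf); apply: nearW => n.
apply: nrm1_le_norm.
- by apply: measurable_funB; exact: measurableT_comp.
- exact: measurable_funB.
- by apply: aeW => x; exact: ler_dist_dist.
Qed.

Lemma cvg1_sum0 (I : Type) (r : seq I) (h_ : I -> nat -> R * R -> R) :
  (forall i n, measurable_fun setT (h_ i n : mR * mR -> R)) ->
  (forall i, cvg1 mu (h_ i) (fun=> 0)) ->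
  cvg1 mu (fun n x => \sum_(i <- r) h_ i n x) (fun=> 0).
Proof.
move=> mh ch; elim: r => [|i r IH].
  rewrite (_ : (fun n => _) = (fun=> (fun=> 0))); first exact: cvg1_cst.
  by apply/funext => n; apply/funext => x; rewrite big_nil.
rewrite (_ : (fun n => _) = (fun n x => h_ i n x + \sum_(j <- r) h_ j n x)); last first.
  by apply/funext => n; apply/funext => x; rewrite big_cons.
rewrite (_ : (fun _ => _) = (fun _ : R * R => 0 + 0 : R)); last by rewrite addr0.
apply: cvg1D => //; by move=> n; exact: measurable_sum.
Qed.

(** The Euclidean norm is Lipschitz for the sum of absolute differences; by induction the list
    reduces to the planar inequality [tri]. *)
Lemma sqrt_sumsq_lip (I : Type) (r : seq I) (x y : I -> R) :
  Num.sqrt (\sum_(i <- r) x i ^+ 2) <= Num.sqrt (\sum_(i <- r) y i ^+ 2) + \sum_(i <- r) `|x i - y i|.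
Proof.
have S0 (z : I -> R) (s : seq I) : 0 <= \sum_(i <- s) z i ^+ 2 by apply: sumr_ge0 => i _; exact: sqr_ge0.
have D0 (s : seq I) : 0 <= \sum_(i <- s) `|x i - y i| by exact: sumr_ge0.
elim: r => [|i r IH]; first by rewrite !big_nil sqrtr0 addr0.
rewrite !big_cons; set X := \sum_(j <- r) _ in IH *; set Y := \sum_(j <- r) y j ^+ 2 in IH *.
set D := \sum_(j <- r) `|_| in IH *.
have X0 : 0 <= X by exact: S0.
have Y0 : 0 <= Y by exact: S0.
have tri (a b p d : R) : 0 <= p -> 0 <= d -> Num.sqrt ((a + b) ^+ 2 + (p + d) ^+ 2) <= Num.sqrt (a ^+ 2 + p ^+ 2) + (`|b| + d).
  move=> p0 d0; set q := Num.sqrt (a ^+ 2 + p ^+ 2).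
  have q0 : 0 <= q by exact: sqrtr_ge0.
  have qE : q ^+ 2 = a ^+ 2 + p ^+ 2 by rewrite sqr_sqrtr// addr_ge0// sqr_ge0.
  have aq : `|a| <= q by rewrite -sqrtr_sqr ler_wsqrtr// lerDl sqr_ge0.
  have pq : p <= q by rewrite -(ger0_norm p0) -sqrtr_sqr ler_wsqrtr// lerDr sqr_ge0.
  rewrite -[leRHS]ger0_norm ?addr_ge0// -sqrtr_sqr ler_wsqrtr//.
  have ab : a * b <= q * `|b| by rewrite (le_trans (ler_norm _))// normrM ler_wpM2r.
  have pd : p * d <= q * d by rewrite ler_wpM2r.
  have bd : 0 <= `|b| * d by rewrite mulr_ge0.
  have b2 : b ^+ 2 = `|b| ^+ 2 by rewrite real_normK// num_real.
  have -> : (a + b) ^+ 2 + (p + d) ^+ 2 = (a ^+ 2 + p ^+ 2) + 2 * (a * b) + 2 * (p * d) + (b ^+ 2 + d ^+ 2) by ring.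
  have -> : (q + (`|b| + d)) ^+ 2 = q ^+ 2 + 2 * (q * `|b|) + 2 * (q * d) + (`|b| ^+ 2 + d ^+ 2) + 2 * (`|b| * d) by ring.
  by rewrite qE b2; lra.
have h : Num.sqrt (x i ^+ 2 + X) <= Num.sqrt (x i ^+ 2 + (Num.sqrt Y + D) ^+ 2).
  rewrite ler_wsqrtr// lerD2l -[X in X <= _](sqr_sqrtr X0).
  rewrite lerXn2r//; [rewrite nnegrE; exact: sqrtr_ge0|].
  by rewrite nnegrE addr_ge0//; exact: D0.
apply: (le_trans h).
have := tri (y i) (x i - y i) (Num.sqrt Y) D (sqrtr_ge0 _) (D0 r).
by rewrite [y i + _]addrC subrK sqr_sqrtr.
Qed.

Lemma sqrt_sumsq_dist (I : Type) (r : seq I) (x y : I -> R) :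
  `|Num.sqrt (\sum_(i <- r) x i ^+ 2) - Num.sqrt (\sum_(i <- r) y i ^+ 2)| <= \sum_(i <- r) `|x i - y i|.
Proof.
have h1 := sqrt_sumsq_lip r x y; have h2 := sqrt_sumsq_lip r y x.
have e : \sum_(i <- r) `|y i - x i| = \sum_(i <- r) `|x i - y i| by apply: eq_bigr => i _; exact: distrC.
by rewrite e in h2; rewrite ler_norml; apply/andP; split; lra.
Qed.

(** The averages of [g_ n - g] tend to 0 by the bound of [nrm1_step_avg], uniform in [n]; those of
    the fixed [g] converge by [step_avg_cvg]. *)
Lemma step_avg_cvg_var (K1 K2 : R -> R) (M L e : R) (r_ : nat -> seq (int * int))
    (g_ : nat -> R * R -> R) (g : R * R -> R) :
  is_kernel K1 M L -> is_kernel K2 M L -> (forall n, uniq (r_ n)) ->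
  (forall n k, k \in r_ n -> inner_cell e n k) ->
  (forall x, Omega x -> \forall n \near \oo, cell_index e n x \in r_ n) ->
  (forall n, mu.-integrable setT (EFin \o g_ n)) -> mu.-integrable setT (EFin \o g) ->
  cvg1 mu g_ g ->
  cvg1 mu (fun n => step e n (r_ n) (avg K1 K2 n (g_ n)))
    (fun x => \int[lam]_x K1 x * \int[lam]_x K2 x * g x).
Proof.
move=> k1 k2 ur ri rO g_i gi gg.
have di n : mu.-integrable setT (EFin \o (fun x => g_ n x - g x)).
  by have := integrableB measurableT (g_i n) gi; apply: eq_integrable => // x _; rewrite /= EFinB.
have -> : (fun n => step e n (r_ n) (avg K1 K2 n (g_ n))) =
  (fun n x => step e n (r_ n) (avg K1 K2 n (fun x => g_ n x - g x)) x + step e n (r_ n) (avg K1 K2 n g) x).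
  apply/funext => n; apply/funext => x; rewrite /step; case: ifP => _; last by rewrite addr0.
  rewrite -(avgD k1 k2)//; congr (avg K1 K2 n _ _).
  by apply/funext => y; rewrite subrK.
rewrite (_ : (fun x => _ * g x) = (fun x => 0 + \int[lam]_x K1 x * \int[lam]_x K2 x * g x)); last first.
  by apply/funext => x; rewrite add0r.
have mg := integrable_mfun gi.
apply: cvg1D => //.
- by move=> n; exact: measurable_step.
- by move=> n; exact: measurable_step.
- exact: measurable_funM.
- have C0 := nrm1_step_avg k1 k2 (ur _) (ri _) (di _).
  apply: (cvg1_squeeze (b_ := fun n => (((count_bound L ^ 2)%:R * M ^+ 2)%:E * nrm1 mu (fun x => g_ n x - g x)%R)%E)).
    apply: nearW => n; apply: le_trans (C0 n n).
    by rewrite /nrm1; under eq_integral do rewrite subr0.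
  by rewrite -(mule0 ((count_bound L ^ 2)%:R * M ^+ 2)%:E); apply: cvgeZl.
- exact: (step_avg_cvg k1 k2 ur ri rO gi).
Qed.

End energy_convergence.

Section energy_limit.
Variable R : realType.
Local Notation mR := (measurableTypeR R).
Local Notation mu := (lebO R).
Local Notation lam := (@lebesgue_measure R).
Variables (m : nat) (q : nat -> int -> R) (phi : R -> R).
Variables (c : R) (lo : nat -> int) (P : nat -> {poly R}).
Hypothesis m0 : (0 < m)%N.
Hypothesis hphi : forall x, phi x = cardinal_bspline m.-1 (x - c).
Hypothesis hq : forall l, (l <= m)%N -> [/\ q l =1 zcoef ((1 - 'X) ^+ l * P l) (lo l),
  (P l).[1] != 0 & ((1 - 'X) ^+ l * P l)`_0 != 0].
Local Notation kap := (kap m c lo P).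
Local Notation rK := (rK m q phi).

Lemma exp2E (d n : nat) : (2 : R) ^ (d%:Z * (n%:Z - 1)) = (2 ^+ n) ^+ d * 2^-1 ^+ d.
Proof.
have two0 : (2 : R) != 0 by rewrite pnatr_eq0.
by rewrite mulrC -exprz_exp expfzDr// exprN1 -!exprnP exprMn.
Qed.

Let Wv n (a : midx m) (u : R * R -> R) k := avg (kap a.1 0) (kap a.2 0) n u k.

Let ku n : uniq (rK n). Proof. exact: rK_uniq. Qed.
Let ki n k : k \in rK n -> inner_cell c n k. Proof. exact: (rK_inner m0 hphi). Qed.
Let kn x : Omega x -> \forall n \near \oo, cell_index c n x \in rK n.
Proof. exact: (rK_near m0 hphi hq). Qed.

(** Absolute values remove the sign of the integration by parts, which the energies do not see. *)
Lemma norm_Wv n (a : midx m) (b1 b2 : nat) (u g : R * R -> R) k : k \in rK n ->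
  mu.-integrable setT (EFin \o u) -> mu.-integrable setT (EFin \o g) ->
  is_weak_deriv (@Omega R) b1 b2 u g -> (b1 <= a.1)%N -> (b2 <= a.2)%N ->
  (2 ^+ n) ^+ (b1 + b2) * `|Wv n a u k| = `|avg (kap a.1 b1) (kap a.2 b2) n g k|.
Proof.
move=> /(mem_rK q m0 hphi n k) Kk ui gi ug h1 h2.
have := avg_kap m0 hphi hq Kk ui gi ug h1 h2 => /(congr1 Num.norm).
by rewrite !normrM [`|(-1) ^+ _|]normrX normrN1 expr1n mul1r ger0_norm// !exprn_ge0.
Qed.

Variables (J : {set midx m}) (w : nat -> midx m -> R) (s : nat) (cc : midx m -> R).
Hypothesis JB : J \subset band m.
Hypothesis ccE : forall a, a \in band m -> cc a = 2^-1 ^+ mabs a * ((P a.1).[1] * (P a.2).[1]).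
Hypothesis hw : admissible_weights cc J s w.
Hypothesis Js : forall a, a \in J -> (mabs a <= s)%N.
Variables (u_ : nat -> L1 R) (u : L1 R).
Hypothesis su_ : forall n, sobolev s (u_ n).
Hypothesis su : sobolev s u.
Hypothesis u_u : sobolev_norm s (u_ n - u) @[n --> \oo] --> (0 : R).

Let w0 n a : a \in band m -> 0 <= w n a.
Proof.
move=> aB; have [aJ|aJ] := boolP (a \in J); first by rewrite hw.1// sqr_ge0.
by apply: (hw.2 a _).1; rewrite inE aJ.
Qed.

Let T_ n (a : midx m) k := Num.sqrt (w n a) * `|Wv n a (u_ n) k|.
Let T0 (a : midx m) (x : R * R) : R := if a \in J then `|wderiv a.1 a.2 u x| else 0.

Let mw (a : midx m) (v : L1 R) : measurable_fun setT (wderiv a.1 a.2 v : mR * mR -> R).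
Proof. exact: (integrable_mfun (L1_integrable _)). Qed.

Let mT0 a : measurable_fun setT (T0 a : mR * mR -> R).
Proof. by rewrite /T0; case: (a \in J) => //; exact: measurableT_comp. Qed.

Let step_avg_wderiv (a b : midx m) : (b.1 + b.2 <= s)%N ->
  cvg1 mu (fun n => step c n (rK n) (avg (kap a.1 b.1) (kap a.2 b.2) n (wderiv b.1 b.2 (u_ n))))
    (fun x => (a.1 <= b.1)%N%:R * (P a.1).[1] * ((a.2 <= b.2)%N%:R * (P a.2).[1]) * wderiv b.1 b.2 u x).
Proof.
move=> bs; have [M1 [L1 k1]] := kap_kernel m c lo P a.1 b.1.
have [M2 [L2 k2]] := kap_kernel m c lo P a.2 b.2.
have [M [L [{}k1 {}k2]]] := is_kernel_join k1 k2.
rewrite -(kap_mass m c lo P a.1 b.1) -(kap_mass m c lo P a.2 b.2).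
apply: (step_avg_cvg_var k1 k2 ku ki kn).
- by move=> n; exact: L1_integrable.
- exact: L1_integrable.
- exact: sobolev_cvg1.
Qed.

Let cvgT a : a \in band m -> cvg1 mu (fun n => step c n (rK n) (T_ n a)) (T0 a).
Proof.
move=> aB; have mS n F : measurable_fun setT (step c n (rK n) F : mR * mR -> R) by exact: measurable_step.
have W n (b : midx m) : (b.1 + b.2 <= s)%N -> is_weak_deriv (@Omega R) b.1 b.2 (u_ n) (wderiv b.1 b.2 (u_ n)).
  by move=> bs; exact: wderivP bs.
have [aJ|aJ] := boolP (a \in J).
- have as_ : (a.1 + a.2 <= s)%N := Js aJ.
  have [_ p1 _] := hq (ltn_ord a.1 : (a.1 <= m)%N); have [_ p2 _] := hq (ltn_ord a.2 : (a.2 <= m)%N).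
  set mu_a := (P a.1).[1] * (P a.2).[1].
  have mua : mu_a != 0 by rewrite mulf_neq0.
  have := @step_avg_wderiv a a as_; rewrite !leqnn !mul1r -/mu_a.
  set A_ := (fun n => _) => h.
  have mA n : measurable_fun setT (A_ n : mR * mR -> R) by exact: mS.
  have mwd : measurable_fun setT (fun x => mu_a * wderiv a.1 a.2 u x : R) by apply: measurable_funM => //; exact: mw.
  have {h} h := cvg1_norm mA mwd h.
  have {h} h := cvg1Z `|mu_a^-1| (fun n => measurableT_comp (@normr_measurable R setT) (mA n)) (measurableT_comp (@normr_measurable R setT) mwd) h.
  rewrite /T0 aJ (_ : (fun x => `|_ x|) = (fun x => `|mu_a^-1| * `|mu_a * wderiv a.1 a.2 u x|)); last first.
    by apply/funext => x; rewrite -normrM mulKf.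
  rewrite (_ : (fun n => _) = (fun n x => `|mu_a^-1| * `|A_ n x|))//.
  apply/funext => n; apply/funext => x; rewrite /A_ /step; case: ifP => [xr|_]; last by rewrite normr0 mulr0.
  rewrite -(norm_Wv xr (L1_integrable _) (L1_integrable _) (W n a as_) (leqnn _) (leqnn _)).
  (* The power of [2^-1] in [cc a] cancels the one in the weight; there remains [(2 ^+ n) ^+ mabs a]
     divided by the mass [mu_a] of the kernel. *)
  rewrite /T_ hw.1// sqrtr_sqr ccE// -/mu_a mulrA; congr (_ * _).
  rewrite exp2E -/(mabs a); set N := 2 ^+ n ^+ mabs a; set H := 2^-1 ^+ mabs a.
  have H0 : H != 0 by rewrite expf_neq0// invr_eq0 pnatr_eq0.
  have -> : (H * mu_a)^-1 * (N * H) = mu_a^-1 * N by field; rewrite H0 mua.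
  by rewrite normrM [`|N|]ger0_norm// !exprn_ge0.
(* Integration by parts is carried only to the [b < a] of (A2): the gain [(2 ^+ n) ^+ mabs b]
   absorbs the weight, and the limit is 0 because this kernel has mass 0. *)
- have aBJ : a \in (band m :\: J)%SET by rewrite inE aJ.
  have [_ [b [ba bs /eqO_exP[k k0 hk]]]] := hw.2 a aBJ.
  have [ba1 ba2 bna] := and3P ba.
  rewrite /T0 (negbTE aJ).
  have := @step_avg_wderiv a b bs.
  have -> : (fun x => (a.1 <= b.1)%N%:R * (P a.1).[1] * ((a.2 <= b.2)%N%:R * (P a.2).[1]) * wderiv b.1 b.2 u x) = fun=> 0.
    apply/funext => x; case: (leqP a.1 b.1) => [h1|_]; last by rewrite !mul0r.
    case: (leqP a.2 b.2) => [h2|_]; last by rewrite !mul0r mulr0 mul0r.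
    case/negP: bna; rewrite -pair_eqE /pair_eq -!val_eqE /=.
    by rewrite !eqn_leq ba1 ba2 h1 h2.
  set A_ := (fun n => _) => h.
  have mA n : measurable_fun setT (A_ n : mR * mR -> R) by exact: mS.
  apply: (cvg1_squeeze (b_ := fun n => (`|Num.sqrt k|%:E * nrm1 mu (fun x => A_ n x - 0)%R)%E)); last first.
    by rewrite -(mule0 `|Num.sqrt k|%:E); apply: cvgeZl.
  apply: filterS hk => n hk.
  have m1 : measurable_fun setT (fun x => A_ n x - 0 : R) by apply: measurable_funB; [exact: mA|exact: measurable_cst].
  rewrite -nrm1Z//; apply: nrm1_le_norm.
  + by apply: measurable_funB => //; exact: mS.
  + exact: measurable_funM.
  apply: aeW => x; rewrite !subr0 /A_ /step; case: ifP => [xr|_]; last by rewrite mulr0.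
  rewrite [leRHS]normrM -(norm_Wv xr (L1_integrable _) (L1_integrable _) (W n b bs) ba1 ba2).
  rewrite mulrA /T_ normrM normr_id ler_wpM2r// !ger0_norm ?sqrtr_ge0//.
  rewrite -[X in _ * X]ger0_norm ?exprn_ge0// -sqrtr_sqr -sqrtrM ?(ltW k0)// ler_wsqrtr//.
  have := hk; rewrite /= ger0_norm ?w0//; move/le_trans; apply.
  rewrite ler_wpM2l ?(ltW k0)// exp2E -/(mabs b) mulnC exprM normrM ger0_norm ?sqr_ge0 ?exprn_ge0//.
  rewrite ler_piMr ?sqr_ge0// ger0_norm ?exprn_ge0// exprn_ile1// invf_le1 ?ler1n//.
Qed.

Variables (V : nat -> int * int -> R) (v : R * R -> R).
Hypothesis V01 : forall n k, k \in rK n -> 0 <= V n k <= 1.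
Hypothesis mv : measurable_fun setT (v : mR * mR -> R).
Hypothesis v01 : {ae mu, forall x, `|v x| <= 1}.
Hypothesis Vv : cvg1 mu (fun n => step c n (rK n) (V n)) v.

Let F n k := Num.sqrt (\sum_(a in band m) w n a * `|Wv n a (u_ n) k| ^+ 2).

Let FE n k : F n k = Num.sqrt (\sum_(a <- enum (band m)) T_ n a k ^+ 2).
Proof.
rewrite /F -big_enum; congr Num.sqrt; rewrite big_seq [RHS]big_seq; apply: eq_bigr => a.
by rewrite mem_enum => aB; rewrite /T_ exprMn sqr_sqrtr ?w0.
Qed.

Let pnE x : pointwise_norm J u x = Num.sqrt (\sum_(a <- enum (band m)) T0 a x ^+ 2).
Proof.
rewrite /pointwise_norm big_enum; congr Num.sqrt.
rewrite big_mkcond [RHS]big_mkcond; apply: eq_bigr => a _; rewrite /T0.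
case: (boolP (a \in J)) => [aJ|_]; first by rewrite (fintype.subsetP JB).
by rewrite expr0n if_same.
Qed.

Let mF n : measurable_fun setT (step c n (rK n) (F n) : mR * mR -> R).
Proof. exact: measurable_step. Qed.

Let mpn : measurable_fun setT (pointwise_norm J u : mR * mR -> R).
Proof.
rewrite (_ : pointwise_norm J u = fun x => Num.sqrt (\sum_(a <- enum (band m)) T0 a x ^+ 2)); last exact/funext.
have ms : measurable_fun setT (Num.sqrt : mR -> R).
  by apply: continuous_measurable_fun; exact: sqrt_continuous.
apply: (measurableT_comp ms); apply: measurable_sum => a.
exact: measurable_funX.
Qed.

(** By [sqrt_sumsq_dist] the Euclidean norm of the coefficients reduces to the finitely many scalar
    convergences [cvgT]. *)
Let cvgF : cvg1 mu (fun n => step c n (rK n) (F n)) (pointwise_norm J u).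
Proof.
pose D (a : midx m) n x := if a \in band m then `|step c n (rK n) (T_ n a) x - T0 a x| else 0 : R.
have mD a n : measurable_fun setT (D a n : mR * mR -> R).
  rewrite /D; case: (a \in band m) => //; apply: measurableT_comp => //.
  by apply: measurable_funB => //; exact: measurable_step.
have D0 a : cvg1 mu (D a) (fun=> 0).
  rewrite /D; case: (boolP (a \in band m)) => [aB|_]; last exact: cvg1_cst.
  have := cvgT aB; rewrite /cvg1 /nrm1.
  by under [X in _ -> X @ _ --> _]eq_fun do under eq_integral do rewrite subr0 normr_id.
apply: (cvg1_squeeze _ (cvg1_sum0 (enum (band m)) mD D0)); apply: nearW => n.
apply: nrm1_le_norm.
- exact: measurable_funB.
- by apply: measurable_funB => //; exact: measurable_sum.
- apply: aeW => x; rewrite subr0 pnE.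
  have -> : step c n (rK n) (F n) x = Num.sqrt (\sum_(a <- enum (band m)) step c n (rK n) (T_ n a) x ^+ 2).
    rewrite /step; case: ifP => _; first exact: FE.
    by rewrite big1 ?sqrtr0// => a _; rewrite expr0n.
  apply: (le_trans (sqrt_sumsq_dist _ _ _)); apply: (le_trans _ (ler_norm _)).
  rewrite big_seq [leRHS]big_seq; apply: ler_sum => a.
  by rewrite mem_enum /D => ->.
Qed.

Let integrable_pn : mu.-integrable setT (EFin \o pointwise_norm J u).
Proof.
apply: (cvg1_integrable_limit mpn _ cvgF) => n.
exact: (integrable_step _ (ku n) (@ki n)).
Qed.

(** Arbitrary weights [V] in [[0, 1]] cover the three regularizing terms at once: [1 - T_n v],
    [T_n v] and the constant 1. *)
Lemma wavelet_energy_cvg :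
  ((2 ^- n) ^+ 2 * \sum_(k <- rK n) V n k * Num.sqrt (\sum_(a in band m) w n a * `|Wv n a (u_ n) k| ^+ 2))%:E
   @[n --> \oo] --> (\int[mu]_x (v x * pointwise_norm J u x)%:E)%E.
Proof.
have c1 : cvg1 mu (fun n x => step c n (rK n) (V n) x * step c n (rK n) (F n) x) (fun x => v x * pointwise_norm J u x).
  apply: cvg1M => //.
  - by move=> n; exact: measurable_step.
  - move=> n x; rewrite /step; case: ifP => [/V01/andP[h1 h2]|_]; last by rewrite normr0.
    by rewrite ger0_norm.
have e1 : (fun n x => step c n (rK n) (V n) x * step c n (rK n) (F n) x) =
    (fun n => step c n (rK n) (fun k => V n k * F n k)).
  by apply/funext => n; apply/funext => x; rewrite /step; case: ifP => // _; rewrite mulr0.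
rewrite e1 in c1.
have iV n : mu.-integrable setT (EFin \o (step c n (rK n) (fun k => V n k * F n k) : R * R -> R)).
  exact: (integrable_step _ (ku n) (@ki n)).
have mvp : measurable_fun setT ((fun x => v x * pointwise_norm J u x) : mR * mR -> R) by exact: measurable_funM.
have := cvg1_integral iV (cvg1_integrable_limit mvp iV c1) c1.
rewrite (_ : (fun n => _) = (fun n => ((2 ^- n) ^+ 2 * \sum_(k <- rK n) V n k * F n k)%:E))//.
apply/funext => n; rewrite (ge0_integral_step (ku n) (@ki n))//.
by move=> k /V01/andP[h1 _]; rewrite mulr_ge0//; exact: sqrtr_ge0.
Qed.

End energy_limit.

(** * The embedding in L_2 *)

Section sobolev_embedding.
Variable R : realType.
Local Notation mR := (measurableTypeR R).
Local Notation mu := (lebO R).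
Local Notation lam := (@lebesgue_measure R).

Definition int2 (f : R * R -> R) : \bar R := (\int[mu]_x (f x ^+ 2)%:E)%E.

Lemma int2E f : int2 f = (\int[mu]_x (`|(EFin \o f) x| `^ 2))%E.
Proof.
by apply: eq_integral => x _; rewrite /= -[2]/(2%:R) powR_mulrn// real_normK// num_real.
Qed.

Lemma int2_Lfun (f : R * R -> R) : measurable_fun setT (f : mR * mR -> R) ->
  (f \in Lfun mu 2%:E) = (int2 f < +oo)%E.
Proof.
move=> mf; rewrite int2E -poweR_Lnorm//; apply/idP/idP.
  by rewrite inE => /andP[_]; rewrite inE/= => h; exact: poweR_lty.
move=> h; rewrite inE; apply/andP; split; first by rewrite inE.
rewrite inE/= /finite_norm; apply: contraTT h; rewrite -!leNgt !leye_eq => /eqP ->.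
by rewrite poweRyr.
Qed.

Lemma L2_measurable (w : L2 R) : measurable_fun setT (w : mR * mR -> R).
Proof. by have := LfunP (Lp_repr w) => /sub_Lfun_mfun/set_mem. Qed.

Lemma L2_int2_fin (w : L2 R) : (int2 w < +oo)%E.
Proof. by rewrite -int2_Lfun; [exact: LfunP|exact: L2_measurable]. Qed.

Lemma L2_norm (w : L2 R) : ((`|w| ^+ 2)%:E = int2 w)%E.
Proof.
rewrite int2E -poweR_Lnorm// /Num.norm/= /Lp_norm -[2%N in LHS]/(2%N).
have fN : ('N[mu]_2%:E[EFin \o Lp_fun w])%E \is a fin_num.
  rewrite ge0_fin_numE ?Lnorm_ge0//.
  by have := LfunP (Lp_repr w); rewrite inE => /andP[_]; rewrite inE.
rewrite -{2}(fineK fN) poweR_EFin -[2 in RHS]/(2%:R) powR_mulrn//.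
by rewrite fine_ge0// Lnorm_ge0.
Qed.

Lemma ae_int2 (f g : R * R -> R) : measurable_fun setT (f : mR * mR -> R) ->
  measurable_fun setT (g : mR * mR -> R) -> {ae mu, forall x, f x = g x} -> int2 f = int2 g.
Proof.
move=> mf mg fg; apply: ae_eq_integral => //.
- by apply/measurable_EFinP; exact: measurable_funX.
- by apply/measurable_EFinP; exact: measurable_funX.
- by apply: (ae_lebO_and fg fg) => x -> _ _.
Qed.

(* Discrete Gagliardo-Nirenberg in one direction: a value is at most the mean
   over its line plus the total variation along the line. *)
Lemma line_bound (N : nat) (h : R) (U D : nat -> R) : (0 < N)%N -> h = N%:R^-1 ->
  (forall i, (i.+1 < N)%N -> `|U i.+1 - U i| <= h * D i) -> (forall i, 0 <= D i) ->
  forall i, (i < N)%N -> `|U i| <= h * (\sum_(l < N) `|U l|) + h * (\sum_(l < N) D l).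
Proof.
move=> N0 hE hU D0 i iN; have h0 : 0 <= h by rewrite hE invr_ge0.
set S := \sum_(l < N) D l.
have path a b : (a + b < N)%N -> `|U (a + b)%N - U a| <= h * \sum_(a <= l < a + b) D l.
  elim: b => [|b IH] abN; first by rewrite addn0 subrr normr0 big_geq// mulr0.
  rewrite addnS big_nat_recr ?leq_addr//= mulrDr.
  have -> : U (a + b).+1 - U a = (U (a + b)%N - U a) + (U (a + b).+1 - U (a + b)%N) by rewrite [RHS]addrC subrKA.
  rewrite addnS in abN; rewrite (le_trans (ler_normD _ _))// lerD ?IH ?hU// ltnW//.
have part a b : (a + b <= N)%N -> \sum_(a <= l < a + b) D l <= S.
  move=> abN; rewrite /S -(big_mkord xpredT D).
  rewrite (@big_cat_nat _ _ _ a 0 N)//=; last by rewrite (leq_trans _ abN)// leq_addr.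
  rewrite (@big_cat_nat _ _ _ (a + b)%N a N)//=; last by rewrite leq_addr.
  by rewrite addrCA lerDl addr_ge0// sumr_ge0.
have dist a : (a < N)%N -> `|U i - U a| <= h * S.
  move=> aN; have [ai|ia] := leqP a i.
    have e : (a + (i - a))%N = i by rewrite subnKC.
    rewrite -{1}e (le_trans (path _ _ _)) ?e// ler_wpM2l// -{1}e part// e ltnW//.
  have e : (i + (a - i))%N = a by rewrite subnKC// ltnW.
  rewrite distrC -{1}e (le_trans (path _ _ _)) ?e// ler_wpM2l// -{1}e part// e ltnW//.
have Ni : N%:R * `|U i| <= \sum_(l < N) `|U l| + N%:R * (h * S).
  have -> : N%:R * `|U i| = \sum_(l < N) `|U i| by rewrite sumr_const card_ord mulr_natl.
  have -> : N%:R * (h * S) = \sum_(l < N) (h * S) by rewrite sumr_const card_ord mulr_natl.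
  rewrite -big_split; apply: ler_sum => l _ /=.
  by rewrite -lerBlDl (le_trans (lerB_dist _ _))// dist.
have NE : N%:R != 0 :> R by rewrite pnatr_eq0 -lt0n.
have e1 : `|U i| = h * (N%:R * `|U i|) by rewrite mulrA hE mulVf ?mul1r.
have e2 : h * S = h * (N%:R * (h * S)) by rewrite mulrA hE mulVf ?mul1r.
by rewrite e1 e2 -mulrDr ler_wpM2l.
Qed.

Let B0 : R -> R := cardinal_bspline 0.
Let B1 : R -> R := cardinal_bspline 1.

Lemma bspline_kernel l (L : R) : l.+1%:R <= L -> is_kernel (cardinal_bspline l : R -> R) 1 L.
Proof.
move=> lL; split; first exact: (cardinal_bspline_in01 R l).1.
- by move=> x; have /andP[h1 h2] := (cardinal_bspline_in01 R l).2 x; rewrite ger0_norm.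
- by move=> x /cardinal_bspline_supp/andP[h1 h2]; rewrite ger0_norm// (le_trans h2).
Qed.

Let k0 : is_kernel B0 1 2. Proof. by apply: bspline_kernel; rewrite ler_nat. Qed.
Let k1 : is_kernel B1 1 2. Proof. exact: bspline_kernel. Qed.

Lemma comb1 (g : R -> R) z : comb 1 g z = g z.
Proof. by rewrite /comb size_poly1 big_ord1 coef1 mul1r subr0. Qed.

Lemma comb_nabla1 (g : R -> R) z : comb ((1 - 'X) ^+ 1 * 1) g z = g z - g (z - 1).
Proof. by rewrite expr1 comb_nabla comb1. Qed.

(** Instance of [weak_deriv_spline] with [P1 = P2 = 1]: the difference of two neighbouring cell
    averages of [u] is [h] times an average of its derivative against a hat function. *)
Lemma avg_diff1 n (u g : R * R -> R) (i j : nat) : mu.-integrable setT (EFin \o u) ->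
  mu.-integrable setT (EFin \o g) -> is_weak_deriv (@Omega R) 1 0 u g ->
  (i.+1 < 2 ^ n)%N -> (j < 2 ^ n)%N ->
  avg B0 B0 n u (i.+1%:Z, j%:Z) - avg B0 B0 n u (i%:Z, j%:Z) = 2 ^- n * avg B1 B0 n g (i%:Z, j%:Z).
Proof.
move=> ui gi ug iN jN; have [H HH] := exists_smooth_step R.
have N1 : 1 <= (2 ^+ n : R) by rewrite exprn_ege1// ler1n.
have p0 : 0 < (2 ^+ n : R) by rewrite exprn_gt0.
have c1 : i%:R + (0 + 1 + size (1%R : {poly R}))%:R <= 2 ^+ n :> R.
  by rewrite size_poly1 -natrD -natrX ler_nat; move: (2 ^ n)%N iN; lia.
have c2 : j%:R + (0 + 0 + size (1%R : {poly R}))%:R <= 2 ^+ n :> R.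
  by rewrite size_poly1 -natrD -natrX ler_nat; move: (2 ^ n)%N jN; lia.
have s1 : (0 < size (1%R : {poly R}))%N by rewrite size_poly1.
have := @weak_deriv_spline _ H HH u g 1 0 0 0 1 1 (2 ^+ n) i%:R j%:R ui gi ug N1 (ler0n _ _) c1 s1 (ler0n _ _) c2 s1.
set X := \int[mu]_x _; set G := \int[mu]_x _; rewrite ?add0n ?addn0 [_ ^+ 1]expr1 [(-1) ^+ 1]expr1 mulN1r => h.
have GE : \int[mu]_x (g x * ker_nk B1 B0 n (i%:Z, j%:Z) x) = G.
  by apply: eq_Rintegral => x _; rewrite /ker_nk /tensor /spline !comb1.
have XE : X = \int[mu]_x (u x * ker_nk B0 B0 n (i%:Z, j%:Z) x) - \int[mu]_x (u x * ker_nk B0 B0 n (i.+1%:Z, j%:Z) x).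
  rewrite -RintegralB//; try exact: (integrable_mulker k0 k0).
  apply: eq_Rintegral => x _; rewrite -mulrBr; congr (_ * _).
  rewrite /ker_nk /tensor /spline comb_nabla1 expr0 mul1r comb1 /= -/B0.
  have e : (i.+1%:Z)%:~R = i%:R + 1 :> R by rewrite natr1.
  by rewrite mulrBl e opprD addrA.
rewrite /avg -mulrBr GE.
have -> : \int[mu]_x (u x * ker_nk B0 B0 n (i.+1%:Z, j%:Z) x) - \int[mu]_x (u x * ker_nk B0 B0 n (i%:Z, j%:Z) x) = - X.
  by rewrite XE opprB.
have -> : G = - (2 ^+ n * X) by rewrite h opprK.
by move: (2 ^+ n) (gt_eqF p0) => p p1; field; rewrite p1.
Qed.

Lemma avg_diff2 n (u g : R * R -> R) (i j : nat) : mu.-integrable setT (EFin \o u) ->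
  mu.-integrable setT (EFin \o g) -> is_weak_deriv (@Omega R) 0 1 u g ->
  (i < 2 ^ n)%N -> (j.+1 < 2 ^ n)%N ->
  avg B0 B0 n u (i%:Z, j.+1%:Z) - avg B0 B0 n u (i%:Z, j%:Z) = 2 ^- n * avg B0 B1 n g (i%:Z, j%:Z).
Proof.
move=> ui gi ug iN jN; have [H HH] := exists_smooth_step R.
have N1 : 1 <= (2 ^+ n : R) by rewrite exprn_ege1// ler1n.
have p0 : 0 < (2 ^+ n : R) by rewrite exprn_gt0.
have c1 : i%:R + (0 + 0 + size (1%R : {poly R}))%:R <= 2 ^+ n :> R.
  by rewrite size_poly1 -natrD -natrX ler_nat; move: (2 ^ n)%N iN; lia.
have c2 : j%:R + (0 + 1 + size (1%R : {poly R}))%:R <= 2 ^+ n :> R.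
  by rewrite size_poly1 -natrD -natrX ler_nat; move: (2 ^ n)%N jN; lia.
have s1 : (0 < size (1%R : {poly R}))%N by rewrite size_poly1.
have := @weak_deriv_spline _ H HH u g 0 1 0 0 1 1 (2 ^+ n) i%:R j%:R ui gi ug N1 (ler0n _ _) c1 s1 (ler0n _ _) c2 s1.
set X := \int[mu]_x _; set G := \int[mu]_x _; rewrite ?add0n ?addn0 [_ ^+ 1]expr1 [(-1) ^+ 1]expr1 mulN1r => h.
have GE : \int[mu]_x (g x * ker_nk B0 B1 n (i%:Z, j%:Z) x) = G.
  by apply: eq_Rintegral => x _; rewrite /ker_nk /tensor /spline !comb1.
have XE : X = \int[mu]_x (u x * ker_nk B0 B0 n (i%:Z, j%:Z) x) - \int[mu]_x (u x * ker_nk B0 B0 n (i%:Z, j.+1%:Z) x).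
  rewrite -RintegralB//; try exact: (integrable_mulker k0 k0).
  apply: eq_Rintegral => x _; rewrite -mulrBr; congr (_ * _).
  rewrite /ker_nk /tensor /spline comb_nabla1 expr0 mul1r comb1 /= -/B0.
  have e : (j.+1%:Z)%:~R = j%:R + 1 :> R by rewrite natr1.
  by rewrite mulrBr e opprD addrA.
rewrite /avg -mulrBr GE.
have -> : \int[mu]_x (u x * ker_nk B0 B0 n (i%:Z, j.+1%:Z) x) - \int[mu]_x (u x * ker_nk B0 B0 n (i%:Z, j%:Z) x) = - X.
  by rewrite XE opprB.
have -> : G = - (2 ^+ n * X) by rewrite h opprK.
by move: (2 ^+ n) (gt_eqF p0) => p p1; field; rewrite p1.
Qed.


Let C : R := (count_bound (2 : R) ^ 2)%:R * 1 ^+ 2.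

Let C0 : 0 <= C. Proof. by rewrite mulr_ge0// expr1n. Qed.

Lemma sq_grid_sum n (F : int * int -> R) :
  \sum_(k <- sq_grid 0 n) F k = \sum_(i < 2 ^ n) \sum_(j < 2 ^ n) F (i%:Z, j%:Z).
Proof.
rewrite /sq_grid subn0 big_allpairs_dep -(big_mkord xpredT (fun i : nat => \sum_(j < 2 ^ n) F (i%:Z, j%:Z))).
rewrite /index_iota subn0; apply: eq_bigr => i _.
by rewrite -(big_mkord xpredT (fun j : nat => F (i%:Z, j%:Z))) /index_iota subn0.
Qed.

Lemma sum_avg_le (K1 K2 : R -> R) n (g : L1 R) : is_kernel K1 1 2 -> is_kernel K2 1 2 ->
  (2 ^- n) ^+ 2 * (\sum_(i < 2 ^ n) \sum_(j < 2 ^ n) `|avg K1 K2 n g (i%:Z, j%:Z)|) <= C * `|g|.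
Proof.
move=> h1 h2; rewrite -(sq_grid_sum n (fun k => `|avg K1 K2 n g k|)).
rewrite -lee_fin -(ge0_integral_step (sq_grid_uniq 0 n) (@sq_grid_inner R 0 n))//.
rewrite EFinM L1_norm.
have := nrm1_step_avg h1 h2 (sq_grid_uniq 0 n) (@sq_grid_inner R 0 n) (L1_integrable g).
by rewrite /nrm1; under eq_integral do rewrite norm_step.
Qed.

(** The Gagliardo-Nirenberg device in dimension 2: a cell average is bounded by a quantity depending
    on its row only and by one depending on its column only, so the sum of squares factors into two
    L_1 bounds. *)
Lemma haar_int2 n (u g10 g01 : L1 R) : is_weak_deriv (@Omega R) 1 0 u g10 ->
  is_weak_deriv (@Omega R) 0 1 u g01 ->
  (int2 (step 0 n (sq_grid 0 n) (avg B0 B0 n u)) <=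
   (C ^+ 2 * ((`|u| + `|g10|) * (`|u| + `|g01|)))%:E)%E.
Proof.
move=> w10 w01.
have -> : int2 (step 0 n (sq_grid 0 n) (avg B0 B0 n u)) =
    (\int[mu]_x (step 0 n (sq_grid 0 n) (fun k => avg B0 B0 n u k ^+ 2) x)%:E)%E.
  by apply: eq_integral => x _; rewrite /step; case: ifP => // _; rewrite expr0n.
rewrite (ge0_integral_step (sq_grid_uniq 0 n) (@sq_grid_inner R 0 n)); last by move=> k _; exact: sqr_ge0.
rewrite lee_fin sq_grid_sum.
pose U (i j : nat) := avg B0 B0 n u (i%:Z, j%:Z).
pose D1 (i j : nat) := `|avg B1 B0 n g10 (i%:Z, j%:Z)|.
pose D2 (i j : nat) := `|avg B0 B1 n g01 (i%:Z, j%:Z)|.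
pose h : R := 2 ^- n.
have h0 : 0 <= h by rewrite invr_ge0 exprn_ge0.
have hE : h = (2 ^ n)%N%:R^-1 by rewrite natrX.
have N0 : (0 < 2 ^ n)%N by rewrite expn_gt0.
pose A j := h * (\sum_(l < 2 ^ n) `|U l j|) + h * (\sum_(l < 2 ^ n) D1 l j).
pose B i := h * (\sum_(l < 2 ^ n) `|U i l|) + h * (\sum_(l < 2 ^ n) D2 i l).
have UA (i j : 'I_(2 ^ n)) : `|U i j| <= A j.
  apply: (@line_bound _ h (fun i => U i j) (fun i => D1 i j)) => //.
  by move=> i' i'N; rewrite /U (avg_diff1 (L1_integrable u) (L1_integrable g10) w10)// normrM ger0_norm.
  by move=> l; exact: normr_ge0.
have UB (i j : 'I_(2 ^ n)) : `|U i j| <= B i.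
  apply: (@line_bound _ h (fun j => U i j) (fun j => D2 i j)) => //.
  by move=> i' i'N; rewrite /U (avg_diff2 (L1_integrable u) (L1_integrable g01) w01)// normrM ger0_norm.
  by move=> l; exact: normr_ge0.
(* One factor of the square is bounded by [A j], the other by [B i], and the double sum splits. *)
have S1 : \sum_(i < 2 ^ n) \sum_(j < 2 ^ n) U i j ^+ 2 <= (\sum_(j < 2 ^ n) A j) * (\sum_(i < 2 ^ n) B i).
  rewrite mulrC big_distrlr; apply: ler_sum => i _; apply: ler_sum => j _ /=.
  by rewrite -real_normK ?num_real// expr2 ler_pM.
have sA : h * (\sum_(j < 2 ^ n) A j) <= C * (`|u| + `|g10|).
  rewrite /A big_split /= -!mulr_sumr -mulrDr mulrA -expr2 mulrDr mulrDr.
  by rewrite lerD// exchange_big sum_avg_le.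
have sB : h * (\sum_(j < 2 ^ n) B j) <= C * (`|u| + `|g01|).
  rewrite /B big_split /= -!mulr_sumr -mulrDr mulrA -expr2 mulrDr mulrDr.
  by rewrite lerD// sum_avg_le.
apply: (@le_trans _ _ ((h * \sum_(j < 2 ^ n) A j) * (h * \sum_(i < 2 ^ n) B i))).
  by rewrite mulrACA -expr2 ler_wpM2l ?sqr_ge0.
have A0 : 0 <= \sum_(j < 2 ^ n) A j by apply: sumr_ge0 => j _; exact: le_trans (normr_ge0 _) (UA j j).
have B0' : 0 <= \sum_(j < 2 ^ n) B j by apply: sumr_ge0 => j _; exact: le_trans (normr_ge0 _) (UB j j).
rewrite (_ : C ^+ 2 * _ = (C * (`|u| + `|g10|)) * (C * (`|u| + `|g01|))); last by ring.
by rewrite ler_pM// mulr_ge0.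
Qed.

Definition trunc2 (M t : R) : R := Num.min `|t| M ^+ 2.

Lemma trunc2_lip M s t : 0 <= M -> `|trunc2 M s - trunc2 M t| <= 2 * M * `|s - t|.
Proof.
move=> M0; rewrite /trunc2 subr_sqr normrM mulrC.
have b (z : R) : 0 <= Num.min `|z| M <= M by rewrite le_min normr_ge0 M0 ge_min lexx orbT.
have /andP[s0 sM] := b s; have /andP[t0 tM] := b t.
apply: ler_pM => //.
  by rewrite ger0_norm ?addr_ge0// mulr_natl mulr2n lerD.
apply: (le_trans _ (ler_dist_dist s t)); rewrite /Num.min.
by case: ltP => h1; case: ltP => h2; rewrite ?subrr ?normr0//;
  rewrite !ler_norml; apply/andP; split; have := ler_norm (`|s| - `|t|); have := ler_norm (- (`|s| - `|t|)); rewrite normrN; lra.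
Qed.

Lemma trunc2_bound M t : 0 <= M -> 0 <= trunc2 M t <= M ^+ 2.
Proof.
move=> M0; rewrite sqr_ge0 /trunc2 lerXn2r ?nnegrE// ?ge_min ?lexx ?orbT//.
by rewrite le_min normr_ge0 M0.
Qed.

Lemma trunc2_le M t : trunc2 M t <= t ^+ 2 \/ M < 0.
Proof.
have [M0|] := leP 0 M; [left|by right].
rewrite /trunc2 -[leRHS]real_normK ?num_real// lerXn2r ?nnegrE// ?ge_min ?lexx//.
by rewrite le_min normr_ge0 M0.
Qed.

Lemma measurable_trunc2 M (f : R * R -> R) : measurable_fun setT (f : mR * mR -> R) ->
  measurable_fun setT (fun x => trunc2 M (f x) : R).
Proof.
move=> mf; apply: measurable_funX; apply: measurable_minr => //.
exact: measurableT_comp.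
Qed.

(* Fatou, through the truncations, which are Lipschitz hence L1-continuous. *)
Lemma int2_cvg1_le (f_ : nat -> R * R -> R) (f : R * R -> R) (B : R) :
  (forall n, measurable_fun setT (f_ n : mR * mR -> R)) -> measurable_fun setT (f : mR * mR -> R) ->
  cvg1 mu f_ f -> (forall n, (int2 (f_ n) <= B%:E)%E) -> (int2 f <= B%:E)%E.
Proof.
move=> mf_ mf cf fB.
have it M (g : R * R -> R) : 0 <= M -> measurable_fun setT (g : mR * mR -> R) ->
    mu.-integrable setT (EFin \o (fun x => trunc2 M (g x))).
  move=> M0 mg; apply: measurable_bounded_integrable => //; first exact: lebO_finite.
  - exact: measurable_trunc2.
  exists (M ^+ 2); split; first exact: num_real.
  move=> y y1 x _ /=; rewrite (le_trans _ (ltW y1))//.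
  by have /andP[h1 h2] := trunc2_bound (g x) M0; rewrite ger0_norm.
have tB (M : R) : 0 <= M -> (\int[mu]_x (trunc2 M (f x))%:E <= B%:E)%E.
  move=> M0.
  have ct : cvg1 mu (fun n x => trunc2 M (f_ n x)) (fun x => trunc2 M (f x)).
    apply: (cvg1_squeeze (b_ := fun n => ((2 * M)%:E * nrm1 mu (fun x => f_ n x - f x)%R)%E)); last first.
      by rewrite -(mule0 (2 * M)%:E); apply: cvgeZl.
    apply: nearW => n; rewrite -[(2 * M)%:E]/(2 * M)%:E -{1}(ger0_norm (mulr_ge0 (ler0n R 2) M0)) -nrm1Z; last exact: measurable_funB.
    apply: ge0_le_integral => //.
    - by apply: measurable_normE; apply: measurable_funB; exact: measurable_trunc2.
    - by apply: measurable_normE; apply: measurable_funM => //; exact: measurable_funB.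
    - move=> x _; rewrite lee_fin (le_trans (trunc2_lip _ _ M0))//.
      by rewrite normrM ler_wpM2r// ler_norm.
  have := cvg1_integral (fun n => it M _ M0 (mf_ n)) (it M _ M0 mf) ct.
  move/(cvg_lim (@ereal_hausdorff R)) <-; apply: lime_le.
    apply/cvg_ex; eexists; exact: (cvg1_integral (fun n => it M _ M0 (mf_ n)) (it M _ M0 mf) ct).
  apply: nearW => n; apply: le_trans (fB n); apply: ge0_le_integral => //.
  - by move=> x _; rewrite lee_fin; have /andP[] := trunc2_bound (f_ n x) M0.
  - by apply/measurable_EFinP; exact: measurable_trunc2.
  - by apply/measurable_EFinP; exact: measurable_funX.
  - by move=> x _; rewrite lee_fin; have [|] := trunc2_le M (f_ n x); rewrite // ltNge M0.
have -> : int2 f = (\int[mu]_x limn (fun n : nat => (trunc2 n%:R (f x))%:E))%E.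
  apply: eq_integral => x _; apply/esym/cvg_lim => //.
  apply: cvg_near_cst; exists (Num.truncn `|f x|).+1 => // n /= fn.
  congr EFin; rewrite /trunc2 min_l ?real_normK ?num_real//.
  by apply: ltW; apply: lt_le_trans (truncnS_gt _) _; rewrite ler_nat.
have mt n : measurable_fun setT (fun x => (trunc2 n%:R (f x))%:E : \bar R).
  by apply/measurable_EFinP; exact: measurable_trunc2.
rewrite monotone_convergence//.
- apply: lime_le; last by apply: nearW => n; exact: tB.
  apply: ereal_nondecreasing_is_cvgn => a b ab; apply: ge0_le_integral => //.
  + by move=> x _; rewrite lee_fin sqr_ge0.
  + exact: mt.
  + exact: mt.
  + move=> x _; rewrite lee_fin lerXn2r ?nnegrE ?le_min ?normr_ge0 ?ler0n//.
    by rewrite ge_min lexx /= ge_min ler_nat ab orbT.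
- by move=> n x _; rewrite lee_fin sqr_ge0.
- move=> x _ a b ab; rewrite lee_fin lerXn2r ?nnegrE ?le_min ?normr_ge0 ?ler0n//.
  by rewrite ge_min lexx /= ge_min ler_nat ab orbT.
Qed.

Lemma sobolev_int2 (u g10 g01 : L1 R) : is_weak_deriv (@Omega R) 1 0 u g10 ->
  is_weak_deriv (@Omega R) 0 1 u g01 ->
  (int2 u <= (C ^+ 2 * ((`|u| + `|g10|) * (`|u| + `|g01|)))%:E)%E.
Proof.
move=> w10 w01.
have := step_avg_cvg k0 k0 (sq_grid_uniq 0) (@sq_grid_inner R 0) (@sq_grid_near R 0) (L1_integrable u).
rewrite cardinal_bspline_mass !mul1r; under [X in cvg1 _ _ X]eq_fun do rewrite mul1r.
move=> h; apply: int2_cvg1_le h _.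
- by move=> n; apply: measurable_step; exact: sq_grid_uniq.
- exact: (integrable_mfun (L1_integrable u)).
- by move=> n; exact: haar_int2.
Qed.

(** The first part shows that the default value of [inL2] is never taken on Sobolev functions, the
    second is the continuity of the embedding. *)
Lemma sobolev_Lfun s (u : L1 R) : (0 < s)%N -> sobolev s u ->
  Lp_fun u \in Lfun mu 2%:E /\ `|inL2 u| <= 2 * C * sobolev_norm s u.
Proof.
move=> s0 su; have su10 : (1 + 0 <= s)%N by [].
have su01 : (0 + 1 <= s)%N by [].
have h := sobolev_int2 (wderivP su su10) (wderivP su su01).
have mu_ := integrable_mfun (L1_integrable u).
have uL : Lp_fun u \in Lfun mu 2%:E by rewrite (int2_Lfun mu_) (le_lt_trans h)// ltry.
split => //.
have e : {ae mu, forall x, Lp_fun (inL2 u) x = Lp_fun u x}.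
  have h' := Lp_reprP (insubd (0 : LfunType mu (le1_2E R)) (Lp_fun u)).
  by apply: (ae_lebO_and h' h') => x /(_ I) + _; rewrite val_insubd uL.
have n0 := sobolev_norm_ge0 s u.
have nu : `|u| <= sobolev_norm s u by rewrite -{1}(wderiv00 u) sobolev_norm_ge.
have n1 := sobolev_norm_ge u su10; have n2 := sobolev_norm_ge u su01.
have : `|inL2 u| ^+ 2 <= (2 * C * sobolev_norm s u) ^+ 2.
  rewrite -lee_fin L2_norm (ae_int2 (L2_measurable _) mu_ e) (le_trans h)// lee_fin.
  rewrite (_ : (2 * C * _) ^+ 2 = C ^+ 2 * ((2 * sobolev_norm s u) * (2 * sobolev_norm s u))); last by ring.
  have d2 : 2 * sobolev_norm s u = sobolev_norm s u + sobolev_norm s u by rewrite mulr_natl mulr2n.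
  rewrite d2; apply: ler_wpM2l; first exact: sqr_ge0.
  by apply: ler_pM; [exact: (addr_ge0 (normr_ge0 _) (normr_ge0 _))|exact: (addr_ge0 (normr_ge0 _) (normr_ge0 _))|exact: (lerD nu n1)|exact: (lerD nu n2)].
by rewrite ler_pXn2r ?nnegrE// mulr_ge0// mulr_ge0.
Qed.

End sobolev_embedding.

(** * Uniform boundedness in L_2 *)

Section L2_complete.
Variable R : realType.
Local Notation mR := (measurableTypeR R).
Local Notation mu := (lebO R).

(** Integrates [2 * t * a <= t ^+ 2 + a ^+ 2], with [a] the absolute value of [f], over the square
    of area 1. *)
Lemma nrm1_le_int2 (f : R * R -> R) (t : R) : 0 < t -> measurable_fun setT (f : mR * mR -> R) ->
  (int2 f <= (t ^+ 2)%:E)%E -> (nrm1 mu f <= t%:E)%E.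
Proof.
move=> t0 mf ft; have t20 : 0 < 2 * t by rewrite mulr_gt0.
rewrite -(@lee_pmul2l R (2 * t)%:E)// -[leLHS]ge0_integralZl//; last 2 first.
- exact: measurable_normE.
- by rewrite lee_fin ltW.
apply: (@le_trans _ _ (\int[mu]_x ((t ^+ 2)%:E + (f x ^+ 2)%:E))%E).
  apply: ge0_le_integral => //.
  - by move=> x _; rewrite -EFinM lee_fin mulr_ge0// ltW.
  - by apply: measurable_funeM; exact: measurable_normE.
  - apply: emeasurable_funD => //.
    by apply/measurable_EFinP; exact: measurable_funX.
  - move=> x _; rewrite -EFinM -EFinD lee_fin.
    have := sqr_ge0 (t - `|f x|); rewrite sqrrB real_normK ?num_real// mulr2n.
    by move: (f x ^+ 2) => z; rewrite -mulrA mulr_natl mulr2n; lra.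
rewrite ge0_integralD//; last 3 first.
- by move=> x _; rewrite lee_fin sqr_ge0.
- by move=> x _; rewrite lee_fin sqr_ge0.
- by apply/measurable_EFinP; exact: measurable_funX.
rewrite integral_cst// lebO_setT mule1 (le_trans (leeD2l _ ft))//.
by rewrite -EFinD -EFinM lee_fin -mulrA -expr2 mulr_natl mulr2n.
Qed.

Lemma sum_half n : \sum_(k < n) 2 ^- k <= 2 :> R.
Proof.
suff -> : \sum_(k < n) 2 ^- k = 2 - 2 * 2 ^- n :> R.
  by rewrite gerBl mulr_ge0// invr_ge0 exprn_ge0.
elim: n => [|n IH]; first by rewrite big_ord0 expr0 invr1 mulr1 subrr.
rewrite big_ord_recr /= IH exprS invfM mulVKf ?pnatr_eq0//.
by ring.
Qed.

(** Riesz-Fischer: the series of increments is integrable, so the sequence converges almost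
    everywhere, and Fatou gives the L_2 rate. *)
Lemma L2_fast_cauchy (x_ : nat -> L2 R) : (forall n, `|x_ n.+1 - x_ n| <= 2 ^- n) ->
  exists w : L2 R, forall n, `|x_ n - w| <= 2 * 2 ^- n.
Proof.
move=> hx; pose d (k : nat) (x : R * R) : R := Lp_fun (x_ k.+1) x - Lp_fun (x_ k) x.
have mx n : measurable_fun setT (Lp_fun (x_ n) : mR * mR -> R) by exact: L2_measurable.
have md k : measurable_fun setT (d k : mR * mR -> R) by exact: measurable_funB.
have nd k : (nrm1 mu (d k) <= (2 ^- k)%:E)%E.
  have p0 : 0 < (2 ^- k : R) by rewrite invr_gt0 exprn_gt0.
  apply: (nrm1_le_int2 p0 (md k)).
  rewrite -(ae_int2 (L2_measurable (x_ k.+1 - x_ k)) (md k) (Lp_B _ _)) -L2_norm lee_fin.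
  by rewrite ler_pXn2r ?nnegrE ?normr_ge0// ltW// invr_gt0 exprn_gt0.
pose Hs x := (\sum_(k <oo) `|d k x|%:E)%E.
have mH : measurable_fun setT (Hs : mR * mR -> \bar R).
  apply: ge0_emeasurable_sum => [k x _ _|k _]; first by rewrite lee_fin.
  exact: measurable_normE.
have iH : (\int[mu]_x Hs x <= 2%:E)%E.
  rewrite /Hs integral_nneseries//; last by move=> k; exact: measurable_normE.
  apply: lime_le; first by apply: is_cvg_nneseries => k _ _; exact: nrm1_ge0.
  apply: nearW => n; apply: (@le_trans _ _ (\sum_(0 <= k < n) (2 ^- k)%:E)%E).
    by apply: lee_sum => k _; exact: nd.
  by rewrite big_mkord sumEFin lee_fin sum_half.
have H0 x : (0 <= Hs x)%E by apply: nneseries_ge0 => k _ _; rewrite lee_fin.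
have HI : mu.-integrable setT Hs.
  apply/integrableP; split => //; under eq_integral do rewrite gee0_abs//.
  by rewrite (le_lt_trans iH)// ltry.
have cvx x : Hs x \is a fin_num -> cvgn (fun n => Lp_fun (x_ n) x).
  move=> Hf; have cs : cvgn (series (d ^~ x)).
    apply: normed_cvg; apply: nondecreasing_is_cvgn.
      by apply: nondecreasing_series => k _ _ /=.
    exists (fine (Hs x)) => _ [n _ <-] /=.
    rewrite -lee_fin fineK// /series /= -sumEFin; apply: nneseries_lim_ge => k _ _.
    by rewrite lee_fin.
  have -> : (fun n => Lp_fun (x_ n) x) = (fun n => Lp_fun (x_ 0%N) x + series (d ^~ x) n).
    apply/funext => n; rewrite /series /d /= telescope_sumr//.
    by rewrite addrC subrK.
  by apply: is_cvgD => //; exact: is_cvg_cst.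
(* An upper limit is measurable without any convergence; it agrees with the limit wherever [Hs] is
   finite, hence almost everywhere. *)
pose w x : R := fine (limn_esup (fun n => (Lp_fun (x_ n) x)%:E)).
have wE x : Hs x \is a fin_num -> (fun n => Lp_fun (x_ n) x) @ \oo --> w x.
  move=> /cvx h; have h' : (fun n => (Lp_fun (x_ n) x)%:E) @ \oo --> (limn (fun n => Lp_fun (x_ n) x))%:E.
    by apply: cvg_EFin; [exact: nearW|exact: h].
  rewrite /w is_cvg_limn_esupE; last by apply/cvg_ex; eexists; exact: h'.
  by rewrite (cvg_lim _ h')//.
have mw : measurable_fun setT (w : mR * mR -> R).
  apply: (measurableT_comp (_ : measurable_fun setT (@fine R))) => //.
  by apply: measurable_fun_limn_esup => n; exact/measurable_EFinP.
have Hae : {ae mu, forall x, Hs x \is a fin_num}.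
  have := integrable_ae measurableT HI => h.
  by apply: (ae_lebO_and h h) => x /(_ I).
have x2 n j : (n <= j)%N -> (int2 (fun x => (Lp_fun (x_ n) x - Lp_fun (x_ j) x)%R) <= ((2 * 2 ^- n) ^+ 2)%:E)%E.
  move=> nj; rewrite -(ae_int2 (L2_measurable (x_ n - x_ j)) _ (Lp_B _ _)); last exact: measurable_funB.
  rewrite -L2_norm lee_fin ler_pXn2r ?nnegrE ?normr_ge0 ?mulr_ge0 ?invr_ge0 ?exprn_ge0//.
  have tel l : `|x_ n - x_ (n + l)%N| <= 2 * 2 ^- n - 2 * 2 ^- (n + l).
    elim: l => [|l IH]; first by rewrite addn0 !subrr normr0.
    have -> : x_ n - x_ (n + l.+1)%N = (x_ n - x_ (n + l)%N) - (x_ (n + l).+1 - x_ (n + l)%N).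
      by rewrite addnS opprB addrA subrK.
    apply: (le_trans (ler_normB _ _)); apply: (le_trans (lerD IH (hx _))).
    rewrite addnS exprS invfM mulVKf ?pnatr_eq0//.
    by rewrite le_eqVlt; apply/orP; left; apply/eqP; ring.
  rewrite -(subnKC nj) (le_trans (tel _))// gerBl mulr_ge0// invr_ge0 exprn_ge0//.
(* Fatou as [j] tends to infinity with [n] fixed; the index [maxn j n] is used to stay in the range
   of [x2]. *)
have B n : (int2 (fun x => (Lp_fun (x_ n) x - w x)%R) <= ((2 * 2 ^- n) ^+ 2)%:E)%E.
  have mF j : measurable_fun setT (fun x : mR * mR => ((Lp_fun (x_ n) x - Lp_fun (x_ j) x) ^+ 2)%:E).
    by apply/measurable_EFinP; apply: measurable_funX; exact: measurable_funB.
  apply: (@le_trans _ _ (\int[mu]_x limn_einf (fun j => ((Lp_fun (x_ n) x - Lp_fun (x_ j) x) ^+ 2)%:E))%E).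
    apply: ae_ge0_le_integral => //.
    - by move=> x _; rewrite lee_fin sqr_ge0.
    - by apply/measurable_EFinP; apply: measurable_funX; exact: measurable_funB.
    - move=> x _; rewrite limn_einf_lim; apply: lime_ge; first exact: is_cvg_einfs.
      by apply: nearW => j; apply: le_ereal_inf_tmp => _ [k _ <-]; rewrite lee_fin sqr_ge0.
    - rewrite /limn_einf; apply: measurableT_comp => //.
      by apply: measurable_fun_limn_esup => j; apply: measurableT_comp => //; exact: mF.
    - apply: (ae_lebO_and Hae Hae) => x Hf _ _.
      have h : (fun j => ((Lp_fun (x_ n) x - Lp_fun (x_ j) x) ^+ 2)%:E) @ \oo --> ((Lp_fun (x_ n) x - w x) ^+ 2)%:E.
        apply: cvg_EFin; first exact: nearW.
        have h2 : (fun j => Lp_fun (x_ n) x - Lp_fun (x_ j) x) @ \oo --> Lp_fun (x_ n) x - w x.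
          by apply: cvgB; [exact: cvg_cst|exact: wE].
        by rewrite /comp /=; under eq_fun do rewrite expr2; rewrite expr2; exact: cvgM.
      rewrite is_cvg_limn_einfE; last by apply/cvg_ex; eexists; exact: h.
      by rewrite (cvg_lim _ h).
  apply: (le_trans (fatou _ _ _ _)) => //.
    by move=> j x _; rewrite lee_fin sqr_ge0.
  rewrite limn_einf_lim; apply: lime_le; first exact: is_cvg_einfs.
  apply: nearW => j; apply: (@le_trans _ _ (int2 (fun x => (Lp_fun (x_ n) x - Lp_fun (x_ (maxn j n)) x)%R))).
    by apply: ereal_inf_lbound; exists (maxn j n) => //=; rewrite leq_maxl.
  by apply: x2; rewrite leq_maxr.
have wL : w \in Lfun mu 2%:E.
  rewrite int2_Lfun//.
  have h2 : (int2 (fun x => (Lp_fun (x_ 0%N) x - w x)%R) < +oo)%E by rewrite (le_lt_trans (B 0%N))// ltry.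
  have h1 := L2_int2_fin (x_ 0%N).
  (* From [b ^+ 2 <= 2 * a ^+ 2 + 2 * (a - b) ^+ 2], whose two sides differ by the square of
     [2 * a - b]. *)
  apply: (@le_lt_trans _ _ (2%:E * int2 (Lp_fun (x_ 0%N)) + 2%:E * int2 (fun x => (Lp_fun (x_ 0%N) x - w x)%R))%E); last first.
    by rewrite lte_add_pinfty// lte_mul_pinfty.
  rewrite -!ge0_integralZl//; last 4 first.
  - by apply/measurable_EFinP; apply: measurable_funX; exact: measurable_funB.
  - by move=> x _; rewrite lee_fin sqr_ge0.
  - by apply/measurable_EFinP; exact: measurable_funX.
  - by move=> x _; rewrite lee_fin sqr_ge0.
  have m1 : measurable_fun setT (fun x : mR * mR => (2%:E * ((Lp_fun (x_ 0%N) x) ^+ 2)%:E)%E).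
    by apply: measurable_funeM; apply/measurable_EFinP; exact: measurable_funX.
  have m2 : measurable_fun setT (fun x : mR * mR => (2%:E * ((Lp_fun (x_ 0%N) x - w x) ^+ 2)%:E)%E).
    by apply: measurable_funeM; apply/measurable_EFinP; apply: measurable_funX; exact: measurable_funB.
  rewrite -ge0_integralD//; last 2 first.
  - by move=> x _; rewrite -EFinM lee_fin mulr_ge0// sqr_ge0.
  - by move=> x _; rewrite -EFinM lee_fin mulr_ge0// sqr_ge0.
  apply: ge0_le_integral => //.
  - by move=> x _; rewrite lee_fin sqr_ge0.
  - by apply/measurable_EFinP; exact: measurable_funX.
  - exact: emeasurable_funD.
  - move=> x _; rewrite -!EFinM -EFinD lee_fin.
    have := sqr_ge0 (2 * Lp_fun (x_ 0%N) x - w x); set a := Lp_fun _ x; set b := w x => h.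
    rewrite -subr_ge0 (_ : _ - _ = (2 * a - b) ^+ 2)//; ring.
exists (Lp_class (Lfun_Sub (le1_2E R) wL)) => n.
have we : {ae mu, forall x, Lp_fun (x_ n - Lp_class (Lfun_Sub (le1_2E R) wL)) x = Lp_fun (x_ n) x - w x}.
  have h := Lp_reprP (Lfun_Sub (le1_2E R) wL).
  have h2 := Lp_B (x_ n) (Lp_class (Lfun_Sub (le1_2E R) wL)).
  by apply: (ae_lebO_and h2 h) => x -> /(_ I); rewrite {2}/Lp_fun => ->.
have := B n; rewrite -(ae_int2 (L2_measurable _) _ we); last exact: measurable_funB.
by rewrite -L2_norm lee_fin ler_pXn2r ?nnegrE ?normr_ge0// mulr_ge0// invr_ge0 exprn_ge0.
Qed.

Lemma L2_complete (F : set_system (L2 R)) : ProperFilter F -> cauchy F -> cvg F.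
Proof.
move=> FF /cauchyP cF.
have p (k : nat) : 0 < (2 ^- k.+2 : R) by rewrite invr_gt0 exprn_gt0.
have h0 k : exists x : L2 R, F (ball x (2 ^- k.+2)) by exact: cF.
have [x_ xF] := choice h0.
(* Two sets of the filter meet, so successive centres are at distance at most
   [2 ^- n.+2 + 2 ^- n.+3], within the [2 ^- n] of [L2_fast_cauchy]. *)
have [w xw] : exists w : L2 R, forall n, `|x_ n - w| <= 2 * 2 ^- n.
  apply: L2_fast_cauchy => n.
  have [y [] /=] := @filter_ex _ _ FF _ (filterI (xF n) (xF n.+1)).
  rewrite -!ball_normE /= => h1 h2.
  have -> : x_ n.+1 - x_ n = (x_ n.+1 - y) - (x_ n - y) by rewrite opprB addrA subrK.
  apply: (le_trans (ler_normB _ _)); apply: (le_trans (lerD (ltW h2) (ltW h1))).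
  have -> : 2 ^- n.+3 = 8^-1 * 2 ^- n :> R by rewrite !exprS !invfM !mulrA; congr (_ * _); field.
  have -> : 2 ^- n.+2 = 4^-1 * 2 ^- n :> R by rewrite !exprS !invfM !mulrA; congr (_ * _); field.
  have : 0 <= 2 ^- n :> R by rewrite invr_ge0 exprn_ge0.
  by lra.
apply/cvg_ex; exists w; apply/cvg_ballP => e e0.
have [n _ /(_ n (leqnn _)) hn] : \forall n \near \oo, 4 < 2 ^+ n * e by exact: mono_exp2.
apply: filterS (xF n) => y; rewrite -!ball_normE /= => h.
have -> : w - y = - (x_ n - w) + (x_ n - y) by rewrite opprB addrA subrK.
apply: (le_lt_trans (ler_normD _ _)); rewrite normrN.
apply: (lt_le_trans (ler_ltD (xw n) h)).
have -> : 2 ^- n.+2 = 4^-1 * 2 ^- n :> R by rewrite !exprS !invfM !mulrA; congr (_ * _); field.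
have p0 : 0 < 2 ^+ n :> R by rewrite exprn_gt0.
have : 4 * 2 ^- n < e by rewrite ltr_pdivrMr// mulrC.
have : 0 <= 2 ^- n :> R by rewrite invr_ge0 exprn_ge0.
by lra.
Qed.

(* The completeness of L2 enters through the library's uniform boundedness
   principle, for a local complete structure. *)
Lemma L2_uniform_bounded (B_ : nat -> L2 R -> L2 R) :
  (forall n, linear (B_ n)) -> (forall n, exists C, forall x, `|B_ n x| <= C * `|x|) ->
  (forall x, exists C, forall n, `|B_ n x| <= C) ->
  exists2 C, 0 <= C & forall n x, `|B_ n x| <= C * `|x|.
Proof.
move=> lB bB pB.
pose V : completeNormedModType R := HB.pack (L2 R) (Uniform_isComplete.Build (L2 R) L2_complete).
have h : uniform_bounded ([set f | exists n, f = B_ n] : set (V -> L2 R)).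
  apply: Banach_Steinhauss.
  - move=> _ [n ->]; split; last exact: lB.
    move=> r; have [C hC] := bB n; exists (`|C| * r) => x xr.
    rewrite (le_trans (hC x))// (le_trans (ler_wpM2r _ (ler_norm C)))//.
    by rewrite ler_wpM2l.
  - by move=> x; have [C hC] := pB x; exists C => _ [n ->].
have [C hC] := h 1; exists `|C| => // n x.
have [->|x0] := eqVneq x 0.
  by have [D hD] := bB n; have := hD 0; rewrite normr0 mulr0 => /le_trans; apply; rewrite mulr0.
have nx : 0 < `|x| by rewrite normr_gt0.
have := hC (B_ n) (ex_intro _ n erefl) (`|x|^-1 *: x).
rewrite normrZ normfV normr_id mulVf ?gt_eqF// => /(_ (lexx _)).
have B0 : B_ n 0 = 0.
  by have [D hD] := bB n; have := hD 0; rewrite normr0 mulr0 normr_le0 => /eqP.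
have lin a y : B_ n (a *: y) = a *: B_ n y.
  by have := lB n a y 0; rewrite B0 !addr0.
rewrite lin normrZ normfV normr_id -ler_pdivlMl ?invr_gt0// invrK mulrC => /le_trans; apply.
by rewrite ler_wpM2r// ler_norm.
Qed.

End L2_complete.

(** * The fidelity term *)

Section plain_averages.
Variable R : realType.
Local Notation mR := (measurableTypeR R).
Local Notation mu := (lebO R).
Local Notation lam := (@lebesgue_measure R).

Lemma L2_integrable (w : L2 R) : mu.-integrable setT (EFin \o (w : R * R -> R)).
Proof.
apply/(@integrable_nrm1P _ _ _ mu); first exact: L2_measurable.
have t0 : 0 < `|w| + 1 :> R by rewrite (lt_le_trans ltr01)// lerDr.
apply: (@le_lt_trans _ _ (`|w| + 1)%:E); last exact: ltry.
apply: (nrm1_le_int2 t0 (L2_measurable w)); rewrite -L2_norm lee_fin.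
by rewrite lerXn2r ?nnegrE ?normr_ge0// ?ltW// ltrDl.
Qed.

Lemma integrable_sqr (w : L2 R) : mu.-integrable setT (EFin \o (fun x => w x ^+ 2)).
Proof.
apply/(@integrable_nrm1P _ _ _ mu); first by apply: measurable_funX; exact: L2_measurable.
apply: le_lt_trans (L2_int2_fin w); rewrite /nrm1 /int2.
by under eq_integral do rewrite ger0_norm ?sqr_ge0//.
Qed.

Lemma inL2_ae (f : R * R -> R) : f \in Lfun mu 2%:E -> {ae mu, forall x, Lp_fun (inL2 f) x = f x}.
Proof.
move=> fL; have h := Lp_reprP (insubd (0 : LfunType mu (le1_2E R)) f).
by apply: (ae_lebO_and h h) => x /(_ I) + _; rewrite val_insubd fL.
Qed.

Lemma cst_integrable (a : R) : mu.-integrable setT (EFin \o (fun _ : R * R => a)).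
Proof.
apply/(@integrable_nrm1P _ _ _ mu); first exact: measurable_cst.
by rewrite /nrm1 integral_cst// lebO_setT mule1 ltry.
Qed.

Lemma step_in_Lfun e n (r : seq (int * int)) F : uniq r -> (forall k, k \in r -> inner_cell e n k) ->
  (int2 (step e n r F) = ((2 ^- n) ^+ 2 * \sum_(k <- r) F k ^+ 2)%:E)%E /\
  step e n r F \in Lfun mu 2%:E.
Proof.
move=> ur ri; have h : (int2 (step e n r F) = ((2 ^- n) ^+ 2 * \sum_(k <- r) F k ^+ 2)%:E)%E.
  rewrite -(ge0_integral_step ur ri); last by move=> k _; exact: sqr_ge0.
  by apply: eq_integral => x _; rewrite /step; case: ifP => //; rewrite expr0n.
by split => //; rewrite int2_Lfun ?h ?ltry//; exact: measurable_step.
Qed.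

Variables (m : nat) (phi : R -> R) (c : R).
Hypothesis m0 : (0 < m)%N.
Hypothesis hphi : forall x, phi x = cardinal_bspline m.-1 (x - c).

Local Notation kk := (phi_kernel m0 hphi).
Local Notation avgp := (avg phi phi).

Let ker_ge0 n k x : 0 <= ker_nk phi phi n k x.
Proof.
have p0 y : 0 <= phi y by rewrite hphi; have /andP[] := (cardinal_bspline_in01 R m.-1).2 (y - c).
exact: mulr_ge0 (p0 _) (p0 _).
Qed.

Lemma avg_ge0 n g k : measurable_fun setT (g : mR * mR -> R) -> {ae mu, forall x, 0 <= g x} ->
  0 <= avgp n g k.
Proof.
move=> mg g0; have mg' : measurable_fun setT (fun x => `|g x| : R) by exact: measurableT_comp.
rewrite (avg_ae kk kk n k mg mg'); last first.
  by apply: (ae_lebO_and g0 g0) => x h _; rewrite ger0_norm.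
rewrite /avg mulr_ge0 ?exprn_ge0//; apply: Rintegral_ge0 => x _.
exact: mulr_ge0 (normr_ge0 _) (ker_ge0 _ _ _).
Qed.

(** Only an inequality: a kernel that sticks out of the square loses mass. *)
Lemma avg_cst1 n k : avgp n (fun=> 1) k <= 1.
Proof.
have p0 : 0 < (2 ^+ n : R) by rewrite exprn_gt0.
apply: (@le_trans _ _ ((2 ^+ n) ^+ 2 * \int[leb2 R]_x ker_nk phi phi n k x)).
  rewrite /avg; apply: ler_wpM2l; first exact: sqr_ge0.
  apply: le_Rintegral_Omega_leb2.
  - exact: (integrable_mulker kk kk n k (cst_integrable 1)).
  - exact: (integrable_ker kk kk n k).
  - by move=> x; rewrite mul1r.
  - by move=> x; rewrite mul1r.
by rewrite (integral_ker kk kk) (phi_mass hphi) !mulr1 exprVn mulfV// gt_eqF// exprn_gt0.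
Qed.

Lemma avg_le1 n g k : mu.-integrable setT (EFin \o g) -> {ae mu, forall x, g x <= 1} ->
  avgp n g k <= 1.
Proof.
move=> gi g1; apply: le_trans (avg_cst1 n k); rewrite -subr_ge0.
have mg := integrable_mfun gi.
have gi' : mu.-integrable setT (EFin \o (fun x => -1 * g x)).
  by have := integrableZl measurableT (-1) gi; apply: eq_integrable.
have -> : avgp n (fun=> 1) k - avgp n g k = avgp n (fun x => 1 + -1 * g x) k.
  rewrite (avgD kk kk n k (cst_integrable 1) gi').
  by rewrite (avgZ kk kk n (-1) k gi) mulN1r.
apply: avg_ge0.
  by apply: measurable_funD => //; exact: measurable_funM.
by apply: (ae_lebO_and g1 g1) => x h _; rewrite mulN1r subr_ge0.
Qed.

(** Jensen's inequality, by expanding the nonnegative average of [(g - a) ^+ 2] with [a] the average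
    of [g]; a total mass at most 1 is enough. *)
Lemma avg_sqr_le n (g : L2 R) k : avgp n g k ^+ 2 <= avgp n (fun x => g x ^+ 2) k.
Proof.
have gi := L2_integrable g; have g2i := integrable_sqr g; have i1 := cst_integrable 1.
set a := avgp n g k.
have zi (z : R) (h : R * R -> R) : mu.-integrable setT (EFin \o h) -> mu.-integrable setT (EFin \o (fun x => z * h x)).
  by move=> hi; have := integrableZl measurableT z hi; apply: eq_integrable.
have di (h h' : R * R -> R) : mu.-integrable setT (EFin \o h) -> mu.-integrable setT (EFin \o h') ->
    mu.-integrable setT (EFin \o (fun x => h x + h' x)).
  by move=> hi hi'; have := integrableD measurableT hi hi'; apply: eq_integrable.
have e : avgp n (fun x => (g x ^+ 2 + (- (2 * a)) * g x) + a ^+ 2 * 1) k =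
    avgp n (fun x => g x ^+ 2) k + (- (2 * a)) * a + a ^+ 2 * avgp n (fun=> 1) k.
  rewrite (avgD kk kk n k (di _ _ g2i (zi _ _ gi)) (zi _ _ i1)).
  by rewrite (avgD kk kk n k g2i (zi _ _ gi)) !(avgZ kk kk).
have : 0 <= avgp n (fun x => (g x ^+ 2 + (- (2 * a)) * g x) + a ^+ 2 * 1) k.
  apply: avg_ge0; first exact: (integrable_mfun (di _ _ (di _ _ g2i (zi _ _ gi)) (zi _ _ i1))).
  apply: aeW => x; rewrite (_ : _ + _ = (g x - a) ^+ 2) ?sqr_ge0//; ring.
rewrite e; have := ler_wpM2l (sqr_ge0 a) (avg_cst1 n k).
by move: (a ^+ 2 * _) => z; move: (avgp n _ k) => y; rewrite mulr1 mulNr -mulrA -expr2; lra.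
Qed.

Variables (r_ : nat -> seq (int * int)).
Hypothesis ur : forall n, uniq (r_ n).
Hypothesis ri : forall n k, k \in r_ n -> inner_cell c n k.
Hypothesis rO : forall x, Omega x -> \forall n \near \oo, cell_index c n x \in r_ n.

Let B : R := (count_bound (m%:R + `|c|) ^ 2)%:R * 1 ^+ 2.

Let PA n (g : L2 R) : R * R -> R := step c n (r_ n) (avgp n g).
Let PS n (g : L2 R) : R * R -> R := step c n (r_ n) (avgp n (fun x => g x ^+ 2)).

Let PA_PS n g : (int2 (PA n g) <= \int[mu]_x (PS n g x)%:E)%E.
Proof.
apply: ge0_le_integral => //.
- by move=> x _; rewrite lee_fin sqr_ge0.
- by apply/measurable_EFinP; apply: measurable_funX; exact: measurable_step.
- by apply/measurable_EFinP; exact: measurable_step.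
- move=> x _; rewrite lee_fin /PA /PS /step; case: ifP => _; last by rewrite expr0n.
  exact: avg_sqr_le.
Qed.

(** Jensen reduces the L_2 bound for [g] to the L_1 bound for its square. *)
Lemma step_avg_L2_bound n (g : L2 R) : (int2 (step c n (r_ n) (avgp n g)) <= (B * `|g| ^+ 2)%:E)%E.
Proof.
apply: (le_trans (PA_PS n g)).
have -> : (\int[mu]_x (PS n g x)%:E = nrm1 mu (PS n g))%E.
  apply: eq_integral => x _; rewrite ger0_norm// /PS /step; case: ifP => // _.
  exact: le_trans (sqr_ge0 _) (avg_sqr_le _ _ _).
apply: (le_trans (nrm1_step_avg kk kk (ur n) (@ri n) (integrable_sqr g))).
rewrite [(B * _)%:E]EFinM L2_norm; apply: lee_wpmul2l; first by rewrite lee_fin mulr_ge0// sqr_ge0.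
by rewrite /nrm1 /int2; under eq_integral do rewrite ger0_norm ?sqr_ge0//.
Qed.

(** Above, Jensen and the L_1 convergence of the averages of [g ^+ 2]; below, lower semicontinuity
    of [int2] for L_1 convergence. *)
Lemma step_avg_L2_norm (g : L2 R) :
  int2 (step c n (r_ n) (avgp n g)) @[n --> \oo] --> int2 g.
Proof.
have lm : \int[lam]_x phi x * \int[lam]_x phi x = 1 by rewrite (phi_mass hphi) mulr1.
have cS : cvg1 mu (fun n => PS n g) (fun x => g x ^+ 2).
  have := step_avg_cvg kk kk ur ri rO (integrable_sqr g).
  by rewrite lm; under [X in cvg1 _ _ X]eq_fun do rewrite mul1r.
have cA : cvg1 mu (fun n => PA n g) g.
  have := step_avg_cvg kk kk ur ri rO (L2_integrable g).
  by rewrite lm; under [X in cvg1 _ _ X]eq_fun do rewrite mul1r.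
have iS n : mu.-integrable setT (EFin \o PS n g) by exact: integrable_step (ur n) (@ri n).
have lS := cvg1_integral iS (integrable_sqr g) cS.
have fA n : int2 (PA n g) \is a fin_num.
  by have [-> _] := step_in_Lfun (avgp n g) (ur n) (@ri n).
have fS n : (\int[mu]_x (PS n g x)%:E)%E \is a fin_num by exact: integrable_fin_num (iS n).
rewrite -L2_norm; apply/fine_cvgP; split; first by apply: nearW => n; exact: fA.
have lS' : fine (\int[mu]_x (PS n g x)%:E)%E @[n --> \oo] --> `|g| ^+ 2.
  by have /fine_cvgP[_] : (\int[mu]_x (PS n g x)%:E)%E @[n --> \oo] --> (`|g| ^+ 2)%:E by rewrite L2_norm.
apply/cvgrPdist_le => e e0.
have up : \forall n \near \oo, fine (int2 (PA n g)) <= `|g| ^+ 2 + e.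
  have /cvgrPdist_le/(_ e e0) := lS'; apply: filterS => n; rewrite ler_norml => /andP[h _].
  have : fine (int2 (PA n g)) <= fine (\int[mu]_x (PS n g x)%:E)%E by rewrite fine_le.
  by lra.
(* Otherwise a sequence of indices [sg] with too small L_2 norms would still converge in L_1 to [g],
   against [int2_cvg1_le]. *)
have dn : \forall n \near \oo, `|g| ^+ 2 - e <= fine (int2 (PA n g)).
  apply: contrapT => nn.
  have hf k : exists n, (k <= n)%N /\ (int2 (PA n g) <= (`|g| ^+ 2 - e)%:E)%E.
    apply: contrapT => /forallNP nk; apply: nn; exists k => // n /= kn.
    have := nk n; rewrite -(fineK (fA n)) lee_fin => h; rewrite leNgt; apply/negP => h'.
    by apply: h; split => //; exact: ltW.
  have [sg hs] := choice hf.
  have cs : cvg1 mu (fun k => PA (sg k) g) g.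
    apply/cvg1P => d d0; have /cvg1P/(_ d d0)[N _ hN] := cA.
    exists N; first by []. by move=> k Nk; apply: hN; exact: leq_trans Nk (hs k).1.
  have mP k : measurable_fun setT (PA (sg k) g : mR * mR -> R) by exact: measurable_step.
  have := int2_cvg1_le mP (L2_measurable g) cs (fun k => (hs k).2).
  by rewrite -L2_norm lee_fin; lra.
by apply: filterS2 up dn => n h1 h2; rewrite distrC ler_distl; apply/andP; split; [exact: h2|exact: h1].
Qed.

End plain_averages.

(** * Grid functions inside L_2 and the consistency error *)

Section grid_embedding.
Variable R : realType.
Local Notation mR := (measurableTypeR R).
Local Notation mu := (lebO R).
Variables (m : nat) (phi : R -> R) (c : R).
Hypothesis m0 : (0 < m)%N.
Hypothesis hphi : forall x, phi x = cardinal_bspline m.-1 (x - c).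

Local Notation kk := (phi_kernel m0 hphi).
Local Notation rM := (rM phi).

Definition grid_ext n (U : gridfun phi n) (k : int * int) : R :=
  if pselect (Mgrid phi n k) is left h then U (exist _ k (mem_set h)) else 0.

Lemma grid_ext_val n (U : gridfun phi n) (k : Mgrid phi n) : grid_ext U (set_val k) = U k.
Proof.
rewrite /grid_ext; case: pselect => [h|]; last by move/(_ (set_valP k)).
by congr U; apply/val_inj.
Qed.

Lemma grid_ext_lin n a (U V : gridfun phi n) k :
  grid_ext (a *: U + V) k = a * grid_ext U k + grid_ext V k.
Proof. by rewrite /grid_ext; case: pselect => // _; rewrite mulr0 addr0. Qed.

Definition grid_L2 n (U : gridfun phi n) : L2 R := inL2 (step c n (rM n) (grid_ext U)).

Let rMi n k : k \in rM n -> inner_cell c n k. Proof. exact: (rM_inner m0 hphi). Qed.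

Lemma grid_L2_ae n (U : gridfun phi n) :
  {ae mu, forall x, grid_L2 U x = step c n (rM n) (grid_ext U) x}.
Proof. by apply: inL2_ae; exact: (step_in_Lfun _ (rM_uniq phi n) (@rMi n)).2. Qed.

Lemma grid_L2_linear n : linear (@grid_L2 n).
Proof.
move=> a U V; apply: Lp_ext.
have h1 := grid_L2_ae (a *: U + V); have h2 := grid_L2_ae U; have h3 := grid_L2_ae V.
have h4 := Lp_D (a *: grid_L2 U) (grid_L2 V); have h5 := Lp_Z a (grid_L2 U).
have h6 := ae_lebO_and h1 h2 (fun x p q => conj p q).
have h7 := ae_lebO_and h3 h4 (fun x p q => conj p q).
have h8 := ae_lebO_and h6 h7 (fun x p q => conj p q).
apply: (ae_lebO_and h8 h5) => x [[-> e2] [e3 ->]] ->; rewrite e2 e3 /step.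
by case: ifP => _; rewrite ?mulr0 ?addr0// grid_ext_lin.
Qed.

HB.instance Definition _ n := GRing.isLinear.Build R (gridfun phi n) (L2 R) _ (@grid_L2 n) (@grid_L2_linear n).

Lemma grid_L2_int2 n (U : gridfun phi n) : `|grid_L2 U| ^+ 2 = (2 ^- n) ^+ 2 * \sum_(k <- rM n) grid_ext U k ^+ 2.
Proof.
have [e1 _] := step_in_Lfun (grid_ext U) (rM_uniq phi n) (@rMi n).
apply: EFin_inj; rewrite -e1 L2_norm; apply: ae_int2; last exact: grid_L2_ae.
- exact: L2_measurable.
- by apply: measurable_step; exact: rM_uniq.
Qed.

Lemma grid_L2_norm n (U : gridfun phi n) : `|grid_L2 U| = grid_norm2 U.
Proof.
rewrite /grid_norm2 -[LHS]ger0_norm ?normr_ge0// -sqrtr_sqr grid_L2_int2 -(Mgrid_sum m0 hphi).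
congr (Num.sqrt (_ * _)); apply: eq_fsbigr => k _.
by rewrite grid_ext_val real_normK ?num_real.
Qed.

Lemma grid_ext_le n (U : gridfun phi n) k : k \in rM n -> `|grid_ext U k| <= 2 ^+ n * `|grid_L2 U|.
Proof.
move=> kr; have p0 : 0 < (2 ^+ n : R) by rewrite exprn_gt0.
have h : `|grid_ext U k| ^+ 2 <= (2 ^+ n * `|grid_L2 U|) ^+ 2.
  rewrite exprMn grid_L2_int2 exprVn mulrA mulfV ?mul1r; last by rewrite gt_eqF// exprn_gt0.
  rewrite real_normK ?num_real// (big_rem k)//= lerDl.
  by apply: sumr_ge0 => j _; exact: sqr_ge0.
by move: h; rewrite ler_pXn2r// ?nnegrE ?normr_ge0// mulr_ge0// ltW.
Qed.

Lemma grid_basis n (U : gridfun phi n) :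
  U = \sum_(k <- rM n) grid_ext U k *: (fun j : Mgrid phi n => (set_val j == k)%:R : R) :> gridfun phi n.
Proof.
apply/funext => j; rewrite -grid_ext_val fct_sumE.
have jr : set_val j \in rM n by apply/(mem_rM m0 hphi); exact: set_valP.
rewrite (bigD1_seq (set_val j)) ?rM_uniq//=.
have sc a (e : gridfun phi n) i : (a *: e) i = a * e i by [].
rewrite big1 ?addr0 ?sc ?eqxx ?mulr1// => i ij.
by rewrite sc eq_sym (negPf ij) mulr0.
Qed.

(** Finite dimension. The constant depends on [n]; uniformity comes only afterwards, from
    [L2_uniform_bounded]. *)
Lemma grid_linear_bounded n (L : {linear gridfun phi n -> gridfun phi n}) :
  exists2 C, 0 <= C & forall U, `|grid_L2 (L U)| <= C * `|grid_L2 U|.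
Proof.
pose e k : gridfun phi n := fun j : Mgrid phi n => (set_val j == k)%:R : R.
pose C := \sum_(k <- rM n) 2 ^+ n * `|grid_L2 (L (e k))|.
exists C; first by apply: sumr_ge0 => k _; exact: mulr_ge0 (exprn_ge0 _ (ler0n _ 2)) (normr_ge0 _).
move=> U; have -> : grid_L2 (L U) = \sum_(k <- rM n) grid_ext U k *: grid_L2 (L (e k)).
  rewrite {1}(grid_basis U) !linear_sum.
  by apply: eq_bigr => k _; rewrite !linearZ.
apply: (le_trans (ler_norm_sum _ _ _)); rewrite mulr_suml [leLHS]big_seq [leRHS]big_seq.
apply: ler_sum => k kr; rewrite normrZ mulrAC.
by apply: ler_wpM2r (grid_ext_le U kr); exact: normr_ge0.
Qed.

(** [sampling] restricted to classes in L_2, so that a linear structure can be attached to it. *)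
Definition sample n (g : L2 R) : gridfun phi n := sampling phi n g.
Arguments sample : clear implicits.
Local Notation Tn := sample.

Lemma sampling_linear n : linear (Tn n).
Proof.
move=> a g h; apply/funext => k.
have gi := L2_integrable g; have hi := L2_integrable h.
have agi : mu.-integrable setT (EFin \o (fun x => a * (g : L2 R) x)).
  by have := integrableZl measurableT a gi; apply: eq_integrable.
have h1 := Lp_D (a *: g) h; have h2 := Lp_Z a g.
have e : {ae mu, forall x, (a *: g + h : L2 R) x = a * (g : L2 R) x + (h : L2 R) x}.
  by apply: (ae_lebO_and h1 h2) => x -> ->.
have -> : (a *: Tn n g + Tn n h) k = a * Tn n g k + Tn n h k by [].
rewrite /sample !(sampling_avg m0 hphi)//; last exact: L2_integrable.
rewrite (avg_ae kk kk n (set_val k) (L2_measurable _) _ e).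
  by rewrite (avgD kk kk n _ agi hi) (avgZ kk kk).
exact: measurable_funD (integrable_mfun agi) (integrable_mfun hi).
Qed.

HB.instance Definition _ n := GRing.isLinear.Build R (L2 R) (gridfun phi n) _ (sample n) (@sampling_linear n).

Lemma sampling_L2 n (g : L2 R) : grid_L2 (Tn n g) = inL2 (step c n (rM n) (avg phi phi n g)).
Proof.
congr inL2; apply/funext => x; rewrite /step; case: ifP => // xr.
have h : Mgrid phi n (cell_index c n x) by apply/(mem_rM m0 hphi).
have := grid_ext_val (Tn n g) (SigSub (mem_set h)) => ->.
by rewrite /sample (sampling_avg m0 hphi)//; exact: L2_integrable.
Qed.

Lemma sampling_L2_int2 n (g : L2 R) : ((`|grid_L2 (Tn n g)| ^+ 2)%:E = int2 (step c n (rM n) (avg phi phi n g)))%E.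
Proof.
have [e1 eL] := step_in_Lfun (avg phi phi n g) (rM_uniq phi n) (@rMi n).
rewrite L2_norm sampling_L2; apply: ae_int2; [exact: L2_measurable| |exact: inL2_ae].
by apply: measurable_step; exact: rM_uniq.
Qed.

Lemma sampling_bounded : exists2 C, 0 <= C & forall n (g : L2 R), `|grid_L2 (Tn n g)| <= C * `|g|.
Proof.
pose B : R := (count_bound (m%:R + `|c|) ^ 2)%:R * 1 ^+ 2.
have B0 : 0 <= B by rewrite mulr_ge0// sqr_ge0.
exists (B + 1); first by rewrite addr_ge0.
move=> n g; have h : `|grid_L2 (Tn n g)| ^+ 2 <= ((B + 1) * `|g|) ^+ 2.
  rewrite -lee_fin sampling_L2_int2; apply: (le_trans (step_avg_L2_bound m0 hphi (rM_uniq phi) rMi n g)).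
  rewrite lee_fin exprMn; apply: ler_wpM2r; first exact: sqr_ge0.
  by rewrite -/B; have := sqr_ge0 B; rewrite sqrrD1 mulr2n; lra.
move: h; rewrite ler_pXn2r// ?nnegrE ?normr_ge0//.
by apply: mulr_ge0 (normr_ge0 _); rewrite addr_ge0.
Qed.

Lemma sampling_norm_cvg (g : L2 R) : `|grid_L2 (Tn n g)| @[n --> \oo] --> `|g|.
Proof.
have h := step_avg_L2_norm m0 hphi (rM_uniq phi) rMi (fun x => @rM_near R m phi c m0 hphi x) (g := g).
have h2 : `|grid_L2 (Tn n g)| ^+ 2 @[n --> \oo] --> `|g| ^+ 2.
  have /fine_cvgP[_] : (`|grid_L2 (Tn n g)| ^+ 2)%:E @[n --> \oo] --> (`|g| ^+ 2)%:E.
    rewrite L2_norm; apply: cvg_trans h; apply: near_eq_cvg; apply: nearW => n.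
    by rewrite sampling_L2_int2.
  exact.
have h3 : Num.sqrt (`|grid_L2 (Tn n g)| ^+ 2) @[n --> \oo] --> Num.sqrt (`|g| ^+ 2).
  by apply: continuous_cvg h2; exact: sqrt_continuous.
have sq (z : L2 R) : Num.sqrt (`|z| ^+ 2) = `|z| by rewrite sqrtr_sqr ger0_norm.
by move: h3; rewrite sq; under eq_fun do rewrite sq.
Qed.

Variables (A : {linear L2 R -> L2 R}) (An : forall n, {linear gridfun phi n -> gridfun phi n}).
Hypothesis cA : continuous A.
Hypothesis hA : operator_consistent A An.

Let D (n : nat) (x : L2 R) : L2 R := grid_L2 (Tn n (A x) - An n (Tn n x)).

Let D_linear n : linear (D n).
Proof.
move=> a x y; rewrite -linearP; congr grid_L2.
by rewrite (linearP A) !(linearP (sample n)) (linearP (An n)) scalerBr opprD addrACA.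
Qed.

Let D_bounded n : exists C, forall x, `|D n x| <= C * `|x|.
Proof.
have [C C0 hC] := sampling_bounded; have [C' C'0 hC'] := grid_linear_bounded (An n).
have /linear_boundedP/pinfty_ex_gt0[K K0 hK] : bounded_near A (nbhs (0 : L2 R)).
  by apply/linear_bounded_continuous.
exists (C * K + C' * C) => x; rewrite /D linearB mulrDl -!mulrA.
apply: (le_trans (ler_normB _ _)); apply: lerD.
  by apply: (le_trans (hC _ _)); apply: ler_wpM2l.
by apply: (le_trans (hC' _)); apply: ler_wpM2l.
Qed.

Let D_cvg x : `|D n x| @[n --> \oo] --> (0 : R).
Proof.
by have := hA x; apply: cvg_trans; apply: near_eq_cvg; apply: nearW => n; rewrite grid_L2_norm.
Qed.

(** The comparison is with the samples of [A w - f], whose norms converge to the right limit by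
    [sampling_norm_cvg]. *)
Lemma fidelity_cvg (f w : L2 R) (w_ : nat -> L2 R) : `|w_ n - w| @[n --> \oo] --> (0 : R) ->
  grid_norm2 (An n (Tn n (w_ n)) - Tn n f) @[n --> \oo] --> `|A w - f|.
Proof.
move=> ww.
have [C C0 hC] : exists2 C, 0 <= C & forall n x, `|D n x| <= C * `|x|.
  apply: L2_uniform_bounded; [exact: D_linear|exact: D_bounded|].
  move=> x; have /cvg_seq_bounded : cvgn (fun n => `|D n x|) by apply/cvg_ex; exists 0; exact: D_cvg.
  move=> /pinfty_ex_gt0[K K0 hK]; exists K => n.
  by have /= := hK n I; rewrite normr_id.
have [C1 C10 hC1] := sampling_bounded.
have /linear_boundedP/pinfty_ex_gt0[K K0 hK] : bounded_near A (nbhs (0 : L2 R)).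
  by apply/linear_bounded_continuous.
(* (A1) takes care of [D n w]; the consistency error at the moving point [w_ n - w] is what requires
   a bound uniform in [n]. *)
have dec n : grid_L2 (An n (Tn n (w_ n)) - Tn n f) - grid_L2 (Tn n (A w - f)) =
    grid_L2 (Tn n (A (w_ n - w))) - D n w - D n (w_ n - w).
  have gB (U V : gridfun phi n) : grid_L2 (U - V) = grid_L2 U - grid_L2 V by rewrite linearB.
  have TB (x y : L2 R) : Tn n (x - y) = Tn n x - Tn n y by rewrite linearB.
  have AB (x y : L2 R) : A (x - y) = A x - A y by rewrite linearB.
  have BB (U V : gridfun phi n) : An n (U - V) = An n U - An n V by rewrite linearB.
  rewrite /D !AB !TB BB !gB.
  have tel (x y z : L2 R) : x - y - (z - y) = x - z by rewrite opprB addrA subrK.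
  have key (x y z : L2 R) : x - y - (x - z) = z - y by rewrite opprB addrC addrA subrK.
  by rewrite tel key tel.
have est n : `|grid_norm2 (An n (Tn n (w_ n)) - Tn n f) - `|grid_L2 (Tn n (A w - f))| | <=
    (C1 * K + C) * `|w_ n - w| + `|D n w|.
  rewrite -grid_L2_norm; apply: (le_trans (ler_dist_dist _ _)); rewrite dec.
  apply: (le_trans (ler_normB _ _)); apply: (le_trans (lerD (ler_normB _ _) (lexx _))).
  rewrite mulrDl addrAC; apply: lerD => //; apply: lerD => //.
  by apply: (le_trans (hC1 _ _)); rewrite -mulrA; apply: ler_wpM2l.
have z : (C1 * K + C) * `|w_ n - w| + `|D n w| @[n --> \oo] --> (0 : R).
  rewrite -[0 in X in _ --> X](addr0 0) -[X in _ --> X + _](mulr0 (C1 * K + C)).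
  by apply: cvgD (D_cvg w); apply: cvgMl_tmp.
have z2 : grid_norm2 (An n (Tn n (w_ n)) - Tn n f) - `|grid_L2 (Tn n (A w - f))| @[n --> \oo] --> (0 : R).
  apply/norm_cvg0P; apply: (squeeze_cvgr _ (cvg_cst 0) z); apply: nearW => n.
  by rewrite normr_ge0 est.
rewrite (_ : (fun n => _) = (fun n => (grid_norm2 (An n (Tn n (w_ n)) - Tn n f) - `|grid_L2 (Tn n (A w - f))|) + `|grid_L2 (Tn n (A w - f))|)); last first.
  by apply/funext => n; rewrite subrK.
by rewrite -[X in _ --> X]add0r; apply: cvgD => //; exact: sampling_norm_cvg.
Qed.

End grid_embedding.

(** * Convergence of the energies *)

Section discrete_limit.
Variable R : realType.
Local Notation mR := (measurableTypeR R).
Local Notation mu := (lebO R).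
Local Notation lam := (@lebesgue_measure R).

(** Step functions vanish off the chosen cells, so the constant 1 in [1 - T_n v] is only a limit of
    step functions. *)
Lemma step_cst1 e (r_ : nat -> seq (int * int)) : (forall n, uniq (r_ n)) ->
  (forall x : R * R, Omega x -> \forall n \near \oo, cell_index e n x \in r_ n) ->
  cvg1 mu (fun n => step e n (r_ n) (fun=> 1)) (fun=> 1).
Proof.
move=> ur rO; apply: (@cvg1_of_ptws _ _ _ _ _ _ 1).
- exact: lebO_finite.
- by move=> n; exact: measurable_step.
- exact: measurable_cst.
- by move=> n x; rewrite /step; case: ifP; rewrite ?normr1 ?normr0.
- by apply: ae_Omega => x Ox; apply: cvg_near_cst; apply: filterS (rO x Ox) => n h; rewrite /step h.
Qed.

Lemma inL2B (u v : L1 R) : Lp_fun u \in Lfun mu 2%:E -> Lp_fun v \in Lfun mu 2%:E ->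
  Lp_fun (u - v) \in Lfun mu 2%:E -> inL2 (Lp_fun u) - inL2 (Lp_fun v) = inL2 (Lp_fun (u - v)).
Proof.
move=> hu hv hd; apply: Lp_ext.
have h1 := Lp_B (inL2 (Lp_fun u)) (inL2 (Lp_fun v)); have h2 := inL2_ae hu; have h3 := inL2_ae hv.
have h4 := inL2_ae hd; have h5 := Lp_B u v.
have h6 := ae_lebO_and h1 h2 (fun x p q => conj p q).
have h7 := ae_lebO_and h3 h4 (fun x p q => conj p q).
have h8 := ae_lebO_and h6 h7 (fun x p q => conj p q).
by apply: (ae_lebO_and h8 h5) => x [[-> ->] [-> ->]] ->.
Qed.

Variables (m : nat) (q : nat -> int -> R) (phi : R -> R).
Variables (c : R) (lo : nat -> int) (P : nat -> {poly R}).
Hypothesis m0 : (0 < m)%N.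
Hypothesis hphi : forall x, phi x = cardinal_bspline m.-1 (x - c).
Hypothesis hq : forall l, (l <= m)%N -> [/\ q l =1 zcoef ((1 - 'X) ^+ l * P l) (lo l),
  (P l).[1] != 0 & ((1 - 'X) ^+ l * P l)`_0 != 0].
Local Notation kap := (kap m c lo P).
Local Notation rK := (rK m q phi).
Local Notation kk := (phi_kernel m0 hphi).

Lemma wavelet_energyE n (w : midx m -> R) (u : L1 R) (V : int * int -> R) :
  \sum_(k \in Kgrid m q phi n) V (set_val k) * wavelet_norm q w (sampling phi n u) k =
  \sum_(k <- rK n) V k * Num.sqrt (\sum_(a in band m) w a * `|avg (kap a.1 0) (kap a.2 0) n u k| ^+ 2).
Proof.
rewrite -(Kgrid_sum q m0 hphi n (fun k => V k * Num.sqrt (\sum_(a in band m) w a * `|avg (kap a.1 0) (kap a.2 0) n u k| ^+ 2))).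
apply: eq_fsbigr => k /set_mem Kk; congr (_ * Num.sqrt _); apply: eq_bigr => a _.
by rewrite (wavelet_avg m0 hphi hq a (L1_integrable u) Kk).
Qed.

Lemma avg_unit_valued n (v : L1 R) k : unit_valued v -> 0 <= avg phi phi n v k <= 1.
Proof.
move=> v01; rewrite (avg_ge0 m0 hphi) ?(avg_le1 m0 hphi)//.
- exact: L1_integrable.
- by apply: (ae_lebO_and v01 v01) => x /andP[].
- by apply: (ae_lebO_and v01 v01) => x /andP[].
Qed.

Lemma sampling_inL2 n (u : L1 R) : Lp_fun u \in Lfun mu 2%:E ->
  sampling phi n u = @sample R phi n (inL2 u).
Proof.
move=> uL; apply/funext => k.
rewrite /sample !(sampling_avg m0 hphi); [|exact: L2_integrable|exact: L1_integrable].
have h := inL2_ae uL.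
by rewrite [RHS](avg_ae kk kk n _ (L2_measurable _) _ h).
Qed.

Variables (I I' I'' : {set midx m}) (s r : nat) (cc : midx m -> R).
Variables (lambda gamma rho : nat -> midx m -> R).
Variables (A : {linear L2 R -> L2 R}) (f : L2 R) (An : forall n, {linear gridfun phi n -> gridfun phi n}).
Hypothesis ccE : forall a, a \in band m -> cc a = 2^-1 ^+ mabs a * ((P a.1).[1] * (P a.2).[1]).
Hypotheses (IB : I \subset band m) (IB' : I' \subset band m) (IB'' : I'' \subset band m).
Hypothesis s0 : (0 < s)%N.
Hypotheses (Is : forall a, a \in I -> (mabs a <= s)%N) (Is' : forall a, a \in I' -> (mabs a <= s)%N).
Hypothesis Ir : forall a, a \in I'' -> (mabs a <= r)%N.
Hypothesis cA : continuous A.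
Hypothesis hA : operator_consistent A An.
Hypotheses (hl : admissible_weights cc I s lambda) (hg : admissible_weights cc I' s gamma).
Hypothesis hr : admissible_weights cc I'' r rho.

Lemma discrete_energy_cvg (u_ v_ : nat -> L1 R) (u v : L1 R) :
  (forall n, sobolev s (u_ n)) -> sobolev s u -> (forall n, sobolev01 r (v_ n)) -> sobolev01 r v ->
  sobolev_norm s (u_ n - u) @[n --> \oo] --> (0 : R) -> sobolev_norm r (v_ n - v) @[n --> \oo] --> (0 : R) ->
  (discrete_energy q lambda gamma rho An f n (u_ n) (v_ n))%:E @[n --> \oo] --> energy I I' I'' A f u v.
Proof.
move=> su_ su sv_ sv uu vv.
have rKu := rK_uniq m q phi.
have rKi n k : k \in rK n -> inner_cell c n k by exact: (rK_inner m0 hphi).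
have rKO (x : R * R) : Omega x -> \forall n \near \oo, cell_index c n x \in rK n by exact: (rK_near m0 hphi hq).
have mv := integrable_mfun (L1_integrable v).
have V2 n k : 0 <= avg phi phi n (v_ n) k <= 1 by exact: avg_unit_valued (sv_ n).2.
pose V1 n k := 1 - avg phi phi n (v_ n) k.
have V11 n k : 0 <= V1 n k <= 1 by have /andP[h1 h2] := V2 n k; rewrite subr_ge0 h2 gerBl h1.
have c2 : cvg1 mu (fun n => step c n (rK n) (avg phi phi n (v_ n))) v.
  have vc : cvg1 mu (fun n => v_ n : R * R -> R) v.
    have := sobolev_cvg1 (a := 0) (b := 0) (fun n => (sv_ n).1) sv.1 vv (leq0n r).
    by under eq_fun do rewrite wderiv00; rewrite wderiv00.
  have := step_avg_cvg_var kk kk rKu rKi rKO (fun n => L1_integrable (v_ n)) (L1_integrable v) vc.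
  by rewrite (phi_mass hphi) mulr1; under [X in cvg1 _ _ X]eq_fun do rewrite mul1r.
have c3 := step_cst1 rKu rKO.
have c1 : cvg1 mu (fun n => step c n (rK n) (V1 n)) (fun x => 1 - v x).
  have mst n F : measurable_fun setT (step c n (rK n) F : mR * mR -> R) by exact: measurable_step.
  have : cvg1 mu (fun n x => step c n (rK n) (fun=> 1) x + -1 * step c n (rK n) (avg phi phi n (v_ n)) x)
      (fun x => 1 + -1 * v x).
    apply: cvg1D c3 _ => //.
    - by move=> n; apply: measurable_funM => //; exact: mst.
    - exact: measurable_funM.
    - by apply: cvg1Z c2 => // n; exact: mst.
  rewrite (_ : (fun x => 1 + -1 * v x) = (fun x => 1 - v x)); last by apply/funext => x; rewrite mulN1r.
  rewrite (_ : (fun n x => _ + _) = (fun n => step c n (rK n) (V1 n)))//.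
  apply/funext => n; apply/funext => x; rewrite /step; case: ifP => _; last by rewrite mulr0 addr0.
  by rewrite mulN1r.
have mv1 : measurable_fun setT ((fun x => 1 - v x) : mR * mR -> R) by exact: measurable_funB.
have m1 : measurable_fun setT ((fun=> 1) : mR * mR -> R) by exact: measurable_cst.
have V3 n k : k \in rK n -> 0 <= (1 : R) <= 1 by move=> _; rewrite ler01 lexx.
have ae1 : {ae mu, forall x, `|1 - v x| <= 1}.
  by apply: (ae_lebO_and sv.2 sv.2) => x /andP[h1 h2] _; rewrite ger0_norm ?subr_ge0// gerBl.
have ae2 : {ae mu, forall x, `|v x| <= 1}.
  by apply: (ae_lebO_and sv.2 sv.2) => x /andP[h1 h2] _; rewrite ger0_norm.
have ae3 : {ae mu, forall x : R * R, `|1 : R| <= 1} by apply: aeW => x; rewrite normr1.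
have e1 := wavelet_energy_cvg m0 hphi hq IB ccE hl Is su_ su uu (fun n k _ => V11 n k) mv1 ae1 c1.
have e2 := wavelet_energy_cvg m0 hphi hq IB' ccE hg Is' su_ su uu (fun n k _ => V2 n k) mv ae2 c2.
have e3 := wavelet_energy_cvg m0 hphi hq IB'' ccE hr Ir (fun n => (sv_ n).1) sv.1 vv
  (V := fun _ _ => 1) V3 m1 ae3 c3.
have uL_ n := (sobolev_Lfun s0 (su_ n)).1; have uL := (sobolev_Lfun s0 su).1.
have e4 : (2^-1 * grid_norm2 (An n (sampling phi n (u_ n)) - sampling phi n f) ^+ 2)%:E @[n --> \oo] -->
    (2^-1 * `|A (inL2 (Lp_fun u)) - f| ^+ 2)%:E.
  apply: cvg_EFin; first exact: nearW.
  have ww : `|inL2 (Lp_fun (u_ n)) - inL2 (Lp_fun u)| @[n --> \oo] --> (0 : R).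
    have dL n := (sobolev_Lfun s0 (sobolevB (su_ n) su)).
    have z : 2 * ((count_bound (2 : R) ^ 2)%:R * 1 ^+ 2) * sobolev_norm s (u_ n - u) @[n --> \oo] --> (0 : R).
      rewrite -[X in _ --> X](mulr0 (2 * ((count_bound (2 : R) ^ 2)%:R * 1 ^+ 2))).
      by apply: cvgMl_tmp.
    apply: (squeeze_cvgr _ (cvg_cst 0) z); apply: nearW => n.
    by rewrite normr_ge0 inL2B ?(dL n).2 ?(dL n).1.
  have := fidelity_cvg m0 hphi cA hA (f := f) ww => h.
  rewrite /comp /=; apply: cvgMl_tmp.
  under eq_fun do rewrite (sampling_inL2 _ (uL_ _)) expr2.
  by rewrite expr2; apply: cvgM; exact: h.
(* Nonnegativity of the three limits is what makes their sum meaningful in the extended reals, where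
   [cvgeD] is applied. *)
have sqr_sum n (V : nat -> int * int -> R) (w : nat -> midx m -> R) (z : L1 R) : (forall k, 0 <= V n k) ->
    0 <= (2 ^- n) ^+ 2 * (\sum_(k <- rK n) V n k * Num.sqrt (\sum_(a in band m) w n a * `|avg (kap a.1 0) (kap a.2 0) n z k| ^+ 2)).
  move=> V0; apply: mulr_ge0; first exact: sqr_ge0.
  by apply: sumr_ge0 => k _; apply: mulr_ge0 (V0 k) (sqrtr_ge0 _).
have pos (a_ : nat -> R) (l : \bar R) : (forall n, 0 <= a_ n) -> (a_ n)%:E @[n --> \oo] --> l -> (0 <= l)%E.
  move=> a0 al; rewrite -(cvg_lim _ al)//; apply: lime_ge; first by apply/cvg_ex; eexists; exact: al.
  by apply: nearW => n; rewrite lee_fin.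
have p1 := pos _ _ (fun n => sqr_sum n V1 lambda (u_ n) (fun k => (andP (V11 n k)).1)) e1.
have p2 := pos _ _ (fun n => sqr_sum n (fun n => avg phi phi n (v_ n)) gamma (u_ n) (fun k => (andP (V2 n k)).1)) e2.
have p3 := pos _ _ (fun n => sqr_sum n (fun _ _ => 1) rho (v_ n) (fun k => ler01)) e3.
rewrite /energy (_ : (\int[mu]_x (pointwise_norm I'' v x)%:E = \int[mu]_x (1 * pointwise_norm I'' v x)%:E)%E); last first.
  by apply: eq_integral => x _; rewrite mul1r.
have p12 := adde_ge0 p1 p2; have p123 := adde_ge0 p12 p3.
apply: cvg_trans (cvgeD (fin_num_adde_defl _ (erefl : (2^-1 * `|A (inL2 (Lp_fun u)) - f| ^+ 2)%:E \is a fin_num))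
  (cvgeD (ge0_adde_def p12 p3) (cvgeD (ge0_adde_def p1 p2) e1 e2) e3) e4).
apply: near_eq_cvg; apply: nearW => n.
rewrite /discrete_energy /= -!EFinD; congr EFin.
have smp k : sampling phi n (v_ n) k = avg phi phi n (v_ n) (set_val k).
  by rewrite (sampling_avg m0 hphi)//; exact: L1_integrable.
have h1 : \sum_(k \in Kgrid m q phi n) (1 - sampling phi n (v_ n) k) * wavelet_norm q (lambda n) (sampling phi n (u_ n)) k =
    \sum_(k \in Kgrid m q phi n) V1 n (set_val k) * wavelet_norm q (lambda n) (sampling phi n (u_ n)) k.
  by apply: eq_fsbigr => k _; rewrite smp.
have h2 : \sum_(k \in Kgrid m q phi n) sampling phi n (v_ n) k * wavelet_norm q (gamma n) (sampling phi n (u_ n)) k =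
    \sum_(k \in Kgrid m q phi n) avg phi phi n (v_ n) (set_val k) * wavelet_norm q (gamma n) (sampling phi n (u_ n)) k.
  by apply: eq_fsbigr => k _; rewrite smp.
have h3 : \sum_(k \in Kgrid m q phi n) wavelet_norm q (rho n) (sampling phi n (v_ n)) k =
    \sum_(k \in Kgrid m q phi n) (fun=> 1) (set_val k) * wavelet_norm q (rho n) (sampling phi n (v_ n)) k.
  by apply: eq_fsbigr => k _; rewrite mul1r.
have h1' := etrans h1 (wavelet_energyE n (lambda n) (u_ n) (V1 n)).
have h2' := etrans h2 (wavelet_energyE n (gamma n) (u_ n) (avg phi phi n (v_ n))).
have h3' := etrans h3 (wavelet_energyE n (rho n) (v_ n) (fun=> 1)).
by congr (_ * _ + _ * _ + _ * _ + _); apply: esym; [exact: h1'|exact: h2'|exact: h3'].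
Qed.

End discrete_limit.

(** The open sets are given directly, so the balls must first be shown open: the triangle inequality
    between points of [S] does it. *)
Lemma normed_subset_cvg (R : realType) (V : zmodType) (S : set V) (N : V -> R)
    (w_ : nat -> normed_subset S N) (w : normed_subset S N) :
  (forall u, S u -> N (u - u) = 0) -> (forall u v, S u -> S v -> 0 <= N (u - v)) ->
  (forall u v z, S u -> S v -> S z -> N (u - z) <= N (u - v) + N (v - z)) ->
  w_ @ \oo --> w -> N (ns_val (w_ n) - ns_val w) @[n --> \oo] --> 0.
Proof.
move=> N0 Nge Ntri ww; apply/cvgrPdist_lt => e e0.
pose U : set (normed_subset S N) := [set v | N (ns_val v - ns_val w) < e].
have oU : open U.
  move=> v Uv; exists (e - N (ns_val v - ns_val w)); first by rewrite subr_gt0.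
  move=> z hz; rewrite /U /= (le_lt_trans (Ntri _ _ _ (ns_valP z) (ns_valP v) (ns_valP w)))//.
  by rewrite -ltrBrDr.
have nU : nbhs w U by apply: open_nbhs_nbhs; split => //; rewrite /U /= N0//; exact: ns_valP.
have hU : \forall n \near \oo, U (w_ n) by exact: ww.
apply: filterS hU => n Un.
by rewrite sub0r normrN ger0_norm ?Nge//; exact: ns_valP.
Qed.

(** * Norms and topology of the space of pairs *)

Section norms.
Variable R : realType.
Local Notation mR := (measurableTypeR R).
Local Notation mu := (lebO R).

Lemma sobolev_norm_subrr s (u : L1 R) : sobolev s u -> sobolev_norm s (u - u) = 0.
Proof.
move=> su; rewrite /sobolev_norm big1// => a ha.
by rewrite (wderivB su su ha) subrr normr0.
Qed.

Lemma sobolev_norm_tri s (u v z : L1 R) : sobolev s u -> sobolev s v -> sobolev s z ->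
  sobolev_norm s (u - z) <= sobolev_norm s (u - v) + sobolev_norm s (v - z).
Proof.
move=> su sv sz; rewrite /sobolev_norm -big_split/=; apply: ler_sum => a ha.
by rewrite (wderivB su sz ha) (wderivB su sv ha) (wderivB sv sz ha); exact: ler_distD.
Qed.

Lemma Linfty_norm_ge0 (u : L1 R) : 0 <= Linfty_norm u.
Proof. by apply: fine_ge0; exact: Lnorm_ge0. Qed.

Let oo1 : (1 <= +oo :> \bar R)%E. Proof. exact: leey. Qed.

(** Sends a class in L_1 with a bounded representative to the quotient space L_oo, from which the
    triangle inequality for [Linfty_norm] is inherited. *)
Let cls (u : L1 R) (h : Linfty u) : Lp mu oo1 := Lp_class (Lfun_Sub oo1 h).

Let cls_ae (u : L1 R) (h : Linfty u) : {ae mu, forall x, cls h x = u x}.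
Proof.
have e := Lp_reprP (Lfun_Sub oo1 h).
by apply: (ae_lebO_and e e) => x /(_ I) + _.
Qed.

Let LinftyB (u v : L1 R) (hu : Linfty u) (hv : Linfty v) : Linfty_norm (u - v) = `|cls hu - cls hv|.
Proof.
have h1 := Lp_B u v; have h2 := Lp_B (cls hu) (cls hv).
have h3 := ae_lebO_and (cls_ae hu) (cls_ae hv) (fun x p q => conj p q).
have h4 := ae_lebO_and h1 h2 (fun x p q => conj p q).
rewrite /Linfty_norm /Num.norm/= /Lp_norm unlock /Lnorm lebO_setT lte01.
congr fine; apply: eq_ess_sup.
by apply: (ae_lebO_and h3 h4) => x [e1 e2] [/= -> ->]; rewrite e1 e2.
Qed.

Lemma Linfty_norm_subrr (u : L1 R) : Linfty u -> Linfty_norm (u - u) = 0.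
Proof. by move=> h; rewrite (LinftyB h h) subrr normr0. Qed.

Lemma Linfty_norm_tri (u v z : L1 R) : Linfty u -> Linfty v -> Linfty z ->
  Linfty_norm (u - z) <= Linfty_norm (u - v) + Linfty_norm (v - z).
Proof.
by move=> hu hv hz; rewrite (LinftyB hu hz) (LinftyB hu hv) (LinftyB hv hz); exact: ler_distD.
Qed.

Lemma pairs01_cvg s r (w_ : nat -> @pairs01 R s r) (w : @pairs01 R s r) : w_ @ \oo --> w ->
  sobolev_norm s (ns_val (set_val (w_ n)).1 - ns_val (set_val w).1) @[n --> \oo] --> (0 : R) /\
  sobolevX_norm r (ns_val (set_val (w_ n)).2 - ns_val (set_val w).2) @[n --> \oo] --> (0 : R).
Proof.
move=> ww; have vw : (fun n => set_val (w_ n)) @ \oo --> set_val w.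
  by apply: (cvg_comp _ _ ww); exact: initial_continuous.
split.
- have h : (fun n => (set_val (w_ n)).1) @ \oo --> (set_val w).1.
    by apply: (cvg_comp _ _ vw); exact: cvg_fst.
  apply: (normed_subset_cvg (@sobolev_norm_subrr s) _ (@sobolev_norm_tri s) h).
  by move=> u v _ _; exact: sobolev_norm_ge0.
- have h : (fun n => (set_val (w_ n)).2) @ \oo --> (set_val w).2.
    by apply: (cvg_comp _ _ vw); exact: cvg_snd.
  apply: (normed_subset_cvg _ _ _ h).
  + by move=> u [su lu]; rewrite /sobolevX_norm sobolev_norm_subrr// Linfty_norm_subrr// addr0.
  + by move=> u v _ _; exact: addr_ge0 (sobolev_norm_ge0 _ _) (Linfty_norm_ge0 _).
  + move=> u v z [su lu] [sv lv] [sz lz]; rewrite /sobolevX_norm addrACA.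
    by apply: lerD; [exact: sobolev_norm_tri|exact: Linfty_norm_tri].
Qed.

End norms.

Theorem theorem4p2 (R : realType)
    (m : nat) (q : nat -> int -> R) (phi : R -> R)
    (vphi : midx m -> R * R -> R)
    (I I' I'' : {set midx m})
    (A : {linear L2 R -> L2 R}) (f : L2 R)
    (An : forall n, {linear gridfun phi n -> gridfun phi n})
    (lambda gamma rho : nat -> midx m -> R) :
  let s := (\max_(a in I :|: I') mabs a)%N in
  let r := (\max_(a in I'') mabs a)%N in
  let c := fun a : midx m => \int[leb2 R]_x vphi a x in
  let E := energy I I' I'' A f in
  let E_ := discrete_energy q lambda gamma rho An f in
  (0 < m)%N ->
  bspline_masks m q ->
  is_bspline m (q 0%N) phi ->
  (forall a, a \in band m -> framelet_antiderivative q phi a (vphi a)) ->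
  I \subset band m -> I' \subset band m -> I'' \subset band m ->
  I != finset.set0 -> I' != finset.set0 -> I'' != finset.set0 ->
  (exists2 a, a \in I & forall b, b \in I' -> mlt b a) ->
  continuous A ->
  operator_consistent A An ->
  admissible_weights c I s lambda ->
  admissible_weights c I' s gamma ->
  admissible_weights c I'' r rho ->
  (forall (u_ v_ : nat -> L1 R) (u v : L1 R),
     (forall n, sobolev s (u_ n)) -> sobolev s u ->
     (forall n, sobolev01 r (v_ n)) -> sobolev01 r v ->
     sobolev_norm s (u_ n - u) + sobolevX_norm r (v_ n - v)
       @[n --> \oo] --> 0 ->
     (E_ n (u_ n) (v_ n))%:E @[n --> \oo] --> E u v) /\
  gamma_cvg
    (fun n (w : @pairs01 R s r) =>
       (E_ n (ns_val (set_val w).1) (ns_val (set_val w).2))%:E)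
    (fun w : @pairs01 R s r =>
       E (ns_val (set_val w).1) (ns_val (set_val w).2)).
Proof.
move=> s r c E E_ m0 hq [[t hphi] _ _] hvphi IB IB' IB'' I0 _ _ _ cA hA hl hg hr.
(* Stated for every [l] so that [choice] applies; [(0, 0)] is a dummy value above [m]. *)
have hmask (l : nat) : exists loP : int * {poly R}, (l <= m)%N ->
    [/\ q l =1 zcoef ((1 - 'X) ^+ l * loP.2) loP.1, loP.2.[1] != 0 & ((1 - 'X) ^+ l * loP.2)`_0 != 0].
  have [lm|lm] := leqP l m; last by exists (0, 0).
  by have [lo [P h]] := mask_factor hq lm; exists (lo, P).
have [loP hloP] := choice hmask.
have cE (a : midx m) : a \in band m -> c a = 2^-1 ^+ mabs a * ((loP a.1).2.[1] * (loP a.2).2.[1]).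
  move=> aB; have [q1 _ _] := hloP a.1 (ltn_ord a.1); have [q2 _ _] := hloP a.2 (ltn_ord a.2).
  exact: antiderivative_mass hphi q1 q2 (hvphi a aB).
have Is (a : midx m) : a \in I -> (mabs a <= s)%N.
  by move=> aI; apply: leq_bigmax_cond; rewrite inE aI.
have Is' (a : midx m) : a \in I' -> (mabs a <= s)%N.
  by move=> aI; apply: leq_bigmax_cond; rewrite inE aI orbT.
have Ir (a : midx m) : a \in I'' -> (mabs a <= r)%N by exact: leq_bigmax_cond.
(* The embedding in L_2 needs one derivative: [I] is nonempty and [band m] excludes the zero
   index. *)
have s0 : (0 < s)%N.
  have /set0Pn[a aI] := I0; apply: leq_trans (Is a aI).
  have := fintype.subsetP IB a aI; rewrite !inE lt0n; apply: contra.
  rewrite /mabs addn_eq0 => /andP[/eqP a1 /eqP a2].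
  by rewrite -pair_eqE /pair_eq /= -!val_eqE /= a1 a2.
have main (u_ v_ : nat -> L1 R) (u v : L1 R) :
    (forall n, sobolev s (u_ n)) -> sobolev s u -> (forall n, sobolev01 r (v_ n)) -> sobolev01 r v ->
    sobolev_norm s (u_ n - u) + sobolevX_norm r (v_ n - v) @[n --> \oo] --> (0 : R) ->
    (E_ n (u_ n) (v_ n))%:E @[n --> \oo] --> E u v.
  move=> su_ su sv_ sv h.
  have hX n : 0 <= sobolevX_norm r (v_ n - v).
    exact: addr_ge0 (sobolev_norm_ge0 _ _) (Linfty_norm_ge0 _).
  pose lo l := (loP l).1; pose P l := (loP l).2.
  have hlo l : (l <= m)%N -> [/\ q l =1 zcoef ((1 - 'X) ^+ l * P l) (lo l),
      (P l).[1] != 0 & ((1 - 'X) ^+ l * P l)`_0 != 0] by exact: hloP.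
  have lim := discrete_energy_cvg m0 hphi hlo (P := P) cE IB IB' IB'' s0 Is Is' Ir cA hA hl hg hr su_ su sv_ sv.
  apply: lim.
  - apply: (squeeze_cvgr _ (cvg_cst 0) h); apply: nearW => n.
    by rewrite sobolev_norm_ge0 lerDl hX.
  - apply: (squeeze_cvgr _ (cvg_cst 0) h); apply: nearW => n.
    rewrite sobolev_norm_ge0 /sobolevX_norm addrCA lerDl.
    exact: addr_ge0 (sobolev_norm_ge0 _ _) (Linfty_norm_ge0 _).
have gmain (w_ : nat -> @pairs01 R s r) (w : @pairs01 R s r) : w_ @ \oo --> w ->
    (E_ n (ns_val (set_val (w_ n)).1) (ns_val (set_val (w_ n)).2))%:E @[n --> \oo] -->
    E (ns_val (set_val w).1) (ns_val (set_val w).2).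
  move=> ww; have [h1 h2] := pairs01_cvg ww.
  apply: main.
  - by move=> n; exact: ns_valP.
  - exact: ns_valP.
  - by move=> n; exact: (set_valP (w_ n)).
  - exact: (set_valP w).
  - by rewrite -[0 in X in _ --> X](addr0 0); exact: cvgD.
split; first exact: main.
split=> [w_ w /gmain/cvg_limn_einf_sup[-> _]//|w].
exists (fun=> w); first exact: cvg_cst.
have cw : (fun _ : nat => w) @ \oo --> w by exact: cvg_cst.
by have [_ ->] := cvg_limn_einf_sup (gmain _ _ cw).
Qed.
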